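(* Let $n\ge3$, let $p_1,\dots,p_n\in\mathbb N$ be pairwise coprime, $P=\prod_{j=1}^np_j$ and $X=\Sigma(p_1,\dots,p_n)$ the oriented Seifert fibered homology sphere with $n$ exceptional fibers. For $\tau$ in the upper half-plane and $q=\exp(2\pi i\tau)$, $$q^\Delta\hat Z_0(X;q)=\frac{\lambda}{\sqrt\tau}\int_\Gamma\exp(-\zeta/\tau)\,\mathcal B(Z_0(X))(\zeta)\,d\zeta=\sum_{m=m_0}^\infty\chi_m\,q^{\frac{m^2}{4P}},$$ where $\lambda=(-1)^n\frac i2(2P)^{-1/2}$, $m_0=P\left(n-2-\sum_{j=1}^np_j^{-1}\right)\in\mathbb Z$, the integers $\chi_m$ are determined by $G(z)=(-1)^n\sum_{m=m_0}^\infty\chi_mz^m$ for $|z|<1$, and $\Delta$, $\hat Z_0(X;q)$, $G$, $\mathcal B(Z_0(X))$ and $\Gamma$ are as defined in the context.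
   Context: $G(z)=\prod_{j=1}^n(z^{P/p_j}-z^{-P/p_j})\,(z^P-z^{-P})^{2-n}$. Fractional powers of $q$ mean $q^r=e^{2\pi ir\tau}$; square roots are principal branches. Borel transform. $Z_0(X)$ is the normalization of the Ohtsuki series of $X$ given by the formal series $$Z_0(x)=\frac{\sqrt{8\pi iP}}{2\pi i}\sum_{r\ge0}\frac{F^{(2r)}(0)(8\pi iP)^r}{(2r)!}\frac{\Gamma(r+\frac12)}{x^{r+1/2}},\qquad F(y)=\tfrac14\left(\sinh\tfrac y2\right)^{2-n}\prod_{j=1}^n\sinh\tfrac y{2p_j}$$ (here $\Gamma(r+\frac12)$ is the Gamma function), and $\mathcal B(Z_0(X))$ is its Borel transform, sending $x^{-\alpha}$ to $\zeta^{\alpha-1}/\Gamma(\alpha)$ termwise, analytically continued. Contour. $\Gamma=\Gamma_++\Gamma_-$ is the unbounded contour with $\Gamma_+=e^{\pi i/4}\mathbb R_+$ and $\Gamma_-=e^{3\pi i/4}\mathbb R_+$, both oriented from $0$ to infinity. Plumbing graph of $X$ (here the $q_j$ are integers). Choose $q_1,\dots,q_n\in\mathbb N$ such that for each $j$ one has $(p_j,q_j)=1$, $p_j\le q_j$, and $p_0:=-\frac1P-\sum_{j=1}^n\frac{q_j}{p_j}\in\mathbb Z_{<0}$. Then $e=-1/P<0$ is the Seifert Euler number. Choose continued fraction expansions $\frac{q_j}{p_j}=k_{j,1}-\cfrac1{k_{j,2}-\cfrac1{\ddots-\frac1{k_{j,s_j}}}}$. $X$ has a negative definite plumbing graph which is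 the star-shaped tree with a central vertex $v_0$ of weight $p_0$ and $n$ arms, the $j$-th arm having vertices $v_{j,1},\dots,v_{j,s_j}$ (with $v_{j,1}$ closest to $v_0$) of weights $-k_{j,1},\dots,-k_{j,s_j}$. The plumbed manifold of a weighted tree is surgery on the link with one unknot $L_v$ per vertex, with framing the weight $m_v$, where $L_v$, $L_w$ are chained together if and only if $v,w$ are joined by an edge. Let $V$ be the vertex set, $s=|V|=1+\sum_js_j$, and $M$ the $s\times s$ matrix with $M_{vv}=m_v$, $M_{vw}=1$ if $v,w$ are joined by an edge, and $0$ otherwise. GPPV invariant. Let $\phi$ be the number of positive eigenvalues of $M$, $\sigma$ the signature of $M$, and $\vec\delta=(\deg v)_{v\in V}$. $\mathrm{Spin}^c$-structures correspond to classes $a=[\vec a]\in(\mathbb Z^s+\vec\delta)/2M\mathbb Z^s$, and for $|q|<1$ $$\hat Z_a(X;q)=(-1)^\phi q^{\frac{3\sigma-\sum_vm_v}4}\;\mathrm{v.p.}\oint_{|z_v|=1}\prod_{v\in V}\frac{dz_v}{2\pi iz_v}\left(z_v-\frac1{z_v}\right)^{2-\deg v}\sum_{\vec l\in2M\mathbb Z^s+\vec a}q^{-\frac{(\vec l,M^{-1}\vec l)}4}\prod_{v\in V}z_v^{l_v},$$ where $\mathrm{v.p.}\oint_{|z|=1}=\frac12\left(\oint_{|z|=1+\epsilon}+\oint_{|z|=1-\epsilon}\right)$ for every sufficiently small $\epsilon>0$. Since $X$ is an integral homology sphere there is only one label, denoted $a=0$, giving $\hat Z_0(X;q)$. Exponent.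 Let $X_j$ be the plumbed manifold whose graph is obtained by deleting the terminal vertex $v_{j,s_j}$ of the $j$-th arm, and $h_j=|H_1(X_j,\mathbb Z)|$. Then $$\Delta=-\frac14\left(\sum_{j=1}^nh_j-3s-p_0+\sum_{j=1}^n\left(-\frac P{p_j^2}+\sum_{i=1}^{s_j}k_{j,i}\right)\right).$$
   Formalization: The arms expand p_j/q_j; labels lie in δ+2Z^s; G(z)=Σχ_m z^m without the factor (-1)^n; λ=8e^{πi/4}(2P)^{-1/2}; the integral over Γ itself is claimed for |Re τ|<Im τ, and for general τ over suitably rotated rays. *)

(* Defs.v *)
From HB Require Import structures.
From mathcomp Require Import all_boot all_order all_algebra finmap.
From mathcomp Require Import all_classical all_reals all_analysis.
From mathcomp.analysis.showcase Require summability.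
From mathcomp.real_closed Require Import polyorder polyrcf complex.

Set Implicit Arguments.
Unset Strict Implicit.
Unset Printing Implicit Defensive.

Import Order.TTheory GRing.Theory Num.Theory.
Import numFieldNormedType.Exports.

Local Open Scope classical_set_scope.
Local Open Scope complex_scope.
Local Open Scope ring_scope.

(** * Complex analysis over [R[i]] *)

Section ComplexAnalysis.
Variable R : realType.
Local Notation C := R[i].
Local Notation leb := (@lebesgue_measure R).

Definition cexp (z : C) : C :=
  (expR (complex.Re z))%:C * (cos (complex.Im z) +i* sin (complex.Im z)).

Definition cis (a : R) : C := cexp ('i%C * a%:C).

(* q^r := exp (2 pi i r tau) *)
Definition qpow (tau : C) (r : R) : C := cexp (2 * pi%:C * 'i%C * r%:C * tau).

Definition cintegrable (D : set R) (f : R -> C) : Prop :=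
  leb.-integrable D (fun t => (complex.Re (f t))%:E) /\
  leb.-integrable D (fun t => (complex.Im (f t))%:E).

Definition cintegral (D : set R) (f : R -> C) : C :=
  (\int[leb]_(t in D) complex.Re (f t)) +i*
  (\int[leb]_(t in D) complex.Im (f t)).

(* The integral of [f] along the ray [e^(ia) R_+], oriented from 0 to
   infinity. *)
Definition ray_integrable (a : R) (f : C -> C) : Prop :=
  cintegrable `]0, +oo[ (fun t => f (t%:C * cis a) * cis a).

Definition ray_integral (a : R) (f : C -> C) : C :=
  cintegral `]0, +oo[ (fun t => f (t%:C * cis a) * cis a).

(* The integral of [f z dz / (2 pi i z)] over [|z| = r], in the
   parametrization [z = r e^(2 pi i t)], where [dz / (2 pi i z) = dt]. *)
Definition circle_integral (r : R) (f : C -> C) : C :=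
  cintegral `[0, 1] (fun t => f (r%:C * cis (2 * pi * t))).

Definition vp_circle_integral (e : R) (f : C -> C) : C :=
  (circle_integral (1 + e) f + circle_integral (1 - e) f) / 2.

(* The iterated integral over all the variables [z_v], [v : 'I_N]; the initial
   assignment [fun=> 1] is irrelevant since every variable is overwritten. *)
Definition vp_torus_integral (N : nat) (e : R) (f : ('I_N -> C) -> C) : C :=
  foldr
    (fun v g => fun z : 'I_N -> C =>
       vp_circle_integral e (fun w => g [eta z with v |-> w]))
    f (enum 'I_N) (fun=> 1).

(* The unconditional sum of [f] over [D]: the limit of the sums over the finite
   subsets of [D]. *)
Definition sum_over (I : choiceType) (D : set I) (f : I -> C) : C :=
  @summability.sum I C C^o (patch (fun=> 0) D f).

Definition holomorphic_on (D : set C) (f : C -> C) : Prop :=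
  forall z, D z -> derivable (f : C^o -> C^o) z 1.

Definition Gamma_fun (a : R) : R :=
  \int[leb]_(t in `]0, +oo[) (t `^ (a - 1) * expR (- t)).

End ComplexAnalysis.

(** * Plumbing graphs *)

(* The star-shaped tree whose [j]-th arm has the weights [- k_(j,i)]:
   [None] is the central vertex and [Some (j, i)], with [i] counted from 0, is
   the [(i+1)]-st vertex of the [j]-th arm, starting from the centre. *)
Definition vertex (n : nat) (k : 'I_n -> seq int) : finType :=
  option {j : 'I_n & 'I_(size (k j))}.

Definition adj (n : nat) (k : 'I_n -> seq int) (v w : vertex k) : bool :=
  match v, w with
  | None, None => false
  | None, Some u | Some u, None => tagged u == 0%N :> nat
  | Some u, Some u' => (tag u == tag u') &&
      (((tagged u).+1 == tagged u' :> nat) || ((tagged u').+1 == tagged u :> nat))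
  end.

Definition weight (n : nat) (p0 : int) (k : 'I_n -> seq int) (v : vertex k) :
    int :=
  if v is Some u then - nth 0 (k (tag u)) (tagged u) else p0.

Definition plumbing_mx (n : nat) (p0 : int) (k : 'I_n -> seq int) :
    'M[int]_#|vertex k| :=
  \matrix_(i, j) if i == j then weight p0 (enum_val i)
                 else (adj (enum_val i) (enum_val j))%:R.

Definition vdeg (n : nat) (k : 'I_n -> seq int) (i : 'I_#|vertex k|) : nat :=
  #|[pred w | adj (enum_val i) w]|.

Definition delete_terminal (n : nat) (k : 'I_n -> seq int) (j : 'I_n) :
    'I_n -> seq int :=
  fun i => if i == j then take (size (k i)).-1 (k i) else k i.

(* [H_1] of the 3-manifold obtained by surgery on a framed link with linking
   matrix [A] is the cokernel of [A]; this is its order (0 if infinite). *)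
Definition H1_order (N : nat) (A : 'M[int]_N) : nat :=
  #|` fset_set (range (fun x : 'cV[int]_N =>
        [set y : 'cV[int]_N | exists z : 'cV[int]_N, y = x + A *m z])) |.

(* [k_1 - 1/(k_2 - 1/( ... - 1/k_s))]; the innermost step uses [0^-1 = 0]. *)
Fixpoint cfrac (k : seq int) : rat :=
  if k is k1 :: k' then k1%:~R - (cfrac k')^-1 else 0.

Section Matrices.
Variable R : realType.

Definition negative_definite (N : nat) (A : 'M[R]_N) : Prop :=
  forall x : 'cV[R]_N, x != 0 -> (x^T *m A *m x) ord0 ord0 < 0.

(* Eigenvalues are counted with multiplicity. *)
Definition pos_eigenvalues (N : nat) (A : 'M[R]_N) : nat :=
  \sum_(x <- rootsR (char_poly A) | 0 < x) \mu_x (char_poly A).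

Definition neg_eigenvalues (N : nat) (A : 'M[R]_N) : nat :=
  \sum_(x <- rootsR (char_poly A) | x < 0) \mu_x (char_poly A).

Definition signature (N : nat) (A : 'M[R]_N) : int :=
  (pos_eigenvalues A)%:Z - (neg_eigenvalues A)%:Z.

End Matrices.

(** * The GPPV invariant of a plumbing matrix *)

Section GPPV.
Variables (R : realType) (N : nat) (M : 'M[int]_N) (deg : 'I_N -> nat).
Local Notation C := R[i].

Let MR : 'M[R]_N := map_mx intr M.

Definition inv_form (l : 'cV[int]_N) : R :=
  let lR : 'cV[R]_N := map_mx intr l in
  (lR^T *m invmx MR *m lR) ord0 ord0.

(* Representatives of the labels: elements of [delta + 2 Z^N]. *)
Definition spinc_label (a : 'cV[int]_N) : Prop :=
  exists x : 'cV[int]_N, a = \col_v (deg v)%:Z + x *+ 2.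

Definition theta_series (a : 'cV[int]_N) (tau : C) (z : 'I_N -> C) : C :=
  sum_over [set l | exists x : 'cV[int]_N, l = (M *m x) *+ 2 + a]
    (fun l => qpow tau (- inv_form l / 4) * \prod_v z v ^ l v ord0).

Definition Zhat_at (a : 'cV[int]_N) (tau : C) (e : R) : C :=
  (-1) ^+ pos_eigenvalues MR *
  qpow tau (((3 * signature MR - \sum_v M v v)%:~R) / 4) *
  vp_torus_integral e (fun z =>
    (\prod_v (z v - (z v)^-1) ^ (2 - (deg v)%:Z)) * theta_series a tau z).

(* [Z] is the value of [hat Z_a] at [q = exp (2 pi i tau)]: the common value of
   the regularized integrals for all sufficiently small [e > 0]. *)
Definition is_Zhat (a : 'cV[int]_N) (tau Z : C) : Prop :=
  \forall e \near 0^'+, Zhat_at a tau e = Z.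

End GPPV.

(** * Seifert data *)

Section Seifert.
Variables (R : realType) (n : nat) (p : 'I_n -> nat).
Local Notation C := R[i].

Definition Pprod : nat := (\prod_j p j)%N.
Local Notation P := Pprod.

Definition star_plumbing (q : 'I_n -> nat) (p0 : int) (k : 'I_n -> seq int) :
    Prop :=
  [/\ forall j, coprime (p j) (q j) /\ (p j <= q j)%N,
      p0%:~R = - P%:R^-1 - \sum_j (q j)%:R / (p j)%:R :> rat /\ p0 < 0,
      (* The arms expand [p_j / q_j], not its inverse: the Schur complement of the arms
         is then [p0 + \sum_j q_j / p_j = - 1 / P], so that the determinant is
         a unit and the boundary is a homology sphere.  *)
      forall j, cfrac (k j) = (p j)%:R / (q j)%:R
    & negative_definite (map_mx intr (plumbing_mx p0 k) : 'M[R]_#|vertex k|)].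

Definition Delta (p0 : int) (k : 'I_n -> seq int) : R :=
  - (1 / 4) *
  (\sum_j (H1_order (plumbing_mx p0 (delete_terminal k j)))%:R
   - 3 * #|vertex k|%:R - p0%:~R
   + \sum_j (- (P%:R / (p j)%:R ^+ 2) + (\sum_(x <- k j) x)%:~R)).

Definition Gfun (z : C) : C :=
  (\prod_j (z ^ (P %/ p j)%:Z - z ^ (- (P %/ p j)%:Z))) *
  (z ^ P%:Z - z ^ (- P%:Z)) ^ (2 - n%:Z).

(* [chi m], for [m >= m0], are the coefficients of the expansion of [G] in the
   punctured unit disc. *)
Definition G_coefficients (m0 : int) (chi : int -> int) : Prop :=
  forall z : C, 0 < `|z| < 1 ->
    series (fun r : nat => (chi (m0 + r%:Z))%:~R * z ^ (m0 + r%:Z) : C^o) @ \oo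
      --> (Gfun z : C^o).

Definition sinh (y : R) : R := (expR y - expR (- y)) / 2.

(* The formula takes the value 0 at [y = 0], which is the value of the analytic
   extension of [F], since [F] vanishes to order 2 there. *)
Definition Ffun (y : R) : R :=
  4^-1 * sinh (y / 2) ^ (2 - n%:Z) * \prod_j sinh (y / (2 * (p j)%:R)).

Definition eightpiiP : C := 8 * pi%:C * 'i%C * P%:R.

(* The coefficient of [x^-(r + 1/2)] in [Z_0]. *)
Definition Z0_coef (r : nat) : C :=
  sqrtc eightpiiP / (2 * pi%:C * 'i%C) *
  ((derive1n (2 * r) Ffun 0)%:C * eightpiiP ^+ r / ((2 * r)`!)%:R
   * (Gamma_fun (r%:R + 2^-1 : R))%:C).

(* [x^-(r + 1/2)] is sent to [zeta^(r - 1/2) / Gamma (r + 1/2)]; the power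
   is the principal one. *)
Definition borel_term (r : nat) (zeta : C) : C :=
  Z0_coef r * (zeta ^+ r / sqrtc zeta) / (Gamma_fun (r%:R + 2^-1 : R))%:C.

(* The slit plane without the points [i pi m^2 / (2 P)], [m >= 1], which
   contain the poles; it is open and connected. *)
Definition borel_domain : set C :=
  [set z | ~ (complex.Im z = 0 /\ complex.Re z <= 0) /\
    forall m : nat, (0 < m)%N ->
      z <> 'i%C * (pi * m%:R ^+ 2 / (2 * P%:R))%:C].

(* [B] is the analytic continuation to [borel_domain] of the sum of the termwise
   Borel transform near 0. *)
Definition is_borel_Z0 (B : C -> C) : Prop :=
  holomorphic_on borel_domain B /\
  \forall z \near (0 : C^o), borel_domain z ->
    series (fun r => borel_term r z : C^o) @ \oo --> (B z : C^o).

(* [F y = G (e^(y / (2 P))) / 16], so the Borel transform is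
   [sqrt (8 pi i P) / (32 pi i) * zeta^(-1/2) * G (e^(sqrt (2 pi i zeta / P)))],
   and each [z^m] in [G], [|z| < 1], contributes
   [sqrt (8 pi i P) / (16 pi i) * sqrt (pi tau) * q^(m^2 / (4 P))] to its
   Laplace integral; [lambda / sqrt tau] normalizes this to [q^(m^2 / (4 P))]. *)
Definition lambda : C := 8 * cis (pi / 4) / (Num.sqrt (2 * P%:R))%:C.

(* The contour is [e^(ia) R_+ + e^(ib) R_+], both rays oriented from 0 to
   infinity; [a = pi / 4] and [b = 3 pi / 4] give the standard contour.  As [B] grows at most
   like [exp (c * sqrt |zeta|)], the integral over a ray of angle [a] converges
   when [0 < Re (e^(ia) / tau)]; for the standard contour this means [|Re tau| < Im tau]. *)
Definition laplace_converges (a b : R) (B : C -> C) (tau : C) : Prop :=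
  ray_integrable a (fun z => cexp (- z / tau) * B z) /\
  ray_integrable b (fun z => cexp (- z / tau) * B z).

Definition laplace (a b : R) (B : C -> C) (tau : C) : C :=
  ray_integral a (fun z => cexp (- z / tau) * B z) +
  ray_integral b (fun z => cexp (- z / tau) * B z).

End Seifert.

(* Main.v *)
Require Import Defs.
From HB Require Import structures.
From mathcomp Require Import all_boot all_order all_algebra finmap.
From mathcomp Require Import all_classical all_reals all_analysis.
From mathcomp Require Import measurable_realfun.
From mathcomp.analysis.showcase Require summability.
From mathcomp.real_closed Require Import polyorder polyrcf complex.
From mathcomp Require Import ring lra zify.

(** All three expressions equal the series over the subsets [S] of the index set
    of the [p_j] and over [k >= 0]

      [(-1) ^ |S| * binomial (k + n - 3) (n - 3) * q ^ (m(S, k) ^ 2 / (4 P))],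

    with [m(S, k) = m_0 + 2 sum_(j in S) P / p_j + 2 P k]. Indeed the powers
    [z ^ m(S, k)], with the same signs and binomials, make up the expansion of
    [G] at 0, so that this series regrouped by exponents is the series
    of the [chi_m] ([sparse_series], [chi_G_coefficients]); the [chi_m] are unique
    by the identity theorem ([G_coefficients_unique]).

    The invariant. The plumbing matrix [M] is negative definite, so the
    coefficients of the theta series have Gaussian decay ([inv_form_bound]) and
    the torus integral acts term by term ([torus_integral_theta]). The integral at
    a vertex of degree two forces [l_v = 0], at a leaf it forces [l_v = 1] or [-1],
    and at the centre the negative binomial expansions outside and inside the unit
    circle leave [l_v = n - 2 + 2 k] and its opposite. All these vectors occur in
    the lattice coset, for the lattice is unimodular ([plumb_onto]). On them the
    inverse form only involves the entries of [M^-1] at the centre and the leaves.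
    Continued fractions give those off the diagonal, and the diagonal entry at the
    end of the arm [j] is [- h_j], as the order of the cokernel of the minor
    ([H1_order_minor], [leaf_cols]). Completing the square then gives
    [m ^ 2 / (4 P)] plus a constant ([leaf_inv_form]), and with signature [- |V|]
    this constant is compensated by [Delta] ([Zhat_value]).

    The Borel transform. The factors [Gamma (r + 1/2)] cancel, which leaves

      [B(z) = c_0 / (2 pi i) * z ^ (-1/2) * F (c_0 z ^ (1/2))], [c_0 = sqrt (8 pi i P)].

    Near 0 this needs the Taylor series of [F], which comes from products and
    inverses of absolutely convergent series ([FC_series], [Ffun_derivatives],
    [Bfun_series]); the closed form is holomorphic wherever the central hyperbolic
    sine has no zero ([Bfun_holomorphic]).

    The Laplace integral. On each ray put [zeta = s ^ 2 * cis a]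
    ([ray_substitution]). Since [F(y) = G(e ^ (y / 2P)) / 16] is even, both rays can be moved
    to the half-plane where [F] is the series of the exponentials
    [chi_m / 16 * e ^ (- m y / 2P)], up to the point 0 where the convergence fails.
    A shift of the argument by [delta > 0] makes integration term by term legitimate
    ([ray_abel]). After completing the square, the two ray integrals of one
    term join into a Gaussian integral over a broken line, which can be straightened
    ([gauss_rays], [two_rays]): its value is a multiple of [q ^ (m ^ 2 / (4 P))]
    times [e ^ (- delta m / 2P)]. Letting [delta] tend to 0 on both sides gives
    the value of the Laplace integral ([ray_abel_limit], [tannery],
    [laplace_value]). *)

Set Implicit Arguments.
Unset Strict Implicit.
Unset Printing Implicit Defensive.
Import Order.TTheory GRing.Theory Num.Theory.
Import numFieldNormedType.Exports ComplexField.Normc.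
Local Open Scope classical_set_scope.
Local Open Scope complex_scope.
Local Open Scope ring_scope.

Arguments cexp : simpl never.
Arguments cis : simpl never.
Arguments sqrtc : simpl never.
Arguments normc : simpl never.

(** * Complex numbers: norm, limits, exponential and square root *)

Section ComplexNorm.
Variable R : realType.
Local Notation C := R[i].
Local Notation Re := (@complex.Re R).
Local Notation Im := (@complex.Im R).
Implicit Types (z w : C).

Lemma normcE' z : `|z| = (normc z)%:C. Proof. by []. Qed.

Lemma normc_ge0 z : 0 <= normc z. Proof. by case: z => a b; exact: sqrtr_ge0. Qed.

Lemma ReD z w : Re (z + w) = Re z + Re w. Proof. by case: z; case: w. Qed.
Lemma ImD z w : Im (z + w) = Im z + Im w. Proof. by case: z; case: w. Qed.
Lemma ReN z : Re (- z) = - Re z. Proof. by case: z. Qed.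
Lemma ImN z : Im (- z) = - Im z. Proof. by case: z. Qed.
Lemma ReM z w : Re (z * w) = Re z * Re w - Im z * Im w. Proof. by case: z; case: w. Qed.
Lemma ImM z w : Im (z * w) = Re z * Im w + Im z * Re w. Proof. by case: z; case: w. Qed.
Lemma ReiE (x : R) : Re x%:C = x. Proof. by []. Qed.
Lemma ImiE (x : R) : Im x%:C = 0. Proof. by []. Qed.
Lemma Re0 : Re (0 : C) = 0. Proof. by []. Qed.
Lemma Im0 : Im (0 : C) = 0. Proof. by []. Qed.
Lemma Re1 : Re (1 : C) = 1. Proof. by []. Qed.
Lemma Im1 : Im (1 : C) = 0. Proof. by []. Qed.

Definition ReImE := (ReD, ImD, ReN, ImN, ReM, ImM, ReiE, ImiE, Re0, Im0, Re1, Im1).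

Lemma complex_eqP z w : Re z = Re w -> Im z = Im w -> z = w.
Proof. by case: z => a b; case: w => c d /= -> ->. Qed.

Lemma Re_sum (I : Type) (r : seq I) (P : pred I) (F : I -> C) :
  Re (\sum_(i <- r | P i) F i) = \sum_(i <- r | P i) Re (F i).
Proof. by apply: (big_morph _ ReD Re0). Qed.

Lemma Im_sum (I : Type) (r : seq I) (P : pred I) (F : I -> C) :
  Im (\sum_(i <- r | P i) F i) = \sum_(i <- r | P i) Im (F i).
Proof. by apply: (big_morph _ ImD Im0). Qed.

Lemma normc_sum (I : Type) (r : seq I) (P : pred I) (F : I -> C) :
  normc (\sum_(i <- r | P i) F i) <= \sum_(i <- r | P i) normc (F i).
Proof.
elim/big_ind2: _ => //; first by rewrite normc0.
by move=> x1 x2 y1 y2 h1 h2; apply: le_trans (le_normcD _ _) _; exact: lerD.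
Qed.

Lemma normc_prod (I : Type) (r : seq I) (P : pred I) (F : I -> C) :
  normc (\prod_(i <- r | P i) F i) = \prod_(i <- r | P i) normc (F i).
Proof. by apply: (big_morph _ (@normcM R) (normc1 R)). Qed.

Lemma normcX z n : normc (z ^+ n) = normc z ^+ n.
Proof. by elim: n => [|n ih]; rewrite ?expr0 ?normc1// !exprS normcM ih. Qed.

Lemma normcXz z (m : int) : normc (z ^ m) = normc z ^ m.
Proof. by case: m => m; rewrite -?exprnP ?NegzE -?exprnN ?normcV normcX. Qed.

Lemma normc_real (x : R) : normc x%:C = `|x|.
Proof. by rewrite /normc /= expr0n /= addr0 sqrtr_sqr. Qed.

Lemma normc_ge_Re z : `|Re z| <= normc z.
Proof. by have := complex.normc_ge_Re z; rewrite lecR. Qed.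

Lemma normc_ge_Im z : `|Im z| <= normc z.
Proof.
case: z => a b; rewrite /normc /= -sqrtr_sqr ler_wsqrtr //.
by rewrite lerDr sqr_ge0.
Qed.

Lemma normc_le_ReIm z : normc z <= `|Re z| + `|Im z|.
Proof.
rewrite [in leLHS](_ : z = (Re z)%:C + 'i%C * (Im z)%:C); last by rewrite -complexE.
apply: le_trans (le_normcD _ _) _; rewrite normcM !normc_real lerD2l.
by rewrite (_ : normc _ = 1) ?mul1r // /normc /= expr0n /= add0r expr1n sqrtr1.
Qed.

Lemma normc_eq0 z : (normc z == 0) = (z == 0).
Proof. by apply/eqP/eqP => [/eq0_normc//|->]; rewrite normc0. Qed.

Lemma normc_gt0 z : (0 < normc z) = (z != 0).
Proof. by rewrite lt_def normc_eq0 normc_ge0 andbT. Qed.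

Lemma normcD z w : normc (z + w) <= normc z + normc w. Proof. exact: le_normcD. Qed.

Lemma normcBC z w : normc (z - w) = normc (w - z).
Proof. by rewrite -normcN opprB. Qed.

Lemma normcB z w : normc z - normc w <= normc (z - w).
Proof. by rewrite lerBlDr; apply: le_trans (normcD _ _); rewrite subrK. Qed.

Lemma normcMr (x : R) z : normc (x%:C * z) = `|x| * normc z.
Proof. by rewrite normcM normc_real. Qed.

End ComplexNorm.

Section ComplexCvg.
Variable R : realType.
Local Notation C := R[i].
Local Notation Re := (@complex.Re R).
Local Notation Im := (@complex.Im R).

(** The order of [R[i]] only compares numbers with equal imaginary parts, so
    the radii that occur in its topology are real. *)
Lemma ltc_realP (e : C) : 0 < e -> exists2 r : R, 0 < r & e = r%:C.
Proof.
case: e => a b; rewrite ltcE /= => /andP[/eqP-> a0].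
by exists a.

Qed.

(** The norm of [R[i]] takes its values in [R[i]]; everything below is estimated
    with the real norm instead. *)
Lemma cvgc_normP {T : Type} (F : set_system T) {FF : Filter F} (f : T -> C) (l : C) :
  (f @ F --> (l : C^o)) <->
  (forall e : R, 0 < e -> \forall x \near F, normc (f x - l) < e).
Proof.
rewrite (@cvgrPdist_lt C C^o T F FF f l); split=> [h e e0|h].
  have := h e%:C; rewrite ltcR => /(_ e0); apply: filterS => x.
  by rewrite normcE' ltcR normcBC.
move=> e /ltc_realP [r r0 ->].
by have := h r r0; apply: filterS => x; rewrite normcE' ltcR normcBC.
Qed.

Lemma cvgc_norm0 {T : Type} (F : set_system T) {FF : Filter F} (f : T -> C) (l : C) :
  (f @ F --> (l : C^o)) <-> ((fun x => normc (f x - l)) @ F --> (0 : R)).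
Proof.
rewrite cvgc_normP; split=> h.
  apply/cvgrPdist_lt => e e0; have := h e e0; apply: filterS => x.
  by rewrite sub0r normrN ger0_norm ?normc_ge0.
move=> e e0; have /cvgrPdist_lt /(_ e e0) := h; apply: filterS => x.
by rewrite sub0r normrN ger0_norm ?normc_ge0.
Qed.

Lemma cvgcP {T : Type} (F : set_system T) {FF : Filter F} (f : T -> C) (l : C) :
  (f @ F --> (l : C^o)) <->
  ((Re \o f) @ F --> Re l) /\ ((Im \o f) @ F --> Im l).
Proof.
rewrite cvgc_normP; split=> [h|[/cvgrPdist_lt hr /cvgrPdist_lt hi] e e0].
  split; apply/cvgrPdist_lt => e e0; have := h e e0; apply: filterS => x;
    apply: le_lt_trans; rewrite distrC.
    by have := normc_ge_Re (f x - l); rewrite !ReImE.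
  by have := normc_ge_Im (f x - l); rewrite !ReImE.
have e2 : 0 < e / 2 by lra.
near=> x.
apply: le_lt_trans (normc_le_ReIm _) _; rewrite !ReImE (splitr e).
apply: ltrD; rewrite distrC; near: x; [exact: hr|exact: hi].
Unshelve. all: by end_near. Qed.

Lemma cvgcD {T : Type} (F : set_system T) {FF : Filter F} (f g : T -> C) (a b : C) :
  (f @ F --> (a : C^o)) -> (g @ F --> (b : C^o)) ->
  ((fun x => f x + g x) @ F --> (a + b : C^o)).
Proof. by move=> h1 h2; exact: (@cvgD C C^o T F FF f g a b h1 h2). Qed.

Lemma cvgcM {T : Type} (F : set_system T) {FF : Filter F} (f g : T -> C) (a b : C) :
  (f @ F --> (a : C^o)) -> (g @ F --> (b : C^o)) ->
  ((fun x => f x * g x) @ F --> (a * b : C^o)).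
Proof. by move=> h1 h2; exact: (@cvgM C T F FF f g a b h1 h2). Qed.

Lemma cvgcN {T : Type} (F : set_system T) {FF : Filter F} (f : T -> C) (a : C) :
  (f @ F --> (a : C^o)) -> ((fun x => - f x) @ F --> (- a : C^o)).
Proof. by move=> h1; exact: (@cvgN C C^o T F FF f a h1). Qed.

Lemma cvgcB {T : Type} (F : set_system T) {FF : Filter F} (f g : T -> C) (a b : C) :
  (f @ F --> (a : C^o)) -> (g @ F --> (b : C^o)) ->
  ((fun x => f x - g x) @ F --> (a - b : C^o)).
Proof. by move=> h1 h2; exact: (@cvgB C C^o T F FF f g a b h1 h2). Qed.

Lemma cvgcV {T : Type} (F : set_system T) {FF : Filter F} (f : T -> C) (a : C) :
  a != 0 -> (f @ F --> (a : C^o)) -> ((fun x => (f x)^-1) @ F --> (a^-1 : C^o)).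
Proof. by move=> a0 h1; exact: (@cvgV C T F FF f a a0 h1). Qed.

Lemma cvgc_cst {T : Type} (F : set_system T) {FF : Filter F} (a : C) :
  ((fun _ : T => a) @ F --> (a : C^o)).
Proof. exact: (@cvg_cst C^o a T F FF). Qed.

Lemma cvgc_real {T : Type} (F : set_system T) {FF : Filter F} (f : T -> R) (a : R) :
  (f @ F --> a) -> ((fun x => (f x)%:C) @ F --> (a%:C : C^o)).
Proof. by move=> h; apply/cvgcP; split => //=; exact: cvg_cst. Qed.

Lemma cvgcX {T : Type} (F : set_system T) {FF : Filter F} (f : T -> C) (a : C) n :
  (f @ F --> (a : C^o)) -> ((fun x => f x ^+ n) @ F --> (a ^+ n : C^o)).
Proof.
move=> h; elim: n => [|n ih].
  by under eq_fun do rewrite expr0; exact: cvgc_cst.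
by under eq_fun do rewrite exprS; rewrite exprS; exact: cvgcM.
Qed.

Lemma cvgc_sum {T : Type} (F : set_system T) {FF : Filter F} (I : Type)
  (r : seq I) (P : pred I) (f : I -> T -> C) (a : I -> C) :
  (forall i, P i -> f i @ F --> (a i : C^o)) ->
  ((fun x => \sum_(i <- r | P i) f i x) @ F --> (\sum_(i <- r | P i) a i : C^o)).
Proof.
move=> h; elim: r => [|i r ih].
  by under eq_fun do rewrite big_nil; rewrite big_nil; exact: cvgc_cst.
rewrite big_cons (_ : (fun x => _) = fun x =>
    if P i then f i x + \sum_(j <- r | P j) f j x else \sum_(j <- r | P j) f j x); last first.
  by apply/funext => x; rewrite big_cons.
case E: (P i); last exact: ih.
exact: (@cvgcD T F FF (f i) (fun x => \sum_(j <- r | P j) f j x) (a i) (\sum_(j <- r | P j) a j) (h _ E) ih).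
Qed.

Lemma cvgc_prod {T : Type} (F : set_system T) {FF : Filter F} (I : Type)
  (r : seq I) (P : pred I) (f : I -> T -> C) (a : I -> C) :
  (forall i, P i -> f i @ F --> (a i : C^o)) ->
  ((fun x => \prod_(i <- r | P i) f i x) @ F --> (\prod_(i <- r | P i) a i : C^o)).
Proof.
move=> h; elim: r => [|i r ih].
  by under eq_fun do rewrite big_nil; rewrite big_nil; exact: cvgc_cst.
rewrite big_cons (_ : (fun x => _) = fun x =>
    if P i then f i x * \prod_(j <- r | P j) f j x else \prod_(j <- r | P j) f j x); last first.
  by apply/funext => x; rewrite big_cons.
case E: (P i); last exact: ih.
exact: (@cvgcM T F FF (f i) (fun x => \prod_(j <- r | P j) f j x) (a i) (\prod_(j <- r | P j) a j) (h _ E) ih).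
Qed.

Lemma cvgcXz {T : Type} (F : set_system T) {FF : Filter F} (f : T -> C) (a : C) (m : int) :
  a != 0 -> (f @ F --> (a : C^o)) -> ((fun x => f x ^ m) @ F --> (a ^ m : C^o)).
Proof.
move=> a0 h; case: m => m; first exact: (@cvgcX T F FF f a m h).
have am : a ^+ m.+1 != 0 by rewrite expf_neq0.
exact: (@cvgcV T F FF (fun x => f x ^+ m.+1) _ am (@cvgcX T F FF f a m.+1 h)).
Qed.

Lemma cvgc_unique {T : Type} (F : set_system T) {FF : ProperFilter F} (f : T -> C) (a b : C) :
  (f @ F --> (a : C^o)) -> (f @ F --> (b : C^o)) -> a = b.
Proof. by move=> h1 h2; exact: (@cvg_unique C^o _ (f @ F) _ a b h1 h2). Qed.

Lemma cvgc_le_norm {T : Type} (F : set_system T) {FF : ProperFilter F} (f : T -> C) (a : C) (M : R) :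
  (f @ F --> (a : C^o)) -> (\forall x \near F, normc (f x) <= M) -> normc a <= M.
Proof.
move=> /cvgc_normP h hM; apply/ler_addgt0Pr => e e0.
near F => x.
have : normc (f x - a) < e by near: x; exact: h.
have : normc (f x) <= M by near: x.
have := normcB a (f x); rewrite normcBC; lra.
Unshelve. all: by end_near. Qed.

End ComplexCvg.

Section ComplexExp.
Variable R : realType.
Local Notation C := R[i].
Local Notation Re := (@complex.Re R).
Local Notation Im := (@complex.Im R).
Implicit Types (z w : C).

Lemma Re_cexp z : Re (cexp z) = expR (Re z) * cos (Im z).
Proof. by rewrite /cexp !ReImE /= mul0r subr0. Qed.

Lemma Im_cexp z : Im (cexp z) = expR (Re z) * sin (Im z).
Proof. by rewrite /cexp !ReImE /= mul0r addr0. Qed.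

Lemma cexpD z w : cexp (z + w) = cexp z * cexp w.
Proof.
apply: complex_eqP; rewrite !(ReM, ImM, Re_cexp, Im_cexp, ReD, ImD) expRD ?cosD ?sinD; ring.
Qed.

Lemma cexp0 : cexp 0 = 1 :> C.
Proof. by apply: complex_eqP; rewrite !(Re_cexp, Im_cexp) /= expR0 ?cos0 ?sin0; ring. Qed.

Lemma normc_cexp z : normc (cexp z) = expR (Re z).
Proof.
rewrite /cexp normcMr ger0_norm ?expR_ge0 //.
by rewrite /normc cos2Dsin2 sqrtr1 mulr1.
Qed.

Lemma cexp_neq0 z : cexp z != 0.
Proof. by rewrite -normc_gt0 normc_cexp expR_gt0. Qed.

Lemma cexpN z : cexp (- z) = (cexp z)^-1.
Proof.
apply: (mulfI (cexp_neq0 z)).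
by rewrite -cexpD subrr cexp0 divff // cexp_neq0.
Qed.

Lemma cexpMn z n : cexp (z *+ n) = cexp z ^+ n.
Proof. by elim: n => [|n ih]; rewrite ?mulr0n ?cexp0 ?expr0 // mulrS exprS cexpD ih. Qed.

Lemma cexpMz z (m : int) : cexp (z *~ m) = cexp z ^ m.
Proof.
case: m => m; first by rewrite -pmulrn cexpMn.
by rewrite NegzE mulrNz cexpN -pmulrn cexpMn -exprnN.
Qed.

Lemma cexp_real (x : R) : cexp x%:C = (expR x)%:C.
Proof. by apply: complex_eqP; rewrite !(Re_cexp, Im_cexp) /= ?cos0 ?sin0; ring. Qed.

Lemma cisE a : cis a = cos a +i* sin a :> C.
Proof.
by apply: complex_eqP; rewrite /cis !(Re_cexp, Im_cexp) !ReImE /= !mul0r ?mulr0 subr0 mul1r ?add0r ?addr0 expR0 mul1r.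
Qed.

Lemma Re_cis a : Re (cis a) = cos a :> R. Proof. by rewrite cisE. Qed.
Lemma Im_cis a : Im (cis a) = sin a :> R. Proof. by rewrite cisE. Qed.

Lemma normc_cis a : normc (cis a : C) = 1.
Proof. by rewrite cisE /normc cos2Dsin2 sqrtr1. Qed.

Lemma cis_neq0 a : (cis a : C) != 0.
Proof. by rewrite -normc_gt0 normc_cis. Qed.

Lemma cisD a b : cis (a + b) = cis a * cis b :> C.
Proof. by rewrite /cis -cexpD rmorphD mulrDr. Qed.

Lemma cis_sqr a : cis a ^+ 2 = cis (a *+ 2) :> C.
Proof. by rewrite mulr2n cisD expr2. Qed.

Lemma cvg_cexp {T : Type} (F : set_system T) {FF : Filter F} (f : T -> C) (a : C) :
  (f @ F --> (a : C^o)) -> ((fun x => cexp (f x)) @ F --> (cexp a : C^o)).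
Proof.
move=> /cvgcP [hr hi]; apply/cvgcP; split.
  rewrite Re_cexp (_ : Re \o (fun x => cexp (f x)) = fun x => expR (Re (f x)) * cos (Im (f x))); last first.
    by apply/funext => x; rewrite /comp Re_cexp.
  apply: cvgM; first by apply: (cvg_comp _ _ hr); exact: continuous_expR.
  by apply: (cvg_comp _ _ hi); exact: continuous_cos.
rewrite Im_cexp (_ : Im \o (fun x => cexp (f x)) = fun x => expR (Re (f x)) * sin (Im (f x))); last first.
  by apply/funext => x; rewrite /comp Im_cexp.
apply: cvgM; first by apply: (cvg_comp _ _ hr); exact: continuous_expR.
by apply: (cvg_comp _ _ hi); exact: continuous_sin.
Qed.

(** The principal root is the root with positive real part. *)
Lemma sqrtc_uniq s : 0 < Re s -> sqrtc (s ^+ 2) = s.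
Proof.
move=> s0; have /eqP := sqr_sqrtc (s ^+ 2); rewrite eqf_sqr => /orP[/eqP//|/eqP h].
have : 0 <= Re (sqrtc (s ^+ 2)) by case: (s ^+ 2) => a b; exact: sqrtr_ge0.
by rewrite h ReN oppr_ge0 leNgt s0.
Qed.

Lemma Re_sqrtc_ge0 z : 0 <= Re (sqrtc z).
Proof. by case: z => a b; exact: sqrtr_ge0. Qed.

Lemma Re_sqrtc_gt0 z : ~ (Im z = 0 /\ Re z <= 0) -> 0 < Re (sqrtc z).
Proof.
move=> h; rewrite lt_def Re_sqrtc_ge0 andbT; apply/eqP => s0; apply: h.
have := sqr_sqrtc z; move: s0; case: (sqrtc z) => a b /= -> <-.
by rewrite expr2 ReM ImM /=; split; [rewrite mulr0 mul0r addr0|nra].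
Qed.

Lemma sqrtc_polar (t a : R) : 0 < t -> - pi < a < pi ->
  sqrtc (t%:C * cis a) = (Num.sqrt t)%:C * cis (a / 2).
Proof.
move=> t0 /andP[a1 a2]; rewrite -(sqrtc_uniq (s := (Num.sqrt t)%:C * cis (a / 2))).
  congr sqrtc; rewrite exprMn -rmorphXn /= sqr_sqrtr ?(ltW t0) // cis_sqr.
  by congr (_ * cis _); rewrite -mulr_natr; field.
rewrite ReM ReiE ImiE Re_cis mul0r subr0 mulr_gt0 ?sqrtr_gt0 // cos_gt0_pihalf //; lra.
Qed.

End ComplexExp.

#[local] Existing Instance summability.totally_filter.

(** * Unconditional sums *)

Section Sums.
Variable R : realType.
Local Notation C := R[i].
Local Notation Re := (@complex.Re R).
Local Notation Im := (@complex.Im R).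
Local Notation totally := summability.totally.
Local Notation partial_sum := summability.partial_sum.

Lemma partial_sumE (I : choiceType) (V : zmodType) (f : I -> V) (A : {fset I}) :
  partial_sum f A = \sum_(i <- A) f i.
Proof. by rewrite /partial_sum (big_seq_fsetE _ A xpredT f). Qed.

Lemma sum_fset_le (I : choiceType) (g : I -> R) (A B : {fset I}) :
  (forall i, 0 <= g i) -> (A `<=` B)%fset ->
  \sum_(i <- A) g i <= \sum_(i <- B) g i.
Proof.
move=> g0 AB; rewrite [leRHS](big_fsetID _ (fun i => i \in A)) /=.
rewrite [X in _ <= X + _](_ : _ = \sum_(i <- A) g i); last first.
  apply: eq_fbigl => i; rewrite !inE /= andbC; case: (boolP (i \in A)) => //= iA.
  exact: (fsubsetP AB).
by rewrite lerDl sumr_ge0.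
Qed.

Lemma nneg_sum_cvg (I : choiceType) (g : I -> R) (M : R) :
  (forall i, 0 <= g i) -> (forall A : {fset I}, \sum_(i <- A) g i <= M) ->
  exists s : R, partial_sum g @ totally --> s.
Proof.
move=> g0 gM.
pose S := [set \sum_(i <- A) g i | A in [set: {fset I}]].
have supS : has_sup S.
  split; first by exists (\sum_(i <- fset0) g i); exists fset0.
  by exists M => _ [A _ <-].
exists (sup S); apply/cvgrPdist_lt => e e0.
have [_ [A _ <-] hA] := sup_adherent e0 supS.
exists A => // B /= AB; rewrite partial_sumE.
have h1 := sum_fset_le g0 AB.
have h2 : \sum_(i <- B) g i <= sup S by apply: ub_le_sup; [case: supS|exists B].
rewrite ger0_norm; lra.
Qed.

(** Real and imaginary parts split into positive and negative parts, for which
    bounded sums converge by monotonicity. *)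
Lemma abs_sum_cvg (I : choiceType) (f : I -> C) (M : R) :
  (forall A : {fset I}, \sum_(i <- A) normc (f i) <= M) ->
  exists s : C, partial_sum f @ totally --> (s : C^o).
Proof.
move=> fM.
have part (h : C -> R) : (forall i, `|h (f i)| <= normc (f i)) ->
    exists s : R, partial_sum (h \o f) @ totally --> s.
  move=> hf.
  have [i|A|s1 h1] := @nneg_sum_cvg I (fun i => Num.max (h (f i)) 0) M.
  - by rewrite le_max lexx orbT.
  - apply: le_trans (fM A); apply: ler_sum => i _; apply: le_trans (hf i).
    by rewrite ge_max ler_norm normr_ge0.
  have [i|A|s2 h2] := @nneg_sum_cvg I (fun i => Num.max (- h (f i)) 0) M.
  - by rewrite le_max lexx orbT.
  - apply: le_trans (fM A); apply: ler_sum => i _; apply: le_trans (hf i).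
    by rewrite ge_max -normrN ler_norm normr_ge0.
  exists (s1 - s2).
  rewrite (_ : partial_sum (h \o f) = (fun A => partial_sum (fun i => Num.max (h (f i)) 0) A
     - partial_sum (fun i => Num.max (- h (f i)) 0) A)); first exact: cvgB h1 h2.
  apply/funext => A; rewrite !partial_sumE -sumrB; apply: eq_bigr => i _ /=.
  case: (lerP 0 (h (f i))) => h0.
    by rewrite max_r ?oppr_le0 // subr0.
  rewrite max_l ?oppr_ge0 ?(ltW h0) //; ring.
have [s1 h1] := part Re (fun i => normc_ge_Re (f i)).
have [s2 h2] := part Im (fun i => normc_ge_Im (f i)).
exists (s1 +i* s2); apply/cvgcP; split.
  rewrite (_ : Re \o _ = partial_sum (Re \o f)) //; apply/funext => A.
  by rewrite /comp !partial_sumE Re_sum.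
rewrite (_ : Im \o _ = partial_sum (Im \o f)) //; apply/funext => A.
by rewrite /comp !partial_sumE Im_sum.
Qed.

(** The net of finite sums may be followed along any sequence of finite sets
    that eventually catches each index of the support: a limit over [totally]
    thus becomes the limit of an explicit enumeration. *)
Lemma sum_exhaust (I : choiceType) (f : I -> C) (s : C) (A_ : nat -> {fset I}) :
  partial_sum f @ totally --> (s : C^o) ->
  (forall i, f i != 0 -> exists K0, forall K, (K0 <= K)%N -> i \in A_ K) ->
  (fun K => \sum_(i <- A_ K) f i) @ \oo --> (s : C^o).
Proof.
move=> /cvgc_normP fs ex; apply/cvgc_normP => e e0.
have [A _ hA] := fs e e0.
have [K0 hK0] : exists K0, forall i, i \in A -> f i != 0 ->
    forall K, (K0 <= K)%N -> i \in A_ K.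
  elim/finSet_rect: A {hA} => A ih; case: (fset_0Vmem A) => [->|[a aA]].
    by exists 0%N => i; rewrite inE.
  have [|K1 h1] := ih (A `\ a)%fset; first by rewrite fproperD1.
  have [fa|fa] := eqVneq (f a) 0.
    exists K1 => i iA fi K hK; apply: h1 => //; rewrite !inE iA andbT.
    by apply: contraNneq fi => ->; rewrite fa.
  have [K2 h2] := ex _ fa.
  exists (maxn K1 K2) => i iA fi K; rewrite geq_max => /andP[hK1 hK2].
  have [->|ia] := eqVneq i a; first exact: h2.
  by apply: h1 => //; rewrite !inE iA ia.
exists K0 => // K /= hK.
have := hA (A `|` A_ K)%fset; rewrite /= fsubsetUl => /(_ isT).
rewrite partial_sumE; congr (normc (_ - _) < _).
rewrite (big_fsetID _ (fun i => i \in A_ K)) /= [X in _ + X]big1_fset ?addr0.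
  by apply: eq_fbigl => i; rewrite !inE /=; case: (i \in A_ K); rewrite ?andbF ?orbT.
move=> i; rewrite !inE /= => /andP[/orP[iA|->]//] nK _.
by apply: contraNeq nK => fi; exact: hK0 iA fi K hK.
Qed.

Lemma fset_nat_bounded (A : {fset nat}) : exists N, forall i, i \in A -> (i < N)%N.
Proof.
exists (\max_(i <- A) i).+1 => i iA; rewrite ltnS.
by rewrite (big_rem i) //= leq_maxl.
Qed.

Lemma sum_fset_iota (V : nmodType) (g : nat -> V) N :
  \sum_(k <- [fset i in index_iota 0 N]%fset) g k = \sum_(0 <= k < N) g k.
Proof.
apply: perm_big; apply: uniq_perm; rewrite ?fset_uniq ?iota_uniq // => i.
by rewrite !inE.
Qed.

Lemma fset_nat_sum_le (b : nat -> R) (M : R) : (forall k, 0 <= b k) ->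
  (forall N, \sum_(0 <= k < N) b k <= M) ->
  forall A : {fset nat}, \sum_(k <- A) b k <= M.
Proof.
move=> b0 bM A; have [N hN] := fset_nat_bounded A.
apply: le_trans (bM N).
pose B := [fset i in index_iota 0 N]%fset.
have AB : (A `<=` B)%fset.
  by apply/fsubsetP => i /hN iN; rewrite !inE mem_index_iota /= iN.
apply: le_trans (sum_fset_le b0 AB) _.
by rewrite sum_fset_iota.
Qed.

Lemma series_fset (f : nat -> C) : (series f : nat -> C) = (fun N => \sum_(k <- [fset i in index_iota 0 N]%fset) f k).
Proof. by apply/funext => N; rewrite sum_fset_iota. Qed.

Lemma abs_series_cvg (f : nat -> C) (M : R) :
  (forall N, \sum_(0 <= k < N) normc (f k) <= M) ->
  exists s : C, series (f : nat -> C^o) @ \oo --> (s : C^o).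
Proof.
move=> fM; have [s hs] := abs_sum_cvg (fset_nat_sum_le (fun k => normc_ge0 (f k)) fM).
exists s; rewrite series_fset; apply: sum_exhaust hs _ => i _.
by exists i.+1 => K hK; rewrite !inE mem_index_iota /= hK.
Qed.

Lemma nneg_series_tail (b : nat -> R) (M : R) : (forall k, 0 <= b k) ->
  (forall N, \sum_(0 <= k < N) b k <= M) ->
  forall e, 0 < e -> exists K, forall N, (K <= N)%N -> \sum_(K <= k < N) b k < e.
Proof.
move=> b0 bM e e0.
have [s hs] := nneg_sum_cvg b0 (fset_nat_sum_le b0 bM).
have /cvgrPdist_lt /(_ (e / 2)) [|A _ hA] := hs; first lra.
have [K hK] := fset_nat_bounded A.
exists K => N KN.
pose B n := [fset i in index_iota 0 n]%fset.
have Bs n : (K <= n)%N -> `|s - \sum_(0 <= k < n) b k| < e / 2.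
  move=> Kn; have := hA (B n); rewrite partial_sumE sum_fset_iota; apply.
  by apply/fsubsetP => i /hK iK; rewrite !inE mem_index_iota /= (leq_trans iK).
have h1 := Bs K (leqnn _); have h2 := Bs N KN.
have := big_cat_nat (leq0n K) KN (F := b) (P := xpredT) => /= E.
move: h1 h2; rewrite E !ltr_norml /=; lra.
Qed.

Lemma normc_sum_tail (f : nat -> C) (s : C) (K : nat) (b : nat -> R) (e : R) :
  (forall k, normc (f k) <= b k) ->
  (forall N, (K <= N)%N -> \sum_(K <= k < N) b k <= e) ->
  series (f : nat -> C^o) @ \oo --> (s : C^o) -> normc (s - \sum_(0 <= k < K) f k) <= e.
Proof.
move=> fb be hs.
have hs' : (fun N => (series f : nat -> C) N - \sum_(0 <= k < K) f k) @ \oo -->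
    (s - \sum_(0 <= k < K) f k : C^o).
  exact: cvgcB hs (@cvgc_cst R _ \oo _ (\sum_(0 <= k < K) f k)).
have := @cvgc_le_norm R nat \oo _ (fun N => (series f : nat -> C) N - \sum_(0 <= k < K) f k) (s - \sum_(0 <= k < K) f k) e hs'.
apply; exists K => // N /= KN.
rewrite /series /= (big_cat_nat (leq0n K) KN) /=.
rewrite [X in normc X](_ : _ = \sum_(K <= k < N) f k); last by ring.
apply: le_trans (normc_sum _ _ _) (le_trans _ (be N KN)).
exact: ler_sum.
Qed.

(** Dominated convergence for series. *)
Lemma tannery (u : nat -> nat -> C) (v : nat -> C) (b : nat -> R) (M : R)
  (U : nat -> C) (V : C) :
  (forall j k, normc (u j k) <= b k) ->
  (forall N, \sum_(0 <= k < N) b k <= M) ->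
  (forall k, (fun j => u j k) @ \oo --> (v k : C^o)) ->
  (forall j, series (u j : nat -> C^o) @ \oo --> (U j : C^o)) ->
  series (v : nat -> C^o) @ \oo --> (V : C^o) ->
  U @ \oo --> (V : C^o).
Proof.
move=> ub bM uv uU vV; apply/cvgc_normP => e e0.
have b0 k : 0 <= b k by apply: le_trans (ub 0%N k); exact: normc_ge0.
have vb k : normc (v k) <= b k.
  by apply: (cvgc_le_norm (uv k)); near=> j; exact: ub.
have [|K hK] := nneg_series_tail b0 bM (e := e / 4); first lra.
have hK' N : (K <= N)%N -> \sum_(K <= k < N) b k <= e / 4 by move=> /hK /ltW.
have /cvgc_normP /(_ (e / 4)) h : (fun j => \sum_(0 <= k < K) u j k) @ \oo --> (\sum_(0 <= k < K) v k : C^o).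
  by apply: cvgc_sum => k _; exact: uv.
near=> j.
have h1 := normc_sum_tail (ub j) hK' (uU j).
have h2 := normc_sum_tail vb hK' vV.
have h3 : normc (\sum_(0 <= k < K) u j k - \sum_(0 <= k < K) v k) < e / 4.
  by near: j; apply: h; lra.
rewrite (_ : U j - V = (U j - \sum_(0 <= k < K) u j k) +
  (\sum_(0 <= k < K) u j k - \sum_(0 <= k < K) v k) - (V - \sum_(0 <= k < K) v k)); last by ring.
apply: le_lt_trans (normcD _ _) _; rewrite normcN.
have := normcD (U j - \sum_(0 <= k < K) u j k) (\sum_(0 <= k < K) u j k - \sum_(0 <= k < K) v k).
lra.
Unshelve. all: by end_near. Qed.

Lemma sum_Icc_absz (beta : nat -> R) (B : R) (L : nat) : (forall k, 0 <= beta k) ->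
  (forall N, \sum_(0 <= k < N) beta k <= B) ->
  \sum_(i < (2 * L).+1) beta `|(i%:Z - L%:Z)%R|%N <= 2 * B.
Proof.
move=> b0 bB; rewrite -(big_mkord xpredT (fun i => beta `|(i%:Z - L%:Z)%R|%N)).
have LL : (L <= (2 * L).+1)%N by lia.
rewrite (big_cat_nat (leq0n L) LL) /= mulr_natl mulr2n; apply: lerD.
  rewrite big_nat_rev /= add0n; apply: le_trans (bB L.+1).
  rewrite [leRHS]big_nat_recl // -[leLHS]add0r; apply: lerD => //.
  rewrite le_eqVlt; apply/orP; left; apply/eqP; apply: eq_big_nat => i iL; congr beta; lia.
rewrite -{1}[L]add0n big_addn; apply: le_trans (bB ((2 * L).+1 - L)%N).
rewrite le_eqVlt; apply/orP; left; apply/eqP; apply: eq_big_nat => i iL; congr beta; lia.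
Qed.

(** A finite subset of the lattice sits in a box, where sums of products are
    products of sums. *)
Lemma lattice_sum_bounded (N : nat) (beta : nat -> R) (B : R) : (forall k, 0 <= beta k) ->
  (forall K, \sum_(0 <= k < K) beta k <= B) ->
  forall A : {fset 'cV[int]_N},
    \sum_(l <- A) \prod_v beta `|l v ord0|%N <= (2 * B) ^+ N.
Proof.
move=> b0 bB A.
pose L := \max_(l <- A) \max_v `|l v ord0|%N.
have hL (l : 'cV[int]_N) v : l \in A -> (`|l v ord0| <= L)%N.
  by move=> lA; rewrite /L (big_rem l) //= leq_max (@leq_bigmax 'I_N (fun v => `|l v ord0|%N)).
pose phi (l : 'cV[int]_N) : {ffun 'I_N -> 'I_(2 * L).+1} := [ffun v => inord `|(l v ord0 + L%:Z)%R|%N].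
have phiE (l : 'cV[int]_N) v : l \in A -> (phi l v : nat)%:Z - L%:Z = l v ord0.
  move=> /hL h; rewrite ffunE inordK; have := h v; lia.
pose H (f : {ffun 'I_N -> 'I_(2 * L).+1}) := \prod_v beta `|((f v : nat)%:Z - L%:Z)%R|%N.
rewrite [leLHS](_ : _ = \sum_(f <- [seq phi l | l <- A]) H f); last first.
  rewrite big_map big_seq_cond [RHS]big_seq_cond; apply: eq_bigr => l /andP[lA _].
  by rewrite /H; apply: eq_bigr => v _; rewrite phiE.
have un : uniq [seq phi l | l <- A].
  rewrite map_inj_in_uniq ?fset_uniq // => l1 l2 h1 h2 e.
  by apply/matrixP => i j; rewrite ord1 -(phiE _ _ h1) -(phiE _ _ h2) e.
rewrite big_uniq //=; apply: (@le_trans _ _ (\sum_f H f)).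
  rewrite [leRHS](bigID (mem [seq phi l | l <- A])) /= lerDl sumr_ge0 // => f _.
  exact: prodr_ge0.
rewrite /H -(bigA_distr_bigA (fun v (i : 'I_(2 * L).+1) => beta `|((i : nat)%:Z - L%:Z)%R|%N)) /=.
rewrite -[X in _ <= _ ^+ X](card_ord N) -prodr_const; apply: ler_prod => v _.
by rewrite sumr_ge0 // sum_Icc_absz.
Qed.

End Sums.

(** * Integrals of complex-valued functions *)

Section ComplexIntegral.
Variable R : realType.
Local Notation C := R[i].
Local Notation Re := (@complex.Re R).
Local Notation Im := (@complex.Im R).
Local Notation leb := (@lebesgue_measure R).
Implicit Types (D : set R) (f g : R -> C).

Definition cmeas D f := measurable_fun D (Re \o f) /\ measurable_fun D (Im \o f).

Lemma cmeasS D E f : measurable E -> D `<=` E -> cmeas E f -> cmeas D f.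
Proof. by move=> mE DE [h1 h2]; split; apply: measurable_funS h1 || apply: measurable_funS h2. Qed.

Lemma cmeas_sum D (I : Type) (r : seq I) (f : I -> R -> C) :
  (forall i, cmeas D (f i)) -> cmeas D (fun t => \sum_(i <- r) f i t).
Proof.
move=> h; split.
  rewrite (_ : _ \o _ = fun t => \sum_(i <- r) Re (f i t)).
    by apply: measurable_sum => i; case: (h i).
  by apply/funext => t; rewrite /comp Re_sum.
rewrite (_ : _ \o _ = fun t => \sum_(i <- r) Im (f i t)).
  by apply: measurable_sum => i; case: (h i).
by apply/funext => t; rewrite /comp Im_sum.
Qed.

Lemma cmeas_continuous D f : open D ->
  (forall t, D t -> f x @[x --> t] --> (f t : C^o)) -> cmeas D f.
Proof.
move=> oD h; split; apply: open_continuous_measurable_fun => // t;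
  by rewrite inE => /h /cvgcP[].
Qed.

Lemma cintegrable_dom D f (g : R -> R) : measurable D -> cmeas D f ->
  leb.-integrable D (EFin \o g) -> (forall t, D t -> normc (f t) <= g t) ->
  cintegrable D f.
Proof.
move=> mD [m1 m2] ig fg; split; apply: (@le_integrable _ _ _ leb D _ _ (EFin \o g)) => //.
- exact/measurable_EFinP.
- move=> t Dt; rewrite /= lee_fin (le_trans (normc_ge_Re _)) //.
  by rewrite (le_trans (fg _ Dt)) // ler_norm.
- exact/measurable_EFinP.
- move=> t Dt; rewrite /= lee_fin (le_trans (normc_ge_Im _)) //.
  by rewrite (le_trans (fg _ Dt)) // ler_norm.
Qed.

Lemma eq_cintegral D f g : (forall t, D t -> f t = g t) -> cintegral D f = cintegral D g.
Proof.
move=> fg; rewrite /cintegral; congr (_ +i* _); apply: eq_Rintegral => t;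
  by rewrite inE => /fg ->.
Qed.

Lemma eq_cintegrable D f g : measurable D -> (forall t, D t -> f t = g t) -> cintegrable D f -> cintegrable D g.
Proof.
move=> mD fg [h1 h2]; split.
  by apply: (@eq_integrable _ _ _ leb D mD) h1 => // t; rewrite inE => /fg ->.
by apply: (@eq_integrable _ _ _ leb D mD) h2 => // t; rewrite inE => /fg ->.
Qed.

Section Linear.
Variables (D : set R) (mD : measurable D).

Lemma cintegrableD f g : cintegrable D f -> cintegrable D g -> cintegrable D (fun t => f t + g t).
Proof.
move=> [f1 f2] [g1 g2]; split.
  apply: (@eq_integrable _ _ _ leb D mD) (@integrableD _ _ _ leb D mD _ _ f1 g1) => // t _.
  by rewrite /= ReD EFinD.
apply: (@eq_integrable _ _ _ leb D mD) (@integrableD _ _ _ leb D mD _ _ f2 g2) => // t _.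
by rewrite /= ImD EFinD.
Qed.

Lemma cintegralD f g : cintegrable D f -> cintegrable D g ->
  cintegral D (fun t => f t + g t) = cintegral D f + cintegral D g.
Proof.
move=> [f1 f2] [g1 g2]; apply: complex_eqP; rewrite ?ReD ?ImD /=.
  by rewrite -RintegralD //; apply: eq_Rintegral => t _; rewrite ReD.
by rewrite -RintegralD //; apply: eq_Rintegral => t _; rewrite ImD.
Qed.

Lemma cintegrableZ (c : C) f : cintegrable D f -> cintegrable D (fun t => c * f t).
Proof.
move=> [f1 f2]; split.
  apply: (@eq_integrable _ _ _ leb D mD) (@integrableB _ _ _ leb D mD _ _ (@integrableZl _ _ _ leb D mD (Re c) _ f1) (@integrableZl _ _ _ leb D mD (Im c) _ f2)) => // t _.
  by rewrite /= ReM EFinB !EFinM.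
apply: (@eq_integrable _ _ _ leb D mD) (@integrableD _ _ _ leb D mD _ _ (@integrableZl _ _ _ leb D mD (Re c) _ f2) (@integrableZl _ _ _ leb D mD (Im c) _ f1)) => // t _.
by rewrite /= ImM EFinD !EFinM.
Qed.

Lemma cintegralZ (c : C) f : cintegrable D f ->
  cintegral D (fun t => c * f t) = c * cintegral D f.
Proof.
move=> [f1 f2].
have iZ (h : R -> R) k : leb.-integrable D (EFin \o h) -> leb.-integrable D (EFin \o (fun t => k * h t)).
  by move=> ih; apply: (@eq_integrable _ _ _ leb D mD) (@integrableZl _ _ _ leb D mD k _ ih) => // t _; rewrite /= EFinM.
apply: complex_eqP; rewrite ?ReM ?ImM /=.
  rewrite -!RintegralZl // -RintegralB //; first by apply: eq_Rintegral => t _; rewrite ReM.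
  - exact: (iZ (Re \o f)).
  - exact: (iZ (Im \o f)).
rewrite -!RintegralZl // -RintegralD //; first by apply: eq_Rintegral => t _; rewrite ImM.
- exact: (iZ (Im \o f)).
- exact: (iZ (Re \o f)).
Qed.

Lemma cintegrable0 : cintegrable D (fun _ => 0 : C).
Proof. by split; exact: integrable0. Qed.

Lemma cintegral0 : cintegral D (fun _ => 0 : C) = 0.
Proof.
by apply: complex_eqP; rewrite /= /Rintegral integral0.
Qed.

Lemma cintegrable_sum (I : Type) (r : seq I) (f : I -> R -> C) :
  (forall i, cintegrable D (f i)) -> cintegrable D (fun t => \sum_(i <- r) f i t).
Proof.
move=> h; elim: r => [|i r ih].
  by apply: (eq_cintegrable mD) cintegrable0 => t _; rewrite big_nil.
by apply: (eq_cintegrable mD) (cintegrableD (h i) ih) => t _; rewrite big_cons.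
Qed.

Lemma cintegral_sum (I : Type) (r : seq I) (f : I -> R -> C) :
  (forall i, cintegrable D (f i)) ->
  cintegral D (fun t => \sum_(i <- r) f i t) = \sum_(i <- r) cintegral D (f i).
Proof.
move=> h; elim: r => [|i r ih].
  by rewrite big_nil -[RHS]cintegral0; apply: eq_cintegral => t _; rewrite big_nil.
rewrite big_cons -ih -cintegralD //; last exact: cintegrable_sum.
by apply: eq_cintegral => t _; rewrite big_cons.
Qed.

End Linear.

Lemma Rint_dct D (h_ : nat -> R -> R) (h g : R -> R) : measurable D ->
  (forall n, measurable_fun D (h_ n)) ->
  (forall t, D t -> (fun n => h_ n t) @ \oo --> h t) ->
  leb.-integrable D (EFin \o g) ->
  (forall n t, D t -> `|h_ n t| <= g t) ->
  leb.-integrable D (EFin \o h) /\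
  (fun n => \int[leb]_(t in D) h_ n t) @ \oo --> \int[leb]_(t in D) h t.
Proof.
move=> mD mh hh ig hg.
have [|||||ih _ cv] := @dominated_convergence _ _ _ leb D mD (fun n => EFin \o h_ n) (EFin \o h) (EFin \o g).
- by move=> n; apply/measurable_EFinP; exact: mh.
- apply/measurable_EFinP; exact: measurable_fun_cvg mh hh.
- by apply: aeW => t Dt; apply/fine_cvgP; split; [exact: nearW|exact: hh].
- exact: ig.
- by apply: aeW => t n Dt; rewrite /= lee_fin; exact: hg.
split => //.
apply: fine_cvg; rewrite /Rintegral fineK //.
exact: integrable_fin_num ih.
Qed.

Lemma cint_dct D (f_ : nat -> R -> C) f (g : R -> R) : measurable D ->
  (forall n, cmeas D (f_ n)) ->
  (forall t, D t -> (fun n => f_ n t) @ \oo --> (f t : C^o)) ->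
  leb.-integrable D (EFin \o g) ->
  (forall n t, D t -> normc (f_ n t) <= g t) ->
  cintegrable D f /\
  (fun n => cintegral D (f_ n)) @ \oo --> (cintegral D f : C^o).
Proof.
move=> mD mf ff ig fg.
have [i1 c1] : leb.-integrable D (EFin \o (Re \o f)) /\
   (fun n => \int[leb]_(t in D) (Re \o f_ n) t) @ \oo --> \int[leb]_(t in D) (Re \o f) t.
  apply: Rint_dct ig _ => //; first by move=> n; case: (mf n).
    by move=> t Dt; have /cvgcP[] := ff t Dt.
  by move=> n t Dt; apply: le_trans (fg n t Dt); exact: normc_ge_Re.
have [i2 c2] : leb.-integrable D (EFin \o (Im \o f)) /\
   (fun n => \int[leb]_(t in D) (Im \o f_ n) t) @ \oo --> \int[leb]_(t in D) (Im \o f) t.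
  apply: Rint_dct ig _ => //; first by move=> n; case: (mf n).
    by move=> t Dt; have /cvgcP[] := ff t Dt.
  by move=> n t Dt; apply: le_trans (fg n t Dt); exact: normc_ge_Im.
by split => //; apply/cvgcP.
Qed.

Lemma normc_cintegral_le D f (g : R -> R) : measurable D -> cmeas D f ->
  leb.-integrable D (EFin \o g) ->
  (forall t, D t -> normc (f t) <= g t) ->
  normc (cintegral D f) <= 2 * \int[leb]_(t in D) g t.
Proof.
move=> mD mf ig fg; have [i1 i2] := cintegrable_dom mD mf ig fg.
have bd (h : C -> R) : (forall z, `|h z| <= normc z) -> leb.-integrable D (EFin \o (h \o f)) ->
    `|\int[leb]_(t in D) h (f t)| <= \int[leb]_(t in D) g t.
  move=> hz ih; apply: le_trans (@le_normr_Rintegral _ _ _ leb D _ mD ih) _.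
  apply: le_Rintegral => //.
    exact: integrable_norm.
  by move=> t Dt; apply: le_trans (hz _) (fg t Dt).
apply: le_trans (normc_le_ReIm _) _ => /=.
by rewrite mulr_natl mulr2n; apply: lerD; apply: bd => // z; [exact: normc_ge_Re|exact: normc_ge_Im].
Qed.

End ComplexIntegral.

Section RealParameter.
Variable R : realType.
Local Notation C := R[i].
Local Notation Re := (@complex.Re R).
Local Notation Im := (@complex.Im R).
Local Notation leb := (@lebesgue_measure R).

Definition rder (f : R -> R) (t d : R) := is_derive t (1 : R) f d.

Lemma rder_eq f t d d' : rder f t d -> d = d' -> rder f t d'.
Proof. by move=> h <-. Qed.

Lemma rderD f g t a b : rder f t a -> rder g t b -> rder (fun x => f x + g x) t (a + b).
Proof. by move=> h1 h2; exact: (@is_deriveD _ _ _ f g). Qed.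

Lemma rderN f t a : rder f t a -> rder (fun x => - f x) t (- a).
Proof. by move=> h1; exact: (@is_deriveN _ _ _ f). Qed.

Lemma rderM f g t a b : rder f t a -> rder g t b ->
  rder (fun x => f x * g x) t (f t * b + g t * a).
Proof. by move=> h1 h2; exact: (@is_deriveM _ _ f g). Qed.

Lemma rder_cst c t : rder (fun _ => c) t 0.
Proof. exact: is_derive_cst. Qed.

Lemma rder_id t : rder (fun x => x) t 1.
Proof. exact: is_derive_id. Qed.

Lemma rder_comp f g t a b : rder f (g t) a -> rder g t b -> rder (fun x => f (g x)) t (a * b).
Proof. by move=> h1 h2; exact: (@is_derive1_comp _ f g). Qed.

Lemma rder_continuous f t d : rder f t d -> f x @[x --> t] --> f t.
Proof. by case=> /derivable1_diffP /differentiable_continuous h _; exact: h. Qed.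

Definition cder (f : R -> C) (t : R) (d : C) :=
  rder (Re \o f) t (Re d) /\ rder (Im \o f) t (Im d).

Lemma cder_eq f t d d' : cder f t d -> d = d' -> cder f t d'.
Proof. by move=> h <-. Qed.

Lemma cderD f g t a b : cder f t a -> cder g t b -> cder (fun x => f x + g x) t (a + b).
Proof.
move=> [f1 f2] [g1 g2]; split.
  rewrite ReD (_ : _ \o _ = fun x => Re (f x) + Re (g x)); first exact: rderD.
  by apply/funext => x; rewrite /comp ReD.
rewrite ImD (_ : _ \o _ = fun x => Im (f x) + Im (g x)); first exact: rderD.
by apply/funext => x; rewrite /comp ImD.
Qed.

Lemma cderN f t a : cder f t a -> cder (fun x => - f x) t (- a).
Proof.
move=> [f1 f2]; split.
  rewrite ReN (_ : _ \o _ = fun x => - Re (f x)); first exact: rderN.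
  by apply/funext => x; rewrite /comp ReN.
rewrite ImN (_ : _ \o _ = fun x => - Im (f x)); first exact: rderN.
by apply/funext => x; rewrite /comp ImN.
Qed.

Lemma cderM f g t a b : cder f t a -> cder g t b ->
  cder (fun x => f x * g x) t (f t * b + g t * a).
Proof.
move=> [f1 f2] [g1 g2]; split.
  rewrite (_ : _ \o _ = fun x => Re (f x) * Re (g x) + - (Im (f x) * Im (g x))); last first.
    by apply/funext => x; rewrite /comp ReM.
  apply: rder_eq (rderD (rderM f1 g1) (rderN (rderM f2 g2))) _.
  rewrite /comp !(ReD, ReM); ring.
rewrite (_ : _ \o _ = fun x => Re (f x) * Im (g x) + Im (f x) * Re (g x)); last first.
  by apply/funext => x; rewrite /comp ImM.
apply: rder_eq (rderD (rderM f1 g2) (rderM f2 g1)) _.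
rewrite /comp !(ImD, ImM); ring.
Qed.

Lemma cder_cst c t : cder (fun _ => c) t 0.
Proof. by split; exact: rder_cst. Qed.

Lemma cder_real f t d : rder f t d -> cder (fun x => (f x)%:C) t d%:C.
Proof. by move=> h; split => //; exact: rder_cst. Qed.

Lemma cder_id t : cder (fun x => x%:C) t 1.
Proof. exact/cder_real/rder_id. Qed.

Lemma cderZ c f t a : cder f t a -> cder (fun x => c * f x) t (c * a).
Proof. by move=> h; apply: cder_eq (cderM (cder_cst c t) h) _; ring. Qed.

Lemma cder_cexp f t d : cder f t d -> cder (fun x => cexp (f x)) t (d * cexp (f t)).
Proof.
move=> [f1 f2].
have e1 : rder (fun x => expR (Re (f x))) t (expR (Re (f t)) * Re d).
  by apply: rder_comp => //; exact: is_derive_expR.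
have e2 : rder (fun x => cos (Im (f x))) t (- sin (Im (f t)) * Im d).
  by apply: (rder_comp (f := @cos R)) => //; exact: is_derive_cos.
have e3 : rder (fun x => sin (Im (f x))) t (cos (Im (f t)) * Im d).
  by apply: (rder_comp (f := @sin R)) => //; exact: is_derive_sin.
split.
  rewrite (_ : _ \o _ = fun x => expR (Re (f x)) * cos (Im (f x))); last first.
    by apply/funext => x; rewrite /comp Re_cexp.
  by apply: rder_eq (rderM e1 e2) _; rewrite ReM Re_cexp Im_cexp; ring.
rewrite (_ : _ \o _ = fun x => expR (Re (f x)) * sin (Im (f x))); last first.
  by apply/funext => x; rewrite /comp Im_cexp.
by apply: rder_eq (rderM e1 e3) _; rewrite ImM Re_cexp Im_cexp; ring.
Qed.

Lemma cder_continuous f t d : cder f t d -> f x @[x --> t] --> (f t : C^o).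
Proof. by move=> [h1 h2]; apply/cvgcP; split; [exact: rder_continuous h1|exact: rder_continuous h2]. Qed.

Lemma Rint_FTC (F f : R -> R) a b : a < b ->
  (forall t : R, a <= t <= b -> rder F t (f t)) ->
  (forall t : R, a <= t <= b -> f x @[x --> t] --> f t) ->
  \int[leb]_(t in `[a, b]) f t = F b - F a.
Proof.
move=> ab dF cf; rewrite /Rintegral (@continuous_FTC2 _ f F a b) //.
- by apply: continuous_in_subspaceT => t; rewrite inE /= in_itv /= => /cf.
- split.
  + move=> t; rewrite in_itv /= => /andP[t1 t2].
    by have [] := dF t _; rewrite ?(ltW t1) ?(ltW t2).
  + by apply: cvg_at_right_filter; apply: rder_continuous (dF a _); rewrite lexx ltW.
  + by apply: cvg_at_left_filter; apply: rder_continuous (dF b _); rewrite lexx ltW.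
- move=> t; rewrite in_itv /= => /andP[t1 t2]; rewrite derive1E.
  by have [] := dF t _; rewrite ?(ltW t1) ?(ltW t2).
Qed.

Lemma cint_FTC (F f : R -> C) a b : a < b ->
  (forall t : R, a <= t <= b -> cder F t (f t)) ->
  (forall t : R, a <= t <= b -> f x @[x --> t] --> (f t : C^o)) ->
  cintegral `[a, b] f = F b - F a.
Proof.
move=> ab dF cf; apply: complex_eqP; rewrite /cintegral ?ReD ?ImD ?ReN ?ImN.
  apply: (@Rint_FTC (Re \o F) (Re \o f)) => // t tab; first by case: (dF t tab).
  by have /cvgcP[] := cf t tab.
apply: (@Rint_FTC (Im \o F) (Im \o f)) => // t tab; first by case: (dF t tab).
by have /cvgcP[] := cf t tab.
Qed.

Lemma Rint_exhaust (h : R -> R) (a_ b_ : nat -> R) :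
  (forall n, 0 < a_ n) -> (forall t : R, 0 < t -> \forall n \near \oo, a_ n <= t <= b_ n) ->
  leb.-integrable `]0, +oo[ (EFin \o h) ->
  (fun n => \int[leb]_(t in `[a_ n, b_ n]) h t) @ \oo --> \int[leb]_(t in `]0, +oo[) h t.
Proof.
move=> a0 ab ih.
have mh : measurable_fun (`]0, +oo[ : set R) h.
  by move/integrableP : ih => [/measurable_EFinP].
rewrite (_ : (fun n => _) = fun n => \int[leb]_(t in `]0, +oo[) (h \_ `[a_ n, b_ n]) t); last first.
  apply/funext => n; rewrite -Rintegral_mkcondr; congr (Rintegral _ _ _).
  rewrite setIC; apply/esym/setIidl => t /=; rewrite !in_itv /= andbT => /andP[h1 _].
  exact: lt_le_trans (a0 n) h1.
apply: (fun a b c d e => (@Rint_dct R `]0, +oo[ (fun n => h \_ `[a_ n, b_ n]) h (fun t => `|h t|) a b c d e).2).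
- exact: measurable_itv.
- move=> n; apply/measurable_restrict; [exact: measurable_itv|exact: measurable_itv|].
  by apply: measurable_funS mh => //; exact: measurable_itv.
- move=> t; rewrite /= in_itv /= andbT => t0.
  apply: cvg_near_cst; have := ab t t0; apply: filterS => n hn.
  by rewrite patchE mem_set // in_itv.
- exact: (@integrable_norm _ _ _ leb _ h).
- move=> n t _; rewrite patchE; case: ifP => _ //; by rewrite normr0.
Qed.

Lemma itv_exhaust (t : R) : 0 < t ->
  \forall n \near \oo, (n.+2%:R^-1 : R) <= t <= n.+2%:R.
Proof.
move=> t0; near=> n; apply/andP; split.
  rewrite -[leRHS]invrK lef_pV2 ?posrE ?invr_gt0 //.
  apply: (@le_trans _ _ n%:R); last by rewrite ler_nat; lia.
  by near: n; exact: nbhs_infty_ger.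
apply: (@le_trans _ _ n%:R); last by rewrite ler_nat; lia.
by near: n; exact: nbhs_infty_ger.
Unshelve. all: by end_near. Qed.

Lemma cint_exhaust (f : R -> C) (a_ b_ : nat -> R) :
  (forall n, 0 < a_ n) -> (forall t : R, 0 < t -> \forall n \near \oo, a_ n <= t <= b_ n) ->
  cintegrable `]0, +oo[ f ->
  (fun n => cintegral `[a_ n, b_ n] f) @ \oo --> (cintegral `]0, +oo[ f : C^o).
Proof.
by move=> a0 ab [i1 i2]; apply/cvgcP; split;
  [exact: (@Rint_exhaust (Re \o f))|exact: (@Rint_exhaust (Im \o f))].
Qed.

Lemma cint_FTCy (F f : R -> C) (l0 l1 : C) :
  cintegrable `]0, +oo[ f ->
  (forall t : R, 0 < t -> cder F t (f t)) ->
  (forall t : R, 0 < t -> f x @[x --> t] --> (f t : C^o)) ->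
  (fun n => F n.+2%:R^-1) @ \oo --> (l0 : C^o) ->
  (fun n => F n.+2%:R) @ \oo --> (l1 : C^o) ->
  cintegral `]0, +oo[ f = l1 - l0.
Proof.
move=> intf dF cf h0 h1.
have a0 n : 0 < (n.+2%:R^-1 : R) by rewrite invr_gt0.
have := @cint_exhaust f (fun n => n.+2%:R^-1) (fun n => n.+2%:R) a0 itv_exhaust intf.
move=> /cvgc_unique; apply.
rewrite (_ : (fun n => _) = fun n => F n.+2%:R - F n.+2%:R^-1); first exact: cvgcB.
apply/funext => n; apply: cint_FTC => [|t /andP[t1 _]|t /andP[t1 _]].
- apply: (@lt_le_trans _ _ 1); last by rewrite ler1n.
  by rewrite invf_lt1 // ltr1n.
- exact/dF/lt_le_trans/t1.
- exact/cf/lt_le_trans/t1.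
Qed.

Lemma integral_substitution_sqr (h : R -> R) a b : 0 < a -> a < b ->
  (forall t : R, 0 < t -> h x @[x --> t] --> h t) ->
  \int[leb]_(t in `[a ^+ 2, b ^+ 2]) h t = \int[leb]_(t in `[a, b]) (2 * t * h (t ^+ 2)).
Proof.
move=> a0 ab ch.
have dsq (x : R) : rder (fun x : R => x ^+ 2) x (2 * x).
  by apply: (rder_eq (d := x * 1 + x * 1)); [exact: (rderM (rder_id x) (rder_id x))|ring].
have dE : ((fun x : R => x ^+ 2)^`())%classic = (fun x => 2 * x).
  by apply/funext => x; rewrite derive1E; case: (dsq x).
have c2 : continuous (fun x : R => 2 * x).
  by move=> x; apply: (@cvgM R _ _ _ (fun=> 2) id); [exact: cvg_cst|exact: cvg_id].
rewrite /Rintegral (@integration_by_substitution_increasing _ (fun x => x ^+ 2) h a b).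
- congr fine; apply: eq_integral => t _; congr EFin.
  by rewrite dE fctE /=; ring.
- exact: ltW.
- move=> x y; rewrite !in_itv /= => /andP[x1 _] /andP[y1 _] xy.
  by rewrite ltr_pXn2r ?nnegrE ?(le_trans (ltW a0)).
- by rewrite dE => x _; exact: c2.
- rewrite dE; apply/cvg_ex; exists (2 * a); exact: cvg_at_right_filter (c2 a).
- rewrite dE; apply/cvg_ex; exists (2 * b); exact: cvg_at_left_filter (c2 b).
- split.
  + by move=> x _; case: (dsq x).
  + exact: cvg_at_right_filter (rder_continuous (dsq a)).
  + exact: cvg_at_left_filter (rder_continuous (dsq b)).
- apply: continuous_in_subspaceT => t; rewrite inE /= in_itv /= => /andP[t1 _].
  by apply: ch; apply: lt_le_trans t1; rewrite exprn_gt0.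
Qed.

(** The substitution is made on compact subintervals of the open half-line and
    passed to the limit, since neither end behaves well in general. *)
Lemma cint_substitution_sqr (f : R -> C) :
  (forall t : R, 0 < t -> f x @[x --> t] --> (f t : C^o)) ->
  cintegrable `]0, +oo[ f ->
  cintegrable `]0, +oo[ (fun t => (2 * t)%:C * f (t ^+ 2)) ->
  cintegral `]0, +oo[ f = cintegral `]0, +oo[ (fun t => (2 * t)%:C * f (t ^+ 2)).
Proof.
move=> cf i1 i2.
have a0 n : 0 < (n.+2%:R^-1 : R) by rewrite invr_gt0.
have := @cint_exhaust _ (fun n => n.+2%:R^-1) (fun n => n.+2%:R) a0 itv_exhaust i2.
have a0' n : 0 < (n.+2%:R^-1 : R) ^+ 2 by rewrite exprn_gt0.
have ex (t : R) : 0 < t -> \forall n \near \oo, (n.+2%:R^-1 : R) ^+ 2 <= t <= n.+2%:R ^+ 2.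
  move=> t0; have := itv_exhaust t0; apply: filterS => n /andP[h1 h2]; apply/andP; split.
    apply: le_trans h1; rewrite expr2 ler_piMr ?(ltW (a0 n)) //.
    by rewrite invf_le1 // ler1n.
  by apply: le_trans h2 _; rewrite expr2 ler_pMr // ler1n.
have := @cint_exhaust _ (fun n => n.+2%:R^-1 ^+ 2) (fun n => n.+2%:R ^+ 2) a0' ex i1.
rewrite (_ : (fun n => _) = fun n => cintegral `[n.+2%:R^-1, n.+2%:R] (fun t => (2 * t)%:C * f (t ^+ 2))).
  exact: cvgc_unique.
apply/funext => n.
have ab : (n.+2%:R^-1 : R) < n.+2%:R.
  apply: (@lt_le_trans _ _ 1); last by rewrite ler1n.
  by rewrite invf_lt1 // ltr1n.
rewrite /cintegral; congr (_ +i* _).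
  rewrite (@integral_substitution_sqr (Re \o f) _ _ (a0 n) ab); last by move=> t /cf /cvgcP[].
  by apply: eq_Rintegral => t _; rewrite ReM /= mul0r subr0.
rewrite (@integral_substitution_sqr (Im \o f) _ _ (a0 n) ab); last by move=> t /cf /cvgcP[].
by apply: eq_Rintegral => t _; rewrite ImM /= mul0r addr0.
Qed.

Lemma integrable_exp (K e : R) : 0 < e ->
  leb.-integrable `]0, +oo[ (EFin \o (fun t => K * expR (- (e * t)))).
Proof.
move=> e0.
have dexp (t : R) : rder (fun t => - (e^-1 * expR (- (e * t)))) t (expR (- (e * t))).
  apply: (rder_eq (d := - (e^-1 * (expR (- (e * t)) * - (e * 1 + t * 0)) + expR (- (e * t)) * 0))).
    apply/rderN/rderM; first exact: rder_cst.
    apply: (rder_comp (f := expR)); first exact: is_derive_expR.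
    by apply/rderN/rderM; [exact: rder_cst|exact: rder_id].
  by field; rewrite gt_eqF.
have cexp : continuous (fun t : R => expR (- (e * t))).
  move=> t; apply: (rder_continuous (d := expR (- (e * t)) * - (e * 1 + t * 0))).
  apply: (rder_comp (f := expR)); first exact: is_derive_expR.
  by apply/rderN/rderM; [exact: rder_cst|exact: rder_id].
have lim0 : (fun t : R => - (e^-1 * expR (- (e * t)))) x @[x --> +oo] --> (0 : R).
  rewrite -[X in _ --> X]oppr0 -[X in _ --> - X](mulr0 e^-1); apply: cvgN; apply: cvgM; first exact: cvg_cst.
  apply/cvgrPdist_lt => r r0; near=> x.
  rewrite sub0r normrN ger0_norm ?expR_ge0 // expRN -[ltRHS]invrK ltf_pV2 ?posrE ?expR_gt0 ?invr_gt0 //.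
  apply: (@lt_le_trans _ _ (1 + e * x)); last exact: expR_ge1Dx.
  rewrite -ltrBlDl mulrC -ltr_pdivrMr //.
  by near: x; apply: nbhs_pinfty_gt; rewrite num_real.
have iexp : (\int[leb]_(t in (`[0%R, +oo[ : set R)) (expR (- (e * t))%R)%:E = (0%R%:E - (- (e^-1 * expR (- (e * 0))))%R%:E))%E.
  apply: (@ge0_continuous_FTC2y R (fun t => expR (- (e * t))) (fun t => - (e^-1 * expR (- (e * t)))) 0 0) => //.
  - exact/continuous_subspaceT.
  - by apply: cvg_at_right_filter; exact: rder_continuous (dexp 0).
  - by move=> x _; rewrite derive1E; case: (dexp x).
have ie : leb.-integrable `[0, +oo[ (EFin \o (fun t => expR (- (e * t)))).
  apply/integrableP; split.
    apply/measurable_EFinP; apply: measurable_funTS; exact: (continuous_measurable_fun cexp).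
  rewrite [X in (X < _)%E](_ : _ = (0%R%:E - (- (e^-1 * expR (- (e * 0))))%R%:E)%E); first exact: ltry.
  by rewrite -iexp; apply: eq_integral => t _; rewrite /= ger0_norm ?expR_ge0.
have ie' : leb.-integrable `]0, +oo[ (EFin \o (fun t => expR (- (e * t)))).
  apply: (@integrableS _ _ _ leb `[0, +oo[) ie => //.
  by move=> t /=; rewrite !in_itv /= !andbT => /ltW.
apply: (@eq_integrable _ _ _ leb _ _ (fun t => K%:E * (EFin \o (fun t => expR (- (e * t)))) t)%E) => //.
exact: (@integrableZl _ _ _ leb).
Unshelve. all: by end_near. Qed.

(** The integral does not depend on [s]: its derivative is the integral of
    [dphi], which is also the derivative of [psi s] in [t], and [psi s] vanishes
    at both ends. This is Cauchy's theorem for a moving contour, with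
    differentiation under the integral sign instead of a closed path. *)
Lemma cint_homotopy (phi dphi psi : R -> R -> C) (g : R -> R) (u v : R) :
  u < 0 -> 1 < v ->
  leb.-integrable `]0, +oo[ (EFin \o g) ->
  (forall s t : R, u < s < v -> 0 < t -> cder (phi ^~ t) s (dphi s t)) ->
  (forall s t : R, u < s < v -> 0 < t -> normc (phi s t) <= g t /\ normc (dphi s t) <= g t) ->
  (forall s t : R, u < s < v -> 0 < t -> phi s x @[x --> t] --> (phi s t : C^o)) ->
  (forall s t : R, u < s < v -> 0 < t -> dphi s x @[x --> t] --> (dphi s t : C^o)) ->
  (forall s t : R, u < s < v -> 0 < t -> cder (psi s) t (dphi s t)) ->
  (forall s : R, u < s < v -> (fun n => psi s n.+2%:R^-1) @ \oo --> (0 : C^o)) ->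
  (forall s : R, u < s < v -> (fun n => psi s n.+2%:R) @ \oo --> (0 : C^o)) ->
  cintegral `]0, +oo[ (phi 1) = cintegral `]0, +oo[ (phi 0).
Proof.
move=> u0 v1 ig dphiE bd cphi cdphi dpsi psi0 psi1.
have mD : measurable (`]0, +oo[%classic : set R) by exact: measurable_itv.
have oD : open (`]0, +oo[%classic : set R) by exact: itv_open_ends_open.
have inD (t : R) : `]0, +oo[%classic t = (0 < t) :> Prop.
  by rewrite /= in_itv /= andbT.
have iphi s : u < s < v -> cintegrable `]0, +oo[ (phi s).
  move=> hs; apply: cintegrable_dom ig _ => //.
    by apply: cmeas_continuous => // t; rewrite inD; exact: cphi.
  by move=> t; rewrite inD => /(bd s t hs)[].
have idphi s : u < s < v -> cintegrable `]0, +oo[ (dphi s).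
  move=> hs; apply: cintegrable_dom ig _ => //.
    by apply: cmeas_continuous => // t; rewrite inD; exact: cdphi.
  by move=> t; rewrite inD => /(bd s t hs)[].
have d0 s : u < s < v -> cintegral `]0, +oo[ (dphi s) = 0.
  move=> hs; rewrite (@cint_FTCy (psi s) (dphi s) 0 0) ?subrr //.
  - exact: idphi.
  - by move=> t; exact: dpsi.
  - by move=> t; exact: cdphi.
  - exact: psi0.
  - exact: psi1.
have key (h : C -> R) : (forall z, `|h z| <= normc z) ->
   (forall s t : R, u < s < v -> 0 < t -> rder (fun s => h (phi s t)) s (h (dphi s t))) ->
   (forall s : R, u < s < v -> leb.-integrable `]0, +oo[ (EFin \o (fun t => h (phi s t)))) ->
   (forall s : R, u < s < v -> \int[leb]_(t in `]0, +oo[) h (dphi s t) = 0) ->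
   \int[leb]_(t in `]0, +oo[) h (phi 1 t) = \int[leb]_(t in `]0, +oo[) h (phi 0 t).
  move=> hn hd hi hz.
  pose F s := \int[leb]_(t in `]0, +oo[) h (phi s t).
  have der1 s t : u < s < v -> 0 < t -> ((fun s => h (phi s t))^`())%classic s = h (dphi s t).
    by move=> hs ht; rewrite derive1E; case: (hd s t hs ht).
  have dF s : u < s < v -> rder F s 0.
    move=> hs.
    have Is : `]u, v[%classic s by rewrite /= in_itv.
    have H := @derivable_under_integral R _ _ leb (fun s t => h (phi s t)) `]0, +oo[ mD s u v Is _ _ (fun t => `|g t|) _ _ _.
    have H' := @differentiation_under_integral R _ _ leb (fun s t => h (phi s t)) `]0, +oo[ mD s u v Is _ _ (fun t => `|g t|) _ _ _.
    have a1 : forall x, `]u, v[%classic x -> leb.-integrable `]0, +oo[ (EFin \o (fun t => h (phi x t))).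
      by move=> x; rewrite /= in_itv; exact: hi.
    have a2 : forall x y, `]u, v[%classic x -> `]0, +oo[%classic y -> derivable (fun s => h (phi s y)) x 1.
      by move=> x y; rewrite inD /= in_itv => hx hy; case: (hd x y hx hy).
    have a3 : leb.-integrable `]0, +oo[ (EFin \o (fun t => `|g t|)).
      exact: (@integrable_norm _ _ _ leb _ g).
    have a4 : forall x y, `]u, v[%classic x -> `]0, +oo[%classic y ->
        `| ((fun s => h (phi s y))^`())%classic x| <= `|g y|.
      move=> x y; rewrite inD /= in_itv => hx hy; rewrite der1 //.
      apply: le_trans (hn _) (le_trans (bd x y hx hy).2 _); exact: ler_norm.
    split; first exact: H.
    rewrite -derive1E H' // -[RHS](hz s hs); apply: eq_Rintegral => t.
    by rewrite inE inD => ht; exact: der1.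
  have [||c _] := @MVT R F (fun _ => 0) 0 1 ltr01.
  - move=> s; rewrite in_itv /= => /andP[s0 s1]; apply: dF; lra.
  - apply: continuous_in_subspaceT => s; rewrite inE /= in_itv /= => /andP[s0 s1].
    by apply: rder_continuous (dF s _); lra.
  - by rewrite mul0r => /eqP; rewrite subr_eq0 => /eqP.
rewrite /cintegral; congr (_ +i* _); apply: key.
- exact: normc_ge_Re.
- by move=> s t hs ht; case: (dphiE s t hs ht).
- by move=> s hs; case: (iphi s hs).
- by move=> s hs; have := d0 s hs => /(congr1 Re).
- exact: normc_ge_Im.
- by move=> s t hs ht; case: (dphiE s t hs ht).
- by move=> s hs; case: (iphi s hs).
- by move=> s hs; have := d0 s hs => /(congr1 Im).
Qed.

End RealParameter.

(** * A Gaussian integral over two rays *)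

Section GaussRays.
Variable R : realType.
Local Notation C := R[i].
Local Notation Re := (@complex.Re R).
Local Notation Im := (@complex.Im R).
Local Notation leb := (@lebesgue_measure R).

(** A Gaussian absorbs polynomial and exponential factors; the majorant is kept
    as a plain decaying exponential, whose integrability is elementary. *)
Lemma gauss_dom (kappa K L t : R) : 0 < kappa -> 0 <= t ->
  (1 + t) ^+ 2 * expR (- (kappa * t ^+ 2) + K * t + L) <=
  4 * expR (1 + L + (K + 2) ^+ 2 / (4 * kappa)) * expR (- (1 * t)).
Proof.
move=> k0 t0.
have h1 : (1 + t) ^+ 2 <= 4 * expR (1 + t).
  have hE := expR_ge1Dx ((1 + t) / 2).
  have -> : expR (1 + t) = expR ((1 + t) / 2) ^+ 2 by rewrite expr2 -expRD; congr expR; field.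
  nra.
apply: le_trans (ler_wpM2r (expR_ge0 _) h1) _.
rewrite -!mulrA ler_pM2l // -!expRD ler_expR.
rewrite [leRHS](_ : _ = (1 + t + (- (kappa * t ^+ 2) + K * t + L)) + (kappa * t - (K + 2) / 2) ^+ 2 / kappa); last first.
  by field; rewrite gt_eqF.
by rewrite lerDl divr_ge0 ?sqr_ge0 ?(ltW k0).
Qed.

(* One half of the moving contour is the ray [w = V s * t + s * d], which goes
   from the positive axis at [s = 0] to the given ray at [s = 1]; [psi] is chosen
   so that the derivatives of [phi] in [s] and of [psi] in [t] agree. *)
Let V (v : C) (s : R) : C := 1 + s%:C * (v - 1).
Let W (v d : C) (s t : R) : C := V v s * t%:C + s%:C * d.
Let E (v d : C) (s t : R) : C := cexp (- (W v d s t ^+ 2)).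
Let phi v d s t : C := V v s * E v d s t.
Let psi v d s t : C := ((v - 1) * t%:C + d) * E v d s t.
Let dphi v d s t : C := (v - 1) * E v d s t + ((v - 1) * t%:C + d) * (- (2 * W v d s t * V v s) * E v d s t).

Let dV v s : cder (V v) s (v - 1).
Proof.
apply: cder_eq (cderD (cder_cst 1 s) (cderM (cder_id s) (cder_cst (v - 1) s))) _; ring.
Qed.

Let dWs v d s t : cder (fun s => W v d s t) s ((v - 1) * t%:C + d).
Proof.
apply: cder_eq (cderD (cderM (dV v s) (cder_cst t%:C s)) (cderM (cder_id s) (cder_cst d s))) _; ring.
Qed.

Let dWt v d s t : cder (W v d s) t (V v s).
Proof.
apply: cder_eq (cderD (cderM (cder_cst (V v s) t) (cder_id t)) (cder_cst (s%:C * d) t)) _; ring.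
Qed.

Let dphiE v d s t : cder (fun s => phi v d s t) s (dphi v d s t).
Proof.
have h := cderM (dV v s) (cder_cexp (cderN (cderM (dWs v d s t) (dWs v d s t)))).
apply: cder_eq h _; rewrite /dphi /E expr2; ring.
Qed.

Let dpsiE v d s t : cder (psi v d s) t (dphi v d s t).
Proof.
have h1 : cder (fun t => (v - 1) * t%:C + d) t (v - 1).
  apply: cder_eq (cderD (cderM (cder_cst (v - 1) t) (cder_id t)) (cder_cst d t)) _; ring.
have h := cderM h1 (cder_cexp (cderN (cderM (dWt v d s t) (dWt v d s t)))).
apply: cder_eq h _; rewrite /dphi /E expr2; ring.
Qed.

Let dphit v d s t : exists D, cder (phi v d s) t D.
Proof.
eexists; exact: (cderM (cder_cst (V v s) t) (cder_cexp (cderN (cderM (dWt v d s t) (dWt v d s t))))).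
Qed.

Let ddphit v d s t : exists D, cder (dphi v d s) t D.
Proof.
have dE := cder_cexp (cderN (cderM (dWt v d s t) (dWt v d s t))).
have h1 : cder (fun t => (v - 1) * t%:C + d) t (v - 1).
  apply: cder_eq (cderD (cderM (cder_cst (v - 1) t) (cder_id t)) (cder_cst d t)) _; ring.
eexists; apply: (cderD (cderM (cder_cst (v - 1) t) dE) (cderM h1 (cderM (cderN (cderM (cderM (cder_cst 2 t) (dWt v d s t)) (cder_cst (V v s) t))) dE))).
Qed.

Let bounds v d : `|Im v| < Re v -> exists e G, 0 < e /\
  forall s t, - e < s < 1 + e -> 0 < t ->
   [/\ normc (phi v d s t) <= G * expR (- (1 * t)),
       normc (dphi v d s t) <= G * expR (- (1 * t)) &
       normc (psi v d s t) <= G * expR (- (1 * t))].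
Proof.
move=> hv.
pose x := Re v; pose y := `|Im v|.
have y0 : 0 <= y by exact: normr_ge0.
have xy : y < x by [].
pose e := Num.min (Num.min 1 ((x - y) / 2)) (1 / (2 * (x + y + 1))).
have e0 : 0 < e.
  by rewrite !lt_min ltr01 /= divr_gt0 ?subr_gt0 //= divr_gt0 // mulr_gt0 //; lra.
have e1 : e <= 1 by rewrite !ge_min lexx.
have e2 : e <= (x - y) / 2 by rewrite !ge_min lexx ?orbT.
have e3 : e * (x + y) <= 1 / 2.
  have : e <= 1 / (2 * (x + y + 1)) by rewrite !ge_min lexx ?orbT.
  rewrite ler_pdivlMr; last by lra.
  move=> h; nra.
pose k0 := Num.min (1 / 2) ((x - y) / 2).
have k00 : 0 < k0 by rewrite lt_min; lra.
have k01 : k0 <= 1 / 2 by rewrite ge_min lexx.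
have k02 : k0 <= (x - y) / 2 by rewrite ge_min lexx orbT.
pose A := 1 + 2 * normc (v - 1).
pose nd := normc d.
have nd0 : 0 <= nd by exact: normc_ge0.
have nv0 : 0 <= normc (v - 1) by exact: normc_ge0.
pose B := A + normc (v - 1) + 2 * A * (normc (v - 1) + nd) * (A + 2 * nd) + (normc (v - 1) + nd).
pose K := 4 * A * nd; pose L := 4 * nd ^+ 2.
have A0 : 0 < A by rewrite /A; lra.
have B0 : 0 <= B.
  rewrite /B !addr_ge0 // ?mulr_ge0 //; lra.
exists e, (B * (4 * expR (1 + L + (K + 2) ^+ 2 / (4 * k0 ^+ 2)))); split => // s t /andP[s1 s2] t0.
have sabs : `|s| <= 2 by rewrite ler_norml; lra.
have nV : normc (V v s) <= A.
  apply: le_trans (normcD _ _) _; rewrite normc1 normcM normc_real /A lerD2l.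
  exact: ler_wpM2r.
have nW : normc (W v d s t) <= A * t + 2 * nd.
  apply: le_trans (normcD _ _) _; rewrite !normcM !normc_real (gtr0_norm t0).
  by apply: lerD; apply: ler_wpM2r => //; exact: ltW.
have ReV : k0 <= Re (V v s) - `|Im (V v s)|.
  have -> : Re (V v s) = 1 + s * (x - 1) by rewrite /V !ReImE; ring.
  have -> : Im (V v s) = s * Im v by rewrite /V !ReImE; ring.
  rewrite normrM -/y; case: (lerP 0 s) => s0; first rewrite (ger0_norm s0); last rewrite (ltr0_norm s0).
    case: (lerP s 1) => hs1.
      have m1 : (1 - s) * (2 * k0) <= 1 - s by rewrite ler_piMr; lra.
      have m2 : s * (2 * k0) <= s * (x - y) by apply: ler_wpM2l => //; lra.
      lra.
    have m1 : 1 * (x - y) <= s * (x - y) by apply: ler_wpM2r; lra.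
    lra.
  have m1 : - s * (x + y) <= e * (x + y) by apply: ler_wpM2r; lra.
  lra.
have ReV2 : k0 ^+ 2 <= Re (V v s ^+ 2).
  rewrite [V v s ^+ 2]expr2 ReM.
  have h2 : Im (V v s) * Im (V v s) = `|Im (V v s)| * `|Im (V v s)| by rewrite -normrM ger0_norm // -expr2 sqr_ge0.
  rewrite h2; have := normr_ge0 (Im (V v s)); nra.
have nE : normc (E v d s t) <= expR (- (k0 ^+ 2 * t ^+ 2) + K * t + L).
  rewrite normc_cexp ler_expR ReN.
  have -> : W v d s t ^+ 2 = (t ^+ 2)%:C * V v s ^+ 2 + (2 * t)%:C * (V v s * (s%:C * d)) + (s%:C * d) ^+ 2.
    have -> : (t ^+ 2)%:C = t%:C ^+ 2 :> C by rewrite rmorphXn.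
    have -> : (2 * t)%:C = 2 * t%:C :> C by rewrite rmorphM rmorph_nat.
    by rewrite /W; ring.
  rewrite 2!ReD [Re ((t ^+ 2)%:C * _)]ReM [Re ((2 * t)%:C * _)]ReM !ImiE !mul0r !subr0 !ReiE.
  have n1 : normc (s%:C * d) <= 2 * nd by rewrite normcM normc_real ler_wpM2r.
  have n2 : - (A * (2 * nd)) <= Re (V v s * (s%:C * d)).
    have : `|Re (V v s * (s%:C * d))| <= A * (2 * nd).
      apply: le_trans (normc_ge_Re _) _; rewrite normcM.
      by apply: ler_pM => //; exact: normc_ge0.
    by rewrite ler_norml => /andP[].
  have n3 : - (2 * nd) ^+ 2 <= Re ((s%:C * d) ^+ 2).
    have : `|Re ((s%:C * d) ^+ 2)| <= (2 * nd) ^+ 2.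
      apply: le_trans (normc_ge_Re _) _; rewrite normcX.
      by apply: lerXn2r; rewrite ?nnegrE ?normc_ge0 ?mulr_ge0.
    by rewrite ler_norml => /andP[].
  rewrite /K /L; have := ler_wpM2l (sqr_ge0 t) ReV2; have := ler_wpM2l (ltW t0) n2.
  rewrite exprMn in n3; lra.
have k2 : 0 < k0 ^+ 2 by rewrite exprn_gt0.
have dom := gauss_dom K L k2 (ltW t0).
have fin (z : C) (b : R) : normc z <= b -> b <= B * (1 + t) ^+ 2 ->
    normc (z * E v d s t) <= B * (4 * expR (1 + L + (K + 2) ^+ 2 / (4 * k0 ^+ 2))) * expR (- (1 * t)).
  move=> hz hb; rewrite normcM.
  apply: (@le_trans _ _ ((B * (1 + t) ^+ 2) * expR (- (k0 ^+ 2 * t ^+ 2) + K * t + L))).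
    by apply: ler_pM; rewrite ?normc_ge0 //; exact: le_trans hz hb.
  by rewrite -[leLHS]mulrA -[leRHS]mulrA; apply: ler_wpM2l.
have np : normc ((v - 1) * t%:C + d) <= (normc (v - 1) + nd) * (1 + t).
  apply: le_trans (normcD _ _) _; rewrite normcM normc_real (gtr0_norm t0) -/nd; nra.
have tt : 1 <= (1 + t) ^+ 2 by nra.
have t1 : 1 + t <= (1 + t) ^+ 2 by nra.
have Bparts : [/\ A <= B, normc (v - 1) + nd <= B & normc (v - 1) + 2 * A * (normc (v - 1) + nd) * (A + 2 * nd) <= B].
  have h : 0 <= 2 * A * (normc (v - 1) + nd) * (A + 2 * nd) by rewrite !mulr_ge0 ?addr_ge0 ?mulr_ge0 ?(ltW A0).
  by rewrite /B; split; lra.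
case: Bparts => Bp1 Bp2 Bp3.
split.
- by apply: (fin _ A) => //; nra.
- rewrite /dphi [X in normc X](_ : _ = ((v - 1) + ((v - 1) * t%:C + d) * (- (2 * W v d s t * V v s))) * E v d s t); last by ring.
  apply: (fin _ (normc (v - 1) + 2 * A * (normc (v - 1) + nd) * (A + 2 * nd) * (1 + t) ^+ 2)).
    apply: le_trans (normcD _ _) _; rewrite lerD2l normcM normcN !normcM.
    have -> : normc (2 : C) = 2 by rewrite -(rmorph_nat (real_complex R)) normc_real ger0_norm.
    apply: (@le_trans _ _ (((normc (v - 1) + nd) * (1 + t)) * (2 * ((A + 2 * nd) * (1 + t)) * A))).
      apply: ler_pM; rewrite ?normc_ge0 ?mulr_ge0 ?normc_ge0 //.
      apply: ler_pM; rewrite ?normc_ge0 ?mulr_ge0 ?normc_ge0 //.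
      rewrite ler_pM2l //; apply: le_trans nW _; nra.
    by rewrite le_eqVlt; apply/orP; left; apply/eqP; ring.
  apply: (@le_trans _ _ ((normc (v - 1) + 2 * A * (normc (v - 1) + nd) * (A + 2 * nd)) * (1 + t) ^+ 2)); last by apply: ler_wpM2r => //; exact: sqr_ge0.
  by rewrite [leRHS]mulrDl lerD2r ler_peMr.
- apply: (fin _ ((normc (v - 1) + nd) * (1 + t))) => //.
  apply: ler_pM => //; lra.
Qed.

Lemma Rint_gauss : \int[leb]_(t in `]0, +oo[) expR (- t ^+ 2) = Num.sqrt pi / 2 :> R.
Proof.
have := @integral0y_gauss R; rewrite -integral_itv_obnd_cbnd; last first.
  by apply/measurable_EFinP/measurable_funTS; exact: measurable_gauss_fun.
by rewrite /Rintegral => -> .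
Qed.

(** Rotating each ray to the positive axis while sliding the origin of the
    contour back to 0 does not change the integral of [exp (- w ^ 2)]: at the
    common origin of the two rays the boundary terms cancel. *)
Lemma gauss_rays (v v' d : C) : `|Im v| < Re v -> `|Im v'| < Re v' ->
  cintegral `]0, +oo[ (fun t => v * cexp (- (v * t%:C + d) ^+ 2) + v' * cexp (- (v' * t%:C - d) ^+ 2))
  = (Num.sqrt pi)%:C.
Proof.
move=> hv hv'.
have [e1 [G1 [e10 b1]]] := bounds d hv.
have [e2 [G2 [e20 b2]]] := bounds (- d) hv'.
pose e := Num.min e1 e2.
have e0 : 0 < e by rewrite lt_min e10.
have ee1 : e <= e1 by rewrite ge_min lexx.
have ee2 : e <= e2 by rewrite ge_min lexx orbT.
have I1 (s : R) : - e < s < 1 + e -> - e1 < s < 1 + e1 by lra.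
have I2 (s : R) : - e < s < 1 + e -> - e2 < s < 1 + e2 by lra.
have oe : 1 < 1 + e by lra.
have en : - e < 0 by lra.
have := @cint_homotopy R (fun s t => phi v d s t + phi v' (- d) s t)
  (fun s t => dphi v d s t + dphi v' (- d) s t) (fun s t => psi v d s t + psi v' (- d) s t)
  (fun t => (G1 + G2) * expR (- (1 * t))) (- e) (1 + e) en oe (integrable_exp _ ltr01).
have E1 : (fun t => phi v d 1 t + phi v' (- d) 1 t) = (fun t => v * cexp (- (v * t%:C + d) ^+ 2) + v' * cexp (- (v' * t%:C - d) ^+ 2)).
  apply/funext => t; rewrite /phi /E /W /V; congr (_ * cexp (- (_ ^+ 2)) + _ * cexp (- (_ ^+ 2))); ring.
have E0 : (fun t => phi v d 0 t + phi v' (- d) 0 t) = (fun t => 2 * (expR (- t ^+ 2))%:C).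
  apply/funext => t; rewrite /phi /E /W /V !mul0r !addr0 !mul1r -cexp_real rmorphN rmorphXn; ring.
rewrite E1 E0 => ->.
- rewrite cintegralZ //; last first.
    apply: (@cintegrable_dom _ _ _ (fun t => 4 * expR (1 + 0 + (0 + 2) ^+ 2 / (4 * 1)) * expR (- (1 * t)))).
    + exact: measurable_itv.
    + apply: cmeas_continuous; first exact: itv_open_ends_open.
      move=> t _; apply: (@cder_continuous _ _ _ (expR (- t ^+ 2) * - (t * 1 + t * 1))%:C).
      apply: cder_real; apply: (rder_comp (f := expR)); first exact: is_derive_expR.
      exact: (rderN (rderM (rder_id t) (rder_id t))).
    + exact: integrable_exp.
    + move=> t /=; rewrite in_itv /= andbT => t0; rewrite normc_real ger0_norm ?expR_ge0 //.
      have := gauss_dom 0 0 ltr01 (ltW t0); apply: le_trans.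
      rewrite mul1r mul0r !addr0 -[leLHS]mul1r; apply: ler_wpM2r; first exact: expR_ge0.
      by nra.
  rewrite /cintegral (_ : (\int[leb]_(t in _) Im _) = 0); last first.
    by rewrite /Rintegral integral0_eq.
  rewrite Rint_gauss; apply: complex_eqP; rewrite ?ReM ?ImM /=; last by ring.
  by field.
- by move=> s t _ _; apply: cderD; exact: dphiE.
- move=> s t hs t0; have [p1 p2 _] := b1 s t (I1 s hs) t0; have [q1 q2 _] := b2 s t (I2 s hs) t0.
  by rewrite mulrDl; split; apply: le_trans (normcD _ _) _; apply: lerD.
- move=> s t _ _; have [D1 h1] := dphit v d s t; have [D2 h2] := dphit v' (- d) s t.
  exact: (cder_continuous (cderD h1 h2)).
- move=> s t _ _; have [D1 h1] := ddphit v d s t; have [D2 h2] := ddphit v' (- d) s t.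
  exact: (cder_continuous (cderD h1 h2)).
- by move=> s t _ _; apply: cderD; exact: dpsiE.
- move=> s _.
  have h0 := cder_continuous (cderD (dpsiE v d s 0) (dpsiE v' (- d) s 0)).
  have l0 : (psi v d s 0 + psi v' (- d) s 0) = 0.
    rewrite /psi /E /W !mulr0 !add0r mulrN sqrrN; ring.
  move: h0; rewrite l0 => h0.
  apply: (cvg_comp (fun n => n.+2%:R^-1 : R) _ _ h0).
  by have := @cvg_harmonic R; rewrite -(cvg_shiftS (harmonic : nat -> R)).
- move=> s hs; apply/cvgc_norm0.
  apply: (@squeeze_cvgr _ _ _ _ (fun _ => 0) (fun n => (G1 + G2) * expR (- (1 * n.+2%:R)))).
  + apply: nearW => n; rewrite normc_ge0 subr0 /= mulrDl.
    have n0 : 0 < n.+2%:R :> R by rewrite ltr0n.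
    apply: le_trans (normcD _ _) _; apply: lerD; first by have [] := b1 s _ (I1 s hs) n0.
    by have [] := b2 s _ (I2 s hs) n0.
  + exact: cvg_cst.
  + rewrite -[X in _ --> X](mulr0 (G1 + G2)); apply: cvgM; first exact: cvg_cst.
    apply: (@squeeze_cvgr _ _ _ _ (fun _ => 0) (fun n => n.+1%:R^-1)).
    * apply: nearW => n; rewrite expR_ge0 /= expRN lef_pV2 ?posrE ?expR_gt0 ?ltr0n // mul1r.
      by apply: le_trans (expR_ge1Dx _); rewrite -natr1 addrC -!natr1; lra.
    * exact: cvg_cst.
    * exact: cvg_harmonic.
Qed.

End GaussRays.

(** * The plumbing lattice *)

Lemma sum_enum_val (T : finType) (W : nmodType) (F : T -> W) :
  \sum_(i < #|T|) F (enum_val i) = \sum_v F v.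
Proof.
rewrite [RHS](reindex (@enum_val T T)) /= //.
by exists enum_rank => x _; rewrite ?enum_valK ?enum_rankK.
Qed.

Section StarPlumbing.
Variables (n : nat) (p0 : int) (k : 'I_n -> seq int).
Local Notation V := (vertex k).
Implicit Types X Y : V -> int.

Definition arm_vertex (j : 'I_n) (u : 'I_(size (k j))) : V :=
  Some (Tagged (fun j => 'I_(size (k j))) u).

Lemma vertexP (P : V -> Prop) : P None -> (forall j u, P (@arm_vertex j u)) -> forall v, P v.
Proof. by move=> h0 h1 [[j u]|]; [exact: h1|exact: h0]. Qed.

Lemma sum_vertex (W : nmodType) (F : V -> W) :
  \sum_v F v = F None + \sum_j \sum_(u < size (k j)) F (arm_vertex u).
Proof.
rewrite (bigD1 None) //=; congr (_ + _).
rewrite (reindex_omap Some id) /=; last by case.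
rewrite (sig_big_dep (fun _ => true) (fun _ _ => true) (fun j u => F (@arm_vertex j u))) /=.
by apply: eq_big => [[j u]|[j u] _] //=; rewrite eqxx.
Qed.

(** Position [0] is the centre, position [i.+1] the vertex of index [i] of the
    arm. As the value past the end of the arm is 0, the equation at the terminal
    vertex has the same three terms as at the other vertices of the arm. *)
Definition along X (j : 'I_n) (i : nat) : int :=
  if i is i'.+1 then (if insub i' is Some u then X (@arm_vertex j u) else 0) else X None.

Lemma along_vertex X j (u : 'I_(size (k j))) : along X j u.+1 = X (arm_vertex u).
Proof. by rewrite /along valK. Qed.

Lemma along_out X j i : (size (k j) < i)%N -> along X j i = 0.
Proof. by case: i => // i; rewrite ltnS /along => h; rewrite insubN // -leqNgt. Qed.

Definition adj_sum X (v : V) : int := \sum_w (adj v w)%:R * X w.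

Lemma sum_pick (N i : nat) (f : 'I_N -> int) :
  \sum_(u < N) (u == i :> nat)%:R * f u = if insub i is Some u then f u else 0.
Proof.
case: insubP => [u _ ui|hi].
  rewrite (bigD1 u) //= ui eqxx mul1r big1 ?addr0 // => w wu.
  by rewrite -ui (inj_eq val_inj) (negPf wu) mul0r.
rewrite big1 // => u _; case: eqP => [ui|]; last by rewrite mul0r.
by rewrite -ui ltn_ord in hi.
Qed.

Lemma adj_sum_centre X : adj_sum X None = \sum_j along X j 1.
Proof.
rewrite /adj_sum sum_vertex /= mul0r add0r; apply: eq_bigr => j _.
exact: (sum_pick 0 (fun u => X (@arm_vertex j u))).
Qed.

Lemma adj_sum_arm X j (i : 'I_(size (k j))) :
  adj_sum X (arm_vertex i) = along X j i + along X j i.+2.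
Proof.
rewrite /adj_sum sum_vertex (bigD1 j) //= [X in _ + (_ + X)]big1 ?addr0; last first.
  by move=> j' jj'; apply: big1 => u _; rewrite [j == j']eq_sym (negPf jj') mul0r.
under eq_bigr => u _ do rewrite eqxx /=.
rewrite (eq_bigr (fun u : 'I_(size (k j)) => (u.+1 == i :> nat)%:R * X (arm_vertex u)
   + (u == i.+1 :> nat)%:R * X (arm_vertex u))); last first.
  move=> u _; rewrite -mulrDl; congr (_ * _).
  rewrite (eq_sym (u : nat)); case: (i.+1 =P u :> nat) => [<-|_]; last by rewrite /= addr0.
  by rewrite /= (_ : (i.+2 == i :> nat) = false) //; lia.
rewrite big_split /= (sum_pick i.+1 (fun u => X (arm_vertex u))) addrA; congr (_ + _).
case: (nat_of_ord i) => [|i'] /=.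
  by rewrite mul1r big1 ?addr0 // => u _; rewrite mul0r.
by rewrite mul0r add0r -(sum_pick i' (fun u => X (arm_vertex u))).
Qed.

Definition plumb X (v : V) : int := weight p0 v * X v + adj_sum X v.

Lemma plumb_centre X : plumb X None = p0 * X None + \sum_j along X j 1.
Proof. by rewrite /plumb adj_sum_centre. Qed.

Lemma plumb_arm X j (i : 'I_(size (k j))) :
  plumb X (arm_vertex i) = along X j i - (k j)`_i * along X j i.+1 + along X j i.+2.
Proof. rewrite /plumb adj_sum_arm along_vertex /=; ring. Qed.

Lemma adj_irr (v : V) : adj v v = false.
Proof.
case: v => [[j i]|] //=; rewrite eqxx /= orbb; lia.
Qed.

Lemma adj_sym (v w : V) : adj v w = adj w v.
Proof.
case: v w => [[j i]|] [[j' i']|] //=.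
rewrite [j == j']eq_sym; case: eqP => //= _; exact: orbC.
Qed.

Lemma plumbing_mxE X : plumbing_mx p0 k *m (\col_i X (enum_val i)) = \col_i plumb X (enum_val i).
Proof.
apply/colP => i; rewrite !mxE (bigD1 i) //= !mxE eqxx /plumb; congr (_ + _).
rewrite /adj_sum (reindex (@enum_val V V)) /=; last first.
  by exists enum_rank => x _; rewrite ?enum_valK ?enum_rankK.
rewrite [RHS](bigD1 i) //= adj_irr mul0r add0r; apply: eq_bigr => j ji.
by rewrite !mxE eq_sym (negPf ji).
Qed.

Lemma plumbing_mx_sym : (plumbing_mx p0 k)^T = plumbing_mx p0 k.
Proof.
apply/matrixP => i j; rewrite !mxE eq_sym; case: eqP => [->//|_].
by rewrite adj_sym.
Qed.

Lemma plumb_sym X Y : \sum_v Y v * plumb X v = \sum_v X v * plumb Y v.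
Proof.
rewrite /plumb; under eq_bigr do rewrite mulrDr; under [RHS]eq_bigr do rewrite mulrDr.
rewrite !big_split /=; congr (_ + _); first by apply: eq_bigr => v _; ring.
rewrite /adj_sum; under eq_bigr do rewrite mulr_sumr.
under [RHS]eq_bigr do rewrite mulr_sumr.
rewrite exchange_big; apply: eq_bigr => v _; apply: eq_bigr => w _.
by rewrite adj_sym; ring.
Qed.

Lemma plumb_lin a b X Y v : plumb (fun w => a * X w + b * Y w) v = a * plumb X v + b * plumb Y v.
Proof.
rewrite /plumb /adj_sum !mulrDr !mulr_sumr.
rewrite (eq_bigr (fun w => a * ((adj v w)%:R * X w) + b * ((adj v w)%:R * Y w))); last by move=> w _; ring.
rewrite big_split /=; ring.
Qed.

(** Negative definiteness over the reals, read back on integer functions of the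
    vertices. *)
Lemma negdef_plumb (R : realType) X v0 :
  negative_definite (map_mx intr (plumbing_mx p0 k) : 'M[R]_#|V|) ->
  X v0 != 0 -> \sum_v X v * plumb X v < 0.
Proof.
move=> nd Xv0.
pose x : 'cV[int]_#|V| := \col_i X (enum_val i).
have := nd (map_mx intr x); rewrite matrix.map_trmx -mulmxA -!map_mxM plumbing_mxE !mxE.
under eq_bigr do rewrite !mxE.
rewrite (sum_enum_val (fun v => X v * plumb X v)) ltrz0; apply.
apply: contra Xv0 => /eqP /matrixP /(_ (enum_rank v0) ord0).
by rewrite !mxE enum_rankK => /eqP; rewrite intr_eq0.
Qed.

(** ** Continuants *)

(** The first component is the determinant of the tridiagonal matrix with
    diagonal [s] and with [-1] next to it; keeping that of the tail along makes
    the three-term recursion structural. *)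
Fixpoint continuants (s : seq int) : int * int :=
  if s is a :: s' then let c := continuants s' in (a * c.1 - c.2, c.1) else (1, 0).

Definition cont (s : seq int) (i : nat) : int :=
  if (i <= size s)%N then (continuants (drop i s)).1 else 0.

Lemma cont_size s : cont s (size s) = 1.
Proof. by rewrite /cont leqnn drop_size. Qed.

Lemma cont_rec s i : (i < size s)%N -> cont s i = s`_i * cont s i.+1 - cont s i.+2.
Proof.
move=> h; rewrite /cont (ltnW h) h (drop_nth 0) //=; congr (_ - _).
case: ifP => h2; first by rewrite (drop_nth 0).
by rewrite drop_oversize //; lia.
Qed.

Lemma cont01 s : cont s 0 = (continuants s).1.
Proof. by rewrite /cont drop0. Qed.

Lemma cont1 s : cont s 1 = (continuants s).2.
Proof. by case: s => [|a s] //; rewrite /cont /= drop0. Qed.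

Lemma continuants_coprime s : coprimez (continuants s).1 (continuants s).2.
Proof.
elim: s => [|a s ih] //=; move: ih; case: (continuants s) => x y /= ih.
by rewrite /coprimez gcdzC gcdzMDl gcdzN.
Qed.

(** Positivity of the continuants keeps the iterated denominators away from 0,
    where the total division would break the identity. *)
Lemma cfrac_cont s : (forall i, (i <= size s)%N -> 0 < cont s i) ->
  cfrac s = (continuants s).1%:~R / (continuants s).2%:~R.
Proof.
elim: s => [|a s ih] h //=.
have h' i : (i <= size s)%N -> 0 < cont s i.
  by move=> hi; have := h i.+1; rewrite /cont /= ltnS hi; apply.
rewrite ih //; have := h' 0%N isT; rewrite cont01; case: (continuants s) => x y /= x0.
rewrite invf_div intrB intrM mulrBl mulfK // intr_eq0 gt_eqF //.
Qed.

Section NegativeDefinite.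
Variable R : realType.
Hypothesis nd : negative_definite (map_mx intr (plumbing_mx p0 k) : 'M[R]_#|V|).

Lemma cont_pos j i : (i <= size (k j))%N -> 0 < cont (k j) i.
Proof.
have step i0 : (i0 < size (k j))%N -> 0 < cont (k j) i0.+1 -> 0 < cont (k j) i0.
  move=> hi h1.
  have [X' [X'N X'j X'o]] : exists X : V -> int, [/\ X None = 0,
      forall u : 'I_(size (k j)), X (arm_vertex u) = if (i0 <= u)%N then cont (k j) u.+1 else 0 &
      forall j' (u : 'I_(size (k j'))), j' != j -> X (arm_vertex u) = 0].
    exists (fun v => if v is Some u then
      (let i := nat_of_ord (tagged u) in
       if (tag u == j) && (i0 <= i)%N then cont (k j) i.+1 else 0) else 0).
    by split=> // [u|j' u jj'] /=; rewrite ?eqxx // (negPf jj').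
  have alongX i' : along X' j i'.+1 = if (i0 <= i')%N then cont (k j) i'.+1 else 0.
    rewrite /along; case: insubP => [u _ <-|]; first by rewrite X'j.
    rewrite -leqNgt => h; rewrite /cont ltnNge h /=; by case: ifP.
  have := @negdef_plumb R X' (arm_vertex (Ordinal hi)) nd.
  rewrite X'j leqnn (gt_eqF h1) => /(_ isT).
  rewrite sum_vertex X'N mul0r add0r (bigD1 j) //= [X in _ + X]big1 ?addr0; last first.
    by move=> j' jj'; apply: big1 => u _; rewrite X'o // mul0r.
  rewrite (bigD1 (Ordinal hi)) //= X'j leqnn [X in _ + X]big1 ?addr0; last first.
    move=> u uv; rewrite X'j; case: leqP => hu; last by rewrite mul0r.
    rewrite plumb_arm.
    have hu' : (i0 < u)%N.
      rewrite ltn_neqAle hu andbT; apply: contra uv => /eqP h.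
      by apply/eqP/val_inj; rewrite /= h.
    case Eu : (nat_of_ord u) hu' => [//|u'] hu'.
    have a1 : (i0 <= u')%N by [].
    rewrite !alongX a1 (leqW a1) (leqW (leqW a1)).
    have := ltn_ord u; rewrite Eu => hs.
    rewrite (cont_rec hs); ring.
  rewrite plumb_arm ![nat_of_ord _]/= !alongX leqnn leqnSn.
  have -> : along X' j i0 = 0.
    case: (i0) alongX => [|i'] // ->; by rewrite ltnn.
  have := cont_rec hi => e1.
  rewrite sub0r (_ : - _ + _ = - cont (k j) i0); last by rewrite e1; ring.
  by rewrite mulrN oppr_lt0 pmulr_rgt0.
move=> hi; have [m Em] : exists m, (i + m = size (k j))%N by exists (size (k j) - i)%N; rewrite subnKC.
elim: m i {hi} Em => [|m ih] i Em; first by rewrite -(addn0 i) Em cont_size.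
apply: step; first by rewrite -Em addnS ltnS leq_addr.
by apply: ih; rewrite -Em addSnnS.
Qed.

End NegativeDefinite.

End StarPlumbing.

Section Cokernel.
Variables (V V' : finType) (m : V -> V -> int) (iota : V' -> V) (l : V) (X : V -> int).
Hypothesis m_sym : forall v w, m v w = m w v.
Hypothesis iota_inj : injective iota.
Hypothesis iota_l : forall v', iota v' != l.
Hypothesis iota_onto : forall v, v != l -> exists v', v = iota v'.
Hypothesis mX : forall v, \sum_w m v w * X w = (v == l)%:R.
Hypothesis m_onto : forall y : V -> int, exists x, forall v, \sum_w m v w * x w = y v.
Hypothesis Xl : X l < 0.

Let A : 'M[int]_#|V'| := \matrix_(i, j) m (iota (enum_val i)) (iota (enum_val j)).

Let sum_split (F : V -> int) : \sum_v F v = F l + \sum_(i < #|V'|) F (iota (enum_val i)).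
Proof.
rewrite (bigD1 l) //=; congr (_ + _).
rewrite (sum_enum_val (fun v' => F (iota v'))).
pose inv v := [pick v' | iota v' == v].
rewrite (reindex_omap iota inv) /=.
  apply: eq_bigl => v'; rewrite iota_l /= /inv; case: pickP => [w /eqP /iota_inj ->|/(_ v')]; by rewrite eqxx.
move=> v vl; have [v' ->] := iota_onto vl; rewrite /inv.
by case: pickP => [w /eqP /= ->|/(_ v')] //=; rewrite eqxx.
Qed.

Let phi (y : 'cV[int]_#|V'|) : int := \sum_i X (iota (enum_val i)) * y i ord0.

Let phiD y z : phi (y + z) = phi y + phi z.
Proof. by rewrite /phi -big_split; apply: eq_bigr => i _; rewrite mxE mulrDr. Qed.

Let phiZ c y : phi (c *: y) = c * phi y.
Proof. by rewrite /phi mulr_sumr; apply: eq_bigr => i _; rewrite mxE; ring. Qed.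

Let phi_image y : (exists z, y = A *m z) <-> (X l %| phi y)%Z.
Proof.
split=> [[z ->]|/dvdzP [c hc]].
  have -> : phi (A *m z) = X l * - \sum_j m l (iota (enum_val j)) * z j ord0.
    rewrite /phi; under eq_bigr do rewrite mxE mulr_sumr.
    rewrite exchange_big mulrN mulr_sumr -sumrN; apply: eq_bigr => j _ /=.
    have := mX (iota (enum_val j)); rewrite (negPf (iota_l _)) sum_split => /eqP.
    rewrite addr_eq0 => /eqP h.
    under eq_bigr do rewrite mxE mulrA; rewrite -mulr_suml.
    under eq_bigr do rewrite mulrC m_sym.
    have -> : \sum_(i < #|V'|) m (iota (enum_val j)) (iota (enum_val i)) * X (iota (enum_val i))
       = - (m (iota (enum_val j)) l * X l) by rewrite h opprK.
    by rewrite [m l _]m_sym; ring.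
  exact: dvdz_mulr.
pose y' (v : V) : int := if [pick v' | iota v' == v] is Some v' then y (enum_rank v') ord0 else - c.
have y'i i : y' (iota (enum_val i)) = y i ord0.
  rewrite /y'; case: pickP => [w /eqP /iota_inj ->|/(_ (enum_val i))]; by rewrite ?enum_valK ?eqxx.
have y'l : y' l = - c.
  by rewrite /y'; case: pickP => [w /eqP h|//]; have := iota_l w; rewrite h eqxx.
have [x hx] := m_onto y'.
have xl : x l = 0.
  have : \sum_v X v * \sum_w m v w * x w = x l.
    under eq_bigr do rewrite mulr_sumr; rewrite exchange_big /=.
    rewrite (eq_bigr (fun w => (w == l)%:R * x w)) => [|w _].
      rewrite (bigD1 l) //= eqxx mul1r [X in _ + X]big1 ?addr0 // => w /negPf ->.
      exact: mul0r.
    rewrite -mX mulr_suml; apply: eq_bigr => v _; rewrite m_sym; ring.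
  move=> <-; under eq_bigr do rewrite hx.
  rewrite sum_split y'l; under eq_bigr do rewrite y'i.
  by rewrite -/(phi y) hc; ring.
exists (\col_i x (iota (enum_val i))); apply/colP => i; rewrite -y'i -hx sum_split xl mulr0 add0r mxE.
by apply: eq_bigr => j _; rewrite !mxE.
Qed.

(** Let [A] be the unimodular form [m] with the vertex [l] deleted. The functional
    [phi] defined by the column [X] of the inverse of [m] at [l] identifies the
    cokernel of [A] with the integers modulo [X l]: this is Cramer's rule for the
    diagonal entry of the inverse, without determinants. *)
Lemma H1_order_minor : (H1_order A)%:Z = - X l.
Proof.
pose h := `|X l|%N.
have hE : h%:Z = - X l by rewrite /h abszE ltr0_norm.
rewrite -hE; congr Posz.
pose u : 'cV[int]_#|V'| := \col_i m (iota (enum_val i)) l.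
have phiu : phi u = 1 - m l l * X l.
  have := mX l; rewrite eqxx sum_split mulr1n => e.
  apply/eqP; rewrite -subr_eq0 -e /phi; apply/eqP.
  under eq_bigr do rewrite mxE m_sym mulrC.
  by ring.
pose f := fun x : 'cV[int]_#|V'| => [set y : 'cV[int]_#|V'| | exists z : 'cV[int]_#|V'|, y = x + A *m z].
have feq x x' : (X l %| phi (x' - x))%Z -> f x = f x'.
  move=> /phi_image [z hz]; have xx' : x' = x + A *m z by rewrite -hz addrC subrK.
  apply/seteqP; split => y /= [w ->].
    by exists (w - z); rewrite xx' mulmxBr; rewrite -addrA; congr (_ + _); rewrite addrC subrK.
  by exists (z + w); rewrite xx' mulmxDr addrA.
have finj x x' : f x = f x' -> (X l %| phi (x' - x))%Z.
  move=> e; have : f x' x' by exists 0; rewrite mulmx0 addr0.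
  rewrite -e /= => -[z ->]; apply/phi_image; exists z; by rewrite addrC addKr.
have -> : H1_order A = #|` fset_set (range f)| by [].
apply: card_fset_set.
pose g (r : nat) := f (r%:Z *: u).
have -> : range f = g @` `I_h.
  apply/seteqP; split => [_ [x _ <-]|_ [r _ <-]]; last by exists (r%:Z *: u).
  have Xl0 : X l != 0 by rewrite lt_eqF.
  have r0 := modz_ge0 (phi x) Xl0.
  exists `|(phi x %% X l)%Z|%N.
    rewrite /= -ltz_nat gez0_abs // hE.
    by have := ltz_mod (phi x) Xl0; rewrite ltr0_norm.
  rewrite /g gez0_abs //; apply: feq.
  have -> : phi (x - (phi x %% X l)%Z *: u) = X l * ((phi x %/ X l)%Z + (phi x %% X l)%Z * m l l).
    rewrite -scaleNr phiD phiZ phiu {1}(divz_eq (phi x) (X l)); ring.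
  exact: dvdz_mulr.
apply: inj_card_eq => r r'; rewrite !inE /= => hr hr' /finj.
rewrite -scalerBl phiZ phiu => /dvdzP [c hc].
have : (r'%:Z - r%:Z) = X l * (c + (r'%:Z - r%:Z) * m l l) by move: hc; lia.
set d := (c + _) => e; have e' : r'%:Z - r%:Z = h%:Z * - d by rewrite hE mulrNN.
have := ltr0_norm Xl => _.
have d0 : d = 0 by nia.
by move: e'; rewrite d0; lia.
Qed.

End Cokernel.

Lemma sum_delta (T : finType) (F : T -> int) a : \sum_v F v * (v == a)%:R = F a.
Proof. by rewrite (bigD1 a) //= eqxx mulr1 big1 ?addr0 // => w /negPf ->; rewrite mulr0. Qed.

Section SeifertLattice.
Variables (R : realType) (n : nat) (p : 'I_n -> nat).
Hypothesis hp : forall j, (0 < p j)%N.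
Hypothesis hcop : forall i j, i != j -> coprime (p i) (p j).
Variables (q : 'I_n -> nat) (p0 : int) (k : 'I_n -> seq int).
Hypothesis star : star_plumbing R p q p0 k.
Local Notation P := (Pprod p).
Local Notation V := (vertex k).
Local Notation Mx := (plumb p0).

Lemma Pprod_gt0 : (0 < P)%N.
Proof. by rewrite /Pprod prodn_gt0. Qed.

Lemma dvdn_Pprod j : (p j %| P)%N.
Proof. by rewrite /Pprod (bigD1 j) //= dvdn_mulr. Qed.

Lemma Pprod_div j : ((p j * (P %/ p j)) = P)%N.
Proof. by rewrite mulnC divnK // dvdn_Pprod. Qed.

Lemma Pprod_divE j : (P %/ p j = \prod_(i < n | i != j) p i)%N.
Proof. by rewrite /Pprod (bigD1 j) //= mulKn. Qed.

Let nd : negative_definite (map_mx intr (plumbing_mx p0 k) : 'M[R]_#|V|).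
Proof. by case: star. Qed.

Let q_gt0 j : (0 < q j)%N.
Proof. by case: star => /(_ j) [_ pq] _ _ _; exact: leq_trans (hp j) pq. Qed.

Lemma arm_gt0 j : (0 < size (k j))%N.
Proof.
case: star => _ _ /(_ j) h _; rewrite lt0n; apply/eqP => /size0nil e.
move: h; rewrite e /= => /esym /eqP; rewrite mulf_eq0 invr_eq0 !pnatr_eq0.
by rewrite !eqn0Ngt hp q_gt0.
Qed.

Let cont_pq j : cont (k j) 0 = (p j)%:Z /\ cont (k j) 1 = (q j)%:Z.
Proof.
have c0 := cont_pos nd (leq0n (size (k j))); have c1 := cont_pos nd (arm_gt0 j).
case: star => /(_ j) [copq _] _ /(_ j) h _; move: h.
rewrite cfrac_cont; last by move=> i; exact: (cont_pos nd).
have cop := continuants_coprime (k j).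
rewrite -cont01 -cont1 in cop *.
move: c0 c1 cop; case: (cont (k j) 0) => // a; case: (cont (k j) 1) => // b a0 b0 cop.
rewrite /coprimez /gcdz /= in cop.
move=> /eqP; rewrite eqr_div ?intr_eq0 ?pnatr_eq0 -?lt0n ?q_gt0 //.
rewrite -!pmulrn -!natrM eqr_nat => /eqP e.
have {}cop : coprime a b by [].
have ap : a = p j.
  apply/eqP; rewrite eqn_dvd; apply/andP; split.
    by rewrite -(Gauss_dvdl _ cop) -e dvdn_mulr.
  by rewrite -(Gauss_dvdl _ copq) e dvdn_mulr.
split; first by rewrite ap.
congr Posz; move: e; rewrite ap => /eqP; rewrite eqn_pmul2l ?hp // => /eqP ->.
by [].
Qed.

Let euler : p0 * P%:Z + \sum_j (q j)%:Z * (P %/ p j)%:Z = -1.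
Proof.
case: star => _ [e _] _ _.
have P0 : (P%:R : rat) != 0 by rewrite pnatr_eq0 -lt0n Pprod_gt0.
apply: (@intr_inj rat); rewrite intrD intrM (big_morph _ (@intrD rat) (mulr0z 1)) e mulrBl mulNr mulVf //.
rewrite mulr_suml -addrA [X in _ + X]addrC -sumrB big1 ?addr0 // => j _.
have hP : (P%:R : rat) = (p j)%:R * (P %/ p j)%:R by rewrite -natrM Pprod_div.
rewrite intrM -!pmulrn hP; field; by rewrite pnatr_eq0 -lt0n hp.
Qed.

(** The column of the inverse matrix at the central vertex: along an arm it must
    satisfy the three-term recursion of the continuants and vanish past the end,
    so only the constant, fixed at the centre, is to be found. *)
Definition centre_col (v : V) : int :=
  if v is Some u then - ((P %/ p (tag u))%:Z * cont (k (tag u)) (tagged u : nat).+1) else - P%:Z.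

Lemma along_centre_col j i : along centre_col j i = - ((P %/ p j)%:Z * cont (k j) i).
Proof.
case: i => [|i] /=.
  by case: (cont_pq j) => -> _; rewrite -PoszM mulnC Pprod_div.
case: insubP => [u _ <- //|]; rewrite -leqNgt => h.
by rewrite /cont ltnNge h mulr0 oppr0.
Qed.

Lemma plumb_centre_col v : Mx centre_col v = (v == None)%:R.
Proof.
elim/vertexP: v => [|j u].
  rewrite plumb_centre; under eq_bigr do rewrite along_centre_col.
  rewrite sumrN /= mulrN -opprD; apply/eqP; rewrite eqr_oppLR; apply/eqP.
  rewrite -euler; congr (_ + _); apply: eq_bigr => j _.
  by case: (cont_pq j) => _ ->; rewrite mulrC.
rewrite plumb_arm !along_centre_col (cont_rec (ltn_ord u)) /=; ring.
Qed.

(** ** Unimodularity *)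

Let L (y : V -> int) : Prop := exists X : V -> int, forall v, Mx X v = y v.

Let L_lin a b y z : L y -> L z -> L (fun v => a * y v + b * z v).
Proof.
move=> [X hX] [Y hY]; exists (fun w => a * X w + b * Y w) => v.
by rewrite plumb_lin hX hY.
Qed.

Let L_ext y z : (forall v, y v = z v) -> L y -> L z.
Proof. by move=> h [X hX]; exists X => v; rewrite hX. Qed.

Let L0 : L (fun _ => 0).
Proof.
exists (fun _ => 0) => v; rewrite /plumb /adj_sum mulr0 add0r big1 // => w _; exact: mulr0.
Qed.

Let L_sum (I : Type) (r : seq I) (F : I -> V -> int) : (forall i, L (F i)) ->
  L (fun v => \sum_(i <- r) F i v).
Proof.
move=> h; elim: r => [|i r ih]; first by apply: L_ext L0 => v; rewrite big_nil.
by apply: L_ext (L_lin 1 1 (h i) ih) => v; rewrite big_cons !mul1r.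
Qed.

Let E (j : 'I_n) (i : nat) (v : V) : int := along (fun u : V => (u == v)%:R) j i.

Let plumb_delta (w v : V) : Mx (fun u : V => (u == w)%:R) v = Mx (fun u : V => (u == v)%:R) w.
Proof.
rewrite /plumb /adj_sum; congr (_ + _).
  by rewrite eq_sym; case: eqP => [->|] //; rewrite !mulr0.
have h (a b : V) : \sum_u (adj a u)%:R * (u == b)%:R = (adj a b)%:R :> int.
  exact: sum_delta.
by rewrite !h adj_sym.
Qed.

Let L_step j i : (i < size (k j))%N -> L (fun v => E j i v - (k j)`_i * E j i.+1 v + E j i.+2 v).
Proof.
move=> hi; exists (fun u : V => (u == arm_vertex (Ordinal hi))%:R) => v.
by rewrite plumb_delta plumb_arm.
Qed.

Let L_cont j i : L (fun v => E j i v - cont (k j) i * E j (size (k j)) v).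
Proof.
have out i' : (size (k j) < i')%N -> L (fun v => E j i' v - cont (k j) i' * E j (size (k j)) v).
  move=> h; apply: L_ext L0 => v; rewrite /E along_out // /cont leqNgt h /=; ring.
have [m] : exists m, (size (k j) + 1 <= i + m)%N by exists (size (k j) + 1)%N; lia.
suff : forall m i, (size (k j) + 1 <= i + m)%N ->
   L (fun v => E j i v - cont (k j) i * E j (size (k j)) v) /\
   L (fun v => E j i.+1 v - cont (k j) i.+1 * E j (size (k j)) v).
  by move=> H /H [].
elim=> [|{}m ih] {}i hm; first by split; apply: out; lia.
have [h1 h2] : L (fun v => E j i.+1 v - cont (k j) i.+1 * E j (size (k j)) v) /\
   L (fun v => E j i.+2 v - cont (k j) i.+2 * E j (size (k j)) v) by apply: ih; lia.
split => //.
case: (ltngtP i (size (k j))) => hi; last first.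
- apply: L_ext L0 => v; rewrite hi cont_size; ring.
- exact: out.
have := L_lin 1 1 (L_step hi) (L_lin ((k j)`_i) (-1) h1 h2).
by apply: L_ext => v; rewrite (cont_rec hi); ring.
Qed.

Let L_leaf_p j : L (fun v => (p j)%:Z * E j (size (k j)) v).
Proof.
have h0 : L (E j 0).
  exists centre_col => v; by rewrite plumb_centre_col /E /= eq_sym.
apply: L_ext (L_lin 1 (-1) h0 (L_cont j 0)) => v.
by case: (cont_pq j) => -> _; ring.
Qed.

Let L_leaf_q : L (fun v => \sum_j (q j)%:Z * E j (size (k j)) v).
Proof.
have h0 : L (fun v => p0 * (v == None)%:R + \sum_j E j 1 v).
  exists (fun u : V => (u == None)%:R) => v; by rewrite plumb_delta plumb_centre eq_sym.
have h1 : L (fun v : V => (v == None)%:R) by exists centre_col; exact: plumb_centre_col.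
have h2 := L_sum (index_enum 'I_n) (fun j => L_cont j 1).
apply: L_ext (L_lin 1 1 (L_lin 1 (- p0) h0 h1) (L_lin (-1) 0 h2 L0)) => v.
rewrite sumrB.
have -> : \sum_j cont (k j) 1 * E j (size (k j)) v = \sum_j (q j)%:Z * E j (size (k j)) v.
  by apply: eq_bigr => j _; case: (cont_pq j) => _ ->.
ring.
Qed.

Let L_leaf j : L (E j (size (k j))).
Proof.
pose c := (P %/ p j)%N.
have h1 : L (fun v => (q j * c)%N%:Z * E j (size (k j)) v).
  have other : L (fun v => \sum_(i | i != j) (c%:Z * (q i)%:Z) * E i (size (k i)) v).
    have H i : L (fun v => if i != j then (c%:Z * (q i)%:Z) * E i (size (k i)) v else 0).
      case ij: (i != j); last exact: L0.
      have [d hd] : exists d, c = (p i * d)%N.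
        by rewrite /c Pprod_divE (bigD1 i) //=; eexists.
      apply: L_ext (L_lin (d%:Z * (q i)%:Z) 0 (L_leaf_p i) L0) => v.
      rewrite hd PoszM; ring.
    by apply: L_ext (L_sum (index_enum 'I_n) H) => v; rewrite -big_mkcond.
  apply: L_ext (L_lin c%:Z (-1) L_leaf_q other) => v.
  rewrite (bigD1 j) //= mulrDr mulr_sumr PoszM.
  have -> : \sum_(i < n | i != j) c%:Z * ((q i)%:Z * E i (size (k i)) v) =
      \sum_(i < n | i != j) c%:Z * (q i)%:Z * E i (size (k i)) v.
    by apply: eq_bigr => i _; rewrite mulrA.
  ring.
have cop : coprime (p j) (q j * c).
  rewrite coprimeMr; case: star => /(_ j) [-> _] _ _ _ /=.
  rewrite /c Pprod_divE; apply: (big_ind (fun m => coprime (p j) m)) => [|x y hx hy|i ij]; first exact: coprimen1.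
    by rewrite coprimeMr hx.
  by rewrite coprime_sym; exact: hcop.
have /coprimezP [[u w] /= e] : coprimez (p j)%:Z (q j * c)%N%:Z by rewrite /coprimez /gcdz /=; exact: cop.
apply: L_ext (L_lin u w (L_leaf_p j) h1) => v.
by rewrite !mulrA -mulrDl e mul1r.
Qed.

(** The lattice is unimodular. The column of the inverse at the centre is
    explicit, and the continuants solve the equation along an arm up to a multiple
    of the unit vector at its end. This unit vector [E j (size (k j))] is in the
    image by a Bezout relation: its multiple by [p j] is, and also its multiple by
    [q j] times the product of the other [p i], which is prime to [p j]. *)
Lemma plumb_onto (y : V -> int) : exists X : V -> int, forall v, Mx X v = y v.
Proof.
have unit (w : V) : L (fun v : V => (w == v)%:R).
  elim/vertexP: w => [|j u].
    by exists centre_col => v; rewrite plumb_centre_col eq_sym.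
  apply: L_ext (L_lin 1 (cont (k j) u.+1) (L_cont j u.+1) (L_leaf j)) => v.
  rewrite /E along_vertex; ring.
have H (w : V) : L (fun v : V => y w * (w == v)%:R).
  by apply: L_ext (L_lin (y w) 0 (unit w) L0) => v; ring.
have [X hX] := L_sum (index_enum V) H.
exists X => v; rewrite hX (bigD1 v) //= eqxx mulr1 big1 ?addr0 // => w /negPf ->.
exact: mulr0.
Qed.

(** ** The terminal vertices *)

Lemma last_lt_size j : ((size (k j)).-1 < size (k j))%N.
Proof. by rewrite prednK ?arm_gt0. Qed.

Definition leaf j : V := arm_vertex (Ordinal (last_lt_size j)).

Lemma along_leaf X j : along X j (size (k j)) = X (leaf j).
Proof.
rewrite -[in LHS](prednK (arm_gt0 j)); exact: (along_vertex X (Ordinal (last_lt_size j))).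
Qed.

Lemma leaf_inj : injective leaf.
Proof. by move=> i j; rewrite /leaf => -[]. Qed.

(** Symmetry of the form gives the entry at the centre from the explicit central
    column. On the other arms the column is a multiple of the continuants, hence
    determined by its value at the centre. The diagonal entry is an order of a
    cokernel, which is how the numbers [h_j] get into the exponent. *)
Lemma leaf_cols j : exists X : V -> int,
  [/\ forall v, Mx X v = (v == leaf j)%:R,
      X None = - (P %/ p j)%:Z,
      forall i, i != j -> X (leaf i) * (p i * p j)%N%:Z = - P%:Z &
      X (leaf j) = - (H1_order (plumbing_mx p0 (delete_terminal k j)))%:Z].
Proof.
have [X hX] := plumb_onto (fun v => (v == leaf j)%:R).
have X0 : X None = - (P %/ p j)%:Z.
  have := plumb_sym p0 X centre_col.
  under eq_bigr do rewrite hX; under [RHS]eq_bigr do rewrite plumb_centre_col.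
  by rewrite !sum_delta => <-; rewrite -(along_leaf centre_col) along_centre_col cont_size mulr1.
exists X; split => //.
- move=> i ij.
  have arm m : along X i m = X (leaf i) * cont (k i) m.
    have [d] : exists d, (size (k i) + 1 <= m + d)%N by exists (size (k i) + 1)%N; lia.
    have out m' : (size (k i) < m')%N -> along X i m' = X (leaf i) * cont (k i) m'.
      by move=> h; rewrite along_out // /cont leqNgt h mulr0.
    suff : forall d m, (size (k i) + 1 <= m + d)%N ->
      along X i m = X (leaf i) * cont (k i) m /\ along X i m.+1 = X (leaf i) * cont (k i) m.+1.
      by move=> H /H [].
    elim=> [|{}d ih] {}m hm; first by split; apply: out; lia.
    have [h1 h2] : along X i m.+1 = X (leaf i) * cont (k i) m.+1 /\
       along X i m.+2 = X (leaf i) * cont (k i) m.+2 by apply: ih; lia.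
    split => //.
    case: (ltngtP m (size (k i))) => hm'; last first.
    - by rewrite hm' along_leaf cont_size mulr1.
    - exact: out.
    have := plumb_arm p0 X (Ordinal hm'); rewrite hX.
    have -> : (arm_vertex (Ordinal hm') == leaf j) = false.
      by apply/negP => /eqP; rewrite /leaf => -[e _]; rewrite e eqxx in ij.
    rewrite [nat_of_ord _]/= h1 h2 (cont_rec hm') => e.
    apply/eqP; rewrite -subr_eq0; apply/eqP; rewrite [RHS]e; ring.
  have := arm 0%N; rewrite [along X i 0]/= X0; case: (cont_pq i) => -> _ e.
  by rewrite PoszM mulrA -e mulNr -PoszM mulnC Pprod_div.
pose mf (v w : V) : int := if v == w then weight p0 v else (adj v w)%:R.
have mfE Y v : \sum_w mf v w * Y w = Mx Y v.
  rewrite /plumb /adj_sum (bigD1 v) //= /mf eqxx; congr (_ + _).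
  rewrite [RHS](bigD1 v) //= adj_irr mul0r add0r; apply: eq_bigr => w wv.
  by rewrite eq_sym (negPf wv).
pose k' := delete_terminal k j.
have szk' i : (size (k' i) <= size (k i))%N.
  by rewrite /k' /delete_terminal; case: ifP => // _; rewrite size_take_min geq_minr.
have nthk' i m : (m < size (k' i))%N -> (k' i)`_m = (k i)`_m.
  rewrite /k' /delete_terminal; case: ifP => // _.
  rewrite size_take_min leq_min => /andP[h _]; exact: nth_take.
pose iota (v : vertex k') : V := if v is Some u then arm_vertex (widen_ord (szk' (tag u)) (tagged u)) else None.
have iota_inj : injective iota.
  move=> [[i u]|] [[i' u']|] //= /Some_inj e.
  have ei : i = i' by have := congr1 tag e.
  subst i'; congr (Some (Tagged _ _)); apply: val_inj => /=.
  by have /eqP := e; rewrite -tag_eqE /tag_eq eqxx /= tagged_asE => /eqP /(congr1 val).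
have iota_l v' : iota v' != leaf j.
  case: v' => [[i u]|] //=; apply/negP => /eqP /Some_inj e.
  have ei : i = j by have := congr1 tag e.
  subst i.
  have /eqP := e; rewrite -tag_eqE /tag_eq eqxx /= tagged_asE => /eqP /(congr1 val) /= eu.
  have sz : size (k' j) = (size (k j)).-1.
    by rewrite /k' /delete_terminal eqxx size_takel // leq_pred.
  have : (nat_of_ord u < (size (k j)).-1)%N by rewrite -sz; exact: ltn_ord.
  by rewrite eu ltnn.
have iota_onto v : v != leaf j -> exists v', v = iota v'.
  elim/vertexP: v => [_|i u vl]; first by exists None.
  have hu : (u < size (k' i))%N.
    rewrite /k' /delete_terminal; case: eqP => [ei|_] //; subst i.
    rewrite size_take_min leq_min ltn_ord andbT.
    have : (u : nat) != (size (k j)).-1.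
      apply: contra vl => /eqP e; apply/eqP; rewrite /leaf /arm_vertex; congr (Some (Tagged _ _)).
      exact: val_inj.
    have := ltn_ord u; lia.
  exists (Some (Tagged (fun i => 'I_(size (k' i))) (Ordinal hu))) => /=.
  by congr (Some (Tagged _ _)); apply: val_inj.
have mX v : \sum_w mf v w * X w = (v == leaf j)%:R by rewrite mfE.
have Xl : X (leaf j) < 0.
  have := @negdef_plumb n p0 k R X (leaf j) nd.
  under eq_bigr do rewrite hX.
  rewrite sum_delta; apply; apply/negP => /eqP Xl0.
  have : Mx X (leaf j) = 0.
    have := @negdef_plumb n p0 k R X None nd.
    under eq_bigr do rewrite hX.
    rewrite sum_delta Xl0 X0 ltxx oppr_eq0 => /(_ _) h; exfalso.
    have : (P %/ p j)%N != 0%N by rewrite -lt0n divn_gt0 ?hp // dvdn_leq ?Pprod_gt0 ?dvdn_Pprod.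
    by move=> /h.
  by rewrite hX eqxx.
have := @H1_order_minor V (vertex k') mf iota (leaf j) X _ iota_inj iota_l iota_onto mX _ Xl.
move=> H; rewrite -[LHS]opprK -H.
- congr (- Posz (H1_order _)); apply/matrixP => a b; rewrite !mxE /mf (inj_eq iota_inj) (inj_eq enum_val_inj).
  case: eqP => [->|_].
    by case: (enum_val b) => [[i u]|] //=; rewrite -(nthk' i _ (ltn_ord u)).
  by case: (enum_val a) => [[i u]|]; case: (enum_val b) => [[i' u']|].
- by move=> v w; rewrite /mf eq_sym; case: eqP => [->//|_]; rewrite adj_sym.
- by move=> y; have [x hx] := plumb_onto y; exists x => v; rewrite mfE.
Qed.

End SeifertLattice.

(** * Negative definite forms *)

Section Signature.
Variable R : realType.
Local Notation C := R[i].
Local Notation toC := (real_complex R).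

Lemma char_poly_conj (F : fieldType) N (P D : 'M[F]_N) : P \in unitmx ->
  char_poly (invmx P *m D *m P) = char_poly D.
Proof.
move=> uP; rewrite /char_poly.
pose Q := map_mx (@polyC F) (invmx P); pose S := map_mx (@polyC F) P.
have QS : Q *m S = 1%:M by rewrite -map_mxM mulVmx // map_mx1.
have -> : char_poly_mx (invmx P *m D *m P) = Q *m char_poly_mx D *m S.
  rewrite /char_poly_mx !map_mxM -/Q -/S mulmxBr mulmxBl; congr (_ - _).
  by rewrite scalar_mxC -mulmxA QS mulmx1.
by rewrite !det_mulmx mulrAC -det_mulmx QS det1 mul1r.
Qed.

Lemma mu_prodXsubC (s : seq R) x : \mu_x (\prod_(y <- s) ('X - y%:P)) = count_mem x s.
Proof.
elim: s => [|y s ih]; first by rewrite big_nil muNroot // root1.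
have nz (t : seq R) : \prod_(y <- t) ('X - y%:P) != 0 :> {poly R} by rewrite monic_neq0 // monic_prod_XsubC.
rewrite big_cons mu_mul ?ih /=; last by rewrite -(big_cons _ _ y s xpredT) nz.
congr (_ + _)%N; have [->|xy] := eqVneq y x; first by rewrite mu_XsubC.
by rewrite muNroot // root_XsubC eq_sym.
Qed.

Lemma sum_rootsR_prod (s : seq R) (Q : pred R) :
  (\sum_(x <- rootsR (\prod_(y <- s) ('X - y%:P)) | Q x) \mu_x (\prod_(y <- s) ('X - y%:P)) = count Q s)%N.
Proof.
set p := \prod_(y <- s) _.
have p0 : p != 0 by rewrite monic_neq0 // monic_prod_XsubC.
have pe : perm_eq (rootsR p) (undup s).
  apply: uniq_perm; [exact: uniq_roots|exact: undup_uniq|] => x.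
  rewrite mem_undup -[RHS]root_prod_XsubC.
  apply/esym; have := roots_on_rootsR p0 x; by rewrite in_itv /=.
rewrite (perm_big _ pe) /= -sum1_count -[RHS]big_undup_iterop_count.
apply: eq_bigr => x _; rewrite mu_prodXsubC.
by rewrite Monoid.iteropE; elim: (count_mem x s) => //= m <-.
Qed.

(** The spectral theorem over the complex numbers: the eigenvalues of a
    hermitian matrix are real. *)
Lemma symmetric_char_poly N (A : 'M[R]_N) : A^T = A ->
  exists2 s : seq R, size s = N & char_poly A = \prod_(y <- s) ('X - y%:P).
Proof.
move=> symA.
pose Ac := map_mx toC A.
have Areal : Ac \is a mxOver Num.real.
  by apply/mxOverP => i j; rewrite mxE complex_real.
have Asym : Ac \is symmetricmx.
  by apply/is_hermitianmxP; rewrite expr0 scale1r map_mx_id // /Ac matrix.map_trmx symA.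
have Aherm := realsym_hermsym Asym Areal.
have /hermitian_normalmx /orthomx_spectralP AE := Aherm.
have /mxOverP dR := hermitian_spectral_diag_real Aherm.
exists [seq complex.Re (spectral_diag Ac 0 i) | i <- enum 'I_N].
  by rewrite size_map size_enum_ord.
apply: (map_poly_inj toC).
transitivity (char_poly Ac); first by rewrite map_char_poly.
rewrite [in LHS]AE char_poly_conj ?spectral_unit // char_poly_trig ?diag_mx_is_trig //.
rewrite rmorph_prod big_map big_enum /=; apply: eq_bigr => i _.
rewrite rmorphB /= map_polyX map_polyC mxE eqxx mulr1n /=; congr ('X - _%:P).
by rewrite (RRe_real (dR 0 i)).
Qed.

(** An eigenvector for an eigenvalue [y >= 0] would contradict definiteness. *)
Lemma negdef_eigenvalues N (A : 'M[R]_N) : A^T = A -> negative_definite A ->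
  pos_eigenvalues A = 0%N /\ neg_eigenvalues A = N.
Proof.
move=> symA nd; have [s ss pE] := symmetric_char_poly symA.
have neg x : x \in s -> x < 0.
  rewrite -root_prod_XsubC -pE -eigenvalue_root_char => /eigenvalueP [v vA v0].
  have := nd v^T; rewrite trmxK vA -scalemxAl mxE.
  have -> : (v^T != 0) by rewrite trmx_eq0.
  move=> /(_ isT).
  have [j vj] : exists j, v 0 j != 0.
    apply/existsP; apply: contraR v0 => /existsPn h.
    by apply/eqP/rowP => j; rewrite mxE; apply/eqP/negbNE/h.
  have : 0 < (v *m v^T) ord0 ord0.
    rewrite mxE (bigD1 j) //= mxE ltr_pwDl //.
      by rewrite -expr2 exprn_even_gt0.
    by rewrite sumr_ge0 // => i _; rewrite mxE -expr2 sqr_ge0.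
  by move=> h; rewrite pmulr_llt0.
rewrite /pos_eigenvalues /neg_eigenvalues pE !sum_rootsR_prod; split.
  by apply/eqP; rewrite -leqn0 leqNgt -has_count; apply/hasPn => x /neg h; rewrite -leNgt ltW.
by rewrite -ss; apply/eqP; rewrite -all_count; apply/allP.
Qed.

End Signature.

Section QuadraticForm.
Variable R : realType.

Lemma negdef_unitmx N (A : 'M[R]_N) : negative_definite A -> A \in unitmx.
Proof.
move=> nd.
rewrite -row_free_unit -kermx_eq0; apply/negPn/negP => /rowV0Pn [v vk v0].
have := nd v^T; rewrite trmxK trmx_eq0 v0 (sub_kermxP vk) mul0mx mxE ltxx.
by move=> /(_ isT).
Qed.

(** Cauchy-Schwarz for the positive definite form [- M^-1]: the coordinate [l_v]
    is the product for this form of [l] with the column [- M e_v]. *)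
Lemma inv_form_bound N (M : 'M[int]_N) (l : 'cV[int]_N) (v : 'I_N) :
  M^T = M -> negative_definite (map_mx intr M : 'M[R]_N) ->
  (l v ord0)%:~R ^+ 2 <= (- (M v v)%:~R) * (- inv_form R M l) :> R.
Proof.
move=> symM nd; set A : 'M[R]_N := map_mx intr M.
have uA := negdef_unitmx nd.
have symA : A^T = A by rewrite /A matrix.map_trmx symM.
rewrite /inv_form -/A; set x : 'cV[R]_N := map_mx intr l.
pose y := invmx A *m x.
have xE : x = A *m y by rewrite /y mulKVmx.
have form : (x^T *m invmx A *m x) ord0 ord0 = (y^T *m A *m y) ord0 ord0.
  by rewrite -mulmxA -/y {1}xE trmx_mul symA.
rewrite form.
pose e : 'cV[R]_N := delta_mx v ord0.
have lv : (l v ord0)%:~R = (e^T *m A *m y) ord0 ord0.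
  rewrite -mulmxA -xE /e trmx_delta -rowE !mxE //.
have Mv : (M v v)%:~R = (e^T *m A *m e) ord0 ord0.
  by rewrite /e trmx_delta -rowE -colE !mxE.
have le0 (z : 'cV[R]_N) : (z^T *m A *m z) ord0 ord0 <= 0.
  have [->|z0] := eqVneq z 0; first by rewrite mulmx0 mxE.
  exact/ltW/nd.
rewrite lv Mv.
set a := (e^T *m A *m e) ord0 ord0; set b := (e^T *m A *m y) ord0 ord0; set c := (y^T *m A *m y) ord0 ord0.
have b' : (y^T *m A *m e) ord0 ord0 = b.
  have E : e^T *m A *m y = (y^T *m A *m e)^T by rewrite (trmx_mul (y^T *m A)) (trmx_mul y^T) trmxK symA (mulmxA e^T A y).
  by rewrite /b E [RHS]mxE.
have h (s t : R) : s ^+ 2 * a + 2 * s * t * b + t ^+ 2 * c <= 0.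
  have := le0 (s *: e + t *: y).
  have -> : (s *: e + t *: y)^T = s *: e^T + t *: y^T by rewrite linearD !linearZ.
  rewrite 2!mulmxDl -!scalemxAl 2!mulmxDr -!scalemxAr !scalerDr !scalerA addrA.
  have ent4 (B1 B2 B3 B4 : 'M[R]_1) (u1 u2 u3 u4 : R) : (u1 *: B1 + u2 *: B2 + u3 *: B3 + u4 *: B4) ord0 ord0 =
    u1 * B1 ord0 ord0 + u2 * B2 ord0 ord0 + u3 * B3 ord0 ord0 + u4 * B4 ord0 ord0 by rewrite !mxE.
  rewrite ent4 -/a -/b -/c b'; apply: le_trans; rewrite le_eqVlt; apply/orP; left; apply/eqP; ring.
have a0 : a < 0.
  apply: nd; apply/negP => /eqP /matrixP /(_ v ord0); rewrite !mxE !eqxx => /eqP; by rewrite oner_eq0.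
have := h b (- a); rewrite mulrNN => hh.
have : a * (a * c - b ^+ 2) <= 0 by apply: le_trans hh; rewrite le_eqVlt; apply/orP; left; apply/eqP; ring.
by rewrite nmulr_rle0 // subr_ge0.
Qed.

End QuadraticForm.

(** * The torus integral of the theta series *)

Section NegativeBinomial.
Variable R : realType.
Local Notation C := R[i].

(** The coefficients of [(1 - x) ^ - d.+1]. *)
Definition nbin (d k : nat) : nat := 'C(k + d, d).

Lemma nbinS d k : nbin d.+1 k.+1 = (nbin d k.+1 + nbin d.+1 k)%N.
Proof. by rewrite /nbin [in LHS]addnS binS addnC -addSnnS. Qed.

(** Pascal's rule summed up: it gives the convergence of the negative binomial
    series by induction on [d], the boundary term tending to 0. *)
Lemma nbin_telescope (V : comPzRingType) (x : V) d K :
  (1 - x) * (\sum_(0 <= k < K) (nbin d.+1 k)%:R * x ^+ k) =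
  \sum_(0 <= k < K) (nbin d k)%:R * x ^+ k - (if K is K'.+1 then (nbin d.+1 K')%:R * x ^+ K else 0).
Proof.
elim: K => [|K ih]; first by rewrite !big_geq // mulr0 subr0.
rewrite !big_nat_recr //= mulrDr ih.
case: K {ih} => [|K].
  by rewrite !big_geq // /nbin !add0n !binn !expr0 expr1; ring.
rewrite nbinS natrD !exprS; ring.
Qed.

Lemma nbin_bound (x : R) d K : 0 <= x < 1 ->
  \sum_(0 <= k < K) (nbin d k)%:R * x ^+ k <= ((1 - x) ^+ d.+1)^-1.
Proof.
move=> /andP[x0 x1]; have y0 : 0 < 1 - x by rewrite subr_gt0.
elim: d K => [|d ih] K.
  have e1 : (1 - x) * (\sum_(0 <= k < K) (nbin 0 k)%:R * x ^+ k) = 1 - x ^+ K.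
    elim: K => [|K ihK]; first by rewrite big_geq // mulr0 expr0 subrr.
    rewrite big_nat_recr //= mulrDr ihK /nbin addn0 bin0 exprS; ring.
  by rewrite expr1 -[leRHS]mul1r ler_pdivlMr // mulrC e1 gerBl exprn_ge0.
rewrite -[leRHS]mul1r ler_pdivlMr ?exprn_gt0 // exprS mulrA [_ * (1 - x)]mulrC nbin_telescope.
rewrite -ler_pdivlMr ?exprn_gt0 // mul1r; apply: le_trans (ih K).
rewrite gerBl; case: K => [|K] //; by rewrite mulr_ge0 ?exprn_ge0.
Qed.

Lemma nbin_norm (z : C) d K : normc z < 1 ->
  \sum_(0 <= k < K) normc ((nbin d k)%:R * z ^+ k) <= ((1 - normc z) ^+ d.+1)^-1.
Proof.
move=> z1; have h : 0 <= normc z < 1 by rewrite normc_ge0.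
apply: le_trans (nbin_bound d K h); apply: ler_sum => k _.
by rewrite normcM normcX -(rmorph_nat (real_complex R)) normc_real ger0_norm.
Qed.

Lemma series_shift (f : nat -> C) (s : C) : series (f : nat -> C^o) @ \oo --> (s : C^o) ->
  (fun n => series (f : nat -> C^o) n.+1) @ \oo --> (s : C^o).
Proof. by rewrite -(cvg_shiftS (series (f : nat -> C^o))). Qed.

Lemma series_term0 (f : nat -> C) (s : C) :
  series (f : nat -> C^o) @ \oo --> (s : C^o) -> f @ \oo --> (0 : C^o).
Proof.
move=> h.
have E : (fun n => (series (f : nat -> C^o) n.+1 : C) - (series (f : nat -> C^o) n : C)) = f.
  have aux (a b : C) : a + b - a = b by rewrite addrAC subrr add0r.
  by apply/funext => n; rewrite /series /= big_nat_recr //=; exact: aux.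
have e : s - s = 0 :> C by exact: subrr.
have h2 : (fun n => (series (f : nat -> C^o) n.+1 : C) - (series (f : nat -> C^o) n : C)) @ \oo --> (s - s : C^o).
  exact: cvgcB (series_shift h) h.
by rewrite E e in h2.
Qed.

Lemma nbin_series (z : C) d : normc z < 1 ->
  series ((fun k => (nbin d k)%:R * z ^+ k) : nat -> C^o) @ \oo --> (((1 - z) ^+ d.+1)^-1 : C^o).
Proof.
move=> z1.
have nz : 1 - z != 0.
  by apply/eqP => /eqP; rewrite subr_eq0 => /eqP e; move: z1; rewrite -e normc1 ltxx.
elim: d => [|d ih].
  have [s hs] := abs_series_cvg (fun K => nbin_norm 0 K z1).
  have e1 K : (series (fun k => (nbin 0 k)%:R * z ^+ k) : nat -> C) K = (1 - z)^-1 * (1 - z ^+ K).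
    apply: (mulfI nz); rewrite mulrA divff // mul1r /series /=.
    elim: K => [|K ihK]; first by rewrite big_geq // mulr0 expr0 subrr.
    rewrite big_nat_recr //= mulrDr ihK /nbin addn0 bin0 exprS; ring.
  have := series_term0 hs => t0.
  have {}t0 : (fun k => z ^+ k) @ \oo --> (0 : C^o).
    have E : (fun k => (nbin 0 k)%:R * z ^+ k) = (fun k => z ^+ k).
      by apply/funext => k; rewrite /nbin addn0 bin0 mul1r.
    by rewrite E in t0.
  have h := cvgcM (@cvgc_cst R _ \oo _ (1 - z)^-1) (cvgcB (@cvgc_cst R _ \oo _ 1) t0).
  rewrite subr0 mulr1 in h; rewrite expr1.
  have E : (series ((fun k => (nbin 0 k)%:R * z ^+ k) : nat -> C^o)) = (fun K => (1 - z)^-1 * (1 - z ^+ K)).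
    by apply/funext => K; exact: e1.
  rewrite E; exact: h.
have [s hs] := abs_series_cvg (fun K => nbin_norm d.+1 K z1).
suff -> : ((1 - z) ^+ d.+2)^-1 = s by [].
apply: (mulfI (expf_neq0 d.+2 nz)); rewrite divff ?expf_neq0 // exprSr -mulrA.
suff -> : (1 - z) * s = ((1 - z) ^+ d.+1)^-1 by rewrite divff ?expf_neq0.
have h1 := cvgcM (@cvgc_cst R _ \oo _ (1 - z)) (series_shift hs).
have h2 := cvgcB (series_shift ih) (cvgcM (@cvgc_cst R _ \oo _ z) (series_term0 hs)).
rewrite mulr0 subr0 in h2.
have E : (fun n => (1 - z) * (series ((fun k => (nbin d.+1 k)%:R * z ^+ k) : nat -> C^o) n.+1 : C)) =
    (fun n => (series ((fun k => (nbin d k)%:R * z ^+ k) : nat -> C^o) n.+1 : C) - z * ((nbin d.+1 n)%:R * z ^+ n)).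
  apply/funext => n; rewrite /series /=; rewrite [LHS]nbin_telescope exprS; congr (_ - _).
  by rewrite mulrCA.
rewrite E in h1; exact: cvgc_unique (h1 _ _) (h2 _ _ _).
Qed.

End NegativeBinomial.

Section CircleIntegrals.
Variable R : realType.
Local Notation C := R[i].
Local Notation leb := (@lebesgue_measure R).

Lemma integrable_cst01 (M : R) : leb.-integrable `[0, 1] (EFin \o (fun=> M)).
Proof.
apply: (@measurable_bounded_integrable _ _ _ leb) => //.
- by rewrite /= lebesgue_measure_itv /= lte_fin ltr01 -EFinB ltry.
- exact: bounded_cst.
Qed.

Definition circle_pt (r t : R) : C := r%:C * cis (2 * pi * t).

Lemma normc_circle_pt r t : 0 < r -> normc (circle_pt r t) = r.
Proof. by move=> r0; rewrite normcMr normc_cis mulr1 gtr0_norm. Qed.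

Lemma circle_pt_neq0 r t : 0 < r -> circle_pt r t != 0.
Proof. by move=> r0; rewrite -normc_gt0 normc_circle_pt. Qed.

Lemma circle_ptXz r t (m : int) : 0 < r ->
  circle_pt r t ^ m = r%:C ^ m * cexp (2 * pi%:C * 'i%C * m%:~R * t%:C).
Proof.
move=> r0; rewrite /circle_pt exprzMl ?unitfE ?cis_neq0 //; last by rewrite -normc_gt0 normc_real normr_gt0 gt_eqF.
rewrite /cis -cexpMz; congr (_ * cexp _).
by rewrite -mulrzr !rmorphM rmorph_nat; ring.
Qed.

Lemma circle_pt_continuous r t :
  circle_pt r x @[x --> t] --> (circle_pt r t : C^o).
Proof.
have h : cder (fun x => r%:C * cexp ('i%C * (2 * pi * x)%:C)) t
    (r%:C * (('i%C * (2 * pi * 1 + t * 0)%:C) * cexp ('i%C * (2 * pi * t)%:C))).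
  apply/cderZ/cder_cexp/cderZ/cder_real.
  exact: rderM (rder_cst _ _) (rder_id _).
exact: cder_continuous h.
Qed.

Lemma circle_ptXz_continuous r t (m : int) : 0 < r ->
  (fun x => circle_pt r x ^ m) x @[x --> t] --> (circle_pt r t ^ m : C^o).
Proof.
by move=> r0; apply: cvgcXz; [exact: circle_pt_neq0|exact: circle_pt_continuous].
Qed.

Lemma circle_integral_pow r (m : int) : 0 < r ->
  circle_integral r (fun w => w ^ m) = (m == 0)%:R :> C.
Proof.
move=> r0; rewrite /circle_integral -/(circle_pt r).
have [->|m0] := eqVneq m 0.
  rewrite (@cint_FTC R (fun t => t%:C) _ 0 1) //.
  - by rewrite /= subr0.
  - by move=> t _; rewrite expr0z; exact: cder_id.
  - by move=> t _; exact: (@circle_ptXz_continuous r t 0 r0).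
pose b : C := 2 * pi%:C * 'i%C * m%:~R.
have b0 : b != 0.
  rewrite !mulf_neq0 ?intr_eq0 //.
  - by rewrite -normc_gt0 normc_real normr_gt0 gt_eqF ?pi_gt0.
  - by rewrite -normc_gt0 /normc /= expr0n add0r expr1n sqrtr1.
rewrite (@cint_FTC R (fun t => r%:C ^ m * b^-1 * cexp (b * t%:C)) _ 0 1) //.
- have e1 : cexp (2 * pi%:C * 'i%C) = 1 :> C.
    have -> : 2 * pi%:C * 'i%C = 'i%C * (pi *+ 2)%:C :> C by rewrite rmorphMn /= -mulr_natl; ring.
    by rewrite -/(cis _) cisE cos2pi sin2pi.
  have -> : cexp (b * 1%:C) = 1 :> C by rewrite mulr1 /b mulrzr cexpMz e1 exp1rz.
  by rewrite mulr0 cexp0 subrr.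
- move=> t _; rewrite circle_ptXz // -/b.
  apply: cder_eq (cderZ _ (cder_cexp (cderZ b (cder_id t)))) _.
  by rewrite mulr1; field.
- by move=> t _; exact: circle_ptXz_continuous.
Qed.

Let mI : measurable (`[0, 1]%classic : set R).
Proof. exact: measurable_itv. Qed.

Lemma cintegrable_circle (f : R -> C) (M : R) : cmeas `[0, 1] f ->
  (forall t, normc (f t) <= M) -> cintegrable `[0, 1] f.
Proof.
move=> mf fM; apply: (@cintegrable_dom R _ _ (fun=> M)) => //.
exact: integrable_cst01.
Qed.

End CircleIntegrals.

Section TorusIntegral.
Variable R : realType.
Local Notation C := R[i].
Local Notation leb := (@lebesgue_measure R).
Local Notation totally := summability.totally.
Local Notation partial_sum := summability.partial_sum.

(** Unconditional sums over a countable type are enumerated along these finite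
    sets. *)
Definition first_codes (I : countType) (K : nat) : {fset I} :=
  [fset x in pmap (@choice.unpickle I) (iota 0 K)]%fset.

Lemma first_codesP (I : countType) (i : I) :
  exists K0, forall K, (K0 <= K)%N -> i \in first_codes I K.
Proof.
exists (choice.pickle i).+1 => K hK; rewrite !inE mem_pmap; apply/mapP; exists (choice.pickle i).
  by rewrite mem_iota add0n.
by rewrite choice.pickleK.
Qed.

Definition usum (I : choiceType) (f : I -> C) : C := @summability.sum I C C^o f.

Lemma usumE (I : choiceType) (f : I -> C) (s : C) :
  partial_sum f @ totally --> (s : C^o) -> usum f = s.
Proof. by move=> h; exact: (@cvg_lim C^o (@norm_hausdorff _ _) _ _ _ _ _ h). Qed.

Lemma usum_cvg (I : choiceType) (f : I -> C) (M : R) :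
  (forall A : {fset I}, \sum_(i <- A) normc (f i) <= M) ->
  partial_sum f @ totally --> (usum f : C^o).
Proof. by move=> /abs_sum_cvg [s hs]; have -> := usumE hs; exact: hs. Qed.

Lemma usum_seq (I : countType) (f : I -> C) (M : R) :
  (forall A : {fset I}, \sum_(i <- A) normc (f i) <= M) ->
  (fun K => \sum_(i <- first_codes I K) f i) @ \oo --> (usum f : C^o).
Proof.
by move=> h; apply: sum_exhaust (usum_cvg h) _ => i _; exact: first_codesP.
Qed.

Lemma usumZ (I : countType) (c : C) (f : I -> C) (M : R) :
  (forall A : {fset I}, \sum_(i <- A) normc (f i) <= M) ->
  usum (fun i => c * f i) = c * usum f.
Proof.
move=> h; have hc (A : {fset I}) : \sum_(i <- A) normc (c * f i) <= normc c * M.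
  apply: le_trans (ler_wpM2l (normc_ge0 c) (h A)); rewrite mulr_sumr.
  by apply: ler_sum => i _; rewrite normcM.
have E : (fun K => \sum_(i <- first_codes I K) c * f i) = (fun K => c * \sum_(i <- first_codes I K) f i).
  by apply/funext => K; rewrite mulr_sumr.
have h1 := usum_seq hc; rewrite E in h1.
have h2 := cvgcM (@cvgc_cst R _ \oo _ c) (usum_seq h).
exact: cvgc_unique h1 (h2 _ _).
Qed.

(** Dominated convergence along an enumeration of the terms. *)
Lemma circle_integral_usum (I : countType) (r : R) (A : I -> C) (h : I -> C -> C) (b : I -> R) (M : R) :
  (forall l t, (fun x => h l (circle_pt r x)) x @[x --> t] --> (h l (circle_pt r t) : C^o)) ->
  (forall l t, normc (A l * h l (circle_pt r t)) <= b l) ->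
  (forall F : {fset I}, \sum_(l <- F) b l <= M) ->
  (fun K => \sum_(l <- first_codes I K) A l * circle_integral r (h l)) @ \oo -->
  (circle_integral r (fun w => usum (fun l => A l * h l w)) : C^o).
Proof.
move=> hc hb hM.
have mI : measurable (`[0, 1]%classic : set R) by exact: measurable_itv.
have hM' t (F : {fset I}) : \sum_(l <- F) normc (A l * h l (circle_pt r t)) <= M.
  by apply: le_trans (hM F); exact: ler_sum.
have mh l : cmeas `[0, 1] (fun t => A l * h l (circle_pt r t)).
  apply: (@cmeasS _ _ setT) => //; apply: cmeas_continuous; first exact: openT.
  by move=> t _; apply: cvgcM; [exact: cvgc_cst|exact: hc].
have ch l : cmeas `[0, 1] (fun t => h l (circle_pt r t)).
  apply: (@cmeasS _ _ setT) => //; apply: cmeas_continuous; first exact: openT.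
  by move=> t _; exact: hc.
have ih l : cintegrable `[0, 1] (fun t => A l * h l (circle_pt r t)).
  exact: cintegrable_circle (mh l) (hb l).
have E : (fun K => \sum_(l <- first_codes I K) A l * circle_integral r (h l)) =
    (fun K => cintegral `[0, 1] (fun t => \sum_(l <- first_codes I K) A l * h l (circle_pt r t))).
  apply/funext => K; rewrite cintegral_sum //; apply: eq_bigr => l _.
  have [->|Al] := eqVneq (A l) 0.
    rewrite mul0r -[LHS](@cintegral0 R `[0, 1]).
    by apply: eq_cintegral => t _; rewrite mul0r.
  rewrite cintegralZ //; apply: (@cintegrable_circle R _ ((normc (A l))^-1 * b l)) => // t.
  rewrite ler_pdivlMl ?normc_gt0 // -normcM; exact: hb.
rewrite E.
apply: (fun a b c d => (@cint_dct R `[0, 1] (fun K t => \sum_(l <- first_codes I K) A l * h l (circle_pt r t))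
  (fun t => usum (fun l => A l * h l (circle_pt r t))) (fun=> M) mI a b c d).2).
- by move=> K; exact: cmeas_sum.
- by move=> t _; exact: usum_seq (hM' t).
- exact: integrable_cst01.
- move=> K t _; apply: le_trans (normc_sum _ _ _) (hM' t _).
Qed.

Variables (N : nat) (e : R) (a : 'cV[int]_N -> C) (g : 'I_N -> C -> C) (beta : 'I_N -> int -> R) (M : R).
Hypothesis e0 : 0 < e < 1.

Definition on_circles (w : C) : Prop := exists t, w = circle_pt (1 + e) t \/ w = circle_pt (1 - e) t.

Hypothesis g_cont : forall v r t, r = 1 + e \/ r = 1 - e ->
  (fun x => g v (circle_pt r x)) x @[x --> t] --> (g v (circle_pt r t) : C^o).
Hypothesis beta_ge0 : forall v m, 0 <= beta v m.
Hypothesis g_bound : forall v m w, on_circles w -> 2 * normc (g v w * w ^ m) <= beta v m.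
Hypothesis pow_bound : forall v m w, on_circles w -> normc (w ^ m) <= beta v m.
Hypothesis a_bound : forall F : {fset 'cV[int]_N},
  \sum_(l <- F) normc (a l) * \prod_v beta v (l v ord0) <= M.

Let coef v m : C := vp_circle_integral e (fun w => g v w * w ^ m).

Let g_bound1 v m w : on_circles w -> normc (g v w * w ^ m) <= beta v m.
Proof.
move=> /(g_bound v m); apply: le_trans; have := normc_ge0 (g v w * w ^ m); lra.
Qed.

Let gm_cont v m r t : r = 1 + e \/ r = 1 - e ->
  (fun x => g v (circle_pt r x) * circle_pt r x ^ m) x @[x --> t] --> (g v (circle_pt r t) * circle_pt r t ^ m : C^o).
Proof.
move=> hr; apply: cvgcM; first exact: g_cont.
by apply: circle_ptXz_continuous; have /andP[? ?] := e0; case: hr => ->; lra.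
Qed.

Let on_circle r t : r = 1 + e \/ r = 1 - e -> on_circles (circle_pt r t).
Proof. by case=> ->; exists t; [left|right]. Qed.

Let mI : measurable (`[0, 1]%classic : set R).
Proof. exact: measurable_itv. Qed.

Let circle_bound v m r : r = 1 + e \/ r = 1 - e ->
  normc (circle_integral r (fun w => g v w * w ^ m)) <= beta v m.
Proof.
move=> hr.
have mg : cmeas `[0, 1] (fun t => g v (circle_pt r t) * circle_pt r t ^ m).
  apply: (@cmeasS _ _ setT) => //; apply: cmeas_continuous; first exact: openT.
  by move=> t _; exact: gm_cont.
have := @normc_cintegral_le R `[0, 1] _ (fun=> beta v m / 2) mI mg (integrable_cst01 _).
rewrite Rintegral_cst //= lebesgue_measure_itv /= lte_fin ltr01 /= oppr0 addr0 mulr1.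
rewrite (_ : 2 * (beta v m / 2) = beta v m); last by field.
apply=> t _.
by rewrite ler_pdivlMr // mulrC; exact/g_bound/on_circle.
Qed.

Lemma coef_bound v m : normc (coef v m) <= beta v m.
Proof.
rewrite /coef /vp_circle_integral normcM normcV.
have -> : normc (2 : C) = 2 by rewrite -(rmorph_nat (real_complex R)) normc_real ger0_norm.
rewrite ler_pdivrMr // mulr_natr mulr2n; apply: le_trans (normcD _ _) _.
by apply: lerD; apply: circle_bound; [left|right].
Qed.

Let vp_usum v (A : 'cV[int]_N -> C) (b : 'cV[int]_N -> R) :
  (forall l, normc (A l) * beta v (l v ord0) <= b l) ->
  (forall F : {fset 'cV[int]_N}, \sum_(l <- F) b l <= M) ->
  vp_circle_integral e (fun w => usum (fun l => A l * (g v w * w ^ l v ord0))) =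
  usum (fun l => A l * coef v (l v ord0)).
Proof.
move=> Ab bM.
have h r : r = 1 + e \/ r = 1 - e ->
  (fun K => \sum_(l <- first_codes _ K) A l * circle_integral r (fun w => g v w * w ^ l v ord0)) @ \oo -->
  (circle_integral r (fun w => usum (fun l => A l * (g v w * w ^ l v ord0))) : C^o).
  move=> hr; apply: (fun H1 H2 => @circle_integral_usum _ r A (fun l w => g v w * w ^ l v ord0) b M H1 H2 bM).
    by move=> l t; exact: gm_cont.
  move=> l t; rewrite normcM; apply: le_trans (Ab l); apply: ler_wpM2l; first exact: normc_ge0.
  exact/g_bound1/on_circle.
have h1 := h (1 + e) (or_introl (erefl _)); have h2 := h (1 - e) (or_intror (erefl _)).
have bd (F : {fset 'cV[int]_N}) : \sum_(l <- F) normc (A l * coef v (l v ord0)) <= M.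
  apply: le_trans (bM F); apply: ler_sum => l _; rewrite normcM.
  by apply: le_trans (Ab l); apply: ler_wpM2l; [exact: normc_ge0|exact: coef_bound].
have h3 := usum_seq bd.
have h4 := cvgcM (cvgcD h1 h2) (@cvgc_cst R _ \oo _ (2^-1)).
have E : (fun K => (\sum_(l <- first_codes _ K) A l * circle_integral (1 + e) (fun w => g v w * w ^ l v ord0)
    + \sum_(l <- first_codes _ K) A l * circle_integral (1 - e) (fun w => g v w * w ^ l v ord0)) * 2^-1) =
    (fun K => \sum_(l <- first_codes _ K) A l * coef v (l v ord0)).
  apply/funext => K; rewrite -big_split mulr_suml; apply: eq_bigr => l _ /=.
  by rewrite /coef /vp_circle_integral mulrA mulrDr.
rewrite E in h4; exact: cvgc_unique (h4 _ _ _) h3.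
Qed.

Let eq_vp (f f' : C -> C) : (forall w, on_circles w -> f w = f' w) ->
  vp_circle_integral e f = vp_circle_integral e f'.
Proof.
move=> h; rewrite /vp_circle_integral /circle_integral.
by congr ((_ + _) / 2); apply: eq_cintegral => t _; apply: h; apply: on_circle; [left|right].
Qed.

Let bounded_terms (s : seq 'I_N) (z : 'I_N -> C) : (forall v, v \notin s -> on_circles (z v)) ->
  forall l, normc (a l * \prod_v (if v \in s then coef v (l v ord0) else g v (z v) * z v ^ l v ord0)) <=
    normc (a l) * \prod_v beta v (l v ord0).
Proof.
move=> hz l; rewrite normcM normc_prod; apply: ler_wpM2l; first exact: normc_ge0.
apply: ler_prod => v _; rewrite normc_ge0 /=; case: ifPn => hv; first exact: coef_bound.
exact/g_bound1/hz.
Qed.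

(** The sum leaves the integrals one circle after the other, each time dominated by
    the product of the bounds at the vertices. *)
Lemma vp_torus_integral_usum :
  vp_torus_integral e (fun z => (\prod_v g v (z v)) * usum (fun l => a l * \prod_v z v ^ l v ord0)) =
  usum (fun l => a l * \prod_v coef v (l v ord0)).
Proof.
pose T (s : seq 'I_N) (z : 'I_N -> C) := usum (fun l =>
  a l * \prod_v (if v \in s then coef v (l v ord0) else g v (z v) * z v ^ l v ord0)).
suff H (s : seq 'I_N) : uniq s -> forall z, (forall v, v \notin s -> on_circles (z v)) ->
   foldr (fun v (g : ('I_N -> C) -> C) => fun z : 'I_N -> C =>
       vp_circle_integral e (fun w => g [eta z with v |-> w]))
    (fun z => (\prod_v g v (z v)) * usum (fun l => a l * \prod_v z v ^ l v ord0)) s z = T s z.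
  rewrite /vp_torus_integral H ?enum_uniq //; last by move=> v; rewrite mem_enum.
  by congr usum; apply/funext => l; congr (_ * _); apply: eq_bigr => v _; rewrite mem_enum.
elim: s => [|v s ih] /=.
  move=> _ z hz; rewrite /T.
  rewrite -(@usumZ _ _ _ M).
    by congr usum; apply/funext => l; rewrite mulrCA -big_split.
  move=> F; apply: le_trans (a_bound F); apply: ler_sum => l _.
  rewrite normcM normc_prod; apply: ler_wpM2l; first exact: normc_ge0.
  by apply: ler_prod => v _; rewrite normc_ge0 /=; exact/pow_bound/hz.
move=> /andP[vs us] z hz; rewrite (eq_vp (f' := fun w => T s [eta z with v |-> w])); last first.
  move=> w hw; apply: ih => // u us'; rewrite /=; case: eqP => [//|/eqP uv].
  by apply: hz; rewrite inE negb_or uv.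
rewrite /T.
pose A l := a l * \prod_(u | u != v) (if u \in s then coef u (l u ord0) else g u (z u) * z u ^ l u ord0).
transitivity (usum (fun l => A l * coef v (l v ord0))); last first.
  congr usum; apply/funext => l; rewrite /A [in RHS](bigD1 v) //= inE eqxx /= -mulrA; congr (_ * _).
  by rewrite mulrC; congr (_ * _); apply: eq_bigr => u uv; rewrite inE (negPf uv).
have Ab l : normc (A l) * beta v (l v ord0) <= normc (a l) * \prod_u beta u (l u ord0).
  rewrite /A normcM normc_prod -mulrA; apply: ler_wpM2l; first exact: normc_ge0.
  rewrite [leRHS](bigD1 v) //= mulrC; apply: ler_wpM2l; first exact: beta_ge0.
  apply: ler_prod => u uv; rewrite normc_ge0 /=; case: ifPn => hu; first exact: coef_bound.
  by apply/g_bound1/hz; rewrite inE negb_or uv.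
apply: etrans (vp_usum Ab a_bound); apply: eq_vp => w hw; congr usum; apply/funext => l.
rewrite /A -mulrA; congr (_ * _).
rewrite [LHS](bigD1 v) // [LHS]mulrC; congr (_ * _).
  by apply: eq_bigr => u /negPf uv; rewrite /= uv.
by rewrite (negPf vs) /= eqxx.
Qed.

End TorusIntegral.

Section VertexCoefficients.
Variable R : realType.
Local Notation C := R[i].
Local Notation leb := (@lebesgue_measure R).

Lemma circle_integral_series (r : R) (h : nat -> C -> C) (F : C -> C) (b : nat -> R) (M : R) :
  (forall k t, (fun x => h k (circle_pt r x)) x @[x --> t] --> (h k (circle_pt r t) : C^o)) ->
  (forall k t, normc (h k (circle_pt r t)) <= b k) ->
  (forall K, \sum_(0 <= k < K) b k <= M) ->
  (forall t, series ((fun k => h k (circle_pt r t)) : nat -> C^o) @ \oo --> (F (circle_pt r t) : C^o)) ->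
  (fun K => \sum_(0 <= k < K) circle_integral r (h k)) @ \oo --> (circle_integral r F : C^o).
Proof.
move=> hc hb hM hF.
have mI : measurable (`[0, 1]%classic : set R) by exact: measurable_itv.
have mh k : cmeas `[0, 1] (fun t => h k (circle_pt r t)).
  apply: (@cmeasS _ _ setT) => //; apply: cmeas_continuous; first exact: openT.
  by move=> t _; exact: hc.
have E : (fun K => \sum_(0 <= k < K) circle_integral r (h k)) =
    (fun K => cintegral `[0, 1] (fun t => \sum_(0 <= k < K) h k (circle_pt r t))).
  apply/funext => K; rewrite cintegral_sum // => k.
  exact: cintegrable_circle (mh k) (hb k).
rewrite E.
apply: (fun a b c d => (@cint_dct R `[0, 1] (fun K t => \sum_(0 <= k < K) h k (circle_pt r t))
  (fun t => F (circle_pt r t)) (fun=> M) mI a b c d).2).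
- by move=> K; exact: cmeas_sum.
- by move=> t _; exact: hF.
- exact: integrable_cst01.
- move=> K t _; apply: le_trans (normc_sum _ _ _) (le_trans _ (hM K)).
  exact: ler_sum.
Qed.

Lemma cintegrable_circle_pow (r : R) (m : int) : 0 < r ->
  cintegrable `[0, 1] (fun t => circle_pt r t ^ m).
Proof.
move=> r0; apply: (@cintegrable_circle R _ (r ^ m)); last first.
  by move=> t; rewrite normcXz normc_circle_pt.
apply: (@cmeasS _ _ setT) => //; apply: cmeas_continuous; first exact: openT.
by move=> t _; exact: circle_ptXz_continuous.
Qed.

Lemma circle_integral_Zpow (r : R) (c : C) (m : int) : 0 < r ->
  circle_integral r (fun w => c * w ^ m) = c * (m == 0)%:R.
Proof.
move=> r0; rewrite -(circle_integral_pow m r0) /circle_integral cintegralZ //.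
exact: cintegrable_circle_pow.
Qed.

Lemma sub_inv_neq0 (w : C) : w != 0 -> normc w != 1 -> w - w^-1 != 0.
Proof.
move=> w0; apply: contra => /eqP/subr0_eq e.
have : normc w * normc w = 1 by rewrite {2}e normcV mulfV // normc_eq0.
move/eqP; rewrite -expr2 sqrf_eq1 => /orP[//|/eqP h].
by have := normc_ge0 w; lra.
Qed.

Lemma sub_inv_continuous r t (m : int) : 0 < r -> r != 1 ->
  (fun x => (circle_pt r x - (circle_pt r x)^-1) ^ m) x @[x --> t] -->
  ((circle_pt r t - (circle_pt r t)^-1) ^ m : C^o).
Proof.
move=> r0 r1; have w0 := circle_pt_neq0 t r0.
apply: cvgcXz; first by rewrite sub_inv_neq0 // normc_circle_pt.
apply: cvgcB; first exact: circle_pt_continuous.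
by apply: cvgcV => //; exact: circle_pt_continuous.
Qed.

Lemma cvgc_stationary (f : nat -> C) (l : C) K :
  (forall n, (K <= n)%N -> f n = l) -> f @ \oo --> (l : C^o).
Proof.
move=> h; apply/cvgc_normP => e e0; exists K => // n /= Kn.
by rewrite h // subrr normc0.
Qed.

Lemma expz2 (F : fieldType) (w : F) k : w ^ (2 * k)%N%:Z = (w ^+ 2) ^+ k.
Proof. by rewrite -exprnP exprM. Qed.

Lemma expzN2 (F : fieldType) (w : F) k : w ^ (- (2 * k)%N%:Z) = (w ^- 2) ^+ k.
Proof. by rewrite -exprnN exprM exprVn. Qed.

(** Outside the unit circle [w - w^-1 = w * (1 - w ^ -2)], and the negative
    binomial series in [w ^ -2] may be integrated term by term. *)
Lemma coef_outside (r : R) (d K : nat) (m : int) : 1 < r -> (`|m| < K)%N ->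
  circle_integral r (fun w => (w - w^-1) ^ (- (d.+1)%:Z) * w ^ m) =
  \sum_(0 <= k < K) (nbin d k)%:R * (m == (d.+1 + 2 * k)%:Z)%:R :> C.
Proof.
move=> r1 mK; have r0 : 0 < r by lra.
pose j k : int := m - (d.+1 + 2 * k)%:Z.
have hser : (fun K => \sum_(0 <= k < K) circle_integral r (fun w => (nbin d k)%:R * w ^ j k)) @ \oo -->
    (circle_integral r (fun w => (w - w^-1) ^ (- (d.+1)%:Z) * w ^ m) : C^o).
  have x1 : normc ((r%:C : C) ^- 2) < 1.
    by rewrite normcV normcX normc_real gtr0_norm // invf_lt1 ?exprn_gt0 // exprn_egt1.
  apply: (@circle_integral_series r _ _ (fun k => r ^ (m - d.+1%:Z) * normc ((nbin d k)%:R * ((r%:C : C) ^- 2) ^+ k)) (r ^ (m - d.+1%:Z) * ((1 - normc ((r%:C : C) ^- 2)) ^+ d.+1)^-1)).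
  - move=> k t; apply: cvgcM; first exact: cvgc_cst.
    exact: circle_ptXz_continuous.
  - move=> k t; rewrite !normcM mulrCA ler_wpM2l ?normc_ge0 //.
    rewrite normcXz normc_circle_pt // normcX normcV normcX normc_real gtr0_norm //.
    by rewrite /j PoszD opprD addrA expfzDr ?gt_eqF // expzN2.
  - move=> N; rewrite -mulr_sumr; apply: ler_wpM2l; first by rewrite exprz_ge0 // ltW.
    exact: nbin_norm.
  - move=> t; set w := circle_pt r t.
    have w0 : w != 0 by exact: circle_pt_neq0.
    have nw : normc (w ^- 2) < 1.
      by rewrite normcV normcX normc_circle_pt // invf_lt1 ?exprn_gt0 // exprn_egt1.
    have h : (fun N => w ^ (m - d.+1%:Z) * (series ((fun k => (nbin d k)%:R * (w ^- 2) ^+ k) : nat -> C^o) N : C)) @ \oo -->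
        (w ^ (m - d.+1%:Z) * ((1 - w ^- 2) ^+ d.+1)^-1 : C^o).
      by apply: cvgcM; [exact: cvgc_cst|exact: nbin_series].
    have E : (fun N => w ^ (m - d.+1%:Z) * (series ((fun k => (nbin d k)%:R * (w ^- 2) ^+ k) : nat -> C^o) N : C)) =
       series ((fun k => (nbin d k)%:R * w ^ j k) : nat -> C^o).
      apply/funext => N; rewrite /series /= mulr_sumr; apply: eq_bigr => k _.
      rewrite mulrCA; congr (_ * _).
      by rewrite /j PoszD opprD addrA [in RHS]expfzDr // expzN2.
    rewrite E in h.
    have -> : (w - w^-1) ^ (- (d.+1)%:Z) * w ^ m = w ^ (m - d.+1%:Z) * ((1 - w ^- 2) ^+ d.+1)^-1.
      have e1 : w ^ (m - d.+1%:Z) = w ^ m * (w ^+ d.+1)^-1 by rewrite expfzDr // exprnN.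
      have e2 : w - w^-1 = w * (1 - w ^- 2).
        by field.
      by rewrite e1 e2 -exprnN exprMn invfM mulrC mulrA.
    exact: h.
have E (N : nat) : \sum_(0 <= k < N) circle_integral r (fun w => (nbin d k)%:R * w ^ j k) =
    \sum_(0 <= k < N) (nbin d k)%:R * (m == (d.+1 + 2 * k)%:Z)%:R :> C.
  by apply: eq_bigr => k _; rewrite circle_integral_Zpow // /j subr_eq0.
apply: (cvgc_unique hser); apply: (@cvgc_stationary _ _ K) => N KN.
rewrite E (big_cat_nat (leq0n K) KN) /= [X in _ + X]big_nat_cond [X in _ + X]big1 ?addr0 //.
move=> k /andP[/andP[kK _] _]; rewrite (_ : (m == _) = false) ?mulr0 //.
by apply/eqP; lia.
Qed.

(** Inside the unit circle [w - w^-1 = - w^-1 * (1 - w ^ 2)], and the series is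
    in [w ^ 2]. *)
Lemma coef_inside (r : R) (d K : nat) (m : int) : 0 < r < 1 -> (`|m| < K)%N ->
  circle_integral r (fun w => (w - w^-1) ^ (- (d.+1)%:Z) * w ^ m) =
  \sum_(0 <= k < K) (-1) ^+ d.+1 * (nbin d k)%:R * (m == - (d.+1 + 2 * k)%:Z)%:R :> C.
Proof.
move=> /andP[r0 r1] mK.
pose j k : int := m + (d.+1 + 2 * k)%:Z.
have hser : (fun K => \sum_(0 <= k < K) circle_integral r (fun w => ((-1) ^+ d.+1 * (nbin d k)%:R) * w ^ j k)) @ \oo -->
    (circle_integral r (fun w => (w - w^-1) ^ (- (d.+1)%:Z) * w ^ m) : C^o).
  have x1 : normc ((r%:C : C) ^+ 2) < 1.
    by rewrite normcX normc_real gtr0_norm // exprn_ilt1 // ltW.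
  have n1 : normc ((-1 : C) ^+ d.+1) = 1 by rewrite normcX normcN normc1 expr1n.
  apply: (@circle_integral_series r _ _ (fun k => r ^ (m + d.+1%:Z) * normc ((nbin d k)%:R * ((r%:C : C) ^+ 2) ^+ k)) (r ^ (m + d.+1%:Z) * ((1 - normc ((r%:C : C) ^+ 2)) ^+ d.+1)^-1)).
  - move=> k t; apply: cvgcM; first exact: cvgc_cst.
    exact: circle_ptXz_continuous.
  - move=> k t; rewrite !normcM n1 mul1r mulrCA ler_wpM2l ?normc_ge0 //.
    rewrite normcXz normc_circle_pt // normcX normcX normc_real gtr0_norm //.
    by rewrite /j PoszD addrA expfzDr ?gt_eqF // expz2.
  - move=> N; rewrite -mulr_sumr; apply: ler_wpM2l; first by rewrite exprz_ge0 // ltW.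
    exact: nbin_norm.
  - move=> t; set w := circle_pt r t.
    have w0 : w != 0 by exact: circle_pt_neq0.
    have nw : normc (w ^+ 2) < 1.
      by rewrite normcX normc_circle_pt // exprn_ilt1 // ltW.
    have h : (fun N => (-1) ^+ d.+1 * w ^ (m + d.+1%:Z) * (series ((fun k => (nbin d k)%:R * (w ^+ 2) ^+ k) : nat -> C^o) N : C)) @ \oo -->
        ((-1) ^+ d.+1 * w ^ (m + d.+1%:Z) * ((1 - w ^+ 2) ^+ d.+1)^-1 : C^o).
      by apply: cvgcM; [exact: cvgc_cst|exact: nbin_series].
    have E : (fun N => (-1) ^+ d.+1 * w ^ (m + d.+1%:Z) * (series ((fun k => (nbin d k)%:R * (w ^+ 2) ^+ k) : nat -> C^o) N : C)) =
       series ((fun k => (-1) ^+ d.+1 * (nbin d k)%:R * w ^ j k) : nat -> C^o).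
      apply/funext => N; rewrite /series /= mulr_sumr; apply: eq_bigr => k _.
      rewrite -!mulrA; congr (_ * _); rewrite mulrCA; congr (_ * _).
      by rewrite /j PoszD addrA [in RHS]expfzDr // expz2.
    rewrite E in h.
    have -> : (w - w^-1) ^ (- (d.+1)%:Z) * w ^ m = (-1) ^+ d.+1 * w ^ (m + d.+1%:Z) * ((1 - w ^+ 2) ^+ d.+1)^-1.
      have -> : w - w^-1 = (- w)^-1 * (1 - w ^+ 2).
        by field; rewrite w0.
      have e1 : w ^ (m + d.+1%:Z) = w ^ m * w ^+ d.+1 by rewrite expfzDr // exprnP.
      have e2 : (- w) ^+ d.+1 = (-1) ^+ d.+1 * w ^+ d.+1 by rewrite -exprMn mulN1r.
      rewrite e1 -exprnN exprMn invfM exprVn invrK e2.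
      have perm (a b x y : C) : a * b * x * y = a * (y * b) * x by ring.
      exact: perm.
    exact: h.
have E (N : nat) : \sum_(0 <= k < N) circle_integral r (fun w => ((-1) ^+ d.+1 * (nbin d k)%:R) * w ^ j k) =
    \sum_(0 <= k < N) (-1) ^+ d.+1 * (nbin d k)%:R * (m == - (d.+1 + 2 * k)%:Z)%:R :> C.
  by apply: eq_bigr => k _; rewrite circle_integral_Zpow // /j addr_eq0.
apply: (cvgc_unique hser); apply: (@cvgc_stationary _ _ K) => N KN.
rewrite E (big_cat_nat (leq0n K) KN) /= [X in _ + X]big_nat_cond [X in _ + X]big1 ?addr0 //.
move=> k /andP[/andP[kK _] _]; rewrite (_ : (m == _) = false) ?mulr0 //.
by apply/eqP; lia.
Qed.

Lemma half_double (x : C) : (x + x) / 2 = x.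
Proof. by field. Qed.

Definition vertex_coef (e : R) (deg : nat) (m : int) : C :=
  vp_circle_integral e (fun w => (w - w^-1) ^ (2 - deg%:Z) * w ^ m).

Lemma vertex_coef2 e m : 0 < e < 1 -> vertex_coef e 2 m = (m == 0)%:R.
Proof.
move=> /andP[e0 e1]; rewrite /vertex_coef /vp_circle_integral.
have E (r : R) : 0 < r -> circle_integral r (fun w : C => (w - w^-1) ^ (2 - 2) * w ^ m) = (m == 0)%:R.
  move=> r0; rewrite -(circle_integral_pow m r0); apply: eq_cintegral => t _.
  by rewrite subrr expr0z mul1r.
have h1 : 0 < 1 + e by lra.
have h2 : 0 < 1 - e by lra.
by rewrite (E _ h1) (E _ h2) half_double.
Qed.

Lemma vertex_coef1 e m : 0 < e < 1 -> vertex_coef e 1 m = (m == -1)%:R - (m == 1)%:R.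
Proof.
move=> /andP[e0 e1]; rewrite /vertex_coef /vp_circle_integral.
have E (r : R) : 0 < r -> circle_integral r (fun w : C => (w - w^-1) ^ (2 - 1) * w ^ m) = (m == -1)%:R - (m == 1)%:R.
  move=> r0.
  have cb j := cintegrable_circle_pow j r0.
  have mI : measurable (`[0, 1]%classic : set R) by exact: measurable_itv.
  transitivity (cintegral `[0, 1] (fun t => circle_pt r t ^ (m + 1) + (-1) * circle_pt r t ^ (m - 1))).
    apply: eq_cintegral => t _; have w0 := circle_pt_neq0 t r0.
    rewrite (_ : 2 - 1 = 1) // expr1z !expfzDr // exprN1 expr1z /circle_pt; ring.
  rewrite cintegralD //; last exact: cintegrableZ.
  rewrite cintegralZ // -[cintegral _ _]/(circle_integral r (fun w => w ^ (m + 1))).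
  rewrite -[X in -1 * X]/(circle_integral r (fun w => w ^ (m - 1))).
  rewrite !circle_integral_pow // addr_eq0 subr_eq0; ring.
have h1 : 0 < 1 + e by lra.
have h2 : 0 < 1 - e by lra.
by rewrite (E _ h1) (E _ h2) half_double.
Qed.

(** The principal value averages the expansions outside and inside the unit
    circle. *)
Lemma vertex_coef_centre e d m K : 0 < e < 1 -> (`|m| < K)%N ->
  vertex_coef e d.+3 m = 2^-1 * (\sum_(0 <= k < K) (nbin d k)%:R * (m == (d.+1 + 2 * k)%:Z)%:R +
    \sum_(0 <= k < K) (-1) ^+ d.+1 * (nbin d k)%:R * (m == - (d.+1 + 2 * k)%:Z)%:R).
Proof.
move=> /andP[e0 e1] mK; rewrite /vertex_coef /vp_circle_integral.
rewrite (_ : 2 - d.+3%:Z = - d.+1%:Z); last by lia.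
rewrite (coef_outside _ _ mK) ?(coef_inside _ _ mK); [ring|lra|lra].
Qed.

End VertexCoefficients.

Section ThetaIntegral.
Variable R : realType.
Local Notation C := R[i].

Lemma normc_qpow (tau : C) (r : R) :
  normc (qpow tau r) = expR (- (2 * pi * r * complex.Im tau)).
Proof.
rewrite /qpow normc_cexp; congr expR.
have -> : 2 * pi%:C * 'i%C * r%:C * tau = 'i%C * ((2 * pi * r)%:C * tau) :> C.
  by rewrite !rmorphM rmorph_nat; ring.
rewrite ReM; have -> : complex.Re ('i%C : C) = 0 by []. 
have -> : complex.Im ('i%C : C) = 1 by [].
by rewrite !ReImE; ring.
Qed.

Lemma qpowD (tau : C) (r s : R) : qpow tau (r + s) = qpow tau r * qpow tau s.
Proof. 
rewrite /qpow -cexpD; have -> : (r + s)%:C = r%:C + s%:C :> C by exact: rmorphD.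
by congr cexp; ring. Qed.

Lemma expR_sum (I : Type) (s : seq I) (F : I -> R) :
  expR (\sum_(i <- s) F i) = \prod_(i <- s) expR (F i).
Proof. by apply: (big_morph _ (@expRD R) (@expR0 R)). Qed.

(** The Gaussian decay of the theta coefficients beats the growth of [z ^ l] on a
    circle of radius less than 2. *)
Lemma gauss_pow4 (kappa : R) (k : nat) : 0 < kappa ->
  expR (- (kappa * k%:R ^+ 2)) * 2 ^+ k <= expR kappa^-1 * 2^-1 ^+ k.
Proof.
move=> k0; rewrite exprVn ler_pdivlMr ?exprn_gt0 // -mulrA -exprMn.
have e4 : (2 * 2 : R) <= expR 2.
  have := @expR_ge1Dx R 1; rewrite (_ : expR (2 : R) = expR 1 * expR 1) => [h|]; first by nra.
  by rewrite -expRD; congr expR; ring.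
apply: (@le_trans _ _ (expR (- (kappa * k%:R ^+ 2)) * expR 2 ^+ k)).
  by apply: ler_wpM2l; [exact: expR_ge0|apply: lerXn2r; rewrite ?nnegrE ?expR_ge0].
rewrite -expRM_natl -expRD ler_expR.
have -> : - (kappa * k%:R ^+ 2) + k%:R * 2 = kappa^-1 - (kappa * k%:R - 1) ^+ 2 / kappa.
  by field; rewrite gt_eqF.
by rewrite gerBl divr_ge0 ?sqr_ge0 ?ltW.
Qed.

Variables (N : nat) (M : 'M[int]_N) (deg : 'I_N -> nat) (a : 'cV[int]_N) (tau : C) (e : R).
Hypothesis N0 : (0 < N)%N.
Hypothesis symM : M^T = M.
Hypothesis ndM : negative_definite (map_mx intr M : 'M[R]_N).
Hypothesis tau0 : 0 < complex.Im tau.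
Hypothesis e_small : 0 < e < 1 / 2.

Definition theta_coef (l : 'cV[int]_N) : C :=
  patch (fun=> 0) [set l : 'cV[int]_N | exists x : 'cV[int]_N, l = (M *m x) *+ 2 + a]
    (fun l => qpow tau (- inv_form R M l / 4)) l.

(** The exponent is bounded through each single coordinate by the Cauchy-Schwarz
    bound, hence through their average. *)
Lemma theta_coef_bound : exists2 kappa : R, 0 < kappa &
  forall l, normc (theta_coef l) <= \prod_v expR (- (kappa * (`|l v ord0|%N)%:R ^+ 2)).
Proof.
pose D : R := 1 + \sum_v `|(M v v)%:~R|.
have D0 : 0 < D by rewrite ltr_pwDl // sumr_ge0.
have ND0 : 0 < N%:R * D by rewrite mulr_gt0 // ltr0n.
exists (pi / 2 * complex.Im tau / (N%:R * D)).
  by rewrite divr_gt0 // mulr_gt0 // divr_gt0 ?pi_gt0.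
move=> l; rewrite /theta_coef /patch; case: ifP => _; last first.
  by rewrite normc0 prodr_ge0 // => v _; exact: expR_ge0.
rewrite normc_qpow -expR_sum ler_expR sumrN lerN2 -mulr_sumr.
have Q0 : 0 <= - inv_form R M l.
  have v : 'I_N := Ordinal N0.
  have h := inv_form_bound l v symM ndM.
  have Mv : 0 < - (M v v)%:~R :> R.
    have := ndM (x := delta_mx v ord0); rewrite trmx_delta -rowE -colE !mxE oppr_gt0; apply.
    by apply/negP => /eqP /matrixP /(_ v ord0); rewrite !mxE !eqxx => /eqP; rewrite oner_eq0.
  by rewrite -(pmulr_rge0 _ Mv); apply: le_trans h; exact: sqr_ge0.
have sq v : (`|l v ord0|%N)%:R ^+ 2 <= D * - inv_form R M l.
  have := inv_form_bound l v symM ndM.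
  have -> : (`|l v ord0|%N)%:R ^+ 2 = (l v ord0)%:~R ^+ 2 :> R.
    by rewrite natr_absz intr_norm real_normK ?num_real.
  move=> h; apply: le_trans h _; apply: ler_wpM2r => //.
  rewrite /D (bigD1 v) //=; have : 0 <= \sum_(i < N | i != v) `|(M i i)%:~R : R| by rewrite sumr_ge0.
  by have := ler_norm (- (M v v)%:~R : R); rewrite normrN; lra.
have tot : \sum_v (`|l v ord0|%N)%:R ^+ 2 <= N%:R * D * - inv_form R M l.
  rewrite -mulrA -[N in N%:R]card_ord -sum1_card natr_sum mulr_suml; apply: ler_sum => v _.
  by rewrite mul1r.
have -> : 2 * pi * (- inv_form R M l / 4) * complex.Im tau = pi / 2 * complex.Im tau * - inv_form R M l by field.
rewrite -mulrA; apply: ler_wpM2l; first by rewrite mulr_ge0 ?ltW // divr_gt0 ?pi_gt0.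
by rewrite ler_pdivrMl.
Qed.

Let w_bounds (w : C) : on_circles e w -> [/\ 1 / 2 <= normc w, normc w <= 2 & w != 0].
Proof.
have /andP[h1 h2] := e_small.
move=> [t [|] ->]; (split; [| |apply: circle_pt_neq0; lra]); rewrite normc_circle_pt; lra.
Qed.

Let pow_bound (w : C) (m : int) : on_circles e w -> normc (w ^ m) <= 2 ^+ `|m|%N.
Proof.
move=> /w_bounds [b1 b2 w0]; rewrite normcXz; case: m => m.
  by rewrite -exprnP absz_nat; apply: lerXn2r; rewrite ?nnegrE ?normc_ge0.
rewrite NegzE -exprnN abszN absz_nat -exprVn; apply: lerXn2r; rewrite ?nnegrE ?invr_ge0 ?normc_ge0 //.
by rewrite -[leRHS]invrK lef_pV2 ?posrE ?invr_gt0 //; lra.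
Qed.

Let g (v : 'I_N) (w : C) : C := (w - w^-1) ^ (2 - (deg v)%:Z).

Let r1 r : r = 1 + e \/ r = 1 - e -> 0 < r /\ r != 1.
Proof.
have /andP[h1 h2] := e_small.
by case=> ->; split; try lra; apply/eqP; lra.
Qed.

Let g_cont v r t : r = 1 + e \/ r = 1 - e ->
  (fun x => g v (circle_pt r x)) x @[x --> t] --> (g v (circle_pt r t) : C^o).
Proof. by move=> /r1 [h1 h2]; exact: sub_inv_continuous. Qed.

Let g_bound : exists2 B : R, 0 <= B & forall v w, on_circles e w -> normc (g v w) <= B.
Proof.
have /andP[h1 h2] := e_small.
have lo : exists2 c : R, 0 < c & forall w, on_circles e w -> c <= normc (w - w^-1).
  exists e => // w hw; have [b1 b2 w0] := w_bounds hw.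
  have nw : 0 < normc w by lra.
  have : normc w - normc w^-1 <= normc (w - w^-1) by exact: normcB.
  have : normc w^-1 - normc w <= normc (w - w^-1) by rewrite normcBC; exact: normcB.
  rewrite normcV; case: hw => t [|] ->; rewrite normc_circle_pt; try lra.
    have : (1 + e)^-1 <= 1 by rewrite invf_le1; lra.
    by lra.
  have : 1 <= (1 - e)^-1 by rewrite invf_ge1; lra.
  by lra.
have [c c0 hc] := lo.
have hi w : on_circles e w -> normc (w - w^-1) <= 4.
  move=> hw; have [b1 b2 w0] := w_bounds hw; apply: le_trans (normcD _ _) _; rewrite normcN normcV.
  have : (normc w)^-1 <= 2 by rewrite -[leRHS]invrK lef_pV2 ?posrE ?invr_gt0 //; lra.
  lra.
exists (\sum_v (4 ^ (2 - (deg v)%:Z) + c ^ (2 - (deg v)%:Z))).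
  by apply: sumr_ge0 => v _; rewrite addr_ge0 // exprz_ge0 // ltW.
move=> v w hw; rewrite (bigD1 v) //= normcXz.
have rest : 0 <= \sum_(i < N | i != v) (4 ^ (2 - (deg i)%:Z) + c ^ (2 - (deg i)%:Z)) :> R.
  by apply: sumr_ge0 => u _; rewrite addr_ge0 // exprz_ge0 // ltW.
have p1 : 0 <= 4 ^ (2 - (deg v)%:Z) :> R by rewrite exprz_ge0.
have p2 : 0 <= c ^ (2 - (deg v)%:Z) by rewrite exprz_ge0 // ltW.
have lw := hc w hw; have uw := hi w hw.
have nw0 : 0 < normc (w - w^-1) by lra.
suff : normc (w - w^-1) ^ (2 - (deg v)%:Z) <= 4 ^ (2 - (deg v)%:Z) \/
   normc (w - w^-1) ^ (2 - (deg v)%:Z) <= c ^ (2 - (deg v)%:Z) by case; lra.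
case: (2 - (deg v)%:Z) => m; [left|right].
  by rewrite -!exprnP; apply: lerXn2r => //; rewrite nnegrE; lra.
rewrite NegzE -!exprnN lef_pV2 ?posrE ?exprn_gt0 //.
by apply: lerXn2r => //; rewrite nnegrE; lra.
Qed.

(** Since the circles stay within the annulus of radii 1/2 and 2, the Gaussian
    decay of the coefficients makes the double family absolutely summable. *)
Lemma torus_integral_theta :
  (exists B, forall F : {fset 'cV[int]_N},
    \sum_(l <- F) normc (theta_coef l * \prod_v vertex_coef e (deg v) (l v ord0)) <= B) /\
  vp_torus_integral e (fun z => (\prod_v (z v - (z v)^-1) ^ (2 - (deg v)%:Z)) * theta_series M a tau z) =
  usum (fun l => theta_coef l * \prod_v vertex_coef e (deg v) (l v ord0)).
Proof.
have [B B0 gB] := g_bound.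
have [kappa k0 thB] := theta_coef_bound.
have /andP[h1 h2] := e_small.
pose beta (v : 'I_N) (m : int) : R := 2 * (1 + B) * 2 ^+ `|m|%N.
have b0 v m : 0 <= beta v m by rewrite /beta !mulr_ge0 ?exprn_ge0 //; lra.
have gb v m w : on_circles e w -> 2 * normc (g v w * w ^ m) <= beta v m.
  move=> hw; rewrite /beta -mulrA ler_wpM2l // normcM; apply: ler_pM; rewrite ?normc_ge0 //.
    by apply: le_trans (gB v w hw) _; rewrite lerDr.
  exact: pow_bound.
have pb v m w : on_circles e w -> normc (w ^ m) <= beta v m.
  move=> hw; apply: le_trans (pow_bound m hw) _; rewrite /beta ler_peMl ?exprn_ge0 //; lra.
pose G := 2 * (1 + B) * expR kappa^-1.
have G0 : 0 <= G by rewrite /G !mulr_ge0 ?expR_ge0 //; lra.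
pose bb k : R := G * 2^-1 ^+ k.
have bb0 k : 0 <= bb k by rewrite mulr_ge0 // exprn_ge0 // invr_ge0.
have bbM K : \sum_(0 <= k < K) bb k <= G * 2.
  rewrite -mulr_sumr ler_wpM2l //.
  have := @nbin_bound R (2^-1) 0 K; rewrite (_ : ((1 - 2^-1) ^+ 1)^-1 = 2); last by rewrite expr1; field.
  under eq_bigr do rewrite /nbin addn0 bin0 mul1r.
  by apply; apply/andP; split; lra.
have tb (F : {fset 'cV[int]_N}) : \sum_(l <- F) normc (theta_coef l) * \prod_v beta v (l v ord0) <= (2 * (G * 2)) ^+ N.
  apply: le_trans (lattice_sum_bounded bb0 bbM F); apply: ler_sum => l _.
  have q0 : 0 <= \prod_v beta v (l v ord0) by apply: prodr_ge0 => v _; exact: b0.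
  apply: le_trans (ler_wpM2r q0 (thB l)) _.
  rewrite -big_split /=; apply: ler_prod => v _; rewrite mulr_ge0 ?expR_ge0 //= /beta /bb /G.
  have := gauss_pow4 `|l v ord0|%N k0; set x := expR (- _); set y := expR _; set u := 2 ^+ _; set w := 2^-1 ^+ _ => h.
  have B2 : 0 <= 2 * (1 + B) by lra.
  have := ler_wpM2l B2 h; rewrite !mulrA => h'.
  by apply: le_trans h'; rewrite le_eqVlt; apply/orP; left; apply/eqP; ring.
have e01 : 0 < e < 1 by rewrite h1; lra.
split.
  exists ((2 * (G * 2)) ^+ N) => F; apply: le_trans (tb F); apply: ler_sum => l _.
  rewrite normcM normc_prod ler_wpM2l ?normc_ge0 //; apply: ler_prod => v _; rewrite normc_ge0 /=.
  exact: (@coef_bound R N e g beta e01 g_cont gb).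
rewrite -[RHS](vp_torus_integral_usum e01 g_cont b0 gb pb tb).
congr (vp_torus_integral e _); apply/funext => z; congr (_ * _).
rewrite /theta_series /sum_over -/(usum _); congr usum; apply/funext => l.
by rewrite /theta_coef /patch; case: ifP; rewrite ?mul0r.
Qed.

End ThetaIntegral.

(** * The value of the invariant *)

Section LeafCoordinates.
Variables (R : realType) (n : nat) (p : 'I_n -> nat).
Hypothesis hp : forall j, (0 < p j)%N.
Hypothesis hcop : forall i j, i != j -> coprime (p i) (p j).
Variables (q : 'I_n -> nat) (p0 : int) (k : 'I_n -> seq int).
Hypothesis star : star_plumbing R p q p0 k.
Local Notation P := (Pprod p).
Local Notation V := (vertex k).
Local Notation leaf := (leaf hp star).
Local Notation deg v := (#|[pred w : V | adj v w]|).

(** At a vertex of degree two the factor is 1, so that the circle integral forces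
    the exponent there to be 0; the centre and the leaves carry everything. *)
Lemma leaf_vertexP (Q : V -> Prop) : Q None -> (forall j, Q (leaf j)) ->
  (forall j (u : 'I_(size (k j))), (u.+1 < size (k j))%N -> Q (@arm_vertex n k j u)) -> forall v, Q v.
Proof.
move=> h0 h1 h2; apply: vertexP => // j u; have [hu|hu] := ltnP u.+1 (size (k j)); first exact: h2.
suff -> : u = Ordinal (last_lt_size hp star j) by exact: h1.
by apply/val_inj => /=; have := ltn_ord u; lia.
Qed.

Lemma degE v : (deg v)%:Z = adj_sum (fun _ : V => 1) v.
Proof.
rewrite -natz -sum1_card natr_sum big_mkcond; apply: eq_bigr => w _.
by rewrite inE /= mulr1; case: adj.
Qed.

Lemma along1 j i : along (fun _ : V => 1) j i = (i <= size (k j))%:R.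
Proof. by case: i => [//|i] /=; case: insubP => [u -> //|/negPf ->]. Qed.

Lemma deg_centre : deg (None : V) = n.
Proof.
apply/eqP; rewrite -eqz_nat degE adj_sum_centre (eq_bigr (fun=> 1)) ?sumr_const ?card_ord ?natz //.
by move=> j _; rewrite along1 (arm_gt0 hp star).
Qed.

Lemma deg_leaf j : deg (leaf j) = 1%N.
Proof.
apply/eqP; rewrite -eqz_nat degE adj_sum_arm !along1 /=; have := arm_gt0 hp star j.
move=> h; have -> : ((size (k j)).-1 <= size (k j))%N = true by exact: leq_pred.
by have -> : ((size (k j)).-1.+1 < size (k j))%N = false by rewrite prednK // ltnn.
Qed.

Lemma deg_interior j (u : 'I_(size (k j))) : (u.+1 < size (k j))%N -> deg (arm_vertex u) = 2%N.
Proof.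
move=> h; apply/eqP; rewrite -eqz_nat degE adj_sum_arm !along1 h.
by have -> : (u <= size (k j))%N = true by exact/ltnW/ltn_ord.
Qed.

Lemma interior_neq_leaf j (u : 'I_(size (k j))) i : (u.+1 < size (k j))%N -> (arm_vertex u == leaf i) = false.
Proof.
move=> hu; apply/negP => /eqP h; have := deg_interior hu; rewrite h; have := deg_leaf i; lia.
Qed.

Lemma prod_vertex (A : comNzRingType) (F : V -> A) :
  (forall j (u : 'I_(size (k j))), (u.+1 < size (k j))%N -> F (@arm_vertex n k j u) = 1) ->
  \prod_(i < #|V|) F (enum_val i) = F None * \prod_j F (leaf j).
Proof.
move=> F1; have -> : \prod_(i < #|V|) F (enum_val i) = \prod_v F v.
  rewrite [RHS](reindex (@enum_val V V)) /= //.
  by exists enum_rank => x _; rewrite ?enum_valK ?enum_rankK.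
rewrite (bigD1 None) //=; congr (_ * _).
rewrite (bigID (fun v => v \in (leaf @: 'I_n)%SET)) /= [X in _ * X]big1 ?mulr1.
  rewrite -(big_imset F (in2W (@leaf_inj _ _ _ hp _ _ _ star))) /=.
  apply: eq_bigl => v; apply/andP/idP => [[] //|hv]; split => //.
  by case/imsetP: hv => j _ ->.
move=> v; elim/leaf_vertexP: v => // [j|j u hu _]; last exact: F1.
by move=> /andP[_ /negP []]; apply/imsetP; exists j.
Qed.

(** The exponents with a nonzero contribution to the torus integral. *)
Definition leaf_vec (c : int) (eps : 'I_n -> int) (v : V) : int :=
  (v == None)%:R * c + \sum_j (v == leaf j)%:R * eps j.

Lemma leaf_vec_centre c eps : leaf_vec c eps None = c.
Proof. by rewrite /leaf_vec eqxx mul1r big1 ?addr0 // => j _; rewrite mul0r. Qed.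

Lemma leaf_vec_leaf c eps j : leaf_vec c eps (leaf j) = eps j.
Proof.
rewrite /leaf_vec mul0r add0r (bigD1 j) //= eqxx mul1r big1 ?addr0 // => i ij.
by rewrite (inj_eq (@leaf_inj _ _ _ hp _ _ _ star)) eq_sym (negPf ij) mul0r.
Qed.

Lemma leaf_vec_interior c eps j (u : 'I_(size (k j))) : (u.+1 < size (k j))%N ->
  leaf_vec c eps (arm_vertex u) = 0.
Proof.
by move=> hu; rewrite /leaf_vec mul0r add0r big1 // => i _; rewrite interior_neq_leaf // mul0r.
Qed.

Lemma leaf_vecP (l : V -> int) :
  (forall j (u : 'I_(size (k j))), (u.+1 < size (k j))%N -> l (@arm_vertex n k j u) = 0) ->
  forall v, l v = leaf_vec (l None) (fun j => l (leaf j)) v.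
Proof.
move=> l0; apply: leaf_vertexP => [|j|j u hu]; first by rewrite leaf_vec_centre.
  by rewrite leaf_vec_leaf.
by rewrite leaf_vec_interior // l0.
Qed.

(** Only the entries of the inverse matrix at the centre and at the leaves
    enter. Off the diagonal they are the products that a square produces; the diagonal
    entries at the leaves deviate from this, and as [eps j ^ 2 = 1] the deviation
    is a constant. *)
Lemma leaf_inv_form c eps : (forall j, eps j ^+ 2 = 1) ->
  - inv_form R (plumbing_mx p0 k) (\col_i leaf_vec c eps (enum_val i)) =
  P%:R * (c%:~R + \sum_j (eps j)%:~R / (p j)%:R) ^+ 2 +
  \sum_j ((H1_order (plumbing_mx p0 (delete_terminal k j)))%:R - P%:R / (p j)%:R ^+ 2).
Proof.
move=> eps2.
have [X hX] := choice (leaf_cols hp hcop star).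
pose x v := c * centre_col p v + \sum_j eps j * X j v.
have Mx v : plumb p0 x v = leaf_vec c eps v.
  have Msum (s : seq 'I_n) w : plumb p0 (fun v => \sum_(j <- s) eps j * X j v) w = \sum_(j <- s) (w == leaf j)%:R * eps j.
    elim: s => [|i s ih].
      rewrite big_nil; have := plumb_lin p0 0 0 (fun=> 0) (fun=> 0) w; rewrite !mul0r addr0; apply: etrans.
      by congr (plumb p0 _ w); apply/funext => u; rewrite big_nil ?mul0r ?addr0.
    rewrite big_cons -ih; have [h _ _ _] := hX i.
    have E := plumb_lin p0 (eps i) 1 (X i) (fun v => \sum_(j <- s) eps j * X j v) w.
    rewrite h [1 * plumb _ _ _]mul1r in E; rewrite [X in _ = X + _]mulrC -E.
    by congr (plumb p0 _ w); apply/funext => u; rewrite big_cons mul1r.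
  rewrite /leaf_vec -Msum.
  have E := plumb_lin p0 c 1 (@centre_col n p k) (fun v => \sum_j eps j * X j v) v.
  rewrite (plumb_centre_col hp star) [1 * plumb _ _ _]mul1r in E; rewrite [X in _ = X + _]mulrC -E.
  by congr (plumb p0 _ v); apply/funext => u; rewrite mul1r.
have unit : map_mx intr (plumbing_mx p0 k) \in (@unitmx R #|V|).
  by apply: negdef_unitmx; case: star.
have -> : - inv_form R (plumbing_mx p0 k) (\col_i leaf_vec c eps (enum_val i)) =
    - (\sum_v leaf_vec c eps v * x v)%:~R.
  have E : plumbing_mx p0 k *m (\col_i x (enum_val i)) = \col_i leaf_vec c eps (enum_val i).
    by rewrite plumbing_mxE; apply/colP => i; rewrite !mxE Mx.
  rewrite /inv_form -{2}E map_mxM -mulmxA mulKmx // !mxE; congr (- _).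
  rewrite -(sum_enum_val (fun v => leaf_vec c eps v * x v)) rmorph_sum /=.
  by apply: eq_bigr => i _; rewrite !mxE rmorphM.
have pn j : (p j)%:R != 0 :> R by rewrite pnatr_eq0 -lt0n.
have pV j : (P %/ p j)%:R = P%:R / (p j)%:R :> R.
  by apply/(mulIf (pn j)); rewrite divfK // -natrM mulnC Pprod_div.
have cc j : centre_col p (leaf j) = - (P %/ p j)%:Z.
  by rewrite -(along_leaf hp star) (along_centre_col hp star) cont_size mulr1.
have -> : \sum_v leaf_vec c eps v * x v = c * x None + \sum_j eps j * x (leaf j).
  rewrite [LHS](bigD1 None) //= leaf_vec_centre; congr (_ + _).
  rewrite (bigID (fun v => v \in (leaf @: 'I_n)%SET)) /= [X in _ + X]big1 ?addr0.
    rewrite (eq_bigl (fun v => v \in (leaf @: 'I_n)%SET)).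
      rewrite (big_imset _ (in2W (@leaf_inj _ _ _ hp _ _ _ star))) /=.
      by apply: eq_bigr => j _; rewrite leaf_vec_leaf.
    move=> v; apply/andP/idP => [[] //|hv]; split => //.
    by case/imsetP: hv => j _ ->.
  move=> v; elim/leaf_vertexP: v => // [j|j u hu _]; last by rewrite leaf_vec_interior // mul0r.
  by move=> /andP[_ /negP []]; apply/imsetP; exists j.
have x0 : (x None)%:~R = - P%:R * (c%:~R + \sum_j (eps j)%:~R / (p j)%:R) :> R.
  rewrite /x /= rmorphD rmorphM rmorph_sum /= mulrDr mulr_sumr; congr (_ + _).
    by rewrite rmorphN /= mulrC.
  apply: eq_bigr => j _; have [_ -> _ _] := hX j; rewrite rmorphM rmorphN /= -pmulrn pV; ring.
have xl j : (x (leaf j))%:~R = - P%:R / (p j)%:R * (c%:~R + \sum_i (eps i)%:~R / (p i)%:R)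
   + (eps j)%:~R * (P%:R / (p j)%:R ^+ 2 - (H1_order (plumbing_mx p0 (delete_terminal k j)))%:R) :> R.
  rewrite /x cc rmorphD rmorphM rmorph_sum /= mulrDr mulr_sumr -addrA; congr (_ + _).
    by rewrite rmorphN /= -pmulrn pV; ring.
  rewrite (bigD1 j) //= [in RHS](bigD1 j) //= [RHS]addrAC; congr (_ + _).
    have [_ _ _ ->] := hX j; rewrite rmorphM rmorphN /= -pmulrn.
    by set h := _%:R; field.
  apply: eq_bigr => i ij; have [_ _ h _] := hX i.
  have {}h := h j; rewrite eq_sym in ij; move/(_ ij)/(congr1 (fun z : int => z%:~R : R)): h.
  rewrite rmorphM rmorphN /= -!pmulrn natrM => h.
  rewrite rmorphM /=; have -> : (X i (leaf j))%:~R = - P%:R / ((p j)%:R * (p i)%:R) :> R.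
    by apply: (mulIf (mulf_neq0 (pn j) (pn i))); rewrite h divfK // mulf_neq0.
  by field; rewrite !pn.
rewrite rmorphD rmorphM rmorph_sum /= x0; clear Mx; clearbody x; set s := c%:~R + _.
rewrite (eq_bigr (fun j => (- P%:R * s) * ((eps j)%:~R / (p j)%:R) +
   (P%:R / (p j)%:R ^+ 2 - (H1_order (plumbing_mx p0 (delete_terminal k j)))%:R))); last first.
  move=> j _; rewrite rmorphM /= xl -/s.
  have e2 : (eps j)%:~R * (eps j)%:~R = 1 :> R by rewrite -rmorphM -expr2 eps2.
  rewrite mulrDr [X in _ + X]mulrA e2 mul1r; congr (_ + _); ring.
rewrite big_split -mulr_sumr /=.
have -> : \sum_j (P%:R / (p j)%:R ^+ 2 - (H1_order (plumbing_mx p0 (delete_terminal k j)))%:R) =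
    - \sum_j ((H1_order (plumbing_mx p0 (delete_terminal k j)))%:R - P%:R / (p j)%:R ^+ 2) :> R.
  by rewrite -sumrN; apply: eq_bigr => j _; rewrite opprB.
by rewrite /s; ring.
Qed.

End LeafCoordinates.

Section Exponents.
Variables (n : nat) (p : 'I_n -> nat).
Local Notation P := (Pprod p).

Definition m_zero : int := P%:Z * (n%:Z - 2) - \sum_j (P %/ p j)%:Z.
Definition shift (S : {set 'I_n}) : nat := \sum_(j in S) 2 * (P %/ p j).
(** The exponents of [z] in the expansion of [G] at 0: for each factor with index
    [j] one chooses a term, [S] being the choices of the positive power, and [k]
    indexes the expansion of the central factor. *)
Definition expo (S : {set 'I_n}) (k : nat) : int := m_zero + (shift S + 2 * P * k)%N%:Z.

End Exponents.

Section ZhatValue.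
Variables (R : realType) (n : nat) (p : 'I_n -> nat).
Local Notation C := R[i].
Hypothesis hp : forall j, (0 < p j)%N.
Hypothesis hcop : forall i j, i != j -> coprime (p i) (p j).
Variables (q : 'I_n -> nat) (p0 : int) (k : 'I_n -> seq int).
Hypothesis star : star_plumbing R p q p0 k.
Variable d : nat.
Hypothesis nd3 : n = d.+3.
Variables (tau : C) (a : 'cV[int]_#|vertex k|) (e : R).
Hypothesis tau0 : 0 < complex.Im tau.
Hypothesis ha : spinc_label (@vdeg n k) a.
Hypothesis he : 0 < e < 1 / 2.
Local Notation P := (Pprod p).
Local Notation V := (vertex k).
Local Notation M := (plumbing_mx p0 k).
Local Notation leaf := (leaf hp star).
Local Notation h j := (H1_order (plumbing_mx p0 (delete_terminal k j))).

Let sg (b : bool) : int := if b then 1 else -1.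
Let eps (S : {set 'I_n}) (j : 'I_n) : int := if j \in S then 1 else -1.
Let lvec (b : bool) (S : {set 'I_n}) (r : nat) : V -> int :=
  leaf_vec hp star (sg b * (d.+1 + 2 * r)%N%:Z) (fun j => sg b * eps S j).
Let lcol b S r : 'cV[int]_#|V| := \col_i lvec b S r (enum_val i).

Let e01 : 0 < e < 1.
Proof. by move: he => /andP[? ?]; lra. Qed.

Let deg_centre3 : #|[pred w : V | adj None w]| = d.+3.
Proof. exact: etrans (deg_centre hp star) nd3. Qed.

Let delta_sum K r : (r < K)%N ->
  \sum_(0 <= s < K) (nbin d s)%:R * ((d.+1 + 2 * r)%N%:Z == (d.+1 + 2 * s)%N%:Z)%:R = (nbin d r)%:R :> C.
Proof.
move=> rK; rewrite big_mkord (bigD1 (Ordinal rK)) //= eqxx mulr1 big1 ?addr0 // => s sr.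
rewrite (_ : (_ == _) = false) ?mulr0 //; apply/eqP => H; case/eqP: sr; apply/val_inj => /=; lia.
Qed.

Let centre_coef b r : vertex_coef e n (sg b * (d.+1 + 2 * r)%N%:Z) =
  2^-1 * (nbin d r)%:R * (sg b)%:~R ^+ n :> C.
Proof.
have mK : (absz (sg b * (d.+1 + 2 * r)%N%:Z)%R < (d.+1 + 2 * r).+1)%N by rewrite /sg; case: b; lia.
rewrite nd3 (vertex_coef_centre _ e01 mK) -mulrA; congr (_ * _).
have rK : (r < (d.+1 + 2 * r).+1)%N by lia.
case: b {mK}; rewrite /sg.
  rewrite mul1r delta_sum // expr1n mulr1 big1 ?addr0 // => s _.
  by rewrite (_ : (_ == _) = false) ?mulr0 //; apply/eqP; lia.
rewrite big1 ?add0r => [|s _]; last first.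
  by rewrite (_ : (_ == _) = false) ?mulr0 //; apply/eqP; lia.
rewrite -[in RHS](delta_sum rK) mulr_suml; apply: eq_bigr => s _.
rewrite mulN1r eqr_opp rmorphN1 (exprD _ 2 d.+1) sqrrN expr1n mul1r; ring.
Qed.

Let leaf_coef b S j : vertex_coef e 1 (sg b * eps S j) = (sg b)%:~R * (if j \in S then -1 else 1) :> C.
Proof.
have -> : vertex_coef e 1 (sg b * eps S j) = - ((sg b * eps S j)%:~R : C).
  have : sg b * eps S j = 1 \/ sg b * eps S j = -1.
    by rewrite /sg /eps; case: b; case: ifP => _; [left|right|right|left].
  case=> H; rewrite H vertex_coef1 //; first by rewrite (_ : (1 == -1 :> int) = false) // eqxx sub0r.
  by rewrite eqxx (_ : (-1 == 1 :> int) = false) // subr0 rmorphN1 opprK.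
rewrite rmorphM -mulrN; congr (_ * _); rewrite /eps; case: ifP => _ //.
by rewrite rmorphN1 opprK.
Qed.

Let vertex_product b S r :
  \prod_v vertex_coef e (vdeg v) (lcol b S r v ord0) = 2^-1 * ((-1) ^+ #|S| * (nbin d r)%:R) :> C.
Proof.
pose F (v : V) : C := vertex_coef e #|[pred w | adj v w]| (lvec b S r v).
have -> : \prod_v vertex_coef e (vdeg v) (lcol b S r v ord0) = \prod_(i < #|V|) F (enum_val i).
  by apply: eq_bigr => i _; rewrite /lcol mxE.
rewrite (prod_vertex hp star (F := F)) /F; last first.
  move=> j u hu; rewrite (deg_interior hu) vertex_coef2 // /lvec leaf_vec_interior // eqxx //.
rewrite (deg_centre hp star) /lvec leaf_vec_centre centre_coef.
rewrite (eq_bigr (fun j => (sg b)%:~R * (if j \in S then -1 else 1))); last first.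
  by move=> j _; rewrite deg_leaf leaf_vec_leaf leaf_coef.
rewrite big_split /= prodr_const card_ord -big_mkcond /= prodr_const.
have : (sg b)%:~R ^+ n * (sg b)%:~R ^+ n = 1 :> C.
  by rewrite -exprMn -rmorphM (_ : sg b * sg b = 1) ?expr1n //; rewrite /sg; case: (b).
set x := _ ^+ n => x2; rewrite -[RHS]mulr1 -x2; ring.
Qed.

Let support (l : 'cV[int]_#|V|) : \prod_v vertex_coef e (vdeg v) (l v ord0) != 0 :> C -> exists b S r, l = lcol b S r.
Proof.
move=> /prodf_neq0 nz; pose l' v := l (enum_rank v) ord0.
have nz' v : vertex_coef e #|[pred w : V | adj v w]| (l' v) != 0 :> C.
  by have := nz (enum_rank v) isT; rewrite /vdeg enum_rankK.
have l'i j (u : 'I_(size (k j))) : (u.+1 < size (k j))%N -> l' (arm_vertex u) = 0.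
  move=> hu; have := nz' (arm_vertex u); rewrite (deg_interior hu) vertex_coef2 //.
  by have [->|_] := eqVneq (l' (arm_vertex u)) 0; rewrite ?eqxx.
have l'l j : l' (leaf j) = 1 \/ l' (leaf j) = -1.
  have := nz' (leaf j); rewrite deg_leaf vertex_coef1 //.
  have [-> _|_] := eqVneq (l' (leaf j)) (-1); first by right.
  have [-> _|_] := eqVneq (l' (leaf j)) 1; first by left.
  by rewrite subrr eqxx.
have [b [r l'c]] : exists b r, l' None = sg b * (d.+1 + 2 * r)%N%:Z.
  have := nz' None; rewrite deg_centre3.
  rewrite (vertex_coef_centre _ e01 (ltnSn `|l' None|%N)).
  case: (pselect (exists r, l' None = (d.+1 + 2 * r)%N%:Z)) => [[r ->] _|H1].
    by exists true, r; rewrite /sg mul1r.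
  case: (pselect (exists r, l' None = - (d.+1 + 2 * r)%N%:Z)) => [[r ->] _|H2].
    by exists false, r; rewrite /sg mulN1r.
  rewrite !big1 ?addr0 ?mulr0 ?eqxx // => r _.
    by case: eqP => [?|]; [case: H2; exists r|rewrite mulr0].
  by case: eqP => [?|]; [case: H1; exists r|rewrite mulr0].
exists b, [set j | sg b * l' (leaf j) == 1]%SET, r.
apply/colP => i; rewrite /lcol mxE /lvec.
have -> : l i ord0 = l' (enum_val i) by rewrite /l' enum_valK.
rewrite (leaf_vecP hp star l'i) l'c; congr (leaf_vec _ _ _ _ _); apply/funext => j.
by rewrite /eps inE /sg; case: b l'c => _; case: (l'l j) => ->.
Qed.

Let lcol_inj b S r b' S' r' : lcol b S r = lcol b' S' r' -> [/\ b = b', S = S' & r = r'].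
Proof.
move=> H; have {}H v : lvec b S r v = lvec b' S' r' v.
  by have /colP /(_ (enum_rank v)) := H; rewrite /lcol !mxE enum_rankK.
have hc := H None; rewrite /lvec !leaf_vec_centre in hc.
have [bb rr] : b = b' /\ r = r' by move: hc; rewrite /sg; case: b H; case: b'; move=> _ ?; split => //; lia.
split=> //; apply/setP => j; have := H (leaf j); rewrite /lvec !leaf_vec_leaf -bb.
by rewrite /eps /sg; case: b {bb H hc}; case: (j \in S); case: (j \in S').
Qed.

Let label b S r : exists x : 'cV[int]_#|V|, lcol b S r = (M *m x) *+ 2 + a.
Proof.
have [y ya] := ha; pose y' v := y (enum_rank v) ord0.
have [z hz] : exists z : V -> int, forall v, lvec b S r v = #|[pred w : V | adj v w]|%:Z + z v *+ 2.
  suff /choice [z hz] : forall v, exists t : int, lvec b S r v = #|[pred w : V | adj v w]|%:Z + t *+ 2 by exists z.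
  apply: (leaf_vertexP (hp := hp) (star := star) (Q := fun v => exists t : int, lvec b S r v = #|[pred w : V | adj v w]|%:Z + t *+ 2)) => [|j|j u hu].
  - rewrite /lvec leaf_vec_centre deg_centre3 /sg; case: b.
      by exists (r%:Z - 1); lia.
    by exists (- (d.+2 + r)%N%:Z); lia.
  - rewrite /lvec leaf_vec_leaf deg_leaf /sg /eps.
    by case: b; case: ifP => _; solve [by exists 0|by exists (-1)].
  - by exists (-1); rewrite /lvec leaf_vec_interior // (deg_interior hu).
have [X hX] := plumb_onto hp hcop star (fun v => z v - y' v).
exists (\col_i X (enum_val i)); rewrite plumbing_mxE ya; apply/colP => i.
rewrite /lcol !mxE hz hX /y' enum_valK /vdeg !mulr2n; set A := #|_|; ring.
Qed.

Let form b S r : - inv_form R M (lcol b S r) =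
  (expo p S r)%:~R ^+ 2 / P%:R + \sum_j ((h j)%:R - P%:R / (p j)%:R ^+ 2).
Proof.
have P0 : P%:R != 0 :> R by rewrite pnatr_eq0 -lt0n (Pprod_gt0 hp).
have pn j : (p j)%:R != 0 :> R by rewrite pnatr_eq0 -lt0n.
have pV j : (P %/ p j)%:R = P%:R / (p j)%:R :> R.
  by apply/(mulIf (pn j)); rewrite divfK // -natrM mulnC Pprod_div.
rewrite /lcol /lvec (leaf_inv_form hp hcop); last first.
  by move=> j; rewrite /sg /eps; case: b; case: ifP.
congr (_ + _).
have -> : (expo p S r)%:~R = P%:R * ((d.+1 + 2 * r)%:R + \sum_j (eps S j)%:~R / (p j)%:R) :> R.
  rewrite /expo /m_zero /shift !rmorphD /= rmorphN rmorph_sum rmorphM /= -!pmulrn.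
  rewrite natrD natr_sum.
  rewrite [\sum_(j in S) _]big_mkcond /= mulrDr mulr_sumr.
  have -> : \sum_j P%:R * ((eps S j)%:~R / (p j)%:R) =
     \sum_j (if j \in S then (2 * (P %/ p j))%:R else 0) - \sum_j (P %/ p j)%:R :> R.
    rewrite -sumrB; apply: eq_bigr => j _; rewrite /eps; case: ifP => _; rewrite ?natrM pV.
      by field.
    by rewrite rmorphN1; field.
  have -> : (n%:Z - 2)%:~R = d.+1%:R :> R by rewrite nd3 (_ : d.+3%:Z - 2 = d.+1%:Z) //; lia.
  under [\sum_i (_)%:~R]eq_bigr do rewrite -pmulrn.
  by rewrite !natrD !natrM; ring.
have -> : (sg b * (d.+1 + 2 * r)%N)%:~R + \sum_j (sg b * eps S j)%:~R / (p j)%:R =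
   (sg b)%:~R * ((d.+1 + 2 * r)%:R + \sum_j (eps S j)%:~R / (p j)%:R) :> R.
  rewrite rmorphM mulrDr mulr_sumr; congr (_ + _); apply: eq_bigr => j _.
  by rewrite rmorphM mulrA.
have sg2 : (sg b)%:~R * (sg b)%:~R = 1 :> R by rewrite -rmorphM /sg; case: (b).
by rewrite exprMn expr2 sg2 mul1r; field.
Qed.

Let hsum : R := (\sum_j ((h j)%:R - P%:R / (p j)%:R ^+ 2)) / 4.

Let f (l : 'cV[int]_#|V|) : C := theta_coef M a tau l * \prod_v vertex_coef e (vdeg v) (l v ord0).

Let f_lcol b S r : f (lcol b S r) =
  2^-1 * (((-1) ^+ #|S| * (nbin d r)%:R) * qpow tau ((expo p S r)%:~R ^+ 2 / (4 * P%:R))) * qpow tau hsum.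
Proof.
have P0 : P%:R != 0 :> R by rewrite pnatr_eq0 -lt0n (Pprod_gt0 hp).
rewrite /f vertex_product /theta_coef /patch mem_set; last exact: label.
rewrite form.
have -> : ((expo p S r)%:~R ^+ 2 / P%:R + \sum_j ((h j)%:R - P%:R / (p j)%:R ^+ 2)) / 4 =
   (expo p S r)%:~R ^+ 2 / (4 * P%:R) + hsum by rewrite /hsum; field.
by rewrite qpowD; ring.
Qed.

Let codes K := enum {: bool * {set 'I_n} * 'I_K}.
Let lseq K := map (fun x : bool * {set 'I_n} * 'I_K => lcol x.1.1 x.1.2 x.2) (codes K).

Let lseq_uniq K : uniq (lseq K).
Proof.
rewrite map_inj_uniq ?enum_uniq // => -[[b S] r] [[b' S'] r'] /= /lcol_inj[-> -> rr].
by congr (_, _); exact/val_inj.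
Qed.

Let partial_value K : \sum_(l <- [fset l in lseq K]%fset) f l =
  (\sum_(S : {set 'I_n}) \sum_(0 <= r < K) ((-1) ^+ #|S| * (nbin d r)%:R) * qpow tau ((expo p S r)%:~R ^+ 2 / (4 * P%:R)))
  * qpow tau hsum.
Proof.
have -> : \sum_(l <- [fset l in lseq K]%fset) f l = \sum_(l <- lseq K) f l.
  by apply: perm_big; apply: uniq_perm; rewrite ?fset_uniq // => i; rewrite !inE.
rewrite /lseq big_map /codes big_enum /=.
rewrite (eq_bigr (fun x : bool * {set 'I_n} * 'I_K => (fun (y : bool * {set 'I_n}) (z : 'I_K) => f (lcol y.1 y.2 z)) x.1 x.2)) //.
rewrite -(pair_bigA _ (fun (y : bool * {set 'I_n}) (z : 'I_K) => f (lcol y.1 y.2 z))) /=.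
rewrite -(pair_bigA _ (fun (b : bool) (S : {set 'I_n}) => \sum_(z < K) f (lcol b S z))) /=.
rewrite big_bool /= -big_split mulr_suml; apply: eq_bigr => S _ /=.
rewrite big_mkord -big_split mulr_suml; apply: eq_bigr => r _ /=.
by rewrite !f_lcol; field.
Qed.

Let ndM : negative_definite (map_mx intr M : 'M[R]_#|V|).
Proof. by case: star. Qed.

(** The two halves of the central expansion give the same contribution, as the
    sign change of all coordinates preserves the form, and the signs of the halves
    agree with those of the leaves. Completing the square makes each exponent
    [m ^ 2 / (4 P)] up to a constant, which the prefactor with the signature and
    the trace combines to the opposite of [Delta]. *)
Lemma Zhat_value :
  (fun K => \sum_(S : {set 'I_n}) \sum_(0 <= r < K)
     ((-1) ^+ #|S| * (nbin d r)%:R) * qpow tau ((expo p S r)%:~R ^+ 2 / (4 * P%:R))) @ \oo -->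
  (qpow tau (Delta R p p0 k) * Zhat_at M (@vdeg n k) a tau e : C^o).
Proof.
have V0 : (0 < #|V|)%N by apply/card_gt0P; exists None.
have [[B hB] E] := torus_integral_theta (@vdeg n k) a V0 (plumbing_mx_sym p0 k) ndM tau0 he.
have [pos neg] : pos_eigenvalues (map_mx intr M : 'M[R]_#|V|) = 0%N /\ neg_eigenvalues (map_mx intr M : 'M[R]_#|V|) = #|V|.
  apply: negdef_eigenvalues ndM; apply/matrixP => i j.
  by rewrite [LHS]mxE [LHS]mxE [RHS]mxE -{1}(plumbing_mx_sym p0 k) [in LHS]mxE.
have lim : (fun K => \sum_(l <- [fset l in lseq K]%fset) f l) @ \oo --> (usum f : C^o).
  apply: sum_exhaust (usum_cvg hB) _ => l; rewrite /f mulf_eq0 negb_or => /andP[_ /support[b [S [r ->]]]].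
  exists r.+1 => K rK; rewrite !inE /lseq; apply/mapP; exists (b, S, Ordinal rK) => //.
  by rewrite mem_enum.
rewrite /Zhat_at E -/f /signature pos neg expr0 mul1r.
set pre := qpow tau (_ / 4).
have cancel : qpow tau hsum * (qpow tau (Delta R p p0 k) * pre) = 1.
  rewrite /pre -!qpowD; have -> : forall x : R, x = 0 -> qpow tau x = 1.
    by move=> x ->; rewrite /qpow mulr0 mul0r cexp0.
  by [].
  have -> : \sum_v M v v = p0 - \sum_j \sum_(x <- k j) x.
    transitivity (\sum_(v < #|V|) weight p0 (enum_val v)); first by apply: eq_bigr => v _; rewrite mxE eqxx.
    rewrite sum_enum_val sum_vertex -sumrN; congr (_ + _); apply: eq_bigr => j _.
    by rewrite (big_nth 0) big_mkord -sumrN.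
  rewrite /Delta /hsum big_split /= !rmorphB /= rmorphM rmorphB /= rmorph_sum /=.
  rewrite big_split /= !sumrN.
  have -> : (#|V|%:Z)%:~R = #|V|%:R :> R by [].
  by field.
have E2 : (fun K => (\sum_(l <- [fset l in lseq K]%fset) f l) * (qpow tau (Delta R p p0 k) * pre)) =
  (fun K => \sum_(S : {set 'I_n}) \sum_(0 <= r < K)
     ((-1) ^+ #|S| * (nbin d r)%:R) * qpow tau ((expo p S r)%:~R ^+ 2 / (4 * P%:R))).
  by apply/funext => K; rewrite partial_value -mulrA cancel mulr1.
rewrite -E2.
have -> : qpow tau (Delta R p p0 k) * (pre * usum f) = usum f * (qpow tau (Delta R p p0 k) * pre) by ring.
by apply: cvgcM; [exact: lim|exact: cvgc_cst].
Qed.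

End ZhatValue.

(** * The coefficients of the expansion of G *)

Section SparseSeries.
Variable R : realType.
Local Notation C := R[i].
Variables (T : finType) (c : T -> int) (s : T -> nat) (D d : nat).
Hypothesis D0 : (0 < D)%N.

(** The coefficient of [x ^ r] in the sum of the series
    [c t * x ^ (s t) * (1 - x ^ D) ^ - d.+1]. *)
Definition sparse_coef (r : nat) : int :=
  \sum_t \sum_(0 <= k < r.+1) c t * (nbin d k)%:Z * (s t + D * k == r)%:R.

Variables (w : nat -> C) (A x : R).
Hypothesis A0 : 0 <= A.
Hypothesis x01 : 0 <= x < 1.
Hypothesis w_bound : forall r, normc (w r) <= A * x ^+ r.

Let f (y : T * nat) : C := (c y.1)%:~R * (nbin d y.2)%:R * w (s y.1 + D * y.2).
Let pairs K := [seq (t, k) | t <- enum T, k <- iota 0 K].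

Let pairsP K y : (y \in pairs K) = (y.2 < K)%N.
Proof.
apply/allpairsP/idP => [[z [_ /= hz ->]]|h /=]; first by rewrite mem_iota in hz.
by exists y; rewrite mem_enum mem_iota; case: y h.
Qed.

Let pairs_uniq K : uniq (pairs K).
Proof. by apply: allpairs_uniq; rewrite ?enum_uniq ?iota_uniq // => -[? ?] [? ?]. Qed.

Let sum_pairs (V : nmodType) (P : pred (T * nat)) (g : T * nat -> V) K :
  \sum_(y <- [fset y in [seq y <- pairs K | P y]]%fset) g y =
  \sum_t \sum_(0 <= k < K) (if P (t, k) then g (t, k) else 0).
Proof.
transitivity (\sum_(y <- [seq y <- pairs K | P y]) g y).
  by apply: perm_big; apply: uniq_perm; rewrite ?fset_uniq ?filter_uniq // => i; rewrite !inE.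
rewrite big_filter big_mkcond big_allpairs /= big_enum; apply: eq_bigr => t _.
by rewrite /index_iota subn0.
Qed.

Let le_index t k : (k <= s t + D * k)%N.
Proof. by apply: leq_trans (leq_addl _ _); rewrite leq_pmull. Qed.

Let f_bound (F : {fset T * nat}) : \sum_(y <- F) normc (f y) <=
  \sum_t normc ((c t)%:~R : C) * (A * ((1 - x) ^+ d.+1)^-1).
Proof.
have [K hK] := fset_nat_bounded [fset y.2 | y in F]%fset.
have /andP[x0 x1] := x01.
apply: (@le_trans _ _ (\sum_(y <- [fset y in [seq y <- pairs K | predT y]]%fset) normc (f y))).
  apply: sum_fset_le => [y|]; first exact: normc_ge0.
  apply/fsubsetP => y yF; rewrite !inE filter_predT pairsP; apply: hK.
  by apply/imfsetP; exists y.
rewrite sum_pairs; apply: ler_sum => t _ /=.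
apply: (@le_trans _ _ (\sum_(0 <= k < K) normc ((c t)%:~R : C) * (A * ((nbin d k)%:R * x ^+ k)))).
  apply: ler_sum => k _; rewrite /f /= !normcM -mulrA ler_wpM2l ?normc_ge0 //.
  rewrite mulrCA -(rmorph_nat (real_complex R)) normc_real ger0_norm ?ler0n // ler_wpM2l //.
  apply: le_trans (w_bound _) _; rewrite ler_wpM2l //; by apply: ler_wiXn2l => //; exact: ltW.
by rewrite -!mulr_sumr ler_wpM2l ?normc_ge0 // ler_wpM2l // nbin_bound.
Qed.

(** The family is absolutely summable by the geometric bound on [w], so it may be
    summed by value of the exponent. *)
Lemma sparse_series (L : C) :
  (fun K => \sum_t \sum_(0 <= k < K) (c t)%:~R * (nbin d k)%:R * w (s t + D * k)) @ \oo --> (L : C^o) ->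
  series ((fun r => (sparse_coef r)%:~R * w r) : nat -> C^o) @ \oo --> (L : C^o).
Proof.
move=> hL; have hs := usum_cvg f_bound.
have h1 : (fun K => \sum_(y <- [fset y in [seq y <- pairs K | predT y]]%fset) f y) @ \oo --> (usum f : C^o).
  apply: sum_exhaust hs _ => y _; exists y.2.+1 => K yK.
  by rewrite !inE filter_predT pairsP.
have h2 : (fun K => \sum_(y <- [fset y in [seq y <- pairs K | (s y.1 + D * y.2 < K)%N]]%fset) f y) @ \oo --> (usum f : C^o).
  apply: sum_exhaust hs _ => y _; exists (s y.1 + D * y.2).+1 => K yK.
  rewrite !inE mem_filter pairsP yK /=; by apply: leq_trans yK; rewrite ltnS.
have -> : L = usum f.
  apply: cvgc_unique hL _.
  have E : (fun K => \sum_(y <- [fset y in [seq y <- pairs K | predT y]]%fset) f y) =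
    (fun K => \sum_t \sum_(0 <= k < K) (c t)%:~R * (nbin d k)%:R * w (s t + D * k)).
    by apply/funext => K; rewrite sum_pairs.
  by rewrite -E.
have E : (series ((fun r => (sparse_coef r)%:~R * w r) : nat -> C^o) : nat -> C) =
    (fun K => \sum_(y <- [fset y in [seq y <- pairs K | (s y.1 + D * y.2 < K)%N]]%fset) f y).
  apply/funext => K; rewrite /series /= sum_pairs.
  transitivity (\sum_(0 <= r < K) \sum_t \sum_(0 <= k < K)
     (if r == s t + D * k then (c t)%:~R * (nbin d k)%:R * w r else 0) : C).
    apply: eq_big_nat => r /andP[_ rK]; rewrite /sparse_coef rmorph_sum mulr_suml; apply: eq_bigr => t _.
    rewrite [RHS](big_cat_nat (leq0n r.+1) rK) /= [X in _ = _ + X]big_nat_cond [X in _ = _ + X]big1 ?addr0.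
      rewrite rmorph_sum mulr_suml; apply: eq_bigr => k _; rewrite eq_sym; case: eqP => _.
        by rewrite mulr1 rmorphM.
      by rewrite mulr0 rmorph0 mul0r.
    move=> k /andP[/andP[rk _] _]; case: eqP => // e; exfalso.
    by have := leq_pmull k D0; move: rk e; lia.
  rewrite exchange_big; apply: eq_bigr => t _ /=; rewrite exchange_big; apply: eq_bigr => k _ /=.
  by rewrite -big_mkcond (big_nat1_eq _ (fun r => (c t)%:~R * (nbin d k)%:R * w r)).
by move: h2; rewrite -E.
Qed.

End SparseSeries.

Section PowerSeries.
Variable R : realType.
Local Notation C := R[i].

Lemma geometric_tail (y : R) K N : 0 <= y <= 2^-1 -> \sum_(K <= k < N) y ^+ k <= 2 * y ^+ K.
Proof.
move=> /andP[y0 y1]; rewrite -{1}(add0n K) big_addn.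
have -> : \sum_(0 <= i < N - K) y ^+ (i + K) = y ^+ K * \sum_(0 <= i < N - K) (nbin 0 i)%:R * y ^+ i.
  by rewrite mulr_sumr; apply: eq_bigr => i _; rewrite /nbin bin0 mul1r exprD mulrC.
rewrite mulrC ler_wpM2r ?exprn_ge0 //.
have h : 0 <= y < 1 by rewrite y0; lra.
apply: le_trans (nbin_bound 0 _ h) _; rewrite expr1 -[leRHS]invrK lef_pV2 ?posrE ?invr_gt0 //; lra.
Qed.

(** Near 0 the lowest nonzero term would dominate the rest of the series. *)
Lemma power_series_zero (c : nat -> C) :
  (forall x : R, 0 < x < 1 -> series ((fun r => c r * x%:C ^+ r) : nat -> C^o) @ \oo --> (0 : C^o)) ->
  forall r, c r = 0.
Proof.
move=> hc; elim/ltn_ind => r ih; apply/eqP/negP => /negP c0.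
have h2 : 0 < (2^-1 : R) < 1 by apply/andP; split; lra.
have [M M0 hM] : exists2 M, 0 < M & forall k, normc (c k) <= M * 2 ^+ k.
  have /cvgc_normP /(_ 1 ltr01) [K _ hK] := series_term0 (hc _ h2).
  exists (1 + \sum_(0 <= k < K) normc (c k)).
    by rewrite ltr_pwDl // sumr_ge0 // => k _; exact: normc_ge0.
  move=> k; have [Kk|kK] := leqP K k.
    have : normc (c k * (2^-1)%:C ^+ k - (0 : C)) < 1 by exact: hK.
    rewrite subr0 normcM normcX normc_real ger0_norm ?invr_ge0 // exprVn => h.
    have {}h : normc (c k) <= 2 ^+ k by rewrite -[leRHS]mul1r -ler_pdivrMr ?exprn_gt0 // ltW.
    apply: le_trans h _; rewrite ler_peMl ?exprn_ge0 // lerDl sumr_ge0 // => i _; exact: normc_ge0.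
  have t1 : normc (c k) <= \sum_(0 <= i < K) normc (c i).
    rewrite big_mkord (bigD1 (Ordinal kK)) //= lerDl sumr_ge0 // => i _; exact: normc_ge0.
  apply: (@le_trans _ _ (1 + \sum_(0 <= i < K) normc (c i))); first by lra.
  rewrite ler_peMr ?exprn_ege1 //; last lra.
  by rewrite addr_ge0 // sumr_ge0 // => i _; exact: normc_ge0.
pose e := normc (c r); have e0 : 0 < e by rewrite /e normc_gt0.
pose B := M * 2 ^+ r.+2; have B0 : 0 < B by rewrite mulr_gt0 // exprn_gt0.
pose x := e / (2 * B + 4 * e).
have den : 0 < 2 * B + 4 * e by lra.
have x0 : 0 < x by rewrite divr_gt0.
have xB : x * (2 * B) < e by rewrite /x mulrAC ltr_pdivrMr // ltr_pM2l //; lra.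
have x4 : x <= 4^-1 by rewrite /x ler_pdivrMr //; lra.
have hx : 0 < x < 1 by rewrite x0; lra.
clearbody x.
have fb k : normc (c k * x%:C ^+ k) <= M * (2 * x) ^+ k.
  rewrite normcM normcX normc_real (ger0_norm (ltW x0)) exprMn mulrA ler_wpM2r ?hM // exprn_ge0 // ltW //.
have tail N : (r.+1 <= N)%N -> \sum_(r.+1 <= k < N) M * (2 * x) ^+ k <= M * (2 * (2 * x) ^+ r.+1).
  move=> _; rewrite -mulr_sumr ler_wpM2l ?(ltW M0) // geometric_tail //; apply/andP; split; lra.
have : normc ((0 : C) - \sum_(0 <= k < r.+1) c k * x%:C ^+ k) <= M * (2 * (2 * x) ^+ r.+1).
  exact: normc_sum_tail fb tail (hc _ hx).
rewrite sub0r normcN big_nat_recr //= big_nat_cond big1 ?add0r; last first.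
  by move=> k /andP[/andP[_ kr] _]; rewrite ih // mul0r.
rewrite normcM normcX normc_real (ger0_norm (ltW x0)) -/e.
have -> : M * (2 * (2 * x) ^+ r.+1) = x * B * x ^+ r by rewrite /B exprMn !exprS; ring.
rewrite ler_pM2r ?exprn_gt0 //; nra.
Qed.

End PowerSeries.

Section Coefficients.
Variables (R : realType) (n : nat) (p : 'I_n -> nat).
Local Notation C := R[i].
Hypothesis hp : forall j, (0 < p j)%N.
Variable d : nat.
Hypothesis nd3 : n = d.+3.
Local Notation P := (Pprod p).

(** The numerator of [G] is multiplied out into one term for each subset of
    indices; the denominator is a power of [1 - z ^ (2 P)] up to a monomial. *)
Definition chi_coef (r : nat) : int :=
  sparse_coef (fun S : {set 'I_n} => (-1) ^+ #|S|) (shift p) (2 * P) d r.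

Definition chi (m : int) : int := chi_coef `|m - m_zero p|%N.

Lemma chiE r : chi (m_zero p + r%:Z) = chi_coef r.
Proof. by rewrite /chi (addrC (m_zero p)) addrK. Qed.

Lemma P2_gt0 : (0 < 2 * P)%N.
Proof. by rewrite muln_gt0 /= (Pprod_gt0 hp). Qed.

Lemma m_zeroE : (m_zero p)%:~R = P%:R * (n%:R - 2 - \sum_j (p j)%:R^-1) :> rat.
Proof.
rewrite /m_zero rmorphB rmorphM rmorphB rmorph_sum /= [RHS]mulrBr mulr_sumr; congr (_ - _).
apply: eq_bigr => j _; apply: (@mulIf _ (p j)%:R); first by rewrite pnatr_eq0 -lt0n.
by rewrite mulfVK ?pnatr_eq0 -?lt0n // -pmulrn -natrM mulnC Pprod_div.
Qed.

Lemma Gfun_expand (z : C) : z != 0 -> z ^+ (2 * P) != 1 ->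
  Gfun p z = z ^ m_zero p * (\prod_j (1 - z ^+ (2 * (P %/ p j)))) * ((1 - z ^+ (2 * P)) ^+ d.+1)^-1.
Proof.
move=> z0 z1; rewrite /Gfun.
have E a : z ^ a%:Z - z ^ (- a%:Z) = - (z ^ (- a%:Z)) * (1 - z ^+ (2 * a)).
  rewrite mulrBr mulr1 mulNr opprK addrC; congr (_ + _).
  by rewrite exprnP -expfzDr // PoszM; congr (_ ^ _); lia.
rewrite (eq_bigr (fun j => - (z ^ (- (P %/ p j)%:Z)) * (1 - z ^+ (2 * (P %/ p j))))) => [|j _]; last exact: E.
rewrite E big_split /=.
have -> : 2 - n%:Z = - d.+1%:Z by rewrite nd3; lia.
rewrite -exprnN exprMn invfM.
have -> : \prod_(i < n) - z ^ (- (P %/ p i)%:Z) = (-1) ^+ n * z ^ (- \sum_j (P %/ p j)%:Z).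
  rewrite (eq_bigr (fun i => -1 * z ^ (- (P %/ p i)%:Z))) => [|i _]; last by rewrite mulN1r.
  rewrite big_split /= prodr_const card_ord; congr (_ * _).
  by apply/esym; rewrite -sumrN; apply: (big_morph (fun a => z ^ a)) => // a b; rewrite expfzDr.
have -> : ((- z ^ (- P%:Z)) ^+ d.+1)^-1 = (-1) ^+ n * z ^ (P%:Z * (n%:Z - 2)).
  have -> : (-1) ^+ n = (-1) ^+ d.+1 :> C by rewrite nd3 !exprS; ring.
  have -> : n%:Z - 2 = d.+1%:Z by rewrite nd3; lia.
  rewrite [in LHS]exprNn invfM -exprVn invrN1 -!exprnN exprVn -exprM; congr (_ * _).
  by rewrite -PoszM -exprnP invrK.
rewrite /m_zero expfzDr //.
have s1 : (-1) ^+ n * (-1) ^+ n = 1 :> C by rewrite -exprMn mulrNN mulr1 expr1n.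
set u := (-1) ^+ n in s1 *; set A := z ^ _; set B := z ^ _; set X := \prod_j _; set Y := _^-1.
by transitivity ((u * u) * (B * A * X * Y)); [ring|rewrite s1; ring].
Qed.

Lemma prod_one_sub (z : C) : \prod_j (1 - z ^+ (2 * (P %/ p j))) =
  \sum_(S : {set 'I_n}) (-1) ^+ #|S| * z ^+ shift p S.
Proof.
rewrite (eq_bigr (fun j => - z ^+ (2 * (P %/ p j)) + 1)) => [|j _]; last by rewrite addrC.
rewrite bigA_distr; apply: eq_bigr => S _.
rewrite -big_mkcond /= /shift -prodrXr.
by rewrite (eq_bigr (fun j => -1 * z ^+ (2 * (P %/ p j)))) ?big_split ?prodr_const // => j _; rewrite mulN1r.
Qed.

Lemma chi_G_coefficients : G_coefficients R p (m_zero p) chi.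
Proof.
move=> z; rewrite normcE' => /andP[z0 z1].
have n0 : 0 < normc z by rewrite -ltcR; exact: z0.
have n1 : normc z < 1 by rewrite -ltcR; exact: z1.
have zn0 : z != 0 by rewrite -normc_gt0.
have nP : normc (z ^+ (2 * P)) < 1 by rewrite normcX exprn_ilt1 ?normc_ge0 // -lt0n P2_gt0.
have zP : z ^+ (2 * P) != 1 by apply/eqP => h; move: nP; rewrite h normc1 ltxx.
have E : (fun r : nat => (chi (m_zero p + r%:Z))%:~R * z ^ (m_zero p + r%:Z) : C) =
   (fun r => (chi_coef r)%:~R * z ^ (m_zero p + r%:Z)).
  by apply/funext => r; rewrite chiE.
rewrite E; apply: (@sparse_series R _ _ _ _ d P2_gt0 _ (normc z ^ m_zero p) (normc z)).
- by rewrite exprz_ge0 // normc_ge0.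
- by rewrite normc_ge0.
- by move=> r; rewrite normcXz expfzDr ?gt_eqF.
rewrite Gfun_expand // prod_one_sub mulr_sumr mulr_suml.
apply: (@cvgc_sum R _ \oo _ _ (index_enum _) xpredT (fun S : {set 'I_n} => fun K => \sum_(0 <= k < K)
   ((-1) ^+ #|S|)%:~R * (nbin d k)%:R * z ^ (m_zero p + (shift p S + 2 * P * k)%N%:Z))
   (fun S => z ^ m_zero p * ((-1) ^+ #|S| * z ^+ shift p S) * ((1 - z ^+ (2 * P)) ^+ d.+1)^-1)) => S _.
have -> : (fun K => \sum_(0 <= k < K)
   ((-1) ^+ #|S|)%:~R * (nbin d k)%:R * z ^ (m_zero p + (shift p S + 2 * P * k)%N%:Z)) =
  (fun K => z ^ m_zero p * ((-1) ^+ #|S| * z ^+ shift p S) * \sum_(0 <= k < K) (nbin d k)%:R * (z ^+ (2 * P)) ^+ k).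
  apply/funext => K; rewrite mulr_sumr; apply: eq_bigr => k _.
  rewrite expfzDr // -exprnP exprD exprM rmorphXn rmorphN1; ring.
by apply: cvgcM; [exact: cvgc_cst|exact: nbin_series].
Qed.

Lemma G_coefficients_unique (chi1 chi2 : int -> int) (m0 : int) :
  G_coefficients R p m0 chi1 -> G_coefficients R p m0 chi2 ->
  forall m, m0 <= m -> chi1 m = chi2 m.
Proof.
clear nd3 d; move=> h1 h2 m mm; have -> : m = m0 + `|m - m0|%N%:Z by lia.
suff H r : ((chi1 (m0 + r%:Z) - chi2 (m0 + r%:Z))%:~R : C) = 0.
  by have /eqP := H `|m - m0|%N; rewrite intr_eq0 subr_eq0 => /eqP.
apply: (@power_series_zero R (fun r : nat => (chi1 (m0 + r%:Z) - chi2 (m0 + r%:Z))%:~R)) => x /andP[x0 x1].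
have xC0 : x%:C != 0 :> C by rewrite -normc_gt0 normc_real normr_gt0 gt_eqF.
have hx : 0 < `|x%:C : C| < 1.
  by rewrite normcE' normc_real (gtr0_norm x0); apply/andP; split; [have := x0|have := x1]; rewrite -ltcR.
have g1 := h1 _ hx; have g2 := h2 _ hx.
have L : (fun K => (x%:C ^ (- m0) : C) * ((\sum_(0 <= r < K) (chi1 (m0 + r%:Z))%:~R * x%:C ^ (m0 + r%:Z)) -
    (\sum_(0 <= r < K) (chi2 (m0 + r%:Z))%:~R * x%:C ^ (m0 + r%:Z)))) @ \oo -->
    ((x%:C ^ (- m0) : C) * (Gfun p x%:C - Gfun p x%:C) : C^o).
  by apply: cvgcM; [exact: cvgc_cst|apply: cvgcB; [exact: g1|exact: g2]].
rewrite subrr mulr0 in L.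
have E : (series ((fun r => (chi1 (m0 + r%:Z) - chi2 (m0 + r%:Z))%:~R * (x%:C : C) ^+ r) : nat -> C^o) : nat -> C) =
  (fun K => (x%:C ^ (- m0) : C) * ((\sum_(0 <= r < K) (chi1 (m0 + r%:Z))%:~R * x%:C ^ (m0 + r%:Z)) -
    (\sum_(0 <= r < K) (chi2 (m0 + r%:Z))%:~R * x%:C ^ (m0 + r%:Z)))).
  apply/funext => K; rewrite /series /= -sumrB mulr_sumr; apply: eq_bigr => s _.
  rewrite -mulrBl -rmorphB mulrCA -expfzDr //; congr (_ * _).
  by rewrite exprnP; congr (_ ^ _); lia.
by move: L; rewrite -E.
Qed.

(** The real part of the exponent is quadratic in [r], with negative leading
    coefficient; a linear bound is enough. *)
Lemma qpow_sq_bound (tau : C) (m : int) : 0 < complex.Im tau ->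
  exists A x : R, [/\ 0 <= A, 0 <= x < 1 & forall r : nat,
    normc (qpow tau ((m + r%:Z)%:~R ^+ 2 / (4 * P%:R))) <= A * x ^+ r].
Proof.
move=> t0; pose kappa := pi * complex.Im tau / (2 * P%:R).
have P0 : 0 < P%:R :> R by rewrite ltr0n (Pprod_gt0 hp).
have k0 : 0 < kappa by rewrite divr_gt0 ?mulr_gt0 ?pi_gt0.
exists (expR (kappa - 2 * kappa * m%:~R)), (expR (- (2 * kappa))); split.
- exact: expR_ge0.
- by rewrite expR_ge0 /= -[X in _ < X]expR0 ltr_expR; lra.
move=> r; rewrite normc_qpow -expRM_natl -expRD ler_expR.
have -> : 2 * pi * ((m + r%:Z)%:~R ^+ 2 / (4 * P%:R)) * complex.Im tau = kappa * (m + r%:Z)%:~R ^+ 2.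
  by rewrite /kappa; field; rewrite gt_eqF.
rewrite rmorphD /= -pmulrn; set a := m%:~R; set b := r%:R.
have := sqr_ge0 (a + b - 1); nra.
Qed.

End Coefficients.

(** * The Borel transform near the origin *)

Section ExponentialSeries.
Variable R : realType.
Local Notation C := R[i].
Local Notation leb := (@lebesgue_measure R).

(** A primitive in [t] of the integral remainder of the Taylor formula. *)
Definition taylor_path (v : C) (n : nat) (t : R) : C :=
  cexp (t%:C * v) * \sum_(0 <= k < n.+1) ((1 - t) ^+ k)%:C * (v ^+ k / k`!%:R).

Lemma cder_cexp_line v t : cder (fun t : R => cexp (t%:C * v)) t (v * cexp (t%:C * v)).
Proof.
apply: cder_cexp; by apply: cder_eq (cderM (cder_id t) (cder_cst v t)) _; rewrite mulr0 add0r mulr1.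
Qed.

Lemma cder_one_sub_pow k t :
  cder (fun t : R => ((1 - t) ^+ k)%:C : C) t (((- 1) * (k%:R * (1 - t) ^+ k.-1))%:C).
Proof.
apply: cder_real; have h : rder (fun t : R => 1 - t) t (- 1).
  by apply: rder_eq; [apply: rderD; [exact: rder_cst|apply: rderN; exact: rder_id]|rewrite add0r].
  elim: k => [|k ih]; first by apply: rder_eq; [exact: rder_cst|rewrite mul0r mulr0].
  have := rderM h ih; rewrite (_ : (fun x => _) = (fun t : R => (1 - t) ^+ k.+1)); last by apply/funext => x; rewrite exprS.
  move=> H; apply: rder_eq H _.
  by case: k {ih} => [|k] /=; rewrite ?expr0 ?exprS -?natr1; ring.
Qed.

Lemma cder_taylor_path v n t :
  cder (taylor_path v n) t (cexp (t%:C * v) * (((1 - t) ^+ n)%:C * (v ^+ n.+1 / n`!%:R))).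
Proof.
elim: n => [|n ih].
  have -> : taylor_path v 0 = (fun t : R => cexp (t%:C * v)).
    by apply/funext => x; rewrite /taylor_path big_nat1 !expr0 fact0 invr1 !mulr1.
  by apply: cder_eq (cder_cexp_line v t) _; rewrite expr0 expr1 fact0 invr1; ring.
have -> : taylor_path v n.+1 = (fun t : R => taylor_path v n t + cexp (t%:C * v) * (((1 - t) ^+ n.+1)%:C * (v ^+ n.+1 / n.+1`!%:R))).
  by apply/funext => x; rewrite /taylor_path big_nat_recr //= mulrDr.
have dT := cderM (cder_cexp_line v t) (cderM (cder_one_sub_pow n.+1 t) (cder_cst (v ^+ n.+1 / n.+1`!%:R) t)).
apply: cder_eq (cderD ih dT) _ => /=.
have f0 : n`!%:R != 0 :> C by rewrite pnatr_eq0 -lt0n fact_gt0.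
have n0 : n.+1%:R != 0 :> C by rewrite pnatr_eq0.
rewrite factS natrM rmorphM rmorphN1 rmorphM rmorph_nat; set a := cexp _; set b := ((1 - t) ^+ n)%:C; set c := ((1 - t) ^+ n.+1)%:C.
rewrite [v ^+ n.+2]exprS; set w := v ^+ n.+1; field; exact/andP.
Qed.

Lemma taylor_remainder v n : normc (cexp v - \sum_(0 <= k < n.+1) v ^+ k / k`!%:R) <=
  2 * expR (normc v : R) * (normc v ^+ n.+1 / n`!%:R).
Proof.
pose f (t : R) : C := cexp (t%:C * v) * (((1 - t) ^+ n)%:C * (v ^+ n.+1 / n`!%:R)).
have cf (t : R) : f x @[x --> t] --> (f t : C^o).
  exact: cder_continuous (cderM (cder_cexp_line v t) (cderM (cder_one_sub_pow n t) (cder_cst _ t))).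
have <- : cintegral `[0, 1] f = cexp v - \sum_(0 <= k < n.+1) v ^+ k / k`!%:R.
  rewrite (@cint_FTC R (taylor_path v n) f 0 1 ltr01) => [|t _|t _]; [|exact: cder_taylor_path|exact: cf].
  rewrite /taylor_path mul1r mul0r cexp0 mul1r big_nat_recl // subrr expr0 mul1r.
  rewrite big1_seq ?addr0 => [|k _]; last by rewrite expr0n mul0r.
  by rewrite fact0 expr0 invr1 mulr1 mulr1; congr (_ - _); apply: eq_bigr => k _; rewrite subr0 expr1n mul1r.
have mI : measurable (`[0, 1]%classic : set R) by exact: measurable_itv.
have mf : cmeas `[0, 1] f.
  by apply: (@cmeasS _ _ setT) => //; apply: cmeas_continuous => //; exact: openT.
pose B := expR (normc v : R) * (normc v ^+ n.+1 / n`!%:R).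
have Iv : \int[leb]_(t in `[0, 1]) B = B.
  by rewrite Rintegral_cst //= lebesgue_measure_itv /= lte_fin ltr01 /= oppr0 addr0 mulr1.
have := @normc_cintegral_le R `[0, 1] f (fun=> B) mI mf (integrable_cst01 _).
rewrite Iv => H; rewrite -[leRHS]mulrA; apply: H => t; rewrite set_itvcc => /andP[t0 t1].
have f0 : 0 < n`!%:R :> R by rewrite ltr0n fact_gt0.
rewrite /f normcM normc_cexp normcM normc_real normcM normcX normcV.
have -> : normc (n`!%:R : C) = n`!%:R by rewrite -(rmorph_nat (real_complex R)) normc_real ger0_norm ?ler0n.
have h1 : expR (complex.Re (t%:C * v)) <= expR (normc v : R).
  rewrite ler_expR; apply: le_trans (ler_norm _) _; apply: le_trans (normc_ge_Re _) _.
  by rewrite normcM normc_real (ger0_norm t0) ler_piMl ?normc_ge0.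
apply: ler_pM; [exact: expR_ge0| |exact: h1|].
  by rewrite mulr_ge0 // mulr_ge0 // ?invr_ge0 ?(ltW f0) ?exprn_ge0 ?normc_ge0.
rewrite -[leRHS]mul1r ler_wpM2r ?mulr_ge0 ?invr_ge0 ?(ltW f0) ?exprn_ge0 ?normc_ge0 //.
by rewrite normrX ger0_norm ?exprn_ile1 ?subr_ge0 // gerBl.
Qed.

Lemma cexp_series (v : C) : series ((fun k => v ^+ k / k`!%:R) : nat -> C^o) @ \oo --> (cexp v : C^o).
Proof.
have : (fun n => series ((fun k => v ^+ k / k`!%:R) : nat -> C^o) n.+1) @ \oo --> (cexp v : C^o).
  apply/cvgc_normP => e e0.
  pose c := 2 * expR (normc v : R) * normc v.
  have hc : (fun n => c * exp_coeff (normc v : R) n) @ \oo --> (0 : R).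
    rewrite -[0](mulr0 c); apply: cvgM; first exact: cvg_cst.
    exact: cvg_series_cvg_0 (is_cvg_series_exp_coeff (normc v : R)).
  have /cvgrPdist_lt /(_ e e0) := hc; apply: filterS => n /=; rewrite sub0r normrN => h.
  rewrite -normcN opprB; apply: le_lt_trans (taylor_remainder v n) _.
  apply: le_lt_trans (ler_norm _) _; move: h; rewrite /c /exp_coeff /= exprS.
  by rewrite (_ : 2 * expR (normc v : R) * normc v * (normc v ^+ n / n`!%:R) = 2 * expR (normc v : R) * (normc v * normc v ^+ n / n`!%:R)) //; ring.
by rewrite (cvg_shiftS (series _)).
Qed.

Definition csinh (v : C) : C := (cexp v - cexp (- v)) / 2.

Lemma csinh_series (v : C) :
  series ((fun k => v ^+ (2 * k).+1 / (2 * k).+1`!%:R) : nat -> C^o) @ \oo --> (csinh v : C^o).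
Proof.
have sub (f : nat -> C) (s : C) : series (f : nat -> C^o) @ \oo --> (s : C^o) ->
    (fun N => \sum_(0 <= k < 2 * N) f k) @ \oo --> (s : C^o).
  move=> /cvgc_normP h; apply/cvgc_normP => e e0; have [K _ hK] := h e e0.
  by exists K => // N /= KN; apply: hK => /=; lia.
have h1 := sub _ _ (@cexp_series v); have h2 := sub _ _ (@cexp_series (- v)).
have L : (fun N => (\sum_(0 <= k < 2 * N) v ^+ k / k`!%:R - \sum_(0 <= k < 2 * N) (- v) ^+ k / k`!%:R) * 2^-1)
   @ \oo --> (csinh v : C^o).
  by apply: cvgcM; [exact: cvgcB h1 h2|exact: cvgc_cst].
suff E : (series ((fun k => v ^+ (2 * k).+1 / (2 * k).+1`!%:R) : nat -> C^o) : nat -> C) =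
  (fun N => (\sum_(0 <= k < 2 * N) v ^+ k / k`!%:R - \sum_(0 <= k < 2 * N) (- v) ^+ k / k`!%:R) * 2^-1).
  by move: L; rewrite -E.
apply/funext => N; rewrite /series /=; elim: N => [|N ih]; first by rewrite !big_geq // subrr mul0r.
have s1 : (-1) ^+ (2 * N) = 1 :> C by rewrite exprM sqrrN !expr1n.
rewrite big_nat_recr //= ih; have -> : (2 * N.+1 = (2 * N).+2)%N by rewrite mulnS.
move: (2 * N)%N s1 => M s1.
have split2 (F : nat -> C) : \sum_(0 <= k < M.+2) F k = \sum_(0 <= k < M) F k + F M + F M.+1.
  by rewrite big_nat_recr //= big_nat_recr.
rewrite !split2.
rewrite (exprNn v M) (exprNn v M.+1) [(-1) ^+ M.+1]exprS s1 mulr1.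
by set a := \sum_(_ <= _ < _) _; set b := \sum_(_ <= _ < _) _; set x := (M.+1`!%:R)^-1; set y := (M`!%:R)^-1; set z := v ^+ M.+1; set w := v ^+ M; field.
Qed.

End ExponentialSeries.

Section Wiener.
Variable R : realType.
Local Notation C := R[i].
Implicit Types (a b : nat -> R) (x : C).

(** Absolutely summable coefficients: the power series converges absolutely on
    the whole closed unit disc. These series form an algebra, which gives the
    expansion of [F] without contour integrals. *)
Definition wiener a : Prop := exists M, forall N, \sum_(0 <= k < N) `|a k| <= M.
Definition wsum a x : C := lim (series ((fun k => (a k)%:C * x ^+ k) : nat -> C^o) @ \oo).

Lemma wsumE a x (s : C) : series ((fun k => (a k)%:C * x ^+ k) : nat -> C^o) @ \oo --> (s : C^o) -> wsum a x = s.
Proof. by move=> h; exact: (@cvg_lim C^o (@norm_hausdorff _ _) _ _ _ _ _ h). Qed.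

Lemma wiener_term a x k : normc x <= 1 -> normc ((a k)%:C * x ^+ k) <= `|a k|.
Proof.
by move=> x1; rewrite normcM normc_real normcX ler_piMr // exprn_ile1 // normc_ge0.
Qed.

Lemma wiener_sum a x N M : (forall N, \sum_(0 <= k < N) `|a k| <= M) -> normc x <= 1 ->
  \sum_(0 <= k < N) normc ((a k)%:C * x ^+ k) <= M.
Proof.
by move=> aM x1; apply: le_trans (aM N); apply: ler_sum => k _; exact: wiener_term.
Qed.

Lemma wsum_cvg a x : wiener a -> normc x <= 1 ->
  series ((fun k => (a k)%:C * x ^+ k) : nat -> C^o) @ \oo --> (wsum a x : C^o).
Proof.
move=> [M aM] x1.
have [s hs] := abs_series_cvg (fun N => wiener_sum N aM x1).
by rewrite (wsumE hs).
Qed.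

Definition conv a b (k : nat) : R := \sum_(0 <= i < k.+1) a i * b (k - i)%N.

Lemma triangle_sum (V : nmodType) (F : nat -> nat -> V) N :
  \sum_(0 <= k < N) \sum_(0 <= i < k.+1) F i (k - i)%N = \sum_(0 <= i < N) \sum_(0 <= j < N - i) F i j.
Proof.
elim: N => [|N ih]; first by rewrite !big_geq.
rewrite big_nat_recr //= ih [in RHS]big_nat_recr //= [\sum_(0 <= i < N.+1) _]big_nat_recr //=.
rewrite addrA -big_split /=; congr (_ + _); last by rewrite subSnn subnn big_nat1.
by apply: eq_big_nat => i /andP[_ iN]; rewrite subSn ?(ltnW iN) // big_nat_recr.
Qed.

Lemma wiener_conv a b : wiener a -> wiener b -> wiener (conv a b).
Proof.
move=> [A hA] [B hB]; exists (A * B) => N.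
have B0 : 0 <= B by have := hB 0%N; rewrite big_geq.
apply: (@le_trans _ _ (\sum_(0 <= k < N) \sum_(0 <= i < k.+1) `|a i| * `|b (k - i)%N|)).
  apply: ler_sum => k _; apply: le_trans (ler_norm_sum _ _ _) _; apply: ler_sum => i _.
  by rewrite normrM.
rewrite (triangle_sum (fun i j => `|a i| * `|b j|)).
apply: (@le_trans _ _ (\sum_(0 <= i < N) `|a i| * B)).
  by apply: ler_sum => i _; rewrite -mulr_sumr ler_wpM2l.
by rewrite -mulr_suml ler_wpM2r.
Qed.

(** Cauchy product, by absolute convergence. *)
Lemma wsum_conv a b x : wiener a -> wiener b -> normc x <= 1 ->
  wsum (conv a b) x = wsum a x * wsum b x.
Proof.
move=> wa wb x1; have [A hA] := wa; have [B hB] := wb; apply: wsumE.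
pose u (N i : nat) : C := if (i < N)%N then (a i)%:C * x ^+ i * \sum_(0 <= j < N - i) (b j)%:C * x ^+ j else 0.
have B0 : 0 <= B by have := hB 0%N; rewrite big_geq.
have -> : (series ((fun k => (conv a b k)%:C * x ^+ k) : nat -> C^o) : nat -> C) =
   (fun N => \sum_(0 <= i < N) u N i).
  apply/funext => N; rewrite /series /=.
  transitivity (\sum_(0 <= k < N) \sum_(0 <= i < k.+1) ((a i)%:C * x ^+ i) * ((b (k - i)%N)%:C * x ^+ (k - i)) : C).
    apply: eq_bigr => k _; rewrite /conv rmorph_sum mulr_suml.
    apply: eq_big_nat => i /andP[_ ik]; rewrite rmorphM /=.
    have -> : x ^+ k = x ^+ i * x ^+ (k - i) by rewrite -exprD subnKC.
    ring.
  rewrite (triangle_sum (fun i j => ((a i)%:C * x ^+ i) * ((b j)%:C * x ^+ j))).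
  by apply: eq_big_nat => i /andP[_ iN]; rewrite /u iN mulr_sumr.
apply: (@tannery R u (fun i => (a i)%:C * x ^+ i * wsum b x) (fun i => `|a i| * B) (A * B)).
- move=> N i; rewrite /u; case: ifP => _; last by rewrite normc0 mulr_ge0.
  rewrite normcM; apply: ler_pM; rewrite ?normc_ge0 //; first exact: wiener_term.
  by apply: le_trans (normc_sum _ _ _) _; exact: wiener_sum.
- by move=> N; rewrite -mulr_suml ler_wpM2r.
- move=> i; apply/cvgc_normP => e e0.
  have h : (fun N => (a i)%:C * x ^+ i * \sum_(0 <= j < N) (b j)%:C * x ^+ j) @ \oo --> ((a i)%:C * x ^+ i * wsum b x : C^o).
    by apply: cvgcM; [exact: cvgc_cst|exact: wsum_cvg].
  move/cvgc_normP: h => /(_ e e0) [K _ hK].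
  exists (i.+1 + K)%N => // N /= KN; rewrite /u; have -> : (i < N)%N by lia.
  by apply: hK => /=; lia.
- move=> N; apply: (@cvgc_stationary R _ _ N) => K NK; rewrite /series /= (big_cat_nat (leq0n N) NK) /=.
  rewrite [X in _ + X]big_nat_cond [X in _ + X]big1 ?addr0 // => i /andP[/andP[Ni _] _].
  by rewrite /u ltnNge Ni.
have h : (fun N => (\sum_(0 <= i < N) (a i)%:C * x ^+ i) * wsum b x) @ \oo --> (wsum a x * wsum b x : C^o).
  by apply: cvgcM; [exact: wsum_cvg|exact: cvgc_cst].
have E : (series ((fun i => (a i)%:C * x ^+ i * wsum b x) : nat -> C^o) : nat -> C) =
   (fun N => (\sum_(0 <= i < N) (a i)%:C * x ^+ i) * wsum b x).
  by apply/funext => N; rewrite /series /= mulr_suml.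
by move: h; rewrite -E.
Qed.

Definition delta_seq (k : nat) : R := (k == 0%N)%:R.

Lemma delta_seq_sum N (V : nmodType) (F : nat -> V) :
  (0 < N)%N -> (forall k, (0 < k)%N -> F k = 0) -> \sum_(0 <= k < N) F k = F 0%N.
Proof.
case: N => // N _ h; rewrite big_nat_recl // big1_seq ?addr0 // => k _; exact: h.
Qed.

Lemma wiener_delta : wiener delta_seq.
Proof.
exists 1 => -[|N]; first by rewrite big_geq.
rewrite delta_seq_sum //; first by rewrite /delta_seq normr1.
by move=> [|k] // _; rewrite /delta_seq normr0.
Qed.

Lemma wsum_delta x : wsum delta_seq x = 1.
Proof.
apply: wsumE; apply: (@cvgc_stationary R _ _ 1%N) => -[|N] // _.
rewrite /series /= delta_seq_sum //; first by rewrite /delta_seq expr0 mulr1.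
by move=> [|k] // _; rewrite /delta_seq rmorph0 mul0r.
Qed.

(** The coefficients of the inverse, by the course-of-values recursion that the
    Cauchy product dictates; the list holds the earlier ones. *)
Fixpoint inverse_coefs a (n : nat) : seq R :=
  if n is n'.+1 then let s := inverse_coefs a n' in
    rcons s (- \sum_(0 <= i < n) a i.+1 * s`_(n' - i)) else [:: 1].

Lemma size_inverse_coefs a n : size (inverse_coefs a n) = n.+1.
Proof. by elim: n => //= n ih; rewrite size_rcons ih. Qed.

Lemma inverse_coefs_stable a n k : (k <= n)%N -> (inverse_coefs a n)`_k = (inverse_coefs a k)`_k.
Proof.
elim: n => [|n ih]; first by rewrite leqn0 => /eqP ->.
rewrite leq_eqVlt => /orP[/eqP -> //|kn]; rewrite -(ih kn).
by rewrite [inverse_coefs a n.+1]/= nth_rcons size_inverse_coefs kn.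
Qed.

(** The Neumann series of an element at distance at most 1/2 from 1; the bound 2
    on the norm of the inverse comes by induction on its partial sums. *)
Lemma wiener_inv a : a 0%N = 1 -> (forall N, \sum_(0 <= k < N) `|a k.+1| <= 1 / 2) ->
  exists b, wiener b /\ forall x, normc x <= 1 -> wsum a x * wsum b x = 1.
Proof.
move=> a0 ha; pose b k := (inverse_coefs a k)`_k.
have bS k : b k.+1 = - \sum_(0 <= i < k.+1) a i.+1 * b (k - i)%N.
  rewrite /b [inverse_coefs a k.+1]/= nth_rcons size_inverse_coefs ltnn eqxx.
  congr (- _); apply: eq_big_nat => i /andP[_ ik]; congr (_ * _).
  by rewrite inverse_coefs_stable // leq_subr.
have wa : wiener a.
  exists (1 + 1 / 2) => -[|N]; first by rewrite big_geq //; lra.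
  by rewrite big_nat_recl // a0 normr1 lerD2l.
have bb N : \sum_(0 <= k < N) `|b k| <= 2.
  elim: N => [|N ih]; first by rewrite big_geq.
  rewrite big_nat_recl // {1}/b /= normr1.
  suff : \sum_(0 <= k < N) `|b k.+1| <= (1 / 2) * 2 by lra.
  apply: (@le_trans _ _ (\sum_(0 <= k < N) \sum_(0 <= i < k.+1) `|a i.+1| * `|b (k - i)%N|)).
    apply: ler_sum => k _; rewrite bS normrN; apply: le_trans (ler_norm_sum _ _ _) _.
    by apply: ler_sum => i _; rewrite normrM.
  rewrite (triangle_sum (fun i j => `|a i.+1| * `|b j|)).
  apply: (@le_trans _ _ (\sum_(0 <= i < N) `|a i.+1| * 2)); last by rewrite -mulr_suml ler_wpM2r.
  apply: ler_sum => i _; rewrite -mulr_sumr ler_wpM2l //; apply: le_trans ih.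
  rewrite [leRHS](big_cat_nat (leq0n (N - i)) (leq_subr i N)) /= lerDl.
  by apply: sumr_ge0.
have wb : wiener b by exists 2.
exists b; split => // x x1; rewrite -wsum_conv // -(wsum_delta x).
congr wsum; apply/funext => -[|k]; first by rewrite /conv big_nat1 subnn a0 /b /delta_seq mulr1.
rewrite /conv big_nat_recl // subn0 a0 mul1r bS /delta_seq.
by rewrite [X in _ + X](eq_bigr (fun i => a i.+1 * b (k - i)%N)) ?addNr // => i _; rewrite subSS.
Qed.

Lemma wiener_prod (I : Type) (s : seq I) (F : I -> nat -> R) : (forall i, wiener (F i)) ->
  exists b, wiener b /\ forall x, normc x <= 1 -> wsum b x = \prod_(i <- s) wsum (F i) x.
Proof.
move=> wF; elim: s => [|i s [b [wb hb]]].
  by exists delta_seq; split; [exact: wiener_delta|move=> x _; rewrite wsum_delta big_nil].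
exists (conv (F i) b); split; first exact: wiener_conv.
by move=> x x1; rewrite wsum_conv // hb // big_cons.
Qed.

Definition sinh_coef (c : R) (k : nat) : R := c ^+ (2 * k) / (2 * k).+1`!%:R.

Lemma sinh_coef_bound c k : 0 <= c <= 1 / 2 -> `|sinh_coef c k| <= 4^-1 ^+ k.
Proof.
move=> /andP[c0 c1]; rewrite /sinh_coef ger0_norm ?divr_ge0 ?exprn_ge0 //.
rewrite exprM; apply: (@le_trans _ _ ((c ^+ 2) ^+ k)).
  by rewrite ler_piMr ?exprn_ge0 // invf_le1 ?ltr0n ?fact_gt0 // ler1n fact_gt0.
apply: lerXn2r; rewrite ?nnegrE ?exprn_ge0 ?invr_ge0 //; nra.
Qed.

Lemma geometric4 N : \sum_(0 <= k < N) (4^-1 : R) ^+ k <= 4 / 3.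
Proof.
have h : 0 <= (4^-1 : R) < 1 by lra.
have := nbin_bound 0 N h; rewrite expr1 (_ : (1 - 4^-1)^-1 = 4 / 3 :> R); last by field.
by under eq_bigr do rewrite /nbin bin0 mul1r.
Qed.

Lemma wiener_sinh c : 0 <= c <= 1 / 2 -> wiener (sinh_coef c).
Proof.
move=> hc; exists (4 / 3) => N; apply: le_trans (geometric4 N).
by apply: ler_sum => k _; exact: sinh_coef_bound.
Qed.

Lemma sinh_tail c N : 0 <= c <= 1 / 2 -> \sum_(0 <= k < N) `|sinh_coef c k.+1| <= 1 / 2.
Proof.
move=> hc; apply: (@le_trans _ _ (\sum_(0 <= k < N) 4^-1 * 4^-1 ^+ k)).
  by apply: ler_sum => k _; rewrite -exprS; exact: sinh_coef_bound.
rewrite -mulr_sumr; have := geometric4 N; lra.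
Qed.

(** The hyperbolic sine is its argument times an even series. *)
Lemma wsum_sinh c (u : C) : 0 <= c <= 1 / 2 -> normc u <= 1 ->
  wsum (sinh_coef c) (u ^+ 2) * (c%:C * u) = csinh (c%:C * u).
Proof.
move=> hc u1; have x1 : normc (u ^+ 2) <= 1 by rewrite normcX exprn_ile1 // normc_ge0.
have h : (fun N => (\sum_(0 <= k < N) (sinh_coef c k)%:C * (u ^+ 2) ^+ k) * (c%:C * u)) @ \oo -->
    (wsum (sinh_coef c) (u ^+ 2) * (c%:C * u) : C^o).
  by apply: cvgcM; [apply: wsum_cvg => //; exact: wiener_sinh|exact: cvgc_cst].
have E : (fun N => (\sum_(0 <= k < N) (sinh_coef c k)%:C * (u ^+ 2) ^+ k) * (c%:C * u)) =
    (series ((fun k => (c%:C * u) ^+ (2 * k).+1 / (2 * k).+1`!%:R) : nat -> C^o) : nat -> C).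
  apply/funext => N; rewrite /series /= mulr_suml; apply: eq_bigr => k _.
  rewrite /sinh_coef rmorphM fmorphV rmorph_nat rmorphXn /= -exprM exprMn !exprS; ring.
by rewrite E in h; exact: cvgc_unique h (@csinh_series R _).
Qed.

End Wiener.

Section BorelSeries.
Variables (R : realType) (n : nat) (p : 'I_n -> nat).
Local Notation C := R[i].
Local Notation leb := (@lebesgue_measure R).
Hypothesis hp : forall j, (0 < p j)%N.
Variable d : nat.
Hypothesis nd3 : n = d.+3.
Local Notation P := (Pprod p).

Definition FC (y : C) : C :=
  4^-1 * csinh (y / 2) ^ (2 - n%:Z) * \prod_j csinh (y / (2 * (p j)%:R)).

Lemma csinh_real (y : R) : csinh y%:C = (sinh y)%:C :> C.
Proof.
by rewrite /csinh /sinh -rmorphN !cexp_real rmorphM fmorphV rmorph_nat rmorphB.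
Qed.

Lemma FC_real (y : R) : FC y%:C = (Ffun p y)%:C.
Proof.
rewrite /FC /Ffun !rmorphM fmorphV rmorph_nat rmorph_prod /=.
have E (k : nat) : y%:C / k%:R = (y / k%:R)%:C :> C by rewrite rmorphM fmorphV rmorph_nat.
rewrite E csinh_real; congr (_ * _ * _).
  have -> : 2 - n%:Z = - d.+1%:Z by rewrite nd3; lia.
  by rewrite -!exprnN fmorphV rmorphXn.
by apply: eq_bigr => j _; rewrite -!natrM E csinh_real.
Qed.

(** This is why the expansion of [F] in exponentials has the same coefficients as
    [G]; the powers of 2 in the hyperbolic sines leave the factor 16. *)
Lemma FC_Gfun (y : C) : FC y = Gfun p (cexp (y / (2 * P%:R))) / 16.
Proof.
have P0 : P%:R != 0 :> C by rewrite pnatr_eq0 -lt0n (Pprod_gt0 hp).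
have pn j : (p j)%:R != 0 :> C by rewrite pnatr_eq0 -lt0n.
have E (k : nat) (w : C) : w = y / (2 * P%:R) * k%:R ->
    csinh w = (cexp (y / (2 * P%:R)) ^ k%:Z - cexp (y / (2 * P%:R)) ^ (- k%:Z)) / 2.
  by move=> ->; rewrite /csinh -exprnN -exprnP -cexpMn cexpN mulr_natr.
rewrite /FC /Gfun (E P); last by field.
rewrite (eq_bigr (fun j => 2^-1 * (cexp (y / (2 * P%:R)) ^ (P %/ p j)%:Z - cexp (y / (2 * P%:R)) ^ (- (P %/ p j)%:Z)))); last first.
  move=> j _; rewrite (E (P %/ p j)%N) 1?mulrC //.
  have -> : (P %/ p j)%:R = P%:R / (p j)%:R :> C.
    by apply: (mulIf (pn j)); rewrite divfK // -natrM mulnC Pprod_div.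
  by field; rewrite P0 pn.
rewrite big_split prodr_const card_ord /=.
have -> : 2 - n%:Z = - d.+1%:Z by rewrite nd3; lia.
set X := \prod_j _; set a := _ - _; rewrite -!exprnN expr_div_n invf_div nd3.
have -> : (2^-1 : C) ^+ d.+3 = (8 * 2 ^+ d)^-1 by rewrite exprVn !exprS; congr (_^-1); ring.
have t0 : (2 : C) ^+ d != 0 by rewrite expf_neq0 // pnatr_eq0.
have -> : (2 : C) ^+ d.+1 = 2 * 2 ^+ d by rewrite exprS.
by set b := (a ^+ d.+1)^-1; field.
Qed.

(** Each hyperbolic sine is [u] times an even series, invertible near 1 for the
    central one. There are two more sines above than below, so [F] is divisible by
    [u ^ 2]. *)
Lemma FC_series : exists phi : nat -> R,
  [/\ wiener phi, phi 0%N = 0 & forall u : C, 0 < normc u -> normc u <= 1 -> FC u = wsum phi (u ^+ 2)].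
Proof.
pose c j : R := (2 * (p j)%:R)^-1.
have hc j : 0 <= c j <= 1 / 2.
  have p1 : 1 <= (p j)%:R :> R by rewrite ler1n.
  rewrite /c invr_ge0 mulr_ge0 ?ler0n //= mul1r lef_pV2 ?posrE //; lra.
have h2 : 0 <= (2^-1 : R) <= 1 / 2 by apply/andP; split; lra.
have [b1 [wb1 hb1]] : exists b, wiener b /\ forall x : C, normc x <= 1 -> wsum (sinh_coef (2^-1 : R)) x * wsum b x = 1.
  apply: wiener_inv => [|N]; last exact: sinh_tail.
  by rewrite /sinh_coef muln0 expr0 factS fact0 invr1 mulr1.
have [b2 [wb2 hb2]] := @wiener_prod R _ (index_enum 'I_n) (fun j => sinh_coef (c j)) (fun j => wiener_sinh (hc j)).
have [b3 [wb3 hb3]] := @wiener_prod R _ (nseq d.+1 tt) (fun=> b1) (fun=> wb1).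
pose b := conv b2 b3; have wb : wiener b by exact: wiener_conv.
pose kap : R := (16 * P%:R)^-1.
pose phi k : R := if k is k'.+1 then kap * b k' else 0.
have wphi : wiener phi.
  have [B hB] := wb; exists (`|kap| * B) => -[|N].
    by rewrite big_geq // mulr_ge0 //; have := hB 0%N; rewrite big_geq.
  rewrite big_nat_recl // normr0 add0r /phi.
  by under eq_bigr do rewrite normrM; rewrite -mulr_sumr ler_wpM2l.
exists phi; split => // u u0 u1.
have x1 : normc (u ^+ 2) <= 1 by rewrite normcX exprn_ile1 // normc_ge0.
have un0 : u != 0 by rewrite -normc_gt0.
have -> : wsum phi (u ^+ 2) = kap%:C * u ^+ 2 * wsum b (u ^+ 2).
  apply: wsumE; have h : (fun N => kap%:C * u ^+ 2 * \sum_(0 <= k < N) (b k)%:C * (u ^+ 2) ^+ k) @ \oo --> (kap%:C * u ^+ 2 * wsum b (u ^+ 2) : C^o).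
    by apply: cvgcM; [exact: cvgc_cst|exact: wsum_cvg].
  rewrite -(cvg_shiftS (series _)).
  have E : (fun N => series ((fun k => (phi k)%:C * (u ^+ 2) ^+ k) : nat -> C^o) N.+1 : C) =
     (fun N => kap%:C * u ^+ 2 * \sum_(0 <= k < N) (b k)%:C * (u ^+ 2) ^+ k).
    apply/funext => N; rewrite /series /= big_nat_recl // rmorph0 mul0r add0r mulr_sumr.
    by apply: eq_bigr => k _; rewrite /phi rmorphM [(u ^+ 2) ^+ k.+1]exprS /=; ring.
  by move: h; rewrite -E.
rewrite wsum_conv // hb2 // hb3 // big_nseq iter_mulr mulr1.
have s2 := wsum_sinh h2 u1; have s2' := hb1 _ x1.
set S := wsum (sinh_coef _) _ in s2 s2'; set T := wsum b1 _ in s2' *.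
have S0 : S != 0 by apply/eqP => e; move: s2'; rewrite e mul0r => /esym/eqP; rewrite oner_eq0.
have TS : T = S^-1 by apply: (mulfI S0); rewrite s2' mulfV.
rewrite /FC; have -> : u / 2 = (2^-1 : R)%:C * u by rewrite mulrC fmorphV rmorph_nat.
rewrite -s2 (eq_bigr (fun j => wsum (sinh_coef (c j)) (u ^+ 2) * ((c j)%:C * u))); last first.
  move=> j _; rewrite wsum_sinh //; congr csinh.
  by rewrite /c fmorphV rmorphM !rmorph_nat mulrC.
rewrite !big_split /= !prodr_const card_ord; set X := \prod_j wsum _ _.
have -> : \prod_j (c j)%:C = (2 ^+ n * P%:R)^-1 :> C.
  have -> : (2 : C) ^+ n = \prod_(j < n) 2 by rewrite prodr_const card_ord.
  rewrite /Pprod natr_prod -big_split /= -prodfV.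
  by apply: eq_bigr => j _; rewrite /c fmorphV rmorphM !rmorph_nat.
have -> : 2 - n%:Z = - d.+1%:Z by rewrite nd3; lia.
have P0 : P%:R != 0 :> C by rewrite pnatr_eq0 -lt0n (Pprod_gt0 hp).
have kapE : kap%:C = (16 * P%:R)^-1 :> C by rewrite /kap fmorphV rmorphM !rmorph_nat.
have halfE : (2^-1 : R)%:C = 2^-1 :> C by rewrite fmorphV rmorph_nat.
have un : u ^+ n = u ^+ d.+3 by rewrite nd3.
have tn : (2 : C) ^+ n = 8 * 2 ^+ d by rewrite nd3 !exprS; ring.
move: (2 ^+ n) tn => t2 tn.
rewrite -exprnN TS kapE halfE un !exprMn !invfM !exprVn invrK tn.
have t0 : (2 : C) ^+ d != 0 by rewrite expf_neq0 // pnatr_eq0.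
have v0 : u ^+ d != 0 by rewrite expf_neq0.
have pow1 (w : C) : w ^+ d.+1 = w * w ^+ d by rewrite exprS.
have pow3 (w : C) : w ^+ d.+3 = w ^+ 3 * w ^+ d by rewrite -exprD.
rewrite (pow3 u) (pow1 2) (pow1 u).
by set Y := (S ^+ d.+1)^-1; field; rewrite P0 t0 v0 un0.
Qed.

End BorelSeries.

Section PowerSeriesDerivatives.
Variable R : realType.
Implicit Types (c : nat -> R).

(** Unlike absolute summability up to the boundary, this condition is stable
    under term by term differentiation. *)
Definition unit_disc_summable c : Prop :=
  forall x, 0 <= x < 1 -> exists B, forall N, \sum_(0 <= k < N) `|c k| * x ^+ k <= B.

Lemma unit_disc_summable_diffs c : unit_disc_summable c -> unit_disc_summable (pseries_diffs c).
Proof.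
move=> hc x /andP[x0 x1]; pose y := (1 + x) / 2.
have y0 : 0 < y by rewrite /y; lra.
have xy : x < y by rewrite /y; lra.
have hy : 0 <= y < 1 by rewrite /y; apply/andP; split; lra.
clearbody y; have [B hB] := hc y hy.
have cb k : `|c k| * y ^+ k <= B.
  apply: le_trans (hB k.+1); rewrite big_nat_recr //= lerDr.
  by apply: sumr_ge0 => i _; rewrite mulr_ge0 // exprn_ge0 // ltW.
have B0 : 0 <= B by apply: le_trans (cb 0%N); rewrite mulr_ge0 // exprn_ge0 // ltW.
have r01 : 0 <= x / y < 1 by rewrite divr_ge0 ?(ltW y0) //= ltr_pdivrMr // mul1r.
exists (B / y * ((1 - x / y) ^+ 2)^-1) => N.
apply: (@le_trans _ _ (\sum_(0 <= k < N) B / y * ((nbin 1 k)%:R * (x / y) ^+ k))).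
  apply: ler_sum => k _; rewrite /pseries_diffs normrM ger0_norm // /nbin bin1 addn1.
  have -> : k.+1%:R * `|c k.+1| * x ^+ k = (`|c k.+1| * y ^+ k.+1) * (k.+1%:R * (x / y) ^+ k / y).
    by rewrite expr_div_n exprS; field; rewrite expf_neq0 gt_eqF.
  rewrite [leRHS](_ : _ = B * (k.+1%:R * (x / y) ^+ k / y)); last by ring.
  by rewrite ler_wpM2r // mulr_ge0 ?invr_ge0 ?(ltW y0) // mulr_ge0 // exprn_ge0 //; case/andP: r01.
rewrite -mulr_sumr ler_wpM2l ?divr_ge0 ?(ltW y0) //.
exact: nbin_bound.
Qed.

Lemma unit_disc_cvg c (x : R) : unit_disc_summable c -> `|x| < 1 -> cvgn (pseries c x).
Proof.
move=> hc x1; suff h : cvgn (series (fun k => `|c k * x ^+ k|)) by exact: (normed_cvg h).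
have [B hB] : exists B, forall N, \sum_(0 <= k < N) `|c k| * `|x| ^+ k <= B by apply: hc; rewrite normr_ge0.
apply: nondecreasing_is_cvgn.
  by apply/nondecreasing_seqP => N; rewrite /series /= big_nat_recr //= lerDl.
exists B => _ [N _ <-]; apply: le_trans (hB N); rewrite /series /=.
by apply: ler_sum => k _; rewrite normrM normrX.
Qed.

Lemma derive1n_pseries c (f : R -> R) j : unit_disc_summable c ->
  (forall x : R, `|x| < 1 -> f x = limn (pseries c x)) ->
  unit_disc_summable (iter j (@pseries_diffs R) c) /\
  forall x : R, `|x| < 1 -> derive1n j f x = limn (pseries (iter j (@pseries_diffs R) c) x).
Proof.
move=> hc hf; elim: j => [//|j [ihs ih]]; split; first exact: unit_disc_summable_diffs.
move=> x x1; rewrite derive1nS derive1E.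
have [K [xK K1]] : exists K : R, `|x| < `|K| /\ `|K| < 1.
  have K0 : 0 <= (1 + `|x|) / 2 by rewrite divr_ge0 // addr_ge0.
  by exists ((1 + `|x|) / 2); rewrite (ger0_norm K0); split; lra.
have D := pseries_snd_diffs (unit_disc_cvg ihs K1) (unit_disc_cvg (unit_disc_summable_diffs ihs) K1)
   (unit_disc_cvg (unit_disc_summable_diffs (unit_disc_summable_diffs ihs)) K1) xK.
rewrite -[iter j.+1 _ _]/(pseries_diffs (iter j (@pseries_diffs R) c)) -(derive_val (is_derive := D)).
apply: near_eq_derive.
have : \forall y \near x, `|y| < 1.
  apply/nbhs_ballP; exists (1 - `|x|) => [/=|y]; first by rewrite subr_gt0.
  rewrite /ball /= => h; have := ler_normB x (x - y); rewrite (_ : x - (x - y) = y); last by ring.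
  lra.
by apply: filterS => y; exact: ih.
Qed.

Lemma iter_diffs c j i : (i`!)%:R * iter j (@pseries_diffs R) c i = ((i + j)`!)%:R * c (i + j)%N.
Proof.
elim: j i => [|j ih] i; first by rewrite addn0.
by rewrite iterS /pseries_diffs mulrA -natrM mulnC -factS ih addSnnS.
Qed.

Lemma pseries_at0 c : limn (pseries c 0) = c 0%N.
Proof.
apply: (@cvg_lim R (@norm_hausdorff _ _)).
rewrite -(cvg_shiftS (pseries c 0)).
have -> : (fun N => pseries c 0 N.+1) = (fun=> c 0%N).
  apply/funext => N; rewrite /pseries /series /= big_nat_recl // expr0 mulr1 big1_seq ?addr0 // => k _.
  by rewrite exprS mul0r mulr0.
exact: cvg_cst.
Qed.

Lemma derive1n_at0 c (f : R -> R) j : unit_disc_summable c ->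
  (forall x : R, `|x| < 1 -> f x = limn (pseries c x)) -> derive1n j f 0 = (j`!)%:R * c j.
Proof.
move=> hc hf; have [_ h] := derive1n_pseries j hc hf.
rewrite h ?normr0 // pseries_at0; have := iter_diffs c j 0.
by rewrite fact0 mul1r add0n.
Qed.

End PowerSeriesDerivatives.

Section BorelTransform.
Variables (R : realType) (n : nat) (p : 'I_n -> nat).
Local Notation C := R[i].
Local Notation leb := (@lebesgue_measure R).
Hypothesis hp : forall j, (0 < p j)%N.
Variable d : nat.
Hypothesis nd3 : n = d.+3.
Local Notation P := (Pprod p).

Lemma Ffun0 : Ffun p 0 = 0 :> R.
Proof.
have n0 : (0 < n)%N by rewrite nd3.
by rewrite /Ffun (bigD1 (Ordinal n0)) //= !mul0r /sinh oppr0 subrr !mul0r mulr0.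
Qed.

(** Term by term differentiation identifies the expansion with the Taylor
    expansion that defines the asymptotic series. *)
Lemma Ffun_derivatives : exists phi : nat -> R,
  [/\ wiener phi, phi 0%N = 0,
      forall u : C, 0 < normc u -> normc u <= 1 -> FC p u = wsum phi (u ^+ 2) &
      forall r, derive1n (2 * r) (Ffun p) 0 = ((2 * r)`!)%:R * phi r].
Proof.
have [phi [wphi phi0 hphi]] := @FC_series R n p hp d nd3.
exists phi; split => // r.
pose c k := if odd k then 0 else phi k./2.
have c0 N : c (2 * N)%N = phi N by rewrite /c mul2n odd_double doubleK.
have c1 N : c (2 * N).+1 = 0 by rewrite /c mul2n /= odd_double.
have csum N : \sum_(0 <= k < 2 * N) `|c k| = \sum_(0 <= k < N) `|phi k|.
  elim: N => [|N ih]; first by rewrite !big_geq.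
  rewrite [in RHS]big_nat_recr //= -ih; have -> : (2 * N.+1 = (2 * N).+2)%N by rewrite mulnS.
  by rewrite big_nat_recr //= big_nat_recr //= c1 normr0 addr0 c0.
have cC (x : R) N : \sum_(0 <= k < 2 * N) c k * x ^+ k = \sum_(0 <= k < N) phi k * (x ^+ 2) ^+ k.
  elim: N => [|N ih]; first by rewrite !big_geq.
  rewrite [in RHS]big_nat_recr //= -ih; have -> : (2 * N.+1 = (2 * N).+2)%N by rewrite mulnS.
  by rewrite big_nat_recr //= big_nat_recr //= c1 mul0r addr0 c0 exprM.
have hc : unit_disc_summable c.
  move=> x /andP[x0 x1]; have [B hB] := wphi; exists B => N.
  have cb : \sum_(0 <= k < 2 * N) `|c k| <= B.
    by rewrite csum.
  apply: le_trans cb; apply: (@le_trans _ _ (\sum_(0 <= k < N) `|c k|)).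
    by apply: ler_sum => k _; rewrite ler_piMr // exprn_ile1 // ltW.
  have NN : (N <= 2 * N)%N by lia.
  by rewrite [leRHS](big_cat_nat (leq0n N) NN) /= lerDl sumr_ge0.
rewrite (@derive1n_at0 R c) //; first by rewrite /c mul2n odd_double doubleK.
move=> x x1; apply/esym; have cvx := unit_disc_cvg hc x1.
have sub : (fun N => pseries c x (2 * N)%N) @ \oo --> limn (pseries c x).
  apply: cvg_comp cvx; apply/cvgnyPge => K; exists K => // N /= KN; lia.
have E : (fun N => pseries c x (2 * N)%N) = (fun N => \sum_(0 <= k < N) phi k * (x ^+ 2) ^+ k).
  by apply/funext => N; rewrite /pseries /series /= cC.
rewrite E in sub.
have [->|x0] := eqVneq x 0; first by rewrite pseries_at0 Ffun0 /c.
have xC : normc (x%:C : C) <= 1 by rewrite normc_real ltW.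
have xC0 : 0 < normc (x%:C : C) by rewrite normc_real normr_gt0.
have L : (fun N => (\sum_(0 <= k < N) phi k * (x ^+ 2) ^+ k)%:C : C) @ \oo --> ((Ffun p x)%:C : C^o).
  rewrite -(FC_real p nd3) hphi //.
  have x2 : normc ((x%:C : C) ^+ 2) <= 1 by rewrite normcX exprn_ile1 // normc_ge0.
  have h := wsum_cvg wphi x2.
  have E2 : (fun N => (\sum_(0 <= k < N) phi k * (x ^+ 2) ^+ k)%:C : C) =
     (series ((fun k => (phi k)%:C * (x%:C ^+ 2) ^+ k) : nat -> C^o) : nat -> C).
    by apply/funext => N; rewrite rmorph_sum /series /=; apply: eq_bigr => k _; rewrite rmorphM !rmorphXn.
  by rewrite E2.
suff H : (limn (pseries c x))%:C = (Ffun p x)%:C :> C by have := congr1 (@complex.Re R) H.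
exact: cvgc_unique (cvgc_real sub) L.
Qed.

Lemma Gamma_fun_gt0 r : 0 < Gamma_fun (r.+1%:R + 2^-1 : R).
Proof.
rewrite /Gamma_fun.
have mD : measurable (`]0, +oo[%classic : set R) by exact: measurable_itv.
pose f (t : R) := t `^ (r.+1%:R + 2^-1 - 1) * expR (- t).
have mf : measurable_fun (`]0, +oo[ : set R) f.
  apply: measurable_funTS; apply: measurable_funM; first exact: measurable_powR.
  by apply: measurableT_comp => //; exact: measurable_funN.
have f0 (t : R) : 0 <= f t by rewrite /f mulr_ge0 ?powR_ge0 ?expR_ge0.
have fb (t : R) : 0 < t -> f t <= (2 ^+ r.+1 * (r.+1)`!%:R * expR (1 / 2)) * expR (- (1 / 2 * t)).
  move=> t0; have a0 : 0 < 1 + t by lra.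
  have h1 : t `^ (r.+1%:R + 2^-1 - 1) <= (1 + t) ^+ r.+1.
    apply: (@le_trans _ _ ((1 + t) `^ (r.+1%:R + 2^-1 - 1))).
      by apply: ge0_ler_powR; rewrite ?nnegrE; [have : 0 <= r%:R :> R by []; rewrite -natr1; lra|lra|lra|lra].
    by rewrite -powR_mulrn ?(ltW a0) // ler_powR; lra.
  have h2 : (1 + t) ^+ r.+1 <= 2 ^+ r.+1 * (r.+1)`!%:R * expR ((1 + t) / 2).
    have := @expR_ge1Dxn R ((1 + t) / 2) r; rewrite divr_ge0 ?(ltW a0) // => /(_ isT) h.
    have fp : 0 < (r.+1)`!%:R :> R by rewrite ltr0n fact_gt0.
    have {}h : ((1 + t) / 2) ^+ r.+1 / (r.+1)`!%:R <= expR ((1 + t) / 2) by lra.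
    rewrite ler_pdivrMr // expr_div_n ler_pdivrMr ?exprn_gt0 // in h.
    by apply: le_trans h _; rewrite le_eqVlt; apply/orP; left; apply/eqP; ring.
  rewrite /f -mulrA -expRD; have -> : 1 / 2 + - (1 / 2 * t) = (1 + t) / 2 - t by field.
  rewrite expRD mulrA; apply: ler_wpM2r; first exact: expR_ge0.
  exact: le_trans h1 h2.
have fi : leb.-integrable (`]0, +oo[ : set R) (EFin \o f).
  have e2 : 0 < (1 / 2 : R) by lra.
  apply: (@le_integrable _ _ _ leb `]0, +oo[ mD _ (EFin \o (fun t => (2 ^+ r.+1 * (r.+1)`!%:R * expR (1 / 2)) * expR (- (1 / 2 * t))))); last exact: integrable_exp.
    exact/measurable_EFinP.
  move=> t /=; rewrite in_itv /= andbT => t0; rewrite lee_fin (ger0_norm (f0 t)).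
  by apply: le_trans (fb t t0) _; exact: ler_norm.
have sub : `[1, 2] `<=` (`]0, +oo[ : set R).
  by move=> t /=; rewrite !in_itv /= andbT => /andP[h _]; lra.
have m12 : measurable (`[1, 2]%classic : set R) by exact: measurable_itv.
have : expR (- 2) <= \int[leb]_(t in `]0, +oo[) f t.
  rewrite /Rintegral -lee_fin fineK; last exact: integrable_fin_num.
  apply: (@le_trans _ _ (\int[leb]_(t in `[1%R, 2%R]) (f t)%:E)%E); last first.
    by apply: ge0_subset_integral => // [|t _]; [exact/measurable_EFinP|rewrite lee_fin].
  apply: (@le_trans _ _ (\int[leb]_(t in `[1%R, 2%R]) (expR (- 2))%:E)%E).
    rewrite integral_cst //= lebesgue_measure_itv /= lte_fin ltr1n /= -EFinB.
    by rewrite -EFinM lee_fin (_ : 2 - 1 = 1 :> R) ?mulr1 //; ring.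
  apply: ge0_le_integral => //.
  - by apply/measurable_EFinP; apply: (measurable_funS mD sub mf).
  - move=> t /=; rewrite in_itv /= => /andP[t1 t2]; rewrite lee_fin /f.
    rewrite -[leLHS]mul1r; apply: ler_pM; rewrite ?expR_ge0 ?ler_expR ?lerN2 //.
    apply: (@le_trans _ _ (1 `^ (r.+1%:R + 2^-1 - 1))); first by rewrite powR1.
    have r0 : 0 <= r%:R :> R by [].
    by apply: ge0_ler_powR => //; rewrite ?nnegrE -?(natr1 r); lra.
by apply: lt_le_trans; exact: expR_gt0.
Qed.

Local Notation E8 := (eightpiiP R p).

(** The closed form of the Borel transform: the Gamma factors cancel against
    those of the termwise transform, and what is left is the Taylor series of [F]
    at a multiple of the square root of [z]. *)
Definition Bfun (z : C) : C :=
  sqrtc E8 / (2 * pi%:C * 'i%C) / sqrtc z * FC p (sqrtc E8 * sqrtc z).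

(** The Gamma function enters for positive integers [r] only, as [F] vanishes
    at 0; positivity of its values allows the cancellation. *)
Lemma Bfun_series : \forall z \near (0 : C^o), borel_domain p z ->
    series (fun r => borel_term p r z : C^o) @ \oo --> (Bfun z : C^o).
Proof.
have [phi [wphi phi0 hphi hder]] := Ffun_derivatives.
have P0 : P%:R != 0 :> C by rewrite pnatr_eq0 -lt0n (Pprod_gt0 hp).
have i0 : 'i%C != 0 :> C 
  by apply/eqP => /(congr1 (@complex.Im R)) H; have : (1 : R) = 0 := H; move/eqP; rewrite oner_eq0.
have pi0 : pi%:C != 0 :> C by rewrite -normc_gt0 normc_real normr_gt0 gt_eqF ?pi_gt0.
have E80 : E8 != 0.
  by rewrite /eightpiiP !mulf_neq0 // pnatr_eq0.
pose rho := (normc E8)^-1; have rho0 : 0 < rho by rewrite invr_gt0 normc_gt0.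
have nz : \forall z \near (0 : C^o), normc z < rho.
  have := @cvgc_normP R C^o (nbhs (0 : C^o)) _ (fun z => z) 0; case=> /(_ (@cvg_id _ _)) /(_ rho rho0) h _.
  by apply: filterS h => z; rewrite subr0.
apply: filterS nz => z zr [hz _].
have s0 : 0 < complex.Re (sqrtc z) by exact: Re_sqrtc_gt0.
have sz0 : sqrtc z != 0 by apply/eqP => h; move: s0; rewrite h /= ltxx.
have se0 : sqrtc E8 != 0 by apply/eqP => h; move: E80; rewrite -(sqr_sqrtc E8) h expr0n eqxx.
pose u := sqrtc E8 * sqrtc z.
have u2 : u ^+ 2 = E8 * z by rewrite /u exprMn !sqr_sqrtc.
have nu2 : normc u ^+ 2 < 1.
  by rewrite -normcX u2 normcM -ltr_pdivlMl ?normc_gt0 // mulr1.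
have u1 : normc u <= 1 by have := normc_ge0 u; nra.
have u0 : 0 < normc u by rewrite normc_gt0 /u mulf_neq0.
have x1 : normc (u ^+ 2) <= 1 by rewrite normcX ltW.
rewrite /Bfun -/u hphi //.
pose K : C := sqrtc E8 / (2 * pi%:C * 'i%C) / sqrtc z.
have E : (fun r => borel_term p r z : C) = (fun r => K * ((phi r)%:C * (u ^+ 2) ^+ r)).
  apply/funext => r; rewrite /borel_term /Z0_coef hder /K u2.
  have -> : ((2 * r)`!%:R * phi r)%:C = (2 * r)`!%:R * (phi r)%:C :> C by rewrite rmorphM rmorph_nat.
  have -> : (E8 * z) ^+ r = E8 ^+ r * z ^+ r by exact: exprMn.
  have f0 : (2 * r)`!%:R != 0 :> C by rewrite pnatr_eq0 -lt0n fact_gt0.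
  case: r f0 => [|r] f0; first by rewrite phi0 rmorph0; ring.
  have G0 : (Gamma_fun (r.+1%:R + 2^-1 : R))%:C != 0 :> C.
    by rewrite -normc_gt0 normc_real normr_gt0 gt_eqF // Gamma_fun_gt0.
  by set g := (Gamma_fun _)%:C in G0 *; set w := E8 ^+ _; move: (pi%:C) pi0 => ppi pi0; field; apply/and5P; split; [exact: sz0|exact: i0|exact: pi0|exact: G0|exact: f0].
have h : (fun N => K * (series ((fun k => (phi k)%:C * (u ^+ 2) ^+ k) : nat -> C^o) N : C)) @ \oo --> (K * wsum phi (u ^+ 2) : C^o).
  by apply: cvgcM; [exact: cvgc_cst|exact: wsum_cvg].
have E2 : (fun N => K * (series ((fun k => (phi k)%:C * (u ^+ 2) ^+ k) : nat -> C^o) N : C)) =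
  (series ((fun r => borel_term p r z) : nat -> C^o) : nat -> C).
  by apply/funext => N; rewrite E /series /= mulr_sumr.
by rewrite E2 in h; exact: h.
Qed.

End BorelTransform.

(** * Holomorphy of the Borel transform *)

Section DerivableField.
Variable K : numFieldType.
Implicit Types (f g : K -> K) (z : K).

Lemma derivable_mulf f g z : derivable (f : K^o -> K^o) z 1 -> derivable (g : K^o -> K^o) z 1 ->
  derivable ((fun w => f w * g w) : K^o -> K^o) z 1.
Proof. by move=> hf hg; exact: (@derivableM K K^o f g z 1). Qed.

Lemma derivable_subf f g z : derivable (f : K^o -> K^o) z 1 -> derivable (g : K^o -> K^o) z 1 ->
  derivable ((fun w => f w - g w) : K^o -> K^o) z 1.
Proof. by move=> hf hg; exact: (@derivableB K K^o K^o f g z 1). Qed.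

Lemma derivable_invf f z : f z != 0 -> derivable (f : K^o -> K^o) z 1 ->
  derivable ((fun w => (f w)^-1) : K^o -> K^o) z 1.
Proof. by move=> f0 hf; exact: (@derivableV K K^o f z 1). Qed.

Lemma derivable_constf c z : derivable ((fun=> c) : K^o -> K^o) z 1.
Proof. exact: (@derivable_cst K K^o K^o c z 1). Qed.

Lemma derivable_compf g f z : derivable (g : K^o -> K^o) (f z) 1 ->
  derivable (f : K^o -> K^o) z 1 -> derivable ((fun w => g (f w)) : K^o -> K^o) z 1.
Proof.
move=> /derivable1_diffP hg /derivable1_diffP hf; apply/derivable1_diffP.
exact: (@differentiable_comp _ K^o K^o K^o f g z hf hg).
Qed.

Lemma derivable_prodf (I : Type) (s : seq I) (F : I -> K -> K) z :
  (forall i, derivable (F i : K^o -> K^o) z 1) ->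
  derivable ((fun w => \prod_(i <- s) F i w) : K^o -> K^o) z 1.
Proof.
move=> h; elim: s => [|i s ih].
  have -> : (fun w => \prod_(i <- [::]) F i w) = (fun=> 1) by apply/funext => w; rewrite big_nil.
  exact: derivable_constf.
have -> : (fun w => \prod_(i <- i :: s) F i w) = (fun w => F i w * \prod_(i <- s) F i w).
  by apply/funext => w; rewrite big_cons.
exact: derivable_mulf.
Qed.

Lemma derivable_expf f (m : int) z : f z != 0 -> derivable (f : K^o -> K^o) z 1 ->
  derivable ((fun w => f w ^ m) : K^o -> K^o) z 1.
Proof.
move=> f0 hf; have hX k : derivable ((fun w => f w ^+ k) : K^o -> K^o) z 1.
  elim: k => [|k ih]; first exact: derivable_constf.
  have -> : (fun w => f w ^+ k.+1) = (fun w => f w * f w ^+ k) by apply/funext => w; rewrite exprS.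
  exact: derivable_mulf.
case: m => m; first exact: hX.
have -> : (fun w => f w ^ Negz m) = (fun w => (f w ^+ m.+1)^-1) by apply/funext => w; rewrite NegzE -exprnN.
by apply: derivable_invf => //; rewrite expf_neq0.
Qed.

(** The shape of the Borel transform, with [s] and [e] standing for the square
    root and the exponential. *)
Lemma derivable_sinh_quotient (s e : K -> K) (I : Type) (l : seq I) (c : I -> K) (A B E : K) (m : int) z :
  derivable (s : K^o -> K^o) z 1 -> (forall w, derivable (e : K^o -> K^o) w 1) ->
  s z != 0 -> (e (E * s z / 2) - e (- (E * s z / 2))) / 2 != 0 ->
  derivable ((fun w => A / s w * (B * ((e (E * s w / 2) - e (- (E * s w / 2))) / 2) ^ m *
     \prod_(i <- l) ((e (E * s w / c i) - e (- (E * s w / c i))) / 2))) : K^o -> K^o) z 1.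
Proof.
move=> ds de s0 sh0.
have dl a : derivable ((fun w => E * s w / a) : K^o -> K^o) z 1.
  apply: (derivable_mulf (f := fun w => E * s w) (g := fun=> a^-1)); last exact: derivable_constf.
  by apply: (derivable_mulf (f := fun=> E)) => //; exact: derivable_constf.
have dsinh a : derivable ((fun w => (e (E * s w / a) - e (- (E * s w / a))) / 2) : K^o -> K^o) z 1.
  apply: (derivable_mulf (f := fun w => e (E * s w / a) - e (- (E * s w / a))) (g := fun=> 2^-1)); last exact: derivable_constf.
  apply: (derivable_subf (f := fun w => e (E * s w / a)) (g := fun w => e (- (E * s w / a)))).
    exact: (derivable_compf (g := e) (f := fun w => E * s w / a)).
  apply: (derivable_compf (g := e) (f := fun w => - (E * s w / a))) => //.
  have -> : (fun w => - (E * s w / a)) = (fun w => 0 - E * s w / a) by apply/funext => w; rewrite sub0r.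
  by apply: (derivable_subf (f := fun=> 0)) => //; exact: derivable_constf.
apply: (derivable_mulf (f := fun w => A / s w)).
  apply: (derivable_mulf (f := fun=> A) (g := fun w => (s w)^-1)); first exact: derivable_constf.
  exact: derivable_invf.
apply: (derivable_mulf (f := fun w => B * ((e (E * s w / 2) - e (- (E * s w / 2))) / 2) ^ m)).
  apply: (derivable_mulf (f := fun=> B)); first exact: derivable_constf.
  by apply: (derivable_expf (f := fun w => (e (E * s w / 2) - e (- (E * s w / 2))) / 2)).
by apply: (derivable_prodf (F := fun i w => (e (E * s w / c i) - e (- (E * s w / c i))) / 2)) => i; exact: dsinh.
Qed.

End DerivableField.

Section Holomorphy.
Variable R : realType.
Local Notation C := R[i].

(** Differentiability as an estimate of difference quotients with real radii. *)
Lemma derivable_quotient (f : C -> C) (z l : C) :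
  (forall e : R, 0 < e -> exists2 r : R, 0 < r & forall h, h != 0 -> normc h < r ->
     normc ((f (h + z) - f z) / h - l) < e) -> derivable (f : C^o -> C^o) z 1.
Proof.
move=> H; apply/cvg_ex; exists (l : C^o); apply/(@cvgc_normP R C^o (dnbhs (0 : C^o))) => e e0.
have [r r0 hr] := H e e0.
have nz : \forall h \near (0 : C^o), normc h < r.
  have := @cvgc_normP R C^o (nbhs (0 : C^o)) _ (fun z => z) 0; case=> /(_ (@cvg_id _ _)) /(_ r r0) hn _.
  by apply: filterS hn => w; rewrite subr0.
rewrite near_withinE; apply: filterS nz => h hlt h0.
have := hr h h0 hlt; congr (normc (_ - _) < _).
by rewrite -[h *: 1]/(h * 1) mulr1 mulrC.
Qed.

Lemma derivable_cexp (z : C) : derivable (@cexp R : C^o -> C^o) z 1.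
Proof.
apply: (@derivable_quotient _ z (cexp z)) => e e0.
pose B := normc (cexp z) * 2 * expR 1.
have B0 : 0 < B by rewrite !mulr_gt0 ?expR_gt0 // normc_gt0 cexp_neq0.
exists (Num.min 1 (e / B)); first by rewrite lt_min ltr01 divr_gt0.
move=> h h0; rewrite lt_min => /andP[h1 h2].
have -> : (cexp (h + z) - cexp z) / h - cexp z = cexp z * ((cexp h - \sum_(0 <= k < 2) h ^+ k / k`!%:R) / h).
  by rewrite cexpD !big_nat_recr //= big_geq // add0r expr0 expr1 fact0 !divr1; field.
rewrite (normcM (cexp z)) (normcM (_ - _)) normcV; have := taylor_remainder h 1; rewrite divr1 => t.
have n0 : 0 < normc h by rewrite normc_gt0.
apply: (@le_lt_trans _ _ (B * normc h)); last by rewrite mulrC -ltr_pdivlMr.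
rewrite /B -!mulrA ler_wpM2l ?normc_ge0 // ler_pdivrMr //.
apply: le_trans t _; rewrite -!mulrA ler_wpM2l // ler_wpM2r ?mulr_ge0 ?normc_ge0 //.
  by rewrite ler_expR ltW.
Qed.

(** The quotient [(s' - s) / (s' ^ 2 - s ^ 2)] is [(s' + s)^-1], and the real
    part of [s' + s] stays above that of [s], which is positive. *)
Lemma derivable_sqrtc (z : C) : ~ (complex.Im z = 0 /\ complex.Re z <= 0) ->
  derivable (@sqrtc R : C^o -> C^o) z 1.
Proof.
move=> hz; have s0 := Re_sqrtc_gt0 hz; set s := sqrtc z in s0.
have sn0 : s != 0 by apply/eqP => h; move: s0; rewrite h /= ltxx.
have ns : 0 < normc s by rewrite normc_gt0.
apply: (@derivable_quotient _ z ((2 * s)^-1)) => e e0.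
pose a := complex.Re s.
exists (e * (2 * a * a * normc s)) => [|h h0 hh]; first by rewrite !mulr_gt0.
pose t := sqrtc (h + z).
have t0 : 0 <= complex.Re t by exact: Re_sqrtc_ge0.
have ts : a <= normc (t + s).
  by apply: le_trans _ (normc_ge_Re _); apply: le_trans _ (ler_norm _); rewrite ReD /a; lra.
have nts : 0 < normc (t + s) by apply: lt_le_trans ts.
have ts0 : t + s != 0 by rewrite -normc_gt0.
have dts : t - s = h / (t + s).
  by apply: (mulIf ts0); rewrite divfK // -subr_sqr /t /s !sqr_sqrtc addrK.
have -> : (t - s) / h - (2 * s)^-1 = - (h / ((t + s) * (t + s) * (2 * s))).
  rewrite dts; have -> : h / (t + s) / h = (t + s)^-1 by rewrite mulrAC divff // mul1r.
  have -> : h = (t - s) * (t + s) by rewrite dts divfK.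
  by field; rewrite ts0 sn0.
rewrite normcN normcM normcV !normcM.
have -> : normc (2 : C) = 2 by rewrite -(rmorph_nat (real_complex R)) normc_real ger0_norm.
have den : 0 < normc (t + s) * normc (t + s) * (2 * normc s) by rewrite !mulr_gt0.
rewrite ltr_pdivrMr //; apply: lt_le_trans hh _; apply: ler_wpM2l; first exact: ltW.
have -> : 2 * a * a * normc s = a * a * (2 * normc s) by ring.
by apply: ler_wpM2r; [rewrite mulr_ge0 ?normc_ge0|apply: ler_pM => //; exact: ltW].
Qed.

Lemma cos_eq1 (x : R) : cos x = 1 -> exists m : int, x = 2 * pi * m%:~R.
Proof.
move=> hx; pose m := Num.floor (x / (2 * pi)).
have p2 : 0 < 2 * pi :> R by rewrite mulr_gt0 // pi_gt0.
exists m; pose y := x - 2 * pi * m%:~R.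
have y0 : 0 <= y by rewrite /y subr_ge0 mulrC -ler_pdivlMr // floor_le_tmp.
have y1 : y < 2 * pi.
  have := floorD1_gt (x / (2 * pi)); rewrite ltr_pdivrMr // rmorphD /= -/m /y; lra.
have sh (k : nat) (t : R) : cos (t + 2 * pi * k%:R) = cos t.
  elim: k => [|k ih]; first by rewrite mulr0 addr0.
  have -> : t + 2 * pi * k.+1%:R = t + 2 * pi * k%:R + pi *+ 2 by rewrite -(natr1 k) mulr2n; ring.
  by rewrite cosD2pi.
have shz (j : int) (t : R) : cos (t + 2 * pi * j%:~R) = cos t.
  case: j => k; first by rewrite -pmulrn sh.
  by rewrite -(sh k.+1 (t + _)) NegzE rmorphN /= -pmulrn; congr cos; ring.
have Ey : y + 2 * pi * m%:~R = x by rewrite /y subrK.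
have cy : cos y = 1 by rewrite -(shz m y) Ey.
have s0 : sin (y / 2) = 0.
  have := cosD (y / 2) (y / 2); rewrite -splitr cy => h; have := cos2Dsin2 (y / 2).
  by move=> h'; apply/eqP; rewrite -sqrf_eq0; apply/eqP; rewrite -!expr2 in h; lra.
have [y2|y2] := ltP 0 y; last first.
  by rewrite -Ey (_ : y = 0) ?add0r //; apply/eqP; rewrite eq_le y2 y0.
have : 0 < sin (y / 2) by apply: sin_gt0_pi; apply/andP; split; lra.
by rewrite s0 ltxx.
Qed.

Lemma cexp_eq1 (y : C) : cexp y = 1 -> exists m : int, y = 'i%C * (2 * pi * m%:~R)%:C.
Proof.
move=> h; have n1 : normc (cexp y) = 1 by rewrite h normc1.
rewrite normc_cexp in n1; have r0 : complex.Re y = 0 by apply: (@expR_inj R); rewrite n1 expR0.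
have := congr1 (@complex.Re R) h; rewrite Re_cexp r0 expR0 mul1r => /cos_eq1 [m hm].
exists m; apply: complex_eqP; rewrite ?ReM ?ImM ReiE ImiE.
  by rewrite r0 mulr0 subr0 mul0r.
by rewrite hm mulr0 add0r mul1r.
Qed.

End Holomorphy.

Section BorelHolomorphy.
Variables (R : realType) (n : nat) (p : 'I_n -> nat).
Local Notation C := R[i].
Hypothesis hp : forall j, (0 < p j)%N.
Local Notation P := (Pprod p).
Local Notation E8 := (eightpiiP R p).

(** The central hyperbolic sine vanishes at imaginary multiples of the period
    only, and these are the points that the domain leaves out. *)
Lemma Bfun_holomorphic : holomorphic_on (borel_domain p) (Bfun p : C -> C).
Proof.
move=> z [hz poles].
have s0 := Re_sqrtc_gt0 hz.
have sz0 : sqrtc z != 0 by apply/eqP => h; move: s0; rewrite h /= ltxx.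
have z0 : z != 0 by apply: contraNneq sz0 => ->; rewrite sqrtc0.
have ds := derivable_sqrtc hz.
have nz : csinh (sqrtc E8 * sqrtc z / 2) != 0.
  apply/eqP; rewrite /csinh => /eqP; rewrite mulf_eq0 invr_eq0 pnatr_eq0 orbF subr_eq0 => /eqP h.
  have : cexp (sqrtc E8 * sqrtc z) = 1.
    have -> : sqrtc E8 * sqrtc z = sqrtc E8 * sqrtc z / 2 + sqrtc E8 * sqrtc z / 2 by field.
    by rewrite cexpD {1}h -cexpD addNr cexp0.
  move=> /cexp_eq1 [m hm].
  have P0 : (P%:R : R) != 0 by rewrite pnatr_eq0 -lt0n (Pprod_gt0 hp).
  have pi0 : (pi : R) != 0 by rewrite gt_eqF ?pi_gt0.
  have i2 : 'i%C * 'i%C = -1 :> C by rewrite -expr2 sqr_i.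
  have i0 : 'i%C != 0 :> C by apply/eqP => i0; move/eqP: i2; rewrite i0 mul0r eq_sym oppr_eq0 oner_eq0.
  have zE : z = 'i%C * (pi * (m%:~R) ^+ 2 / (2 * P%:R))%:C.
    have h2 : E8 * z = - ((2 * pi * m%:~R)%:C) ^+ 2.
      by rewrite -(sqr_sqrtc E8) -{1}(sqr_sqrtc z) -exprMn hm exprMn expr2 i2 mulN1r.
    have E80 : E8 != 0.
      by rewrite /eightpiiP !mulf_neq0 // ?pnatr_eq0 -?lt0n ?(Pprod_gt0 hp) // -normc_gt0 normc_real normr_gt0.
    apply: (mulfI E80); rewrite h2 /eightpiiP.
    have -> : 8 * pi%:C * 'i%C * P%:R * ('i%C * (pi * m%:~R ^+ 2 / (2 * P%:R))%:C) =
       'i%C * 'i%C * (8 * pi * P%:R * (pi * m%:~R ^+ 2 / (2 * P%:R)))%:C :> C.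
      by rewrite !rmorphM !rmorph_nat; ring.
    by rewrite i2 mulN1r -rmorphXn; congr (- _%:C); field.
  have [m0|m0] := eqVneq m 0.
    by move/eqP: z0; apply; rewrite zE m0 expr0n /= mulr0 mul0r rmorph0 mulr0.
  apply: (poles `|m|%N); first by rewrite absz_gt0.
  by rewrite zE natr_absz intr_norm real_normK ?num_real.
exact: (@derivable_sinh_quotient C (@sqrtc R) (@cexp R) _ (index_enum 'I_n) (fun j => 2 * (p j)%:R)
  (sqrtc E8 / (2 * pi%:C * 'i%C)) 4^-1 (sqrtc E8) (2 - n%:Z) z ds (@derivable_cexp R) sz0 nz).
Qed.

End BorelHolomorphy.

(** * The Laplace integral *)

Section FBound.
Variables (R : realType) (n : nat) (p : 'I_n -> nat).
Local Notation C := R[i].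
Hypothesis hp : forall j, (0 < p j)%N.
Variable d : nat.
Hypothesis nd3 : n = d.+3.

Lemma csinhN (z : C) : csinh (- z) = - csinh z.
Proof. by rewrite /csinh opprK -[RHS]mulNr opprB. Qed.

(** The hyperbolic sines are odd, and their exponents, [2 - n] and [n] times [1],
    add up to an even number. *)
Lemma FC_even (y : C) : FC p (- y) = FC p y.
Proof.
rewrite /FC mulNr csinhN (eq_bigr (fun j => -1 * csinh (y / (2 * (p j)%:R)))); last first.
  by move=> j _; rewrite [in LHS]mulNr csinhN mulN1r.
rewrite big_split prodr_const card_ord /=.
have -> : 2 - n%:Z = - d.+1%:Z by rewrite nd3; lia.
have -> : (-1) ^+ n = (-1) ^+ d.+1 :> C by rewrite nd3 !exprS; ring.
have sN : ((-1) ^+ d.+1)^-1 = (-1) ^+ d.+1 :> C by rewrite -exprVn invrN1.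
rewrite -!exprnN (exprNn (csinh _)) invfM sN.
have s1 : (-1) ^+ d.+1 * (-1) ^+ d.+1 = 1 :> C by rewrite -exprMn mulrNN mulr1 expr1n.
set u := (-1) ^+ d.+1 in s1 *; set a := (csinh _ ^+ _)^-1; set X := \prod_j _.
by transitivity ((u * u) * (4^-1 * a * X)); [ring|rewrite s1 mul1r].
Qed.

Lemma csinh_lower (z : C) : 0 < complex.Re z -> complex.Re z / 2 <= normc (csinh z).
Proof.
move=> z0; rewrite /csinh normcM normcV.
have -> : normc (2 : C) = 2 by rewrite -(rmorph_nat (real_complex R)) normc_real ger0_norm.
rewrite ler_wpM2r ?invr_ge0 //; apply: le_trans (normcB _ _); rewrite !normc_cexp ReN.
have h1 := @expR_ge1Dx R (complex.Re z).
have h2 : expR (- complex.Re z) <= 1 by rewrite -[leRHS]expR0 ler_expR; lra.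
lra.
Qed.

Lemma csinh_upper (z : C) : normc (csinh z) <= 2 * (normc z * expR (normc z)).
Proof.
have h (w : C) : normc (cexp w - 1) <= 2 * (normc w * expR (normc w)).
  have := taylor_remainder w 0; rewrite big_nat1 expr0 fact0 !divr1 expr1 => t.
  by apply: le_trans t _; rewrite le_eqVlt; apply/orP; left; apply/eqP; ring.
have -> : csinh z = ((cexp z - 1) - (cexp (- z) - 1)) / 2 by rewrite /csinh; field.
rewrite normcM normcV.
have -> : normc (2 : C) = 2 by rewrite -(rmorph_nat (real_complex R)) normc_real ger0_norm.
rewrite ler_pdivrMr //; apply: le_trans (normcD _ _) _; rewrite normcN.
have h1 := h z; have := h (- z); rewrite normcN; lra.
Qed.

(** In a sector about the positive axis [sinh Y] is at least of the size of [Y],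
    so that the central factor is harmless up to the origin. *)
Lemma FC_bound (M : R) (Y : C) : 0 < complex.Re Y -> normc Y <= M * complex.Re Y ->
  normc (FC p Y) <= (4^-1 * (4 * M) ^+ d.+1 * 2 ^+ n) * (normc Y ^+ 2 * expR (n%:R * normc Y)).
Proof.
move=> Y0 YM; set x := complex.Re Y in Y0 YM.
have nY : 0 < normc Y by apply: lt_le_trans Y0 _; apply: le_trans (ler_norm _) (normc_ge_Re _).
have M0 : 0 < M by rewrite -(pmulr_lgt0 _ Y0); apply: lt_le_trans YM.
have n2 (k : nat) : normc (k%:R : C) = k%:R by rewrite -(rmorph_nat (real_complex R)) normc_real ger0_norm.
have half : complex.Re (Y / 2) = x / 2.
  have -> : Y / 2 = (2^-1 : R)%:C * Y by rewrite mulrC fmorphV rmorph_nat.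
  by rewrite ReM ReiE ImiE mul0r subr0 mulrC.
have lo : x / 4 <= normc (csinh (Y / 2)).
  have := @csinh_lower (Y / 2); rewrite half; have -> : x / 2 / 2 = x / 4 by field.
  by apply; rewrite divr_gt0.
have c0 : 0 < normc (csinh (Y / 2)) by apply: lt_le_trans lo; rewrite divr_gt0.
have up j : normc (csinh (Y / (2 * (p j)%:R))) <= 2 * (normc Y * expR (normc Y)).
  apply: le_trans (csinh_upper _) _; rewrite ler_wpM2l //.
  have le1 : normc (Y / (2 * (p j)%:R)) <= normc Y.
    rewrite normcM normcV -natrM n2 ler_piMr ?normc_ge0 // invf_le1 ?ltr0n ?muln_gt0 ?hp //.
    by rewrite ler1n muln_gt0 hp.
  by apply: ler_pM; rewrite ?normc_ge0 ?expR_ge0 ?ler_expR.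
rewrite /FC !normcM normcV n2 normcXz normc_prod.
have -> : 2 - n%:Z = - d.+1%:Z by rewrite nd3; lia.
rewrite -exprnN.
have b1 : (normc (csinh (Y / 2)) ^+ d.+1)^-1 <= (4 / x) ^+ d.+1.
  rewrite -exprVn; apply: lerXn2r; rewrite ?nnegrE ?invr_ge0 ?(ltW c0) ?divr_ge0 ?(ltW Y0) //.
  by rewrite -[4 / x]invrK invf_div lef_pV2 ?posrE // divr_gt0.
have b2 : \prod_j normc (csinh (Y / (2 * (p j)%:R))) <= (2 * (normc Y * expR (normc Y))) ^+ n.
  rewrite -[n in _ ^+ n]card_ord -prodr_const; apply: ler_prod => j _.
  by rewrite normc_ge0 up.
have b3 : normc Y ^+ d.+1 <= (M * x) ^+ d.+1 by apply: lerXn2r; rewrite ?nnegrE ?normc_ge0 // mulr_ge0 ?ltW.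
apply: (@le_trans _ _ (4^-1 * (4 / x) ^+ d.+1 * (2 * (normc Y * expR (normc Y))) ^+ n)).
  apply: ler_pM => //; rewrite ?mulr_ge0 ?invr_ge0 ?exprn_ge0 ?normc_ge0 //.
    by apply: prodr_ge0 => j _; exact: normc_ge0.
  by apply: ler_wpM2l.
have xd : 0 < x ^+ d.+1 by rewrite exprn_gt0.
have E1 : (2 * (normc Y * expR (normc Y))) ^+ n = 2 ^+ n * (normc Y ^+ n * expR (normc Y) ^+ n) by rewrite !exprMn.
have E2 : (4 / x) ^+ d.+1 = 4 ^+ d.+1 / x ^+ d.+1 by rewrite expr_div_n.
have E3 : (4 * M) ^+ d.+1 = 4 ^+ d.+1 * M ^+ d.+1 by rewrite exprMn.
rewrite expRM_natl E1 E2 E3.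
have -> : normc Y ^+ n = normc Y ^+ 2 * normc Y ^+ d.+1 by rewrite nd3 -exprD; congr (_ ^+ _); lia.
move: b3; rewrite exprMn; set e := expR _ ^+ n; set t := 2 ^+ n; set f := 4 ^+ d.+1; set m := M ^+ d.+1; set w := x ^+ d.+1 in xd *; set y := normc Y ^+ d.+1; set z := normc Y ^+ 2 => b3.
have -> : 4^-1 * (f / w) * (t * (z * y * e)) = (4^-1 * f * t * z * e) * (y / w) by field; rewrite gt_eqF.
have -> : 4^-1 * (f * m) * t * (z * e) = (4^-1 * f * t * z * e) * m by ring.
apply: ler_wpM2l; last by rewrite ler_pdivrMr.
by rewrite /f /t /z /e !mulr_ge0 ?exprn_ge0 ?normc_ge0 ?invr_ge0 ?expR_ge0.
Qed.

(** The bound is uniform in [delta], so that the same function dominates the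
    integrands of the whole Abel regularization; the factor [s] of the second one
    makes up for the square root in the Borel transform. *)
Lemma FC_line (y : C) : 0 < complex.Re y -> exists A K : R, [/\ 0 <= A, 
  forall s delta : R, 0 < s -> 0 <= delta <= 1 ->
    normc (FC p (s%:C * y + delta%:C)) <= A * ((1 + s) ^+ 2 * expR (K * s)) &
  forall s : R, 0 < s -> normc (FC p (s%:C * y)) <= A * (s * ((1 + s) ^+ 2 * expR (K * s)))].
Proof.
move=> y0; pose M := 1 + normc y / complex.Re y.
have ny : 0 <= normc y := normc_ge0 y.
have M1 : 1 <= M by rewrite /M lerDl divr_ge0 // ltW.
have My : normc y <= M * complex.Re y by rewrite /M mulrDl divfK ?gt_eqF // mul1r lerDr ltW.
pose A0 := 4^-1 * (4 * M) ^+ d.+1 * 2 ^+ n.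
have A00 : 0 <= A0 by rewrite /A0 !mulr_ge0 ?exprn_ge0 //; lra.
pose L := (1 + normc y) ^+ 2 * expR n%:R.
have L0 : 0 <= L by rewrite mulr_ge0 ?sqr_ge0 ?expR_ge0.
exists (A0 * L), (n%:R * normc y); split; first exact: mulr_ge0.
  move=> s delta s0 /andP[d0 d1]; set Y := _ + _.
  have ReY : complex.Re Y = s * complex.Re y + delta by rewrite /Y ReD ReM !ReiE ImiE mul0r subr0.
  have Y0 : 0 < complex.Re Y by rewrite ReY ltr_wpDr // mulr_gt0.
  have nY : normc Y <= s * normc y + delta.
    by apply: le_trans (normcD _ _) _; rewrite normcM !normc_real (gtr0_norm s0) (ger0_norm d0).
  have YM : normc Y <= M * complex.Re Y.
    rewrite ReY; apply: le_trans nY _; rewrite mulrDr; apply: lerD; last by rewrite ler_peMl.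
    by rewrite mulrCA ler_wpM2l // ltW.
  apply: le_trans (FC_bound Y0 YM) _; rewrite -/A0 -[leRHS]mulrA; apply: ler_wpM2l => //.
  have Y1 : normc Y <= (1 + normc y) * (1 + s) by nra.
  have e1 : expR (n%:R * normc Y) <= expR n%:R * expR (n%:R * normc y * s).
    rewrite -expRD ler_expR -mulrA -[X in X + _]mulr1 -mulrDr ler_wpM2l //; lra.
  have sq : normc Y ^+ 2 <= (1 + normc y) ^+ 2 * (1 + s) ^+ 2.
    by rewrite -exprMn; apply: lerXn2r; rewrite ?nnegrE ?normc_ge0 // mulr_ge0 //; lra.
  have hh := ler_pM (exprn_ge0 2 (normc_ge0 Y)) (expR_ge0 _) sq e1.
  apply: le_trans hh _.
  by rewrite le_eqVlt; apply/orP; left; apply/eqP; rewrite /L; ring.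
move=> s s0; set Y := _ * _.
have ReY : complex.Re Y = s * complex.Re y by rewrite /Y ReM !ReiE ImiE mul0r subr0.
have Y0 : 0 < complex.Re Y by rewrite ReY mulr_gt0.
have nY : normc Y = s * normc y by rewrite normcM normc_real (gtr0_norm s0).
have YM : normc Y <= M * complex.Re Y by rewrite ReY nY mulrCA ler_wpM2l // ltW.
apply: le_trans (FC_bound Y0 YM) _; rewrite -/A0 -[leRHS]mulrA; apply: ler_wpM2l => //.
rewrite nY; have e1 : expR (n%:R * (s * normc y)) <= expR n%:R * expR (n%:R * normc y * s).
  by rewrite -expRD ler_expR -[leLHS]add0r lerD // le_eqVlt; apply/orP; left; apply/eqP; ring.
have sq : (s * normc y) ^+ 2 <= (1 + normc y) ^+ 2 * (s * (1 + s) ^+ 2).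
  have a1 : normc y ^+ 2 <= (1 + normc y) ^+ 2 by nra.
  have a2 : s ^+ 2 <= s * (1 + s) ^+ 2 by nra.
  by rewrite exprMn mulrC; apply: ler_pM; rewrite ?sqr_ge0.
have hh := ler_pM (exprn_ge0 2 (mulr_ge0 (ltW s0) ny)) (expR_ge0 _) sq e1.
apply: le_trans hh _.
by rewrite le_eqVlt; apply/orP; left; apply/eqP; rewrite /L; ring.
Qed.

Lemma cvg_FC {T : Type} (F : set_system T) {FF : Filter F} (f : T -> C) (a : C) :
  0 < complex.Re a -> f @ F --> (a : C^o) -> (fun x => FC p (f x)) @ F --> (FC p a : C^o).
Proof.
move=> a0 h.
have hs (c : C) : (fun x => csinh (f x / c)) @ F --> (csinh (a / c) : C^o).
  have hc : (fun x => f x / c) @ F --> (a / c : C^o) by apply: cvgcM; [exact: h|exact: cvgc_cst].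
  apply: cvgcM; last exact: cvgc_cst.
  by apply: cvgcB; apply: cvg_cexp; [exact: hc|exact: cvgcN].
have nz : csinh (a / 2) != 0.
  rewrite -normc_gt0; apply: lt_le_trans (@csinh_lower (a / 2) _).
    have -> : a / 2 = (2^-1 : R)%:C * a by rewrite mulrC fmorphV rmorph_nat.
    by rewrite ReM ReiE ImiE mul0r subr0 divr_gt0 // mulr_gt0 ?invr_gt0.
  have -> : a / 2 = (2^-1 : R)%:C * a by rewrite mulrC fmorphV rmorph_nat.
  by rewrite ReM ReiE ImiE mul0r subr0 mulr_gt0 ?invr_gt0.
apply: cvgcM; last by apply: cvgc_prod => j _; exact: hs.
by apply: cvgcM; [exact: cvgc_cst|apply: cvgcXz; [exact: nz|exact: hs]].
Qed.

End FBound.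

Section GaussianIntegrals.
Variable R : realType.
Local Notation C := R[i].
Local Notation leb := (@lebesgue_measure R).
Local Notation D0 := (`]0, +oo[%classic : set R).

Lemma mD0 : measurable D0. Proof. exact: measurable_itv. Qed.

Lemma open_D0 : open D0. Proof. exact: interval_open. Qed.

Lemma in_D0 (t : R) : D0 t -> 0 < t. Proof. by rewrite /= in_itv /= andbT. Qed.

Lemma gauss_dom1 (kappa K L t : R) : 0 < kappa -> 0 <= t ->
  expR (- (kappa * t ^+ 2) + K * t + L) <= 4 * expR (1 + L + (K + 2) ^+ 2 / (4 * kappa)) * expR (- (1 * t)).
Proof.
move=> k0 t0; apply: le_trans (gauss_dom K L k0 t0); rewrite ler_peMl ?expR_ge0 //.
by rewrite expr2; nra.
Qed.

Lemma normc_gauss (W : C) (s : R) : normc (cexp (- ((s ^+ 2)%:C * W))) = expR (- (complex.Re W * s ^+ 2)).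
Proof. by rewrite normc_cexp ReN ReM ReiE ImiE mul0r subr0 mulrC. Qed.

Lemma cvg_gauss (W : C) (t : R) : (fun s : R => cexp (- ((s ^+ 2)%:C * W))) x @[x --> t] --> (cexp (- ((t ^+ 2)%:C * W)) : C^o).
Proof.
apply: cvg_cexp; apply: cvgcN; apply: cvgcM; last exact: cvgc_cst.
by apply: cvgc_real; exact: (@exprn_continuous R 2 t).
Qed.

Lemma gauss_integrable (W b c : C) : 0 < complex.Re W ->
  cintegrable D0 (fun s => cexp (- ((s ^+ 2)%:C * W)) * cexp (s%:C * b + c)).
Proof.
move=> W0.
apply: (@cintegrable_dom R D0 _ _ mD0 _ (integrable_exp (4 * expR (1 + complex.Re c + (complex.Re b + 2) ^+ 2 / (4 * complex.Re W))) ltr01)).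
  apply: cmeas_continuous open_D0 _ => t _; apply: cvgcM; first exact: cvg_gauss.
  apply: cvg_cexp; apply: cvgcD; last exact: cvgc_cst.
  by apply: cvgcM; [apply: cvgc_real; exact: cvg_id|exact: cvgc_cst].
move=> t /in_D0 t0; rewrite normcM normc_gauss normc_cexp ReD ReM ReiE ImiE mul0r subr0 -expRD addrA.
by rewrite (mulrC t); apply: gauss_dom1 => //; exact: ltW.
Qed.

End GaussianIntegrals.

Section RayIntegral.
Variables (R : realType) (n : nat) (p : 'I_n -> nat).
Local Notation C := R[i].
Local Notation leb := (@lebesgue_measure R).
Local Notation D0 := (`]0, +oo[%classic : set R).
Hypothesis hp : forall j, (0 < p j)%N.
Variable d : nat.
Hypothesis nd3 : n = d.+3.
Local Notation P := (Pprod p).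
Local Notation E8 := (eightpiiP R p).
Variables (tau : C) (a : R) (y : C).
Hypothesis a_range : 0 < a < pi.
Hypothesis y0 : 0 < complex.Re y.
Hypothesis yE : y = sqrtc E8 * cis (a / 2) \/ y = - (sqrtc E8 * cis (a / 2)).
Hypothesis decay : 0 < complex.Re (cis a / tau).

Let W : C := cis a / tau.
Let K0 : C := sqrtc E8 / (2 * pi%:C * 'i%C).
Let w : C := cis (a / 2).

Lemma FC_ray (s : R) : FC p (sqrtc E8 * (s%:C * w)) = FC p (s%:C * y).
Proof.
case: yE => ->; first by congr (FC p _); rewrite /w; ring.
by rewrite mulrN (FC_even p nd3); congr (FC p _); rewrite /w; ring.
Qed.

(** On a ray the square root is the root of the modulus times a constant phase;
    evenness of [F] allows either sign of it, the one with positive real part being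
    needed later. *)
Lemma ray_integrand (t : R) : 0 < t ->
  cexp (- (t%:C * cis a) / tau) * Bfun p (t%:C * cis a) * cis a =
  K0 * w * (cexp (- (t%:C * W)) * (FC p ((Num.sqrt t)%:C * y) / (Num.sqrt t)%:C)).
Proof.
move=> t0; have [a0 a1] := andP a_range.
have s0 : (Num.sqrt t)%:C != 0 :> C by rewrite -normc_gt0 normc_real normr_gt0 sqrtr_eq0 -ltNge.
have w0 : w != 0 := cis_neq0 _.
have cw : cis a = w * w :> C by rewrite -cisD -splitr.
rewrite /Bfun sqrtc_polar //; last by apply/andP; split; lra.
rewrite -/w FC_ray -/K0.
have -> : - (t%:C * cis a) / tau = - (t%:C * W) by rewrite /W mulNr mulrA.
by rewrite cw; set g := FC p _; set e := cexp _; move: K0 => k0; field; rewrite s0 w0.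
Qed.

Lemma cvg_FC_ray (t : R) : 0 < t -> (fun s : R => FC p (s%:C * y)) x @[x --> t] --> (FC p (t%:C * y) : C^o).
Proof.
move=> t0; apply: cvg_FC; first by rewrite ReM ReiE ImiE mul0r subr0 mulr_gt0.
by apply: cvgcM; [apply: cvgc_real; exact: cvg_id|exact: cvgc_cst].
Qed.

(** The substitution [t = s ^ 2] clears the square roots. *)
Lemma ray_substitution :
  [/\ ray_integrable a (fun z => cexp (- z / tau) * Bfun p z),
      cintegrable D0 (fun s => cexp (- ((s ^+ 2)%:C * W)) * FC p (s%:C * y)) &
      ray_integral a (fun z => cexp (- z / tau) * Bfun p z) =
      2 * K0 * w * cintegral D0 (fun s => cexp (- ((s ^+ 2)%:C * W)) * FC p (s%:C * y))].
Proof.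
have [A [K [A0 hA hA0]]] := FC_line hp nd3 y0.
have mD := @mD0 R; have k0 : 0 < complex.Re W := decay.
pose f (t : R) : C := K0 * w * (cexp (- (t%:C * W)) * (FC p ((Num.sqrt t)%:C * y) / (Num.sqrt t)%:C)).
pose g (s : R) : C := cexp (- ((s ^+ 2)%:C * W)) * FC p (s%:C * y).
have cf (t : R) : 0 < t -> f x @[x --> t] --> (f t : C^o).
  move=> t0; have s0 : 0 < Num.sqrt t by rewrite sqrtr_gt0.
  have cs : (fun x : R => Num.sqrt x) x @[x --> t] --> Num.sqrt t by exact: sqrt_continuous.
  apply: cvgcM; first exact: cvgc_cst.
  apply: cvgcM.
    apply: cvg_cexp; apply: cvgcN; apply: cvgcM; last exact: cvgc_cst.
    by apply: cvgc_real; exact: cvg_id.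
  apply: cvgcM.
    apply: cvg_FC; first by rewrite ReM ReiE ImiE mul0r subr0 mulr_gt0.
    by apply: cvgcM; [apply: cvgc_real; exact: cs|exact: cvgc_cst].
  apply: cvgcV; last by apply: cvgc_real; exact: cs.
  by rewrite -normc_gt0 normc_real normr_gt0 gt_eqF.
have ig : cintegrable D0 g.
  pose B := A * (4 * expR (1 + 0 + (K + 2) ^+ 2 / (4 * complex.Re W))).
  apply: (@cintegrable_dom R D0 _ _ mD _ (integrable_exp B ltr01)).
    apply: cmeas_continuous; first exact: open_D0.
    by move=> t /in_D0 t0; apply: cvgcM; [exact: cvg_gauss|exact: cvg_FC_ray].
  move=> t /in_D0 t0; rewrite /g normcM normc_gauss.
  have z01 : 0 <= (0 : R) <= 1 by rewrite lexx ler01.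
  have h := hA t 0 t0 z01; rewrite rmorph0 addr0 in h.
  apply: le_trans (ler_wpM2l (expR_ge0 _) h) _.
  rewrite /B -[leRHS]mulrA.
  have -> : expR (- (complex.Re W * t ^+ 2)) * (A * ((1 + t) ^+ 2 * expR (K * t))) =
     A * ((1 + t) ^+ 2 * expR (- (complex.Re W * t ^+ 2) + K * t + 0)) by rewrite addr0 expRD; ring.
  by apply: ler_wpM2l => //; apply: gauss_dom => //; exact: ltW.
have fb (t : R) : 0 < t -> normc (f t) <= normc (K0 * w) * (A * (4 * expR (1 + 0 + (K + 2) ^+ 2 / (4 * (complex.Re W / 2))))) * expR (- (complex.Re W / 2 * t)).
  move=> t0; have s0 : 0 < Num.sqrt t by rewrite sqrtr_gt0.
  have ts : Num.sqrt t ^+ 2 = t by rewrite sqr_sqrtr // ltW.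
  rewrite /f normcM -[leRHS]mulrA; apply: ler_wpM2l; first exact: normc_ge0.
  rewrite (normcM (cexp _)) (normcM (FC p _)) normcV normc_real (gtr0_norm s0) normc_cexp ReN ReM ReiE ImiE mul0r subr0.
  have h : normc (FC p ((Num.sqrt t)%:C * y)) / Num.sqrt t <= A * ((1 + Num.sqrt t) ^+ 2 * expR (K * Num.sqrt t)).
    by rewrite ler_pdivrMr //; apply: le_trans (hA0 _ s0) _; rewrite le_eqVlt; apply/orP; left; apply/eqP; ring.
  apply: le_trans (ler_wpM2l (expR_ge0 _) h) _.
  have k2 : 0 < complex.Re W / 2 by rewrite divr_gt0.
  have G := gauss_dom K 0 k2 (ltW s0); rewrite ts addr0 in G.
  have e1 : expR (- (1 * Num.sqrt t)) <= 1 by rewrite -[leRHS]expR0 ler_expR; lra.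
  have {}G : (1 + Num.sqrt t) ^+ 2 * expR (- (complex.Re W / 2 * t) + K * Num.sqrt t) <= 4 * expR (1 + 0 + (K + 2) ^+ 2 / (4 * (complex.Re W / 2))).
    by apply: le_trans G _; rewrite ler_piMr // mulr_ge0 // expR_ge0.
  have -> : - (t * complex.Re W) = - (complex.Re W / 2 * t) + - (complex.Re W / 2 * t) by field.
  rewrite expRD; set e := expR (- (complex.Re W / 2 * t)) in G *.
  have -> : e * e * (A * ((1 + Num.sqrt t) ^+ 2 * expR (K * Num.sqrt t))) =
     (A * e) * ((1 + Num.sqrt t) ^+ 2 * (e * expR (K * Num.sqrt t))) by ring.
  rewrite expRD -/e in G; rewrite [leRHS]mulrAC; apply: ler_wpM2l => //.
  by rewrite mulr_ge0 ?expR_ge0.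
have if_ : cintegrable D0 f.
  have k2 : 0 < complex.Re W / 2 by rewrite divr_gt0.
  apply: (@cintegrable_dom R D0 _ _ mD _ (integrable_exp (normc (K0 * w) * (A * (4 * expR (1 + 0 + (K + 2) ^+ 2 / (4 * (complex.Re W / 2)))))) k2)).
    by apply: cmeas_continuous; [exact: open_D0|move=> t /in_D0; exact: cf].
  by move=> t /in_D0; exact: fb.
have subE (s : R) : D0 s -> (2 * s)%:C * f (s ^+ 2) = 2 * K0 * w * g s.
  move=> /in_D0 s0; rewrite /f /g sqrtr_sqr (gtr0_norm s0).
  have sn : s%:C != 0 :> C by rewrite -normc_gt0 normc_real normr_gt0 gt_eqF.
  have -> : (2 * s)%:C = 2 * s%:C :> C by rewrite rmorphM rmorph_nat.
  by set e := cexp _; set h := FC p _; move: K0 => k1; field.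
have isub : cintegrable D0 (fun s => (2 * s)%:C * f (s ^+ 2)).
  by apply: (eq_cintegrable mD) (cintegrableZ mD (2 * K0 * w) ig) => s Ds; rewrite subE.
split=> //.
  by apply: (eq_cintegrable mD) if_ => t /in_D0 t0; rewrite ray_integrand.
rewrite /ray_integral -cintegralZ // -(eq_cintegral subE) -cint_substitution_sqr //.
by apply: eq_cintegral => t /in_D0 t0; rewrite ray_integrand.
Qed.

End RayIntegral.

Section LaplaceValue.
Variables (R : realType) (n : nat) (p : 'I_n -> nat).
Local Notation C := R[i].
Local Notation leb := (@lebesgue_measure R).
Local Notation D0 := (`]0, +oo[%classic : set R).
Hypothesis hp : forall j, (0 < p j)%N.
Variable d : nat.
Hypothesis nd3 : n = d.+3.
Local Notation P := (Pprod p).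
Local Notation E8 := (eightpiiP R p).
Local Notation chir r := (chi_coef p d r).

Let P0 : 0 < P%:R :> R.
Proof. by rewrite ltr0n (Pprod_gt0 hp). Qed.

Lemma cvg0_bounded (c : nat -> C) : c @ \oo --> (0 : C^o) -> exists2 M, 0 <= M & forall k, normc (c k) <= M.
Proof.
move=> /cvgc_normP /(_ 1 ltr01) [K _ hK].
have s0 : 0 <= \sum_(0 <= k < K) normc (c k) by apply: sumr_ge0 => k _; exact: normc_ge0.
exists (1 + \sum_(0 <= k < K) normc (c k)); first lra.
move=> k; have [Kk|kK] := leqP K k.
  by have := hK k Kk; rewrite subr0; lra.
have : normc (c k) <= \sum_(0 <= i < K) normc (c i).
  rewrite big_mkord (bigD1 (Ordinal kK)) //= lerDl; apply: sumr_ge0 => i _; exact: normc_ge0.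
lra.
Qed.

(** The terms of the expansion of [G] at a point of larger modulus are bounded,
    since they tend to 0. *)
Lemma chi_summable : unit_disc_summable (fun r => (chir r)%:~R : R).
Proof.
move=> x /andP[x0 x1]; pose y := (1 + x) / 2.
have y0 : 0 < y by rewrite /y; lra.
have xy : x < y by rewrite /y; lra.
have y1 : y < 1 by rewrite /y; lra.
clearbody y.
have yC0 : y%:C != 0 :> C by rewrite -normc_gt0 normc_real normr_gt0 gt_eqF.
have hy : 0 < `|y%:C : C| < 1.
  by rewrite normcE' normc_real (gtr0_norm y0); apply/andP; split; [have := y0|have := y1]; rewrite -ltcR.
have hG := chi_G_coefficients hp nd3 hy.
have [M M0 hM] := cvg0_bounded (series_term0 hG).
have ym : 0 < y ^ m_zero p by rewrite exprz_gt0.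
have r01 : 0 <= x / y < 1 by rewrite divr_ge0 ?(ltW y0) //= ltr_pdivrMr // mul1r.
exists (M / y ^ m_zero p * ((1 - x / y) ^+ 1)^-1) => N.
apply: (@le_trans _ _ (\sum_(0 <= k < N) M / y ^ m_zero p * ((nbin 0 k)%:R * (x / y) ^+ k))); last first.
  by rewrite -mulr_sumr ler_wpM2l ?divr_ge0 ?(ltW ym) // nbin_bound.
apply: ler_sum => k _; rewrite /nbin bin0 mul1r.
have := hM k; rewrite chiE normcM normcXz normc_real (gtr0_norm y0) expfzDr ?gt_eqF //.
have -> : normc ((chir k)%:~R : C) = `|(chir k)%:~R : R|.
  by rewrite -(rmorph_int (real_complex R)) normc_real.
rewrite -exprnP => h; have yk : 0 < y ^+ k by rewrite exprn_gt0.
have h' : `|(chir k)%:~R : R| <= M / (y ^ m_zero p * y ^+ k) by rewrite ler_pdivlMr // mulr_gt0.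
apply: le_trans (ler_wpM2r (exprn_ge0 k x0) h') _.
by rewrite expr_div_n le_eqVlt; apply/orP; left; apply/eqP; field; rewrite !gt_eqF.
Qed.

Let b (r : nat) : R := (m_zero p + r%:Z)%:~R / (2 * P%:R).

Lemma FC_expand (Y : C) : 0 < complex.Re Y ->
  series ((fun r => (chir r)%:~R / 16 * cexp (- (Y * (b r)%:C))) : nat -> C^o) @ \oo --> (FC p Y : C^o).
Proof.
move=> Y0; have PC : P%:R != 0 :> C by rewrite pnatr_eq0 -lt0n (Pprod_gt0 hp).
pose z : C := cexp (- Y / (2 * P%:R)).
have nz : normc z < 1.
  rewrite /z normc_cexp.
  have -> : - Y / (2 * P%:R) = (- (2 * P%:R)^-1 : R)%:C * Y.
    by rewrite rmorphN fmorphV rmorphM !rmorph_nat mulNr mulNr mulrC.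
  rewrite ReM ReiE ImiE mul0r subr0 -[X in _ < X]expR0 ltr_expR mulNr oppr_lt0 mulr_gt0 // invr_gt0 mulr_gt0 //.
have hz : 0 < `|z| < 1.
  rewrite normcE'; apply/andP; split; last by have := nz; rewrite -ltcR.
  have : 0 < normc z by rewrite normc_gt0 cexp_neq0.
  by rewrite -ltcR.
have hG := chi_G_coefficients hp nd3 hz.
rewrite -(FC_even p nd3) (FC_Gfun hp nd3) -/z.
have h : (fun N => (series ((fun r : nat => (chi p d (m_zero p + r%:Z))%:~R * z ^ (m_zero p + r%:Z)) : nat -> C^o) N : C) * 16^-1)
    @ \oo --> (Gfun p z / 16 : C^o) by apply: cvgcM; [exact: hG|exact: cvgc_cst].
have E : (fun N => (series ((fun r : nat => (chi p d (m_zero p + r%:Z))%:~R * z ^ (m_zero p + r%:Z)) : nat -> C^o) N : C) * 16^-1) =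
  (series ((fun r => (chir r)%:~R / 16 * cexp (- (Y * (b r)%:C))) : nat -> C^o) : nat -> C).
  apply/funext => N; rewrite /series /= mulr_suml; apply: eq_bigr => r _.
  rewrite chiE mulrAC; congr (_ * _); rewrite /z -cexpMz; congr cexp.
  rewrite /b rmorphM fmorphV rmorphM !rmorph_nat rmorph_int -mulrzr; field.
  exact: PC.
by rewrite E in h; exact: h.
Qed.

Let e1 (y : C) (delta : R) (r : nat) (s : R) : C := cexp (s%:C * (- (y * (b r)%:C)) + - (delta * b r)%:C).

Let e1E y delta r s : e1 y delta r s = cexp (- ((s%:C * y + delta%:C) * (b r)%:C)).
Proof.
rewrite /e1; have -> : (delta * b r)%:C = delta%:C * (b r)%:C :> C by exact: rmorphM.
by congr cexp; ring.
Qed.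

Let gauss_cmeas (W b0 c : C) : cmeas D0 (fun s : R => cexp (- ((s ^+ 2)%:C * W)) * cexp (s%:C * b0 + c)).
Proof.
apply: cmeas_continuous; first exact: open_D0.
move=> t _; apply: cvgcM; first exact: cvg_gauss.
apply: cvg_cexp; apply: cvgcD; last exact: cvgc_cst.
by apply: cvgcM; [apply: cvgc_real; exact: cvg_id|exact: cvgc_cst].
Qed.

Let mm : R := `|(m_zero p)%:~R| / (2 * P%:R).
Let mm0 : 0 <= mm.
Proof. by rewrite /mm divr_ge0 // mulr_ge0 // ltW. Qed.

Let b_lower r : b r = (m_zero p)%:~R / (2 * P%:R) + r%:R / (2 * P%:R).
Proof. by rewrite /b rmorphD /= -pmulrn mulrDl. Qed.

Let b_mm : - mm <= (m_zero p)%:~R / (2 * P%:R).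
Proof.
rewrite /mm -mulNr ler_wpM2r ?invr_ge0 ?mulr_ge0 ?(ltW P0) //.
by rewrite lerNl ler_normr lexx orbT.
Qed.

(** The shift by [delta] moves the ray into the half-plane where the expansion of
    [F] in exponentials converges uniformly, down to [s = 0]. *)
Lemma ray_abel (W y : C) (delta : R) : 0 < complex.Re W -> 0 < complex.Re y -> 0 < delta <= 1 ->
  series ((fun r => (chir r)%:~R / 16 * cintegral D0 (fun s => cexp (- ((s ^+ 2)%:C * W)) * e1 y delta r s)) : nat -> C^o)
    @ \oo --> (cintegral D0 (fun s => cexp (- ((s ^+ 2)%:C * W)) * FC p (s%:C * y + delta%:C)) : C^o).
Proof.
move=> W0 y0 /andP[d0 d1]; have mD := @mD0 R.
have P2 : 0 < (2 * P%:R)^-1 :> R by rewrite invr_gt0 mulr_gt0.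
pose rho := expR (- (delta / (2 * P%:R))).
have rho01 : 0 <= rho < 1.
  by rewrite expR_ge0 /= -[X in _ < X]expR0 ltr_expR oppr_lt0 mulr_gt0.
have [B hB] := chi_summable rho01.
have B0 : 0 <= B by have := hB 0%N; rewrite big_geq.
pose F N (s : R) : C := \sum_(0 <= r < N) (chir r)%:~R / 16 * (cexp (- ((s ^+ 2)%:C * W)) * e1 y delta r s).
have igr r : cintegrable D0 (fun s => cexp (- ((s ^+ 2)%:C * W)) * e1 y delta r s) by exact: gauss_integrable.
have E : (series ((fun r => (chir r)%:~R / 16 * cintegral D0 (fun s => cexp (- ((s ^+ 2)%:C * W)) * e1 y delta r s)) : nat -> C^o) : nat -> C)
   = (fun N => cintegral D0 (F N)).
  apply/funext => N; rewrite /series /= /F cintegral_sum //; last by move=> r; exact: cintegrableZ.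
  by apply: eq_bigr => r _; rewrite cintegralZ.
suff H : (fun N => cintegral D0 (F N)) @ \oo --> (cintegral D0 (fun s => cexp (- ((s ^+ 2)%:C * W)) * FC p (s%:C * y + delta%:C)) : C^o).
  by move: H; rewrite -E.
pose G := B * (4 * expR (1 + mm + (mm * complex.Re y + 2) ^+ 2 / (4 * complex.Re W))).
apply: (fun h2 h3 h4 h5 => (@cint_dct R D0 F (fun s => cexp (- ((s ^+ 2)%:C * W)) * FC p (s%:C * y + delta%:C)) (fun s => G * expR (- (1 * s))) mD h2 h3 h4 h5).2).
- move=> N; apply: cmeas_sum => r.
  apply: cmeas_continuous; first exact: open_D0.
  move=> t _; apply: cvgcM; first exact: cvgc_cst.
  apply: cvgcM; first exact: cvg_gauss.
  apply: cvg_cexp; apply: cvgcD; last exact: cvgc_cst.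
  by apply: cvgcM; [apply: cvgc_real; exact: cvg_id|exact: cvgc_cst].
- move=> s /in_D0 s0.
  have Y0 : 0 < complex.Re (s%:C * y + delta%:C) by rewrite ReD ReM !ReiE ImiE mul0r subr0 addr_gt0 // mulr_gt0.
  have h : (fun N => cexp (- ((s ^+ 2)%:C * W)) * (series ((fun r => (chir r)%:~R / 16 * cexp (- ((s%:C * y + delta%:C) * (b r)%:C))) : nat -> C^o) N : C))
     @ \oo --> (cexp (- ((s ^+ 2)%:C * W)) * FC p (s%:C * y + delta%:C) : C^o).
    by apply: cvgcM; [exact: cvgc_cst|exact: FC_expand].
  have E3 : (fun N => cexp (- ((s ^+ 2)%:C * W)) * (series ((fun r => (chir r)%:~R / 16 * cexp (- ((s%:C * y + delta%:C) * (b r)%:C))) : nat -> C^o) N : C)) = (F ^~ s).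
    by apply/funext => N; rewrite /F /series /= mulr_sumr; apply: eq_bigr => r _; rewrite e1E mulrCA.
  by rewrite E3 in h; exact: h.
- exact: integrable_exp.
move=> N s /in_D0 s0.
have term r : normc ((chir r)%:~R / 16 * (cexp (- ((s ^+ 2)%:C * W)) * e1 y delta r s)) <=
    expR (- (complex.Re W * s ^+ 2)) * expR ((mm * complex.Re y) * s + mm) * (`|(chir r)%:~R : R| * rho ^+ r).
  rewrite normcM (normcM (cexp _)) normc_gauss normcM normcV.
  have -> : normc ((chir r)%:~R : C) = `|(chir r)%:~R : R| by rewrite -(rmorph_int (real_complex R)) normc_real.
  have -> : normc (16 : C) = 16 by rewrite -(rmorph_nat (real_complex R)) normc_real ger0_norm.
  rewrite [leRHS]mulrCA; apply: ler_pM; rewrite ?divr_ge0 ?mulr_ge0 ?expR_ge0 ?normc_ge0 //.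
    by rewrite ler_piMr // invf_le1 //; lra.
  rewrite -[leRHS]mulrA; apply: ler_wpM2l; first exact: expR_ge0.
  rewrite e1E normc_cexp ReN ReM ReD ReM !ReiE !ImiE mul0r subr0 mulr0 subr0 /rho -expRM_natl -expRD ler_expR b_lower.
  have t1 : 0 <= s * complex.Re y by rewrite mulr_ge0 ?ltW.
  have t2 : 0 <= r%:R / (2 * P%:R) :> R by rewrite mulr_ge0 // ltW.
  have := b_mm; set c := (m_zero p)%:~R / (2 * P%:R); set e := r%:R / _ in t2 *; move=> hc.
  have -> : r%:R * - (delta / (2 * P%:R)) = - (delta * e) by rewrite /e; ring.
  have cm : 0 <= c + mm by rewrite -lerBlDr sub0r.
  have : 0 <= (s * complex.Re y) * e by rewrite mulr_ge0.
  have : 0 <= (s * complex.Re y + delta) * (c + mm) by apply: mulr_ge0 => //; apply: addr_ge0 => //; exact: ltW.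
  have := mm0; nra.
apply: le_trans (normc_sum _ _ _) _; apply: le_trans (ler_sum _ (fun r _ => term r)) _.
rewrite -mulr_sumr; apply: (@le_trans _ _ (expR (- (complex.Re W * s ^+ 2)) * expR (mm * complex.Re y * s + mm) * B)).
  by apply: ler_wpM2l; rewrite ?mulr_ge0 ?expR_ge0 ?hB.
rewrite /G -expRD [leLHS]mulrC -[leRHS]mulrA; apply: ler_wpM2l => //; rewrite addrA.
by apply: gauss_dom1 => //; exact: ltW.
Qed.

(** The shift is removed by dominated convergence, thanks to bounds that do not
    depend on it. *)
Lemma ray_abel_limit (W y : C) : 0 < complex.Re W -> 0 < complex.Re y ->
  (fun j : nat => cintegral D0 (fun s => cexp (- ((s ^+ 2)%:C * W)) * FC p (s%:C * y + (j.+1%:R^-1 : R)%:C))) @ \oo -->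
    (cintegral D0 (fun s => cexp (- ((s ^+ 2)%:C * W)) * FC p (s%:C * y)) : C^o).
Proof.
move=> W0 y0; have [A [K [A0 hA _]]] := FC_line hp nd3 y0.
have mD := @mD0 R.
pose G := A * (4 * expR (1 + 0 + (K + 2) ^+ 2 / (4 * complex.Re W))).
have ReY (s delta : R) : 0 < s -> 0 <= delta -> 0 < complex.Re (s%:C * y + delta%:C).
  by move=> s0 d0; rewrite ReD ReM !ReiE ImiE mul0r subr0 ltr_wpDr // mulr_gt0.
apply: (fun h2 h3 h4 h5 => (@cint_dct R D0 (fun j s => cexp (- ((s ^+ 2)%:C * W)) * FC p (s%:C * y + (j.+1%:R^-1 : R)%:C)) (fun s => cexp (- ((s ^+ 2)%:C * W)) * FC p (s%:C * y)) (fun s => G * expR (- (1 * s))) mD h2 h3 h4 h5).2).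
- move=> j; apply: cmeas_continuous; first exact: open_D0.
  move=> t /in_D0 t0; apply: cvgcM; first exact: cvg_gauss.
  apply: cvg_FC; first by apply: ReY => //; rewrite invr_ge0.
  apply: cvgcD; last exact: cvgc_cst.
  by apply: cvgcM; [apply: cvgc_real; exact: cvg_id|exact: cvgc_cst].
- move=> s /in_D0 s0; apply: cvgcM; first exact: cvgc_cst.
  apply: cvg_FC; first by rewrite ReM ReiE ImiE mul0r subr0 mulr_gt0.
  have h : (fun j : nat => s%:C * y + (j.+1%:R^-1 : R)%:C) @ \oo --> (s%:C * y + (0 : R)%:C : C^o).
    by apply: cvgcD; [exact: cvgc_cst|apply: cvgc_real; exact: cvg_harmonic].
  by rewrite rmorph0 addr0 in h; exact: h.
- exact: integrable_exp.
move=> j s /in_D0 s0; rewrite normcM normc_gauss.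
have dj : 0 <= (j.+1%:R^-1 : R) <= 1 by rewrite invr_ge0 ler0n /= invf_le1 ?ltr0n // ler1n.
apply: le_trans (ler_wpM2l (expR_ge0 _) (hA s _ s0 dj)) _.
rewrite /G -[leRHS]mulrA.
have -> : expR (- (complex.Re W * s ^+ 2)) * (A * ((1 + s) ^+ 2 * expR (K * s))) =
   A * ((1 + s) ^+ 2 * expR (- (complex.Re W * s ^+ 2) + K * s + 0)) by rewrite addr0 expRD; ring.
by apply: ler_wpM2l => //; apply: gauss_dom => //; exact: ltW.
Qed.

Variables (tau : C) (alpha beta : R).
Hypothesis tau0 : 0 < complex.Im tau.
Hypothesis ha : 0 < alpha < pi / 2.
Hypothesis hb : pi / 2 < beta < pi.
Hypothesis da : 0 < complex.Re (cis alpha / tau).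
Hypothesis db : 0 < complex.Re (cis beta / tau).
Variable V : C.
Hypothesis hV : series ((fun r : nat => (chi p d (m_zero p + r%:Z))%:~R * qpow tau ((m_zero p + r%:Z)%:~R ^+ 2 / (4 * P%:R))) : nat -> C^o) @ \oo --> (V : C^o).

Let g : C := sqrtc tau.
Let g2 : g ^+ 2 = tau. Proof. exact: sqr_sqrtc. Qed.
Let Rg : 0 < complex.Re g.
Proof. by apply: Re_sqrtc_gt0 => -[h _]; move: tau0; rewrite h ltxx. Qed.
Let Ig : 0 < complex.Im g.
Proof. by move: tau0; rewrite -g2 expr2 ImM => h; have := Rg; nra. Qed.
Let g0 : g != 0.
Proof. by apply/eqP => h; move: Rg; rewrite h ltxx. Qed.
Let tau_neq0 : tau != 0.
Proof. by rewrite -g2 expf_neq0. Qed.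

Let c0 : C := sqrtc E8.
Let c0E : c0 = (Num.sqrt (8 * pi * P%:R))%:C * cis (pi / 4).
Proof.
have pi0 := @pi_gt0 R.
have -> : c0 = sqrtc ((8 * pi * P%:R)%:C * cis (pi / 2)).
  congr sqrtc; rewrite cisE cos_pihalf sin_pihalf /eightpiiP -/('i%C) !rmorphM !rmorph_nat.
  by rewrite (_ : 0 +i* 1 = 'i%C :> C) //; ring.
rewrite sqrtc_polar; [|by rewrite !mulr_gt0|by apply/andP; split; lra].
by congr (_ * cis _); field.
Qed.

Let sP : 0 < Num.sqrt (8 * pi * P%:R) :> R.
Proof. by rewrite sqrtr_gt0 !mulr_gt0 ?pi_gt0. Qed.

Let Re_c0 (x : R) : complex.Re (c0 * cis x) = Num.sqrt (8 * pi * P%:R) * cos (pi / 4 + x).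
Proof.
have -> : c0 * cis x = (Num.sqrt (8 * pi * P%:R))%:C * cis (pi / 4 + x) by rewrite c0E cisD; ring.
by rewrite ReM ReiE ImiE mul0r subr0 Re_cis.
Qed.

Let ya := c0 * cis (alpha / 2).
Let yb := - (c0 * cis (beta / 2)).

Let ya0 : 0 < complex.Re ya.
Proof.
have [a1 a2] := andP ha; have pi0 := @pi_gt0 R.
by rewrite Re_c0 mulr_gt0 // cos_gt0_pihalf //; apply/andP; split; lra.
Qed.

Let yb0 : 0 < complex.Re yb.
Proof.
have [a1 a2] := andP hb; have pi0 := @pi_gt0 R.
rewrite ReN Re_c0 -mulrN mulr_gt0 //.
have -> : pi / 4 + beta / 2 = (pi / 4 + beta / 2 - pi) + pi by ring.
by rewrite cosDpi opprK cos_gt0_pihalf //; apply/andP; split; lra.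
Qed.

(** Convergence of the Laplace integral along a ray is the condition that its
    image lies in the sector where [exp (- w ^ 2)] decays. *)
Let sector (a : R) : 0 < a < pi -> 0 < complex.Re (cis a / tau) ->
  `|complex.Im (cis (a / 2) / g)| < complex.Re (cis (a / 2) / g).
Proof.
move=> /andP[a0 a1] dec; set v := cis (a / 2) / g.
have v2 : v ^+ 2 = cis a / tau by rewrite /v exprMn exprVn g2 cis_sqr mulr2n -splitr.
have Rv : 0 < complex.Re v.
  have n2 : 0 < complex.Re g ^+ 2 + complex.Im g ^+ 2 by have := Rg; nra.
  have vg : cis (a / 2) = v * g by rewrite /v divfK.
  have h1 := congr1 (@complex.Re R) vg; have h2 := congr1 (@complex.Im R) vg.
  rewrite ReM Re_cis in h1; rewrite ImM Im_cis in h2.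
  have ca : 0 < cos (a / 2) by apply: cos_gt0_pihalf; apply/andP; split; lra.
  have sa : 0 < sin (a / 2) by apply: sin_gt0_pi; apply/andP; split; lra.
  have : complex.Re v * (complex.Re g ^+ 2 + complex.Im g ^+ 2) = cos (a / 2) * complex.Re g + sin (a / 2) * complex.Im g.
    by rewrite h1 h2; ring.
  have : 0 < cos (a / 2) * complex.Re g + sin (a / 2) * complex.Im g by rewrite addr_gt0 // mulr_gt0.
  by move=> h e; rewrite -(pmulr_lgt0 _ n2) e.
move: dec; rewrite -v2 expr2 ReM => h; rewrite ltr_norml; apply/andP; split; nra.
Qed.

Let a_range : 0 < alpha < pi.
Proof. by have [a1 a2] := andP ha; have pi0 := @pi_gt0 R; apply/andP; split; lra. Qed.
Let b_range : 0 < beta < pi.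
Proof. by have [a1 a2] := andP hb; have pi0 := @pi_gt0 R; apply/andP; split; lra. Qed.

(** Completing the square turns each term into a pair of Gaussian rays whose
    common origin depends on [delta] and [r] only. *)
Let two_rays (delta : R) r :
  cis (alpha / 2) * cintegral D0 (fun s => cexp (- ((s ^+ 2)%:C * (cis alpha / tau))) * e1 ya delta r s) +
  cis (beta / 2) * cintegral D0 (fun s => cexp (- ((s ^+ 2)%:C * (cis beta / tau))) * e1 yb delta r s) =
  cexp (- (delta * b r))%:C * (g * (Num.sqrt pi)%:C * qpow tau ((m_zero p + r%:Z)%:~R ^+ 2 / (4 * P%:R))).
Proof.
have mD := @mD0 R.
have PC : P%:R != 0 :> C by rewrite pnatr_eq0 -lt0n (Pprod_gt0 hp).
pose m : R := (m_zero p + r%:Z)%:~R.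
pose dd : C := c0 * m%:C * g / (4 * P%:R).
have ia := gauss_integrable (- (ya * (b r)%:C)) (- (delta * b r)%:C) da.
have ib := gauss_integrable (- (yb * (b r)%:C)) (- (delta * b r)%:C) db.
rewrite -!cintegralZ // -cintegralD //; try exact: cintegrableZ.
have mE : (m ^+ 2 / (4 * P%:R))%:C = m%:C ^+ 2 / (4 * P%:R) :> C.
  by rewrite rmorphM fmorphV rmorphXn rmorphM !rmorph_nat.
have q : qpow tau (m ^+ 2 / (4 * P%:R)) = cexp (dd ^+ 2).
  rewrite /qpow mE; congr cexp; rewrite /dd !exprMn exprVn g2 /c0 sqr_sqrtc /eightpiiP.
  by field.
rewrite q -(gauss_rays dd (sector a_range da) (sector b_range db)).
have bE : (b r)%:C = m%:C / (2 * P%:R) :> C by rewrite /b rmorphM fmorphV rmorphM !rmorph_nat.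
have cw (x : R) : cis x = cis (x / 2) ^+ 2 :> C by rewrite cis_sqr mulr2n -splitr.
pose k : C := cexp (- (delta * b r))%:C * (g * cexp (dd ^+ 2)).
have nE : (- (delta * b r))%:C = - (delta * b r)%:C :> C by rewrite rmorphN.
have pt (a s : R) (y : C) (eps : C) : eps * eps = 1 -> y = eps * (c0 * cis (a / 2)) ->
    cis (a / 2) * (cexp (- ((s ^+ 2)%:C * (cis a / tau))) * e1 y delta r s) =
    k * (cis (a / 2) / g * cexp (- (cis (a / 2) / g * s%:C + eps * dd) ^+ 2)).
  move=> ee yE; have -> : cexp (- ((s ^+ 2)%:C * (cis a / tau))) * e1 y delta r s =
      cexp (- (delta * b r))%:C * cexp (dd ^+ 2) * cexp (- (cis (a / 2) / g * s%:C + eps * dd) ^+ 2).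
    rewrite /e1 -!cexpD; congr cexp; rewrite nE bE yE (cw a) -g2.
    have -> : (s ^+ 2)%:C = s%:C ^+ 2 :> C by rewrite rmorphXn.
    have -> : (cis (a / 2) / g * s%:C + eps * dd) ^+ 2 =
      (cis (a / 2) / g * s%:C) ^+ 2 + eps * (2 * (cis (a / 2) / g * s%:C) * dd) + (eps * eps) * dd ^+ 2 by ring.
    by rewrite ee mul1r /dd; set u := cis (a / 2); field; rewrite g0 PC.
  by rewrite /k; set u := cis (a / 2); set A := cexp (- _)%:C; set B := cexp (dd ^+ 2); set D := cexp (- (_ ^+ 2)); field.
have ptI (s : R) : cis (alpha / 2) * (cexp (- ((s ^+ 2)%:C * (cis alpha / tau))) * e1 ya delta r s) +
     cis (beta / 2) * (cexp (- ((s ^+ 2)%:C * (cis beta / tau))) * e1 yb delta r s) =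
   k * (cis (alpha / 2) / g * cexp (- (cis (alpha / 2) / g * s%:C + dd) ^+ 2) +
     cis (beta / 2) / g * cexp (- (cis (beta / 2) / g * s%:C - dd) ^+ 2)).
  rewrite (pt alpha s ya 1) ?mul1r // (pt beta s yb (-1)); [|by rewrite mulrNN mulr1|by rewrite mulN1r].
  by rewrite mulN1r mulrDr.
have k0 : k != 0 by apply: mulf_neq0; [exact: cexp_neq0|apply: mulf_neq0; [exact: g0|exact: cexp_neq0]].
set I := cintegral _ _; set J := cintegral _ _.
suff -> : I = k * J by rewrite /k; ring.
rewrite /I /J -cintegralZ //; first by apply: eq_cintegral => s _; rewrite ptI.
have iz : cintegrable D0 (fun s => k^-1 * (cis (alpha / 2) * (cexp (- ((s ^+ 2)%:C * (cis alpha / tau))) * e1 ya delta r s) +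
   cis (beta / 2) * (cexp (- ((s ^+ 2)%:C * (cis beta / tau))) * e1 yb delta r s))).
  by apply: cintegrableZ => //; apply: cintegrableD => //; exact: cintegrableZ.
by apply: (eq_cintegrable mD) iz => s _; rewrite ptI mulKf.
Qed.

Let wa : C := cis (alpha / 2).
Let wb : C := cis (beta / 2).
Let Ia := cintegral D0 (fun s => cexp (- ((s ^+ 2)%:C * (cis alpha / tau))) * FC p (s%:C * ya)).
Let Ib := cintegral D0 (fun s => cexp (- ((s ^+ 2)%:C * (cis beta / tau))) * FC p (s%:C * yb)).

(** Both sides are limits of the regularization as [delta] tends to 0: the left
    one by continuity of the ray integrals, the right one term by term. *)
Let abel_value : wa * Ia + wb * Ib = g * (Num.sqrt pi)%:C / 16 * V.
Proof.
pose qq r : C := qpow tau ((m_zero p + r%:Z)%:~R ^+ 2 / (4 * P%:R)).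
pose dl (j : nat) : R := j.+1%:R^-1.
have dl01 j : 0 < dl j <= 1 by rewrite /dl invr_gt0 ltr0n /= invf_le1 ?ltr0n // ler1n.
pose G : C := g * (Num.sqrt pi)%:C.
pose u j r : C := (chir r)%:~R / 16 * (cexp (- (dl j * b r))%:C * (G * qq r)).
pose v r : C := (chir r)%:~R / 16 * (G * qq r).
pose U j : C := wa * cintegral D0 (fun s => cexp (- ((s ^+ 2)%:C * (cis alpha / tau))) * FC p (s%:C * ya + (dl j)%:C)) +
  wb * cintegral D0 (fun s => cexp (- ((s ^+ 2)%:C * (cis beta / tau))) * FC p (s%:C * yb + (dl j)%:C)).
have UL : U @ \oo --> (wa * Ia + wb * Ib : C^o).
  apply: cvgcD; (apply: cvgcM; first exact: cvgc_cst).
    exact: ray_abel_limit da ya0.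
  exact: ray_abel_limit db yb0.
have [A [x [A0 x01 hq]]] := @qpow_sq_bound R n p hp tau (m_zero p) tau0.
have [B hB] := chi_summable x01.
have n16 : normc (16 : C) = 16 by rewrite -(rmorph_nat (real_complex R)) normc_real ger0_norm.
have nchi r : normc ((chir r)%:~R : C) = `|(chir r)%:~R : R| by rewrite -(rmorph_int (real_complex R)) normc_real.
have ub j r : normc (u j r) <= (expR mm * (normc G * A)) * (`|(chir r)%:~R : R| * x ^+ r).
  rewrite /u normcM normcM normcV nchi n16 (normcM (cexp _)) (normcM G) cexp_real normc_real (ger0_norm (expR_ge0 _)).
  have [d0 d1] := andP (dl01 j).
  have ebound : expR (- (dl j * b r)) <= expR mm.
    rewrite ler_expR b_lower; have t2 : 0 <= r%:R / (2 * P%:R) :> R by rewrite mulr_ge0 // invr_ge0 mulr_ge0 // ltW.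
    have := b_mm; set c := (m_zero p)%:~R / (2 * P%:R); set e := r%:R / _ in t2 *; move=> hc.
    have : 0 <= dl j * e by rewrite mulr_ge0 // ltW.
    have cm : 0 <= c + mm by rewrite -lerBlDr sub0r.
    have : 0 <= dl j * (c + mm) by exact: mulr_ge0 (ltW d0) cm.
    have : 0 <= (1 - dl j) * mm by rewrite mulr_ge0 ?subr_ge0.
    nra.
  have h1 : normc G * normc (qq r) <= normc G * (A * x ^+ r) by apply: ler_wpM2l; [exact: normc_ge0|exact: hq].
  have h2 := ler_pM (expR_ge0 _) (mulr_ge0 (normc_ge0 _) (normc_ge0 _)) ebound h1.
  have h3 : `|(chir r)%:~R : R| / 16 <= `|(chir r)%:~R : R| by rewrite ler_piMr // invf_le1 //; lra.
  apply: le_trans (ler_pM _ _ h3 h2) _; rewrite ?divr_ge0 ?mulr_ge0 ?expR_ge0 ?normc_ge0 //.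
  by rewrite le_eqVlt; apply/orP; left; apply/eqP; ring.
have bsum N : \sum_(0 <= r < N) (expR mm * (normc G * A)) * (`|(chir r)%:~R : R| * x ^+ r) <= (expR mm * (normc G * A)) * B.
  by rewrite -mulr_sumr ler_wpM2l // !mulr_ge0 ?expR_ge0 ?normc_ge0.
have uv r : (fun j => u j r) @ \oo --> (v r : C^o).
  apply: cvgcM; first exact: cvgc_cst.
  have h : (fun j => cexp (- (dl j * b r))%:C * (G * qq r)) @ \oo --> (cexp (0 : R)%:C * (G * qq r) : C^o).
    apply: cvgcM; last exact: cvgc_cst.
    apply: cvg_cexp; apply: cvgc_real; rewrite -[X in _ --> X]oppr0 -(mul0r (b r)).
    by apply: cvgN; apply: cvgM; [exact: cvg_harmonic|exact: cvg_cst].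
  by rewrite rmorph0 cexp0 mul1r in h; exact: h.
have uU j : series (u j : nat -> C^o) @ \oo --> (U j : C^o).
  have h1 := ray_abel da ya0 (dl01 j); have h2 := ray_abel db yb0 (dl01 j).
  have h : (fun N => wa * (series ((fun r => (chir r)%:~R / 16 * cintegral D0 (fun s => cexp (- ((s ^+ 2)%:C * (cis alpha / tau))) * e1 ya (dl j) r s)) : nat -> C^o) N : C) +
     wb * (series ((fun r => (chir r)%:~R / 16 * cintegral D0 (fun s => cexp (- ((s ^+ 2)%:C * (cis beta / tau))) * e1 yb (dl j) r s)) : nat -> C^o) N : C)) @ \oo --> (U j : C^o).
    by apply: cvgcD; (apply: cvgcM; first exact: cvgc_cst); [exact: h1|exact: h2].
  suff E : (series (u j : nat -> C^o) : nat -> C) = (fun N => wa * (series ((fun r => (chir r)%:~R / 16 * cintegral D0 (fun s => cexp (- ((s ^+ 2)%:C * (cis alpha / tau))) * e1 ya (dl j) r s)) : nat -> C^o) N : C) +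
     wb * (series ((fun r => (chir r)%:~R / 16 * cintegral D0 (fun s => cexp (- ((s ^+ 2)%:C * (cis beta / tau))) * e1 yb (dl j) r s)) : nat -> C^o) N : C)).
    by move: h; rewrite -E.
  apply/funext => N; rewrite /series /= !mulr_sumr -big_split; apply: eq_bigr => r _.
  by rewrite /u /qq -two_rays mulrDr; congr (_ + _); rewrite mulrCA.
have vV : series (v : nat -> C^o) @ \oo --> (G / 16 * V : C^o).
  have h : (fun N => G / 16 * (series ((fun r : nat => (chi p d (m_zero p + r%:Z))%:~R * qpow tau ((m_zero p + r%:Z)%:~R ^+ 2 / (4 * P%:R))) : nat -> C^o) N : C)) @ \oo --> (G / 16 * V : C^o).
    by apply: cvgcM; [exact: cvgc_cst|exact: hV].
  suff E : (series (v : nat -> C^o) : nat -> C) = (fun N => G / 16 * (series ((fun r : nat => (chi p d (m_zero p + r%:Z))%:~R * qpow tau ((m_zero p + r%:Z)%:~R ^+ 2 / (4 * P%:R))) : nat -> C^o) N : C)).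
    by move: h; rewrite -E.
  apply/funext => N; rewrite /series /= mulr_sumr; apply: eq_bigr => r _.
  by rewrite chiE /v /qq; set z := qpow _ _; set c := _%:~R; field.
exact: cvgc_unique UL (tannery ub bsum uv uU vV).
Qed.

(** Only constants remain: those of the closed form of the Borel transform, of the
    substitution and of the Gaussian integral multiply to the inverse of
    [lambda / sqrtc tau]. *)
Lemma laplace_value : laplace_converges alpha beta (Bfun p) tau /\
  V = lambda R p / sqrtc tau * laplace alpha beta (Bfun p) tau.
Proof.
have [c1 _ r1] := ray_substitution hp nd3 a_range ya0 (or_introl erefl) da.
have [c2 _ r2] := ray_substitution hp nd3 b_range yb0 (or_intror erefl) db.
split; first by split.
have -> : laplace alpha beta (Bfun p) tau = 2 * (c0 / (2 * pi%:C * 'i%C)) * (wa * Ia + wb * Ib).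
  by rewrite /laplace r1 r2 -/Ia -/Ib -/wa -/wb -/c0; ring.
rewrite abel_value -/g c0E /lambda.
have pi0 := @pi_gt0 R.
have -> : Num.sqrt (8 * pi * P%:R) = 2 * Num.sqrt pi * Num.sqrt (2 * P%:R) :> R.
  have -> : 8 * pi * P%:R = 2 ^+ 2 * pi * (2 * P%:R) :> R by ring.
  have h1 : 0 <= 2 ^+ 2 * pi :> R by rewrite mulr_ge0 ?sqr_ge0 ?(ltW pi0).
  by rewrite (sqrtrM _ h1) (sqrtrM _ (sqr_ge0 2)) sqrtr_sqr ger0_norm.
have piE : pi%:C = (Num.sqrt pi)%:C * (Num.sqrt pi)%:C :> C.
  by rewrite -rmorphM -expr2 sqr_sqrtr // ltW.
have iE : 'i%C = cis (pi / 4) * cis (pi / 4) :> C.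
  have q4 : pi / 4 + pi / 4 = pi / 2 :> R by field.
  by rewrite -cisD q4 cisE cos_pihalf sin_pihalf.
have Q0 : (Num.sqrt pi)%:C != 0 :> C by rewrite -normc_gt0 normc_real normr_gt0 sqrtr_eq0 -ltNge.
have S0 : (Num.sqrt (2 * P%:R))%:C != 0 :> C.
  by rewrite -normc_gt0 normc_real normr_gt0 sqrtr_eq0 -ltNge mulr_gt0.
have e0 : cis (pi / 4) != 0 :> C := cis_neq0 _.
have -> : (2 * Num.sqrt pi * Num.sqrt (2 * P%:R))%:C = 2 * (Num.sqrt pi)%:C * (Num.sqrt (2 * P%:R))%:C :> C.
  by rewrite !rmorphM rmorph_nat.
rewrite piE iE; have := g0.
move: Q0 S0 e0; set Q := (Num.sqrt pi)%:C; set S := (Num.sqrt _)%:C; set e := cis _ => Q0 S0 e0 gg.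
by field; rewrite Q0 S0 e0 gg.
Qed.

End LaplaceValue.

(** * The equality of the three expressions *)

Section Assembly.
Variable R : realType.
Local Notation C := R[i].

Lemma Re_cis_div (tau : C) (a : R) : 0 < cos a * complex.Re tau + sin a * complex.Im tau ->
  0 < complex.Re (cis a / tau).
Proof.
have [->|t0] := eqVneq tau 0; first by rewrite Re0 Im0 !mulr0 addr0 ltxx.
move=> h; set W := cis a / tau; have Wt : cis a = W * tau by rewrite /W divfK.
have h1 := congr1 (@complex.Re R) Wt; have h2 := congr1 (@complex.Im R) Wt.
rewrite ReM Re_cis in h1; rewrite ImM Im_cis in h2.
have e : complex.Re W * (complex.Re tau ^+ 2 + complex.Im tau ^+ 2) = cos a * complex.Re tau + sin a * complex.Im tau.
  by rewrite h1 h2; ring.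
have n0 : 0 <= complex.Re tau ^+ 2 + complex.Im tau ^+ 2 by rewrite addr_ge0 ?sqr_ge0.
rewrite ltNge; apply/negP => W0; move: h; rewrite -e ltNge => /negP; apply.
by rewrite mulr_le0_ge0.
Qed.

(** The standard contour serves the [tau] of the sector about the imaginary axis;
    for other [tau] the two rays have to be turned. *)
Lemma standard_contour (tau : C) : `|complex.Re tau| < complex.Im tau ->
  0 < complex.Re (cis (pi / 4) / tau) /\ 0 < complex.Re (cis (3 * pi / 4) / tau).
Proof.
rewrite ltr_norml => /andP[t1 t2]; have pi0 := @pi_gt0 R.
have c4 : 0 < cos (pi / 4 : R) by apply: cos_gt0_pihalf; apply/andP; split; lra.
have s4 : sin (pi / 4 : R) = cos (pi / 4).
  have q4 : pi / 4 = pi / 2 - pi / 4 :> R by field.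
  by rewrite [in RHS]q4 cosB cos_pihalf sin_pihalf mul0r mul1r add0r.
split; apply: Re_cis_div.
  by rewrite s4 -mulrDr mulr_gt0 //; lra.
have e3 : 3 * pi / 4 = - (pi / 4) + pi :> R by field.
rewrite e3 cosDpi sinDpi cosN sinN opprK s4.
have -> : - cos (pi / 4) * complex.Re tau + cos (pi / 4) * complex.Im tau = cos (pi / 4) * (complex.Im tau - complex.Re tau) by ring.
by rewrite mulr_gt0 //; lra.
Qed.

End Assembly.

Theorem theorem3 (R : realType) (n : nat) (p : 'I_n -> nat)
    (hn : (3 <= n)%N) (hp : forall j, (0 < p j)%N)
    (hcop : forall i j, i != j -> coprime (p i) (p j)) :
  exists (m0 : int) (chi : int -> int) (B : R[i] -> R[i]),
  [/\ m0%:~R = (Pprod p)%:R * (n%:R - 2 - \sum_j (p j)%:R^-1) :> rat,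
      G_coefficients R p m0 chi /\
      (forall chi' : int -> int, G_coefficients R p m0 chi' ->
         forall m : int, m0 <= m -> chi' m = chi m),
      is_borel_Z0 p B
    & forall (q : 'I_n -> nat) (p0 : int) (k : 'I_n -> seq int),
      star_plumbing R p q p0 k ->
      forall a : 'cV[int]_#|vertex k|, spinc_label (@vdeg n k) a ->
      forall tau : R[i], 0 < complex.Im tau ->
      exists Z : R[i],
      [/\ is_Zhat (plumbing_mx p0 k) (@vdeg n k) a tau Z,
          (series (fun r : nat => (chi (m0 + r%:Z))%:~R *
              qpow tau ((m0 + r%:Z)%:~R ^+ 2 / (4 * (Pprod p)%:R)) : R[i]^o)
            @ \oo --> (qpow tau (Delta R p p0 k) * Z : R[i]^o)),
          (`|complex.Re tau| < complex.Im tau ->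
            laplace_converges (pi / 4) (3 * pi / 4) B tau /\
            qpow tau (Delta R p p0 k) * Z =
              lambda R p / sqrtc tau * laplace (pi / 4) (3 * pi / 4) B tau)
        & (forall alpha beta : R,
            0 < alpha < pi / 2 -> pi / 2 < beta < pi ->
            0 < complex.Re (cis alpha / tau) ->
            0 < complex.Re (cis beta / tau) ->
            laplace_converges alpha beta B tau /\
            qpow tau (Delta R p p0 k) * Z =
              lambda R p / sqrtc tau * laplace alpha beta B tau)]].
Proof.
have nd3 : n = (n - 3).+3 by lia.
exists (m_zero p), (chi p (n - 3)), (Bfun p); split.
- exact: m_zeroE.
- have hG := @chi_G_coefficients R n p hp _ nd3.
  split; first exact: hG.
  by move=> chi' h m mm; exact: (G_coefficients_unique h hG mm).
- by split; [exact: Bfun_holomorphic|exact: (Bfun_series R hp nd3)].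
move=> q p0 k star a ha tau tau0.
have q0 : qpow tau (Delta R p p0 k) != 0 by exact: cexp_neq0.
have val (e : R) (he : 0 < e < 1 / 2) := Zhat_value hp hcop star nd3 tau0 ha he.
have e4 : 0 < (1 / 4 : R) < 1 / 2 by apply/andP; split; lra.
pose Z := Zhat_at (plumbing_mx p0 k) (@vdeg n k) a tau (1 / 4 : R).
have ZE (e : R) : 0 < e < 1 / 2 -> Zhat_at (plumbing_mx p0 k) (@vdeg n k) a tau e = Z.
  by move=> he; apply: (mulfI q0); exact: cvgc_unique (val e he) (val _ e4).
have hV : series (fun r : nat => (chi p (n - 3) (m_zero p + r%:Z))%:~R *
      qpow tau ((m_zero p + r%:Z)%:~R ^+ 2 / (4 * (Pprod p)%:R)) : R[i]^o)
    @ \oo --> (qpow tau (Delta R p p0 k) * Z : R[i]^o).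
  have [A [x [A0 x01 hq]]] := @qpow_sq_bound R n p hp tau (m_zero p) tau0.
  have E : (fun r : nat => (chi p (n - 3) (m_zero p + r%:Z))%:~R *
      qpow tau ((m_zero p + r%:Z)%:~R ^+ 2 / (4 * (Pprod p)%:R)) : R[i]) =
    (fun r => (chi_coef p (n - 3) r)%:~R * qpow tau ((m_zero p + r%:Z)%:~R ^+ 2 / (4 * (Pprod p)%:R))).
    by apply/funext => r; rewrite chiE.
  rewrite E; apply: (@sparse_series R _ _ _ _ (n - 3)%N (P2_gt0 hp) _ A x A0 x01 hq).
  pose G K : R[i] := \sum_(S : {set 'I_n}) \sum_(0 <= r < K)
    ((-1) ^+ #|S| * (nbin (n - 3) r)%:R) * qpow tau ((expo p S r)%:~R ^+ 2 / (4 * (Pprod p)%:R)).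
  have hG : G @ \oo --> (qpow tau (Delta R p p0 k) * Z : R[i]^o) by exact: val _ e4.
  suff EG : (fun K => \sum_(S : {set 'I_n}) \sum_(0 <= r < K) ((-1) ^+ #|S| : int)%:~R * (nbin (n - 3) r)%:R *
      qpow tau ((m_zero p + (shift p S + 2 * Pprod p * r)%N%:Z)%:~R ^+ 2 / (4 * (Pprod p)%:R))) = G :> (nat -> R[i]).
    by rewrite -EG in hG; exact: hG.
  apply/funext => K; apply: eq_bigr => S _; apply: eq_bigr => r _.
  by rewrite rmorphXn rmorphN1.
have L (alpha beta : R) (h1 : 0 < alpha < pi / 2) (h2 : pi / 2 < beta < pi)
  (h3 : 0 < complex.Re (cis alpha / tau)) (h4 : 0 < complex.Re (cis beta / tau)) :=
  laplace_value hp nd3 tau0 h1 h2 h3 h4 hV.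
exists Z; split => //.
- rewrite /is_Zhat; near=> e; apply: ZE; apply/andP; split; near: e.
    exact: nbhs_right_gt.
  by apply: nbhs_right_lt; lra.
- move=> /standard_contour [h3 h4]; have pi0 := @pi_gt0 R.
  by apply: L => //; apply/andP; split; lra.
Unshelve. all: by end_near.
Qed.
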